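(* Let $k\ge 2$, let $\boldsymbol{\mathsf M}=(\mathsf M_1,\dots,\mathsf M_k)$ be a tuple of $k$ matroids on $E=[n]$ with no common loop, and let $\boldsymbol w\in\mathbb R^{[k]\times E}$ be sufficiently generic. (1) One has $$\mathcal K(\Delta_{\boldsymbol w}(\boldsymbol{\mathsf M});V_1,\dots,V_k)=\mathcal K_{\boldsymbol{\mathsf M}}(V_1,\dots,V_k).$$ In particular, the left-hand side is independent of $\boldsymbol w$ and is valuative in each of $\mathsf M_1,\dots,\mathsf M_k$. (2) The external activity complex $\Delta_{\boldsymbol w}(\boldsymbol{\mathsf M})$ is Cohen–Macaulay over $\Bbbk$ of dimension $n+\rho(E)-1$.
   Context: Fix a field $\Bbbk$ and $E=[n]=\{1,\dots,n\}$. ''No common loop'' means that no element of $E$ is a loop of every $\mathsf M_j$. For $A\subseteq E$, $\rho(A)=\min\sum_{q=1}^s(\sum_{j=1}^k\mathrm{rk}_{\mathsf M_j}(A_q)-1)$ over partitions $A=A_1\sqcup\cdots\sqcup A_s$ into nonempty parts, $\rho(\varnothing)=0$. Braid fan. For a finite set $A$, let $N_A=\mathbb Z^A/\mathbb Z(1,\dots,1)$, $N_{A,\mathbb R}=N_A\otimes\mathbb R$, and let $\bar e_S$ be the image of $\sum_{i\in S}e_i$. The braid fan $\Sigma_A$ in $N_{A,\mathbb R}$ has cones $\sigma_{\mathcal F}=\mathrm{cone}(\bar e_{F_1},\dots,\bar e_{F_\ell})$ indexed by flags $\varnothing\subsetneq F_1\subsetneq\cdots\subsetneq F_\ell\subsetneq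 A$. Write $N=N_E$, $N_{\mathbb R}=N_{E,\mathbb R}$. $X_E$ is the toric variety over $\Bbbk$ of $\Sigma_E$, with Grothendieck ring $K(X_E)$ and Euler characteristic $\chi$. Initial matroids. For a matroid $\mathsf M$ on $E$ and $v\in N_{\mathbb R}$, $\mathrm{in}_v\mathsf M$ is the matroid whose bases are the bases $B$ of $\mathsf M$ maximizing $\sum_{i\in B}v_i$; it depends only on the cone $\sigma_{\mathcal F}$ whose relative interior contains $v$ and is then written $\mathrm{in}_{\mathcal F}\mathsf M$. For a maximal flag, its unique basis is $B_{\mathcal F}(\mathsf M)$. $\mathrm{Loop}(\cdot)$ denotes the set of loops. Genericity. Put $\widetilde E=[k]\times E$ and $\boldsymbol w=(w_j)_{j\in[k]}$ with $w_j\in\mathbb R^E$; also write $w_j$ for its image in $N_{\mathbb R}$ and $\widetilde w$ for the image of $\boldsymbol w$ in $N_{\widetilde E,\mathbb R}$. ''Sufficiently generic'' means both: (i) for all $\sigma_1,\dots,\sigma_k\in\Sigma_E$, if $\bigcap_j(\sigma_j+w_j)\ne\varnothing$ then $\bigcap_j(\sigma_j^\circ+w_j)\neq\varnothing$ and $\dim\bigcap_j(\sigma_j+w_j)=\sum_j\dim\sigma_j-(k-1)(n-1)$; (ii) for all $\sigma,\tau\in\Sigma_{\widetilde E}$, if $(\sigma+\widetilde w)\cap\tau\neq\varnothing$ then $(\sigma^\circ+\widetilde w)\cap\tau^\circ\ne\varnothing$ and its dimension is $\dim\sigma+\dim\tau-(kn-1)$. Here $^\circ$ is relative interior. External activity complex.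 $\Delta_{\boldsymbol w}(\boldsymbol{\mathsf M})$ is the simplicial complex on ambient vertex set $\widetilde E$ (some elements may fail to be vertices, ''ghost vertices'') whose faces are the $F\subseteq\widetilde E$ for which there is $u\in N_{\mathbb R}$ such that $i\notin\mathrm{Loop}(\mathrm{in}_{u-w_j}\mathsf M_j)$ for all $(j,i)\in F$. It is Cohen–Macaulay over $\Bbbk$ if its Stanley–Reisner ring is Cohen–Macaulay. Its $\mathbb Z^k$-graded $K$-polynomial (vertex $(j,i)$ of degree $e_j$) is $$\mathcal K(\Delta;V_1,\dots,V_k)=\sum_{F\in\Delta}\ \prod_{(j,i)\in F}V_j\prod_{(j,i)\in\widetilde E\setminus F}(1-V_j).$$ The polynomial $\mathcal K_{\boldsymbol{\mathsf M}}$. Let $H=\mathbb G_m^E$ with coordinate characters $t_i$ act on $X_E$ through the dense torus $H/\mathbb G_m$ (cocharacter lattice $N$); for a maximal flag $\mathcal F$ with $F_a=\{i_1,\dots,i_a\}$ the tangent characters at the fixed point $p_{\mathcal F}$ are $t_{i_a}/t_{i_{a+1}}$. The tautological quotient class $\mathcal Q_{\mathsf M}\in K_H(X_E)$ (Berget–Eur–Spink–Tseng) is the unique class with $\mathcal Q_{\mathsf M}^\vee|_{p_{\mathcal F}}=\sum_{i\notin B_{\mathcal F}(\mathsf M)}t_i$; the same symbol denotes its image in $K(X_E)$. Let $\lambda_u(\mathcal E)=\sum_i[\wedge^i\mathcal E]u^i$, extended to virtual classes multiplicatively. Then $\mathcal K_{\boldsymbol{\mathsf M}}(V_1,\dots,V_k)=\chi\bigl(X_E,\prod_{j=1}^k\lambda_{-V_j}(\mathcal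 Q_{\mathsf M_j}^\vee)\bigr)$. Valuative. A function $\varphi$ of a matroid on $E$ with values in an abelian group is valuative if $\sum_a c_a\varphi(\mathsf M^{(a)})=0$ whenever $\sum_a c_a\mathbf 1_{P(\mathsf M^{(a)})}=0$ (finite integer combinations), where $\mathbf 1_{P(\mathsf M)}$ is the indicator function of the base polytope in $\mathbb R^E$; ''valuative in $\mathsf M_j$'' refers to varying $\mathsf M_j$ with the other entries fixed (within tuples with no common loop). *)

(* Defs.v *)
From HB Require Import structures.
From mathcomp Require Import all_boot all_order all_algebra perm.
From mathcomp Require Import boolp reals.
From mathcomp Require Import mpoly.

Set Implicit Arguments.
Unset Strict Implicit.
Unset Printing Implicit Defensive.

Import Order.TTheory GRing.Theory Num.Theory.
Local Open Scope ring_scope.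

(* Definite description; [x0] is returned only when no [x] satisfies [P]. *)
Definition the (T : Type) (x0 : T) (P : T -> Prop) : T :=
  if pselect (exists x, P x) is left h then projT1 (cid h) else x0.

Definition is_matroid (T : finType) (Bs : {set {set T}}) : bool :=
  (Bs != set0) &&
  [forall B1 in Bs, forall B2 in Bs, forall x in B1 :\: B2,
    exists y in B2 :\: B1, (y |: (B1 :\ x)) \in Bs].

Record matroid (T : finType) := Matroid {
  bases : {set {set T}};
  basesP : is_matroid bases
}.

Definition rk (T : finType) (M : matroid T) (A : {set T}) : nat :=
  \max_(B in bases M) #|A :&: B|.

(* Loops are defined on the collection of bases, so that they make sense for
   the initial matroid, which is given by its collection of bases. *)
Definition loops (T : finType) (Bs : {set {set T}}) : {set T} :=
  ~: \bigcup_(B in Bs) B.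

(* [v] is a representative in R^T of a vector of N_R. *)
Definition initial (R : realDomainType) (T : finType) (v : {ffun T -> R})
    (M : matroid T) : {set {set T}} :=
  [set B in bases M |
    [forall B' in bases M, \sum_(i in B') v i <= \sum_(i in B) v i]].

Definition no_common_loop (k : nat) (T : finType) (M : 'I_k -> matroid T) :=
  forall i : T, exists j : 'I_k, i \notin loops (bases (M j)).

Definition rho_cost (k : nat) (T : finType) (M : 'I_k -> matroid T)
    (P : {set {set T}}) : int :=
  \sum_(A in P) ((\sum_(j < k) rk (M j) A)%N%:Z - 1).

(* [partition] requires nonempty blocks; the partition into singletons is a
   legitimate starting value for the minimum, also for [A = set0]. *)
Definition rho (k : nat) (T : finType) (M : 'I_k -> matroid T)
    (A : {set T}) : int :=
  \big[Order.min/rho_cost M [set [set x] | x in A]]_(P | partition P A)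
    rho_cost M P.

Definition in_base_polytope (R : realType) (T : finType) (M : matroid T)
    (x : {ffun T -> R}) : Prop :=
  exists c : {set T} -> R,
    [/\ forall B, 0 <= c B,
        \sum_(B in bases M) c B = 1
      & forall i, x i = \sum_(B in bases M) c B * (i \in B)%:R].

Definition polytope_indicator (R : realType) (T : finType) (M : matroid T)
    (x : {ffun T -> R}) : int := `[< in_base_polytope M x >]%:Z.

Definition update (k : nat) (T : Type) (M : 'I_k -> T) (j : 'I_k) (x : T) :
    'I_k -> T := fun i => if i == j then x else M i.

(* A subset of N_{A,R} = R^A / R(1,...,1) is represented by its preimage in
   R^A, a subset stable under translation by (1,...,1).  Relative interiors
   commute with taking preimages, dimensions increase by one. *)

Section BraidFan.
Variables (R : realType) (A : finType).
Local Notation V := {ffun A -> R^o}.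

Definition indic (S : {set A}) : V := [ffun i => (i \in S)%:R].

Definition is_flag (F : seq {set A}) : bool :=
  sorted (fun S T : {set A} => S \proper T) F
  && all (fun S => (S != set0) && (S != setT)) F.

Definition cone (F : seq {set A}) (x : V) : Prop :=
  exists (c : {set A} -> R) (t : R),
    (forall S, 0 <= c S)
    /\ x = t *: indic setT + \sum_(S <- F) c S *: indic S.

Definition translate (S : V -> Prop) (w : V) : V -> Prop := fun x => S (x - w).

(* [U] is the linear span of the differences of elements of [S], that is, the
   direction of the affine hull of [S] *)
Definition direction (S : V -> Prop) (U : {vspace V}) : Prop :=
  forall W : {vspace V},
    (U <= W)%VS <-> (forall x y, S x -> S y -> x - y \in W).

Definition relint (S : V -> Prop) (x : V) : Prop :=
  S x /\ exists U, direction S U /\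
    exists e : R, 0 < e /\
      forall y, y - x \in U -> (forall i, `|y i - x i| < e) -> S y.

(* dimension in N_{A,R}, whence the [d.+1] *)
Definition has_dim (S : V -> Prop) (d : nat) : Prop :=
  exists U, direction S U /\ \dim U = d.+1.

End BraidFan.

Section Generic.
Variables (R : realType) (k n : nat).

Definition weight (w : {ffun 'I_k * 'I_n -> R}) (j : 'I_k) : {ffun 'I_n -> R} :=
  [ffun i => w (j, i)].

Definition generic_tuple (w : {ffun 'I_k * 'I_n -> R}) : Prop :=
  forall F : 'I_k -> seq {set 'I_n}, (forall j, is_flag (F j)) ->
  let meet x := forall j, translate (cone (F j)) (weight w j) x in
  (exists x, meet x) ->
  (exists x, forall j, translate (relint (cone (F j))) (weight w j) x)
  /\ exists (d : nat) (ds : 'I_k -> nat),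
       [/\ has_dim meet d,
           forall j, has_dim (@cone R _ (F j)) (ds j)
         & (d + (k - 1) * (n - 1) = \sum_(j < k) ds j)%N].

Definition generic_pair (w : {ffun 'I_k * 'I_n -> R}) : Prop :=
  forall F G : seq {set 'I_k * 'I_n}, is_flag F -> is_flag G ->
  (exists x, translate (cone F) w x /\ cone G x) ->
  let meet x := translate (relint (cone F)) w x /\ relint (cone G) x in
  (exists x, meet x)
  /\ exists d d1 d2 : nat,
       [/\ has_dim meet d,
           has_dim (@cone R _ F) d1,
           has_dim (@cone R _ G) d2
         & (d + (k * n - 1) = d1 + d2)%N].

Definition sufficiently_generic (w : {ffun 'I_k * 'I_n -> R}) : Prop :=
  generic_tuple w /\ generic_pair w.

End Generic.

(* An element [x : V] with [[set x]] not a face is a ghost vertex. *)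
Record complex (V : finType) := Complex {
  faces : {set {set V}};
  faces0 : set0 \in faces;
  faces_sub : forall F G : {set V}, F \subset G -> G \in faces -> F \in faces
}.

Definition cdim (V : finType) (D : complex V) : int :=
  (\max_(F in faces D) #|F|)%N%:Z - 1.

Definition kpoly (k n : nat) (D : complex ('I_k * 'I_n)%type) :
    {mpoly int[k]} :=
  \sum_(F in faces D)
    (\prod_(p in F) 'X_(p.1)) * (\prod_(p in ~: F) (1 - 'X_(p.1))).

Section ExternalActivity.
Variables (R : realType) (k n : nat).
Variables (w : {ffun 'I_k * 'I_n -> R}) (M : 'I_k -> matroid 'I_n).

Definition ext_face (F : {set 'I_k * 'I_n}) : Prop :=
  exists u : {ffun 'I_n -> R}, forall p, p \in F ->
    p.2 \notin loops (initial (u - weight w p.1) (M p.1)).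

Definition ext_faces : {set {set 'I_k * 'I_n}} := [set F | `[< ext_face F >]].

Lemma ext_faces0 : set0 \in ext_faces.
Proof. by rewrite inE; apply/asboolP; exists 0 => p; rewrite inE. Qed.

Lemma ext_faces_sub (F G : {set 'I_k * 'I_n}) :
  F \subset G -> G \in ext_faces -> F \in ext_faces.
Proof.
move=> /subsetP FG; rewrite !inE => /asboolP[u Gu]; apply/asboolP.
by exists u => p /FG; exact: Gu.
Qed.

Definition ext_complex := Complex ext_faces0 ext_faces_sub.

End ExternalActivity.

Section CohenMacaulay.
Variable A : comNzRingType.
Implicit Types (I J : A -> Prop) (s : seq A).

Definition ideal I : Prop :=
  [/\ I 0, forall x y, I x -> I y -> I (x + y) & forall a x, I x -> I (a * x)].

Definition prime_ideal I : Prop :=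
  [/\ ideal I, ~ I 1 & forall x y, I (x * y) -> I x \/ I y].

Definition maximal_ideal I : Prop :=
  [/\ ideal I, ~ I 1
    & forall J, ideal J -> (forall x, I x -> J x) ->
        J 1 \/ (forall x, J x -> I x)].

Definition generated s (x : A) : Prop :=
  exists c : nat -> A, x = \sum_(i < size s) c i * s`_i.

Definition regular_sequence s : Prop :=
  ~ generated s 1 /\
  forall i x, (i < size s)%N ->
    generated (take i s) (s`_i * x) -> generated (take i s) x.

Definition prime_chain I (d : nat) : Prop :=
  exists P : nat -> A -> Prop,
    [/\ forall i, (i <= d)%N -> prime_ideal (P i),
        forall i, (i < d)%N ->
          (forall x, P i x -> P i.+1 x) /\ (exists x, P i.+1 x /\ ~ P i x)
      & forall x, P d x <-> I x].

Definition regular_in I (d : nat) : Prop :=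
  exists s, [/\ size s = d, regular_sequence s & forall x, x \in s -> I x].

Definition greatest (P : nat -> Prop) (d : nat) : Prop :=
  P d /\ forall e, P e -> (e <= d)%N.

Definition height I := greatest (prime_chain I).
Definition depth I := greatest (regular_in I).

(* For Noetherian A. For I maximal, depth of I on A and height of I are the
   depth and the dimension of the localization of A at I. *)
Definition cohen_macaulay : Prop :=
  forall I, maximal_ideal I -> exists d, height I d /\ depth I d.

End CohenMacaulay.

Section StanleyReisner.
Variables (kk : fieldType) (V : finType) (D : complex V).
Local Notation P := {mpoly kk[#|V|]}.

Definition sr_monomial (F : {set V}) : P := \prod_(x in F) 'X_(enum_rank x).

Definition sr_ideal : {pred P} :=
  fun p => `[< exists h : {set V} -> P,
                 p = \sum_(F in ~: faces D) h F * sr_monomial F >].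

Lemma sr_idealP : idealr_closed sr_ideal.
Proof.
split.
- by apply/asboolP; exists (fun=> 0); rewrite big1 // => F _; rewrite mul0r.
- apply/negP => /asboolP[h /(congr1 (fun p : P => p.@[fun=> 0]))].
  rewrite rmorph1 rmorph_sum /= big1 => [/eqP|F]; first by rewrite oner_eq0.
  rewrite inE => FD; rewrite rmorphM /= rmorph_prod /=.
  have /set0Pn[x xF]: F != set0.
    by apply: contraNneq FD => ->; exact: faces0.
  by rewrite (bigD1 x) //= mevalXU mul0r mulr0.
- move=> a p q /asboolP[h ->] /asboolP[g ->]; apply/asboolP.
  exists (fun F => a * h F + g F); rewrite mulr_sumr -big_split /=.
  by apply: eq_bigr => F _; rewrite mulrDl mulrA.
Qed.

HB.instance Definition _ := isIdealr.Build P sr_ideal sr_idealP.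

Definition stanley_reisner : comNzRingType := {ideal_quot sr_ideal}.

End StanleyReisner.

(* X_E is the permutohedral toric variety.  The maximal cones of the braid fan are indexed by permutations s, via the
   flag F_a = {s 0, ..., s (a-1)}, 0 < a < n.  The function field of X_E is a
   subfield of kk(t_0, ..., t_(n-1)), with character lattice the set of integer
   vectors of sum zero.  The charts are affine spaces, on which every vector
   bundle is trivial, so a vector bundle is a cocycle of transition matrices. *)

Section Toric.
Variables (kk : fieldType) (n : nat).
Local Notation K := {fraction {mpoly kk[n]}}.
Local Notation chart := {perm 'I_n}.
Local Notation char := {ffun 'I_n -> int}.

Definition scal (c : kk) : K := tofrac (c%:MP : {mpoly kk[n]}).

Definition tchar (m : char) : K :=
  \prod_(i < n) (tofrac ('X_i : {mpoly kk[n]})) ^ (m i).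

Definition rays (s : chart) : {set {set 'I_n}} :=
  [set [set s i | i : 'I_n & (i < a)%N] | a : 'I_n & (0 < a)%N].

(* The charts indexed by [I] meet in the affine toric variety of the cone
   spanned by their common rays; this is the semigroup of characters regular
   on it. *)
Definition dual_cone (I : {set chart}) (m : char) : bool :=
  (\sum_i m i == 0) &&
  [forall S in \bigcap_(s in I) rays s, 0 <= \sum_(i in S) m i].

Definition regular_on (I : {set chart}) (f : K) : Prop :=
  exists s : seq (kk * char),
    all (fun cm => dual_cone I cm.2) s
    /\ f = \sum_(cm <- s) scal cm.1 * tchar cm.2.

(* [frame E] indexes the frame on every chart; a section with coordinates [v]
   in the frame of chart [t] has coordinates [trans E s t *m v] in that of
   chart [s]. *)
Record bundle := Bundle {
  frame : finType;
  trans : chart -> chart -> frame -> frame -> K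
}.

Definition is_bundle (E : bundle) : Prop :=
  [/\ forall s t a b, regular_on [set s; t] (@trans E s t a b),
      forall s a b, @trans E s s a b = (a == b)%:R
    & forall s t u a c,
        \sum_b @trans E s t a b * @trans E t u b c = @trans E s u a c].

Definition trivial_bundle : bundle :=
  @Bundle unit (fun _ _ _ _ => 1).

Definition zero_bundle : bundle :=
  @Bundle void (fun _ _ _ _ => 0).

Definition dual_bundle (E : bundle) : bundle :=
  @Bundle (frame E) (fun s t a b => trans t s b a).

Definition tensor_bundle (E F : bundle) : bundle :=
  @Bundle (frame E * frame F)%type
    (fun s t a b => trans s t a.1 b.1 * trans s t a.2 b.2).

Definition dsubset (T : finType) (d : nat) := {A : {set T} | #|A| == d}.

Definition dsubset_nth (T : finType) (d : nat) (A : dsubset T d) (i : 'I_d) : T :=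
  enum_val (cast_ord (esym (eqP (valP A))) i).

Definition ext_bundle (d : nat) (E : bundle) : bundle :=
  @Bundle {A : {set frame E} | #|A| == d}
    (fun s t A B =>
       \det (\matrix_(i < d, j < d)
               @trans E s t (dsubset_nth A i) (dsubset_nth B j))).

(* A linearization for H = G_m^E: on chart [s], the frame vector [a] spans a
   constant family with character [wt s a]; in particular these are the
   characters of the fibre at the fixed point of chart [s].  As the function
   t^m has weight -m, equivariance of the transition functions reads: *)
Definition linearization (E : bundle) (wt : chart -> frame E -> char) : Prop :=
  forall s t a b, exists c : kk,
    @trans E s t a b = scal c * tchar (wt s a - wt t b).

Section Cech.
Variable E : bundle.

(* Alternating Cech cochains for the cover by the toric charts, which is affine
   with affine intersections.  A section is given by its coordinates in the frame of chart [1%g]. *)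
Local Notation sec := {ffun frame E -> K^o}.
Local Notation cochains := {ffun {set chart} -> sec}.

Definition section_on (I : {set chart}) (v : sec) : Prop :=
  forall s, s \in I -> forall a,
    regular_on I (\sum_b @trans E s 1%g a b * v b).

Definition cochain (p : nat) (c : cochains) : Prop :=
  forall I : {set chart}, if #|I| == p.+1 then section_on I (c I) else c I = 0.

Definition coboundary (c : cochains) : cochains :=
  [ffun J : {set chart} => \sum_(s in J)
     ((-1) ^+ #|[set t in J | (enum_rank t < enum_rank s)%N]| : K)
       *: c (J :\ s)].

Definition is_cocycle (p : nat) (c : cochains) : Prop :=
  cochain p c /\ coboundary c = 0.

Definition is_coboundary (p : nat) (c : cochains) : Prop :=
  if p is q.+1 then exists b, cochain q b /\ c = coboundary b else c = 0.

(* the dimension over kk of H^p(X_E, E) *)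
Definition cohomology_dim (p : nat) : nat :=
  the 0%N (fun d => exists b : 'I_d -> cochains,
    (forall i, is_cocycle p (b i)) /\
    forall z, is_cocycle p z ->
      exists! a : {ffun 'I_d -> kk},
        is_coboundary p (z - \sum_i scal (a i) *: b i)).

Definition euler_char : int :=
  \sum_(p < #|[set: chart]|) (-1) ^+ p * (cohomology_dim p)%:Z.

End Cech.

(* Elements of K(X_E) are represented by formal integer combinations of bundles;
   the Euler characteristic, being additive on exact sequences, depends only on
   the class. *)

Definition kclass := seq (int * bundle).

Definition kone : kclass := [:: (1, trivial_bundle)].
Definition kopp (x : kclass) : kclass := [seq (- a.1, a.2) | a <- x].
Definition kmul (x y : kclass) : kclass :=
  [seq (a.1 * b.1, tensor_bundle a.2 b.2) | a <- x, b <- y].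
Definition kexp (d : nat) (E : bundle) : kclass := [:: (1, ext_bundle d E)].

Definition keuler (x : kclass) : int := \sum_(a <- x) a.1 * euler_char a.2.

(* [:: s_d; ...; s_0], the first coefficients of the inverse of the power
   series lambda_u(E), whose constant coefficient is 1:
   s_(d+1) = - sum_(i <= d) (wedge^(i+1) E) s_(d-i) *)
Fixpoint lambda_inv_rec (E : bundle) (d : nat) : seq kclass :=
  if d is e.+1 then
    let l := lambda_inv_rec E e in
    kopp (flatten [seq kmul (kexp i.+1 E) (nth [::] l i) | i <- iota 0 d]) :: l
  else [:: kone].

Definition lambda_inv (E : bundle) (d : nat) : kclass :=
  head [::] (lambda_inv_rec E d).

(* the coefficient of u^d in lambda_u([P] - [N]) = lambda_u(P) / lambda_u(N) *)
Definition lambda (q : bundle * bundle) (d : nat) : kclass :=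
  flatten [seq kmul (kexp i q.1) (lambda_inv q.2 (d - i)) | i <- iota 0 d.+1].

Definition kdual (q : bundle * bundle) : bundle * bundle :=
  (dual_bundle q.1, dual_bundle q.2).

Definition flag_vector (s : chart) : {ffun 'I_n -> int} :=
  [ffun i => \sum_(S in rays s) (i \in S)%:R].

(* the unique basis of the initial matroid for the flag of [s] *)
Definition flag_basis (s : chart) (M : matroid 'I_n) : {set 'I_n} :=
  odflt set0 [pick B in initial (flag_vector s) M].

Definition coord_char (i : 'I_n) : char := [ffun j => (i == j)%:R].

(* Every class of K_H(X_E) is of the form [P] - [N], and it is determined by its
   restrictions to the fixed points, here given by character multiplicities.
   [q] is the pair (P, N), whose image in K(X_E) forgets the linearizations. *)
Definition is_taut_quotient (M : matroid 'I_n) (q : bundle * bundle) : Prop :=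
  [/\ is_bundle q.1, is_bundle q.2
    & exists wP wN,
        [/\ @linearization q.1 wP, @linearization q.2 wN
          & forall (s : chart) (m : char),
              #|[set a | - wP s a == m]|%:Z - #|[set a | - wN s a == m]|%:Z
              = #|[set i | (i \notin flag_basis s M) && (coord_char i == m)]|%:Z]].

Definition taut_quotient (M : matroid 'I_n) : bundle * bundle :=
  the (zero_bundle, zero_bundle) (is_taut_quotient M).

(* the coefficient of V^d in the K-polynomial of the tuple [M] *)
Definition taut_kpoly_coeff (k : nat) (M : 'I_k -> matroid 'I_n)
    (d : 'X_{1..k}) : int :=
  (\prod_(j < k) (-1) ^+ d j) *
  keuler (\big[kmul/kone]_(j < k) lambda (kdual (taut_quotient (M j))) (d j)).

End Toric.

(* Main.v *)
(** Cohen-Macaulayness: the faces of the external activity complex and the independent sets of a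
matroid of rank n + rho(E), a Dilworth truncation, are the ends of a family of complexes [Gam F Q],
whose successive members are related by links and deletions.  Complete homogeneous symmetric
polynomials in the vertices form a regular sequence modulo each of their Stanley-Reisner ideals; at
an arbitrary maximal ideal one first applies a univariate polynomial to the vertices.

The K-polynomial: give the vertex (j, i) the weight V_j t_i.  The Euler characteristic of convex
polyhedra turns the sum over the faces into a sum over the permutations s of the products of the
1 - V_j t_i, where i is not in the basis B_s(M_j), times a rational function of t depending on s
only.  The Euler characteristic of an equivariant bundle, computed weight by weight from its Cech
complex, is a sum of the same kind over the fixed points, with t_i = q^i and q specialized to 1.
For fixed s the indicator of B_s(M) = B is valuative in M, because the slices of a base polytope by
half-spaces are convex. *)
Require Import Defs.
From HB Require Import structures.
From mathcomp Require Import all_boot all_order all_algebra perm.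
From mathcomp Require Import boolp reals.
From mathcomp Require classical_sets.
From mathcomp Require Import mpoly.
From mathcomp Require Import ring lra zify.
Set Implicit Arguments.
Unset Strict Implicit.
Unset Printing Implicit Defensive.
Import Order.TTheory GRing.Theory Num.Theory.
Local Open Scope ring_scope.

(** * Matroids and initial bases *)

(** [Gam F Q] asks for heights [v] on all of [k] x E for which the elements of F are nonloops in
    their row and those of Q are maximal in their column. With Q everything, the rows of [v] agree
    and form one vector u; with Q = F, a count of distinct values (genericity) in one direction and
    a linear program in the other identify F with an independent set. Changing Q by one element is a
    union and an intersection of complexes, so the argument is a Mayer-Vietoris one. It needs a
    single sequence that serves all members at once, over finite fields too: symmetric polynomials
    do, generic linear forms do not. Because every maximal ideal is tested, Zariski's lemma has to
    supply the univariate polynomial.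

    The weights t_i keep the fixed-point denominators nonzero. A vector u has ties, which factors
    1/(1 - t_z/t_y) resolve; after integration over u, tuples of different orderings contribute 0,
    because their constraints contain a directed cycle whose ratios multiply to 1. Integers are read
    off in the fraction field of Z[q], whatever the characteristic of the ground field. *)

Section MatroidBasics.
Local Open Scope nat_scope.
Variables (T : finType) (M : matroid T).
Implicit Types (A B I J X : {set T}) (i x y : T).

Definition indep I := [exists B in bases M, I \subset B].

Lemma basis_exchange B1 B2 x : B1 \in bases M -> B2 \in bases M ->
  x \in B1 :\: B2 -> exists2 y, y \in B2 :\: B1 & y |: (B1 :\ x) \in bases M.
Proof.
have /andP[_ /forall_inP H] := basesP M.
move=> b1 b2 xB; have /forall_inP/(_ _ b2)/forall_inP/(_ _ xB) := H _ b1.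
by case/exists_inP=> y yB yb; exists y.
Qed.

Lemma bases_neq0 : exists B, B \in bases M.
Proof. by apply/set0Pn; case/andP: (basesP M). Qed.

Lemma indep_sub I J : I \subset J -> indep J -> indep I.
Proof.
move=> IJ /exists_inP[B bB JB]; apply/exists_inP; exists B => //.
exact: subset_trans JB.
Qed.

Lemma basis_indep B : B \in bases M -> indep B.
Proof. by move=> bB; apply/exists_inP; exists B. Qed.

Lemma indep0 : indep set0.
Proof. by have [B bB] := bases_neq0; apply/exists_inP; exists B; rewrite ?sub0set. Qed.

Lemma card_exchange A x y : x \in A -> y \notin A -> #|y |: (A :\ x)| = #|A|.
Proof.
move=> xA yA; rewrite cardsU1 !inE negb_and yA orbT (cardsD1 x A) xA //.
Qed.

Lemma basis_card_le B1 B2 : B1 \in bases M -> B2 \in bases M -> #|B1| <= #|B2|.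
Proof.
move: {2}#|B1 :\: B2|.+1 (ltnSn #|B1 :\: B2|) => m.
elim: m B1 => // m IH B1 le1 b1 b2.
have [E|[x xB]] := set_0Vmem (B1 :\: B2).
  by apply: subset_leq_card; rewrite -setD_eq0 E.
have [y yB b'] := basis_exchange b1 b2 xB.
move: (xB) (yB); rewrite !inE => /andP[xB2 xB1] /andP[yB1 yB2].
rewrite -(card_exchange xB1 yB1); apply: IH => //.
rewrite -ltnS; apply: leq_trans le1; rewrite ltnS; apply: proper_card; apply/properP; split.
  apply/subsetP => z; rewrite !inE => /andP[zB2 /orP[/eqP zy|/andP[_ ->]]].
    by rewrite zy yB2 in zB2.
  by rewrite zB2.
exists x; rewrite !inE ?xB2 ?xB1 // eqxx /= orbF.
by apply: contraNN xB2 => /eqP ->.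
Qed.

Lemma basis_card B1 B2 : B1 \in bases M -> B2 \in bases M -> #|B1| = #|B2|.
Proof. by move=> b1 b2; apply/eqP; rewrite eqn_leq !basis_card_le. Qed.

Lemma indep_extend I B : indep I -> B \in bases M ->
  exists B', [/\ B' \in bases M, I \subset B' & B' \subset I :|: B].
Proof.
move=> iI bB.
have [B1 b1 IB1] := exists_inP iI.
move: {2}#|B1 :\: (I :|: B)|.+1 (ltnSn #|B1 :\: (I :|: B)|) => m.
elim: m B1 b1 IB1 => // m IH B1 b1 IB1 le1.
have [E|[x]] := set_0Vmem (B1 :\: (I :|: B)).
  by exists B1; split=> //; rewrite -setD_eq0 E.
rewrite !inE negb_or => /andP[/andP[xI xB] xB1].
have xD : x \in B1 :\: B by rewrite inE xB xB1.
have [y yB b'] := basis_exchange b1 bB xD.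
move: yB; rewrite !inE => /andP[yB1 yB].
apply: (IH _ b').
  apply/subsetP => z zI; rewrite !inE (subsetP IB1 _ zI) andbT.
  by apply/orP; right; apply: contraNneq xI => <-.
rewrite -ltnS; apply: leq_trans le1; rewrite ltnS; apply: proper_card; apply/properP; split.
  apply/subsetP => z; rewrite !inE => /andP[zB /orP[/eqP zy|/andP[_ ->]]].
    by rewrite zy yB orbT in zB.
  by rewrite zB.
exists x; rewrite !inE ?(negPf xB) ?(negPf xI) ?xB1 // eqxx /= orbF.
by apply: contraNN xB => /eqP ->.
Qed.

Lemma indep_augment I J : indep I -> indep J -> #|I| < #|J| ->
  exists2 x, x \in J :\: I & indep (x |: I).
Proof.
move=> iI /exists_inP[B2 b2 JB2] lt.
have [B' [b' IB' sub]] := indep_extend iI b2.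
have [E|[x]] := set_0Vmem (B' :&: (J :\: I)); last first.
  rewrite inE => /andP[xB' xJ]; exists x => //; apply/exists_inP; exists B' => //.
  by rewrite subUset sub1set xB' IB'.
have S : B' :\: I \subset B2 :\: J.
  apply/subsetP => z; rewrite !inE => /andP[zI zB'].
  have := subsetP sub _ zB'; rewrite !inE (negPf zI) /= => ->; rewrite andbT.
  apply/negP => zJ; have : z \in B' :&: (J :\: I) by rewrite !inE zB' zI zJ.
  by rewrite E inE.
have := subset_leq_card S.
have := cardsID I B'; have := cardsID J B2.
rewrite (setIidPr IB') (setIidPr JB2) (basis_card b' b2); lia.
Qed.

Lemma rk_max I A : indep I -> I \subset A -> #|I| <= rk M A.
Proof.
move=> /exists_inP[B bB IB] IA; rewrite /rk.
apply: (@leq_trans #|A :&: B|); first by apply: subset_leq_card; rewrite subsetI IA IB.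
by rewrite (bigD1 B) //= leq_maxl.
Qed.

Lemma rk_witness A : exists I, [/\ indep I, I \subset A & #|I| = rk M A].
Proof.
have [B0 b0] := bases_neq0.
have [B bB E] := @eq_bigmax_cond _ (mem (bases M)) (fun B => #|A :&: B|) (ltac:(by apply/card_gt0P; exists B0)).
exists (A :&: B); split; rewrite ?subsetIl //.
by apply: indep_sub (subsetIr _ _) (basis_indep bB).
Qed.

Lemma indep_extend_in I A : indep I -> I \subset A ->
  exists J, [/\ indep J, I \subset J, J \subset A & #|J| = rk M A].
Proof.
move=> iI IA; have [K [iK KA cK]] := rk_witness A.
move: {2}(rk M A - #|I|) (leqnn (rk M A - #|I|)) => m.
elim: m I iI IA => [|m IH] I iI IA.
  rewrite leqn0 subn_eq0 => le; exists I; split=> //.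
  by apply/eqP; rewrite eqn_leq le rk_max.
move=> le; have [lt|ge] := ltnP #|I| #|K|; last first.
  by exists I; split=> //; apply/eqP; rewrite eqn_leq -{2}cK ge rk_max.
have [x] := indep_augment iI iK lt; rewrite inE => /andP[xI xK] ix.
have [||J [iJ sJ JA cJ]] := IH _ ix.
- by rewrite subUset sub1set (subsetP KA).
- by rewrite cardsU1 xI; move: le; rewrite -cK; lia.
by exists J; split=> //; apply: subset_trans sJ; apply: subsetUr.
Qed.

Lemma rkS A B : A \subset B -> rk M A <= rk M B.
Proof.
move=> AB; have [I [iI IA <-]] := rk_witness A.
by apply: rk_max => //; apply: subset_trans AB.
Qed.

Lemma rk_le_card A : rk M A <= #|A|.
Proof. by have [I [iI IA <-]] := rk_witness A; apply: subset_leq_card. Qed.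

Lemma rk0 : rk M set0 = 0.
Proof. by have := rk_le_card set0; rewrite cards0 leqn0 => /eqP. Qed.

Lemma rk_indep I : indep I -> rk M I = #|I|.
Proof. by move=> iI; apply/eqP; rewrite eqn_leq rk_le_card rk_max. Qed.

Lemma indep_rk I : indep I = (rk M I == #|I|).
Proof.
apply/idP/eqP => [/rk_indep //|E].
have [J [iJ JI cJ]] := rk_witness I.
by have /eqP <- : J == I by rewrite eqEcard JI cJ E leqnn.
Qed.

Lemma rk_submod A B : rk M (A :|: B) + rk M (A :&: B) <= rk M A + rk M B.
Proof.
have [I [iI IA cI]] := rk_witness (A :&: B).
have IU : I \subset A :|: B.
  by apply: subset_trans IA _; apply: subset_trans (subsetIl _ _) (subsetUl _ _).
have [J [iJ IJ JU <-]] := indep_extend_in iI IU.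
rewrite -cI.
have h1 : #|J :&: A| <= rk M A by rewrite rk_max ?subsetIr // (indep_sub (subsetIl _ _) iJ).
have h2 : #|J :&: B| <= rk M B by rewrite rk_max ?subsetIr // (indep_sub (subsetIl _ _) iJ).
apply: leq_trans (leq_add h1 h2).
rewrite -[leqRHS]cardsUI -setIUr (setIidPl JU) leq_add2l; apply: subset_leq_card.
by rewrite setIACA setIid subsetI IJ IA.
Qed.

(** The closure operator of the matroid. Being a loop of an initial matroid is expressed through
    closures of superlevel sets, which behave well when heights are moved. *)
Definition spn A i := rk M (i |: A) == rk M A.

Lemma rkU1 A i : rk M (i |: A) = rk M A + ~~ spn A i.
Proof.
rewrite /spn; have le : rk M A <= rk M (i |: A) by rewrite rkS ?subsetUr.
have := rk_submod [set i] A; have := rk_le_card [set i]; rewrite cards1.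
by case: eqP; lia.
Qed.

Lemma spnS A B i : A \subset B -> spn A i -> spn B i.
Proof.
move=> AB /eqP E; rewrite /spn eqn_leq (rkS (subsetUr _ _)) andbT.
have := rk_submod (i |: A) B; rewrite -setUA (setUidPr AB) E.
have : rk M A <= rk M ((i |: A) :&: B).
  by rewrite rkS // subsetI subsetUr.
lia.
Qed.

Lemma spn_mem A i : i \in A -> spn A i.
Proof. by move=> iA; rewrite /spn (setUidPr _) // sub1set. Qed.

Lemma spn_setU A X : (forall x, x \in X -> spn A x) -> rk M (A :|: X) = rk M A.
Proof.
move: {2}#|X| (erefl #|X|) => m; elim: m X => [|m IH] X.
  by move/eqP; rewrite cards_eq0 => /eqP -> _; rewrite setU0.
move=> cX H; have [x xX] : exists x, x \in X by apply/card_gt0P; rewrite cX.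
rewrite -(setD1K xX) setUCA.
rewrite (eqP (spnS (subsetUl A (X :\ x)) (H _ xX))) IH //.
  by move: cX; rewrite (cardsD1 x) xX => -[].
by move=> y; rewrite inE => /andP[_]; apply: H.
Qed.

Lemma spn_trans A X i : (forall x, x \in X -> spn A x) -> spn X i -> spn A i.
Proof.
move=> H /(spnS (subsetUr A X))/eqP E.
rewrite /spn eqn_leq (rkS (subsetUr _ _)) andbT -[leqRHS](spn_setU H) -E rkS //.
by rewrite setUA subsetUl.
Qed.

Lemma indepU1 I i : indep I -> ~~ spn I i -> indep (i |: I).
Proof.
move=> iI ni; rewrite indep_rk rkU1 ni rk_indep // cardsU1.
by rewrite (contra (@spn_mem _ _) ni) addnC.
Qed.

Lemma indep_spn I i : indep (i |: I) -> i \notin I -> ~~ spn I i.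
Proof.
move=> iI ni; have iI' : indep I by apply: indep_sub iI; apply: subsetUr.
by rewrite /spn !rk_indep // cardsU1 ni; lia.
Qed.

Lemma loopsP i : (i \in loops (bases M)) = spn set0 i.
Proof.
rewrite /loops inE; apply/idP/idP; last first.
  apply: contraL => /bigcupP[B bB iB].
  by apply/indep_spn; rewrite ?inE // setU0 (indep_sub _ (basis_indep bB)) // sub1set.
apply: contraR => /(indepU1 indep0); rewrite setU0 => /exists_inP[B bB].
by rewrite sub1set => iB; apply/bigcupP; exists B.
Qed.

End MatroidBasics.

(** * Greedy bases and loops of initial matroids *)

Section Greedy.
Variables (R : realDomainType) (T : finType) (M : matroid T) (v : {ffun T -> R}).
Implicit Types (B I : {set T}) (i x y : T).

Definition above (i : T) : {set T} := [set e | v i < v e].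

Lemma sum_exchange B x y : x \notin B -> y \in B ->
  \sum_(i in x |: (B :\ y)) v i = \sum_(i in B) v i + v x - v y.
Proof.
move=> xB yB; rewrite big_setU1 ?inE ?negb_and ?xB ?orbT //=.
by rewrite (big_setD1 y yB) /=; ring.
Qed.

Lemma initial_max B B' : B \in initial v M -> B' \in bases M ->
  \sum_(i in B') v i <= \sum_(i in B) v i.
Proof. by rewrite inE => /andP[_ /forall_inP H] /H. Qed.

Lemma initialW B : B \in initial v M -> B \in bases M.
Proof. by rewrite inE => /andP[]. Qed.

Lemma initial_neq0 : exists B, B \in initial v M.
Proof.
have [B0 b0] := bases_neq0 M.
have [B bB H] := @arg_maxP _ _ _ B0 (mem (bases M)) (fun B => \sum_(i in B) v i) b0.
exists B; rewrite inE; apply/andP; split; first exact: bB.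
by apply/forall_inP => B' /H.
Qed.

(** Extending [x |: I] by elements of [B] gives a basis inside [x |: B]; it misses exactly one
    element of [B], which lies outside [I]. The choice of [I] protects the heavy elements from being
    removed. *)
Lemma basis_swap B I x : B \in bases M -> I \subset B -> x \notin B ->
  indep M (x |: I) -> exists2 y, y \in B :\: I & x |: (B :\ y) \in bases M.
Proof.
move=> bB IB xB ix; have [B' [b' sB' B's]] := indep_extend ix bB.
have xB' : x \in B' by apply: (subsetP sB'); rewrite !inE eqxx.
have sub : B' \subset x |: B.
  by apply: subset_trans B's _; rewrite -setUA setUS // subUset IB subxx.
have [E|[y]] := set_0Vmem (B :\: B').
  have /eqP EB : B == B' by rewrite eqEcard -setD_eq0 E eqxx (basis_card b' bB) /=.
  by rewrite EB xB' in xB.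
rewrite inE => /andP[yB' yB]; exists y.
  rewrite inE yB andbT; apply: contra yB' => yI; apply: (subsetP sB').
  by rewrite inE yI orbT.
suff /eqP -> : x |: (B :\ y) == B' by [].
rewrite eq_sym eqEcard; apply/andP; split.
  apply/subsetP => z zB'; have := subsetP sub _ zB'; rewrite !inE.
  by case/orP => [->//|->]; rewrite andbT; apply/orP; right; apply: contraNneq yB' => <-.
by rewrite card_exchange // (basis_card bB b').
Qed.

(** Otherwise an element with value in [P] could be swapped in for one without, increasing the
    weight. An upward closed [P] covers strict and weak superlevel sets at once. *)
Lemma initial_super B (P : R -> bool) : B \in initial v M ->
  (forall a b, P a -> a <= b -> P b) ->
  #|B :&: [set e | P (v e)]| = rk M [set e | P (v e)].
Proof.
move=> iB Pmon; have bB := initialW iB; set A := [set e | _].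
apply/eqP; rewrite eqn_leq rk_max ?subsetIr ?(indep_sub (subsetIl _ _) (basis_indep bB)) //=.
have iBA : indep M (B :&: A) by apply: indep_sub (subsetIl _ _) (basis_indep bB).
rewrite leqNgt; apply/negP => lt.
have [I [iI IA cI]] := rk_witness M A.
rewrite -cI in lt.
have [x xI ix] := indep_augment iBA iI lt.
move: xI; rewrite !inE => /andP[nx xI].
have xA : x \in A by apply: (subsetP IA).
have xB : x \notin B by apply: contra nx => ->; move: xA; rewrite inE.
have [y yB b'] := basis_swap bB (subsetIl _ _) xB ix.
have := initial_max iB b'; move: yB; rewrite !inE.
case: (y \in B) / boolP => yB; rewrite ?andbF // andbT /= => Py.
rewrite sum_exchange // -addrA gerDl subr_le0 => le.
by case/negP: Py; apply: Pmon le; move: xA; rewrite inE.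
Qed.

(** The greedy algorithm decides on an element after all strictly heavier ones. In one direction a
    maximal basis already contains a basis of the strict superlevel set; in the other, a swap
    against an element that is not heavier keeps the weight maximal. *)
Lemma nonloopP i : (i \notin loops (initial v M)) = ~~ spn M (above i) i.
Proof.
rewrite /loops inE negbK; apply/idP/idP.
  case/bigcupP => B iB iBi; apply/negP => sp; have bB := initialW iB.
  have := initial_super iB (P := fun a => v i < a) (fun a b h1 h2 => lt_le_trans h1 h2).
  rewrite -/(above i) => E.
  have iBA : indep M (B :&: above i) by apply: indep_sub (subsetIl _ _) (basis_indep bB).
  suff : indep M (i |: (B :&: above i)).
    move=> h; have := rk_max h (setUS _ (subsetIr _ _)); rewrite (eqP sp) cardsU1 -E.
    by rewrite !inE ltxx andbF; lia.
  by apply: indep_sub (basis_indep bB); rewrite subUset sub1set iBi subsetIl.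
move=> ns; have [B iB] := initial_neq0; have bB := initialW iB.
have [iBi|nB] := boolP (i \in B); first by apply/bigcupP; exists B.
have ix : indep M (i |: (B :&: above i)).
  apply: indepU1; first by apply: indep_sub (subsetIl _ _) (basis_indep bB).
  by apply: contra ns; apply: spnS; apply: subsetIr.
have [y yB b'] := basis_swap bB (subsetIl _ _) nB ix.
move: yB; rewrite !inE; case: (y \in B) / boolP => yB; rewrite ?andbF // andbT /= -leNgt => le.
apply/bigcupP; exists (i |: (B :\ y)); last by rewrite !inE eqxx.
rewrite inE b'; apply/forall_inP => B' bB'; apply: le_trans (initial_max iB bB') _.
by rewrite sum_exchange // -addrA lerDl subr_ge0.
Qed.

Lemma initial_uniq B : injective v -> B \in initial v M ->
  B = [set i | ~~ spn M (above i) i].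
Proof.
move=> vi iB; have bB := initialW iB; apply/setP => i; rewrite inE -nonloopP.
apply/idP/idP => [iBi|]; first by rewrite /loops inE negbK; apply/bigcupP; exists B.
rewrite nonloopP; apply: contraLR => nB.
apply/negP => ns; have ix : indep M (i |: (B :&: above i)).
  apply: indepU1; first by apply: indep_sub (subsetIl _ _) (basis_indep bB).
  by apply: contra ns; apply: spnS; apply: subsetIr.
have [y yB b'] := basis_swap bB (subsetIl _ _) nB ix.
have := initial_max iB b'; move: yB; rewrite !inE.
case: (y \in B) / boolP => yB; rewrite ?andbF // andbT /= -leNgt => le.
rewrite sum_exchange // -addrA gerDl subr_le0 => le2.
have /vi E : v i = v y by apply/eqP; rewrite eq_le le le2.
by rewrite E yB in nB.
Qed.

End Greedy.

(** * Genericity *)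

Section ValueCount.
Variables (R : realDomainType) (T : finType).
Implicit Types (A B : {set T}) (f g : T -> R).

(** For nonempty [A], one more than the dimension of the braid cone of R^A whose relative interior
    contains [f]; genericity is used only through inequalities between such numbers. *)
Definition nval A f : nat := size (undup [seq f x | x <- enum A]).

Lemma nval_le A f (s : seq R) :
  (forall x, x \in A -> f x \in s) -> (nval A f <= size s)%N.
Proof.
move=> H; apply: uniq_leq_size; first exact: undup_uniq.
by move=> y; rewrite mem_undup => /mapP[x]; rewrite mem_enum => /H xs ->.
Qed.

Lemma nval_mem A f x : x \in A -> f x \in undup [seq f x | x <- enum A].
Proof. by move=> xA; rewrite mem_undup map_f // mem_enum. Qed.

Lemma nval_gt0 A f : A != set0 -> (0 < nval A f)%N.
Proof.
by case/set0Pn => x /(nval_mem f); rewrite /nval; case: (undup _).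
Qed.

Lemma nval_card A f : (nval A f <= #|A|)%N.
Proof. by rewrite /nval (leq_trans (size_undup _)) // size_map cardE. Qed.

Lemma nvalU A B f : (nval (A :|: B) f <= nval A f + nval B f)%N.
Proof.
rewrite /nval -size_cat; apply: nval_le => x; rewrite inE mem_cat.
by case/orP => /(nval_mem f) ->; rewrite ?orbT.
Qed.

Lemma eq_nval A f g : {in A, f =1 g} -> nval A f = nval A g.
Proof.
move=> E; apply/eqP; rewrite eqn_leq; apply/andP; split; apply: nval_le => x xA.
  by rewrite E // nval_mem.
by rewrite -E // nval_mem.
Qed.

End ValueCount.

(** * The braid cone around a given vector *)

Section Flags.
Variables (R : realType) (A : finType).
Implicit Types (v : {ffun A -> R}) (F : seq {set A}).

Definition superlevel v (a : R) : {set A} := [set p | a <= v p].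

Definition level_seq v : seq R := sort >=%O (undup [seq v x | x <- enum A]).

(** The lowest value is dropped: its superlevel set is the whole set, which is no member of a
    flag. *)
Definition level_flag v : seq {set A} :=
  [seq superlevel v a | a <- take (size (level_seq v)).-1 (level_seq v)].

Lemma size_level_seq v : size (level_seq v) = nval [set: A] v.
Proof. by rewrite size_sort /nval enum_setT enumT. Qed.

Lemma mem_level_seq v a : (a \in level_seq v) = (a \in [seq v x | x <- enum A]).
Proof. by rewrite mem_sort mem_undup. Qed.

Lemma level_seq_mem v p : v p \in level_seq v.
Proof. by rewrite mem_level_seq map_f // mem_enum. Qed.

Lemma level_seq_sorted v : sorted >%O (level_seq v).
Proof.
have : uniq (level_seq v) by rewrite sort_uniq undup_uniq.
have : sorted >=%O (level_seq v) by apply: sort_sorted => x y; apply: le_total.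
elim: (level_seq v) => //= a [|b s] //= IH /andP[le pth] /andP[na us].
by rewrite IH // andbT lt_def le andbT; apply: contraNneq na => ->; rewrite inE eqxx.
Qed.

Lemma level_seq_lt v i j : (i < j < size (level_seq v))%N ->
  (level_seq v)`_j < (level_seq v)`_i.
Proof.
case/andP => ij js; have tr : transitive (>%O : rel R) by move=> x y z h1 h2; apply: lt_trans h2 h1.
by apply: (sorted_ltn_nth tr 0 (level_seq_sorted v)) => //; rewrite inE ?(ltn_trans ij).
Qed.

Lemma level_seq_le v i j : (i <= j < size (level_seq v))%N ->
  (level_seq v)`_j <= (level_seq v)`_i.
Proof.
case/andP; rewrite leq_eqVlt => /orP[/eqP -> //|ij js].
by apply/ltW/level_seq_lt; rewrite ij.
Qed.

Lemma superlevel_proper v a b : a \in level_seq v -> a < b ->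
  superlevel v b \proper superlevel v a.
Proof.
rewrite mem_level_seq => /mapP[x _ E] ab; apply/properP; split.
  by apply/subsetP => p; rewrite !inE; apply: le_trans (ltW ab).
by exists x; rewrite !inE -E ?lexx // -ltNge.
Qed.

Lemma level_flag_is_flag v : is_flag (level_flag v).
Proof.
have [s Es] : exists s, s = level_seq v by exists (level_seq v).
have lts := @level_seq_lt v; have ms := mem_level_seq v; rewrite /level_flag -Es in lts ms *.
apply/andP; split.
  rewrite sorted_map; apply: (sub_in_sorted (P := mem s) (e := >%O)).
  - by move=> a b _ bs ab; apply: superlevel_proper => //; rewrite -Es.
  - by apply/allP => a /mem_take.
  - by apply: take_sorted; rewrite Es; apply: level_seq_sorted.
apply/allP => S /mapP[a /(nthP 0)[i]]; rewrite size_take => lti E ->.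
have lt1 : (i < (size s).-1)%N by move: lti; case: ifP; lia.
have Ea : a = s`_i by rewrite -E nth_take.
have as_ : a \in s by rewrite Ea mem_nth // (leq_trans lt1) // leq_pred.
apply/andP; split.
  move: as_; rewrite ms => /mapP[x _ Ex].
  by apply/set0Pn; exists x; rewrite inE Ex.
have := mem_nth 0 (ltac:(lia) : (i.+1 < size s)%N).
rewrite ms => /mapP[x _ Ex]; apply/negP => /eqP/setP/(_ x).
by rewrite !inE Ea -Ex leNgt lts // ltnSn /=; lia.
Qed.

Lemma cone_level_flag v : cone (level_flag v) v.
Proof.
set s := level_seq v.
(* Coefficients in [cone] are indexed by sets, so the gap after a value is looked up through the
   position of its superlevel set. All other sets, the full one included, get 0. *)
pose c S := let i := index S [seq superlevel v a | a <- s] in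
  if (i.+1 < size s)%N then s`_i - s`_i.+1 else 0.
have cE i : (i.+1 < size s)%N -> c (superlevel v s`_i) = s`_i - s`_i.+1.
  move=> lti; rewrite /c; set j := index _ _.
  have -> : j = i; last by rewrite lti.
  have ls : (i < size s)%N by apply: ltnW.
  rewrite /j -(nth_map 0 set0) // index_uniq ?size_map //.
  rewrite map_inj_in_uniq ?sort_uniq ?undup_uniq // => a b ain bin E.
  case: (ltgtP a b) => // ab.
    by have := superlevel_proper ain ab; rewrite E properxx.
  by have := superlevel_proper bin ab; rewrite E properxx.
exists c, (s`_(size s).-1); split.
  move=> S; rewrite /c; case: ifP => // lti; rewrite subr_ge0 ltW // level_seq_lt //.
  by rewrite ltnSn.
apply/ffunP => p; rewrite !ffunE !inE sum_ffunE -[_ *: _]/(_ * _) mulr1 /level_flag big_map.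
rewrite (big_nth 0) size_takel ?leq_pred //.
rewrite -/s; have E1 i : (0 <= i < (size s).-1)%N ->
    (c (superlevel v (take (size s).-1 s)`_i) *: indic R (superlevel v (take (size s).-1 s)`_i)) p
    = (s`_i - s`_i.+1) * (s`_i <= v p)%R%:R :> R.
  move=> /andP[_ lti]; rewrite !ffunE nth_take // cE ?inE //.
  by case: (size s) lti.
rewrite (eq_big_nat _ _ E1).
have /(nthP 0)[j ltj Ej] := level_seq_mem v p; rewrite -/s in ltj Ej.
have ltj' : (j <= (size s).-1)%N by rewrite -ltnS (ltn_predK ltj).
rewrite -/s (big_cat_nat (n := j)) //=.
rewrite big_nat big1 ?add0r; last first.
  move=> i /andP[_ lti]; rewrite -Ej leNgt level_seq_lt ?mulr0 //.
  by rewrite lti ltj.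
have E2 i : (j <= i < (size s).-1)%N ->
    (s`_i - s`_i.+1) * (s`_i <= v p)%R%:R = - s`_i.+1 - (- s`_i).
  move=> /andP[le1 lt1]; rewrite -Ej level_seq_le ?mulr1 1?addrC ?opprK //.
  by rewrite le1 (leq_trans lt1) ?leq_pred.
rewrite (eq_big_nat _ _ E2).
rewrite telescope_sumr //.
by rewrite opprK -Ej addrA subrr add0r.
Qed.

Lemma size_level_flag v : size (level_flag v) = (nval [set: A] v).-1.
Proof. by rewrite size_map size_takel ?leq_pred // size_level_seq. Qed.

Lemma cone_dim F d : has_dim (@cone R A F) d -> (d <= size F)%N.
Proof.
case=> U [HU dU]; pose W := <<indic R setT :: [seq indic R B | B <- F]>>%VS.
have : (U <= W)%VS.
  apply/HU => x y; have memW z : cone F z -> z \in W.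
    case=> c [t [_ ->]]; apply: memvD.
      by apply: memvZ; apply: memv_span; rewrite inE eqxx.
    rewrite big_seq; apply: memv_suml => S SF; apply: memvZ; apply: memv_span.
    by rewrite inE map_f ?orbT.
  by move=> /memW xW /memW yW; apply: memvB.
move/dimvS; rewrite dU => le; have := leq_trans le (dim_span _).
by rewrite /= size_map ltnS.
Qed.

End Flags.

(** * Genericity as a lower bound on numbers of distinct values *)

Section Generic.
Variables (R : realType) (k n : nat) (w : {ffun 'I_k * 'I_n -> R}).
Hypothesis gw : generic_pair w.
Local Notation P := ('I_k * 'I_n)%type.
Implicit Types (v : {ffun P -> R}) (T : {set P}).

(** The cones of the level flags of [v - w] (translated) and of [v] meet at [v]. Transversality
    makes their dimensions, each at most a number of values minus one, add up to at least kn - 1. *)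
Lemma generic_countT v : (0 < k * n)%N ->
  (k * n < nval [set: P] (v - w)%R + nval [set: P] v)%N.
Proof.
move=> kn; have ne : [set: P] != set0.
  by rewrite -card_gt0 cardsT card_prod !card_ord.
have [] := gw (level_flag_is_flag (v - w)) (level_flag_is_flag v).
  by exists v; split; [rewrite /translate|]; apply: cone_level_flag.
move=> _ [d [d1 [d2 [_ /cone_dim le1 /cone_dim le2 E]]]].
move: le1 le2; rewrite !size_level_flag.
have := nval_gt0 v ne; have := nval_gt0 (v - w) ne.
by move: E kn; move: (nval _ _) (nval _ _) => a b; lia.
Qed.

Lemma generic_count v T : T != set0 ->
  (#|T| < nval T (fun p => v p - w p)%R + nval T v)%N.
Proof.
move=> /set0Pn[p0 p0T].
have kn : (0 < k * n)%N.
  by case: p0 p0T => -[i lti] [j ltj] _; rewrite muln_gt0; apply/andP; split; lia.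
(* Collapsing [v] outside [T] to one of its values on [T] adds no value of [v], while [v - w] gains
   at most one value per element outside [T]; so the bound for the full set descends to [T]. *)
pose v' : {ffun P -> R} := [ffun p => if p \in T then v p else v p0].
have := generic_countT v' kn.
have le1 : (nval [set: P] v' <= nval T v)%N.
  apply: nval_le => p _; rewrite ffunE; case: ifP => // pT; apply: nval_mem => //.
have le2 : (nval [set: P] (v' - w)%R <= nval T (fun p => v p - w p)%R + #|~: T|)%N.
  rewrite -(setUCr T); apply: leq_trans (nvalU _ _ _) _; apply: leq_add (nval_card _ _).
  by rewrite (@eq_nval _ _ _ _ (fun p => v p - w p)) // => p pT; rewrite !ffunE pT.
have : (#|T| + #|~: T| = k * n)%N by rewrite cardsC card_prod !card_ord.
lia.
Qed.

Definition row T (j : 'I_k) : {set 'I_n} := [set i | (j, i) \in T].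
Definition proj T : {set 'I_n} := [set p.2 | p in T].

Lemma nval_rows T (f : P -> R) :
  (nval T f <= \sum_(j < k) nval (row T j) (fun i => f (j, i)))%N.
Proof.
pose s j := undup [seq f (j, i) | i <- enum (row T j)].
have -> : (\sum_(j < k) nval (row T j) (fun i => f (j, i)) =
    size (flatten [seq s j | j <- enum 'I_k]))%N.
  by rewrite size_flatten /shape -map_comp sumnE big_map big_enum.
apply: nval_le => -[j i] pT; apply/flatten_mapP; exists j; first by rewrite mem_enum.
by apply: (nval_mem (fun i => f (j, i))); rewrite inE.
Qed.

(** The case of heights that are constant along columns; it excludes tight cycles of constraints
    later on. *)
Lemma generic_count1 (u : {ffun 'I_n -> R}) (Y : {set 'I_n}) :
  (0 < k)%N -> Y != set0 -> (k * #|Y| < \sum_(j < k) nval Y (fun i => u i - w (j, i))%R + #|Y|)%N.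
Proof.
move=> kp Y0; pose T : {set P} := [set p | p.2 \in Y].
have T0 : T != set0.
  by case/set0Pn: Y0 => i iY; apply/set0Pn; exists (Ordinal kp, i); rewrite inE.
have cT : #|T| = (k * #|Y|)%N.
  rewrite -[X in (X * _)%N](card_ord k) -cardsT -cardsX; apply: eq_card => -[j i].
  by rewrite !inE.
have := generic_count [ffun p : P => u p.2] T0; rewrite cT => /leq_trans; apply.
apply: leq_add.
  apply: leq_trans (nval_rows _ _) _; apply: leq_sum => j _.
  apply: nval_le => i; rewrite !inE /= ffunE => iY.
  exact: (nval_mem (fun i => u i - w (j, i))).
apply: leq_trans (_ : size [seq u i | i <- enum Y] <= _)%N; last by rewrite size_map cardE.
by apply: nval_le => -[j i]; rewrite inE ffunE /= => iY; rewrite map_f // mem_enum.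
Qed.

End Generic.

(** The independent sets of the Dilworth truncation: the matroid induced by [f - 1] when [f] is
    monotone and submodular. *)
Definition dil (V : finType) (f : {set V} -> nat) (S : {set V}) : bool :=
  [forall T : {set V}, (T \subset S) && (T != set0) ==> (#|T| < f T)%N].

Lemma dilP (V : finType) (f : {set V} -> nat) (S : {set V}) :
  reflect (forall T : {set V}, T \subset S -> T != set0 -> (#|T| < f T)%N) (dil f S).
Proof.
apply: (iffP forallP) => H T; first by move=> TS T0; have := H T; rewrite TS T0.
by apply/implyP => /andP[TS T0]; apply: H.
Qed.

(** * The interpolating complexes *)

Section Gam.
Variables (R : realType) (k n : nat) (w : {ffun 'I_k * 'I_n -> R}).
Variable M : 'I_k -> matroid 'I_n.
Local Notation P := ('I_k * 'I_n)%type.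
Implicit Types (u v : {ffun P -> R}) (T F S Q L : {set P}) (p q : P).

Definition above_row v p : {set 'I_n} :=
  [set e | v p - w p < v (p.1, e) - w (p.1, e)].
Definition act v p : bool := ~~ spn (M p.1) (above_row v p) p.2.
Definition dom v p : bool := [forall j, v (j, p.2) <= v p].

(* The faces of the external activity complex are the [F] with
   [Gam F setT].  The intermediate conditions interpolate between this complex
   and the independence complex of a matroid. *)
Definition Gam F Q : Prop := exists v,
  (forall p, p \in F -> act v p) /\ (forall p, p \in Q -> dom v p).

Lemma Gam_sub F F' Q Q' : F' \subset F -> Q' \subset Q -> Gam F Q -> Gam F' Q'.
Proof.
by move=> /subsetP FF /subsetP QQ [v [av dv]]; exists v; split=> p;
  [move/FF; apply: av|move/QQ; apply: dv].
Qed.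

Lemma actE v p : act v p =
  (p.2 \notin loops (initial (weight v p.1 - weight w p.1) (M p.1))).
Proof.
rewrite nonloopP /act; congr (~~ spn _ _ _); apply/setP => e.
by rewrite !inE !ffunE; case: p.
Qed.

Lemma ext_facesE F : (0 < k)%N -> F \in ext_faces w M <-> Gam F setT.
Proof.
move=> kp; rewrite inE; split=> [/asboolP[u Hu]|[v [av dv]]].
  exists [ffun p => u p.2]; split=> p pF; last by apply/forallP => j; rewrite !ffunE.
  rewrite actE; have := Hu _ pF.
  by have -> : weight [ffun p : P => u p.2] p.1 = u by apply/ffunP => e; rewrite !ffunE.
apply/asboolP; exists (weight v (Ordinal kp)) => p /av; rewrite actE.
have -> // : weight v p.1 = weight v (Ordinal kp).
apply/ffunP => e; rewrite !ffunE; apply/eqP; rewrite eq_le.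
have /forallP/(_ p.1) := dv (Ordinal kp, e) (in_setT _).
by have /forallP/(_ (Ordinal kp)) := dv (p.1, e) (in_setT _) => /= -> ->.
Qed.

Lemma act_spn u v p :
  (forall e, e \in above_row u p -> spn (M p.1) (above_row v p) e) ->
  act v p -> act u p.
Proof. by move=> H; apply: contra => sp; apply: spn_trans H sp. Qed.

Lemma act_sub u v p : above_row u p \subset above_row v p -> act v p -> act u p.
Proof. by move=> /subsetP H; apply: act_spn => e /H; apply: spn_mem. Qed.

(** Both conditions are invariant under adding a constant to all heights. This normalises two
    witnesses so that they can be compared at one element. *)
Lemma Gam_shift F Q p (c : R) : Gam F Q -> exists v, [/\ v p = c,
  forall q, q \in F -> act v q & forall q, q \in Q -> dom v q].
Proof.
case=> v [av dv]; pose d := c - v p; exists [ffun q => v q + d]; split.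
- by rewrite ffunE addrC subrK.
- move=> q /av; apply: act_sub; apply/subsetP => e; rewrite !inE !ffunE; lra.
- by move=> q /dv /forallP H; apply/forallP => j; rewrite !ffunE lerD2r.
Qed.

(** Normalise both witnesses to vanish at p and take their minimum. Where it equals one witness, the
    set above an element only shrinks, so nonloops survive; at p the two agree, so activity comes
    from one and dominance from the other. *)
Lemma Gam_meet F Q p :
  Gam (p |: F) Q -> Gam F (p |: Q) -> Gam (p |: F) (p |: Q).
Proof.
move=> /(@Gam_shift _ _ p 0)[v [v0 av dv]] /(@Gam_shift _ _ p 0)[v' [v'0 av' dv']].
pose u : {ffun P -> R} := [ffun q => Num.min (v q) (v' q)].
have ul q : u q <= v q by rewrite ffunE ge_min lexx.
have ur q : u q <= v' q by rewrite ffunE ge_min lexx orbT.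
have H q : act v q -> u q = v q -> act u q.
  move=> aq E; apply: act_sub aq; apply/subsetP => e; rewrite !inE E.
  by have := ul (q.1, e); lra.
have H' q : act v' q -> u q = v' q -> act u q.
  move=> aq E; apply: act_sub aq; apply/subsetP => e; rewrite !inE E.
  by have := ur (q.1, e); lra.
have mq q : u q = v q \/ u q = v' q.
  by rewrite ffunE; case: leP; [left|right].
exists u; split=> q; rewrite !inE; case/orP => [/eqP -> {q}|qF].
- by apply: H; [apply: av; rewrite !inE eqxx | rewrite ffunE v0 v'0 minxx].
- have [E|E] := mq q; [apply: H E|apply: H' E]; last by apply: av'.
  by apply: av; rewrite inE qF orbT.
- apply/forallP => j; have := ur (j, p.2).
  have /forallP/(_ j) := dv' p (setU11 _ _).
  have -> : u p = v' p by rewrite ffunE v0 v'0 minxx.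
  lra.
- apply/forallP => j; have := ul (j, q.2); have := ur (j, q.2).
  have /forallP/(_ j) := dv _ qF.
  have /forallP/(_ j) := dv' q (setU1r _ qF).
  by case: (mq q) => ->; lra.
Qed.

(* Move only the coordinate [p]: it can be raised until either [p] becomes a
   nonloop or it dominates the other coordinates in its column. *)
Lemma Gam_extend F Q p : (1 < k)%N -> p \notin F -> p \notin Q ->
  Gam F Q -> Gam (p |: F) Q \/ Gam F (p |: Q).
Proof.
case: p => j i k1 pF pQ [v [av dv]].
have [j0 j0j] : exists j0 : 'I_k, j0 != j.
  apply/existsP; rewrite -negb_forall; apply/negP => /forallP H.
  have k0 : (0 < k)%N by apply: ltnW.
  have /eqP E0 := H (Ordinal k0); have /eqP E1 := H (Ordinal k1).
  by have /(congr1 val) := etrans E0 (esym E1).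
have [j1 j1j j1max] := @arg_maxP _ _ _ j0 (fun j' => j' != j) (fun j' => v (j', i)) j0j.
(* [c2] is the height from which p dominates its column. [good y] says that p, placed in its row at
   shifted height [y], is a nonloop. *)
pose c2 := v (j1, i); pose z e := v (j, e) - w (j, e).
pose rel (y : R) : {set 'I_n} := [set e | (e != i) && (y < z e)].
pose good y := ~~ spn (M j) (rel y) i.
pose vx (x : R) : {ffun P -> R} := [ffun q => if q == (j, i) then x else v q].
(* When p rises above an element [e] of its row, it joins the set above [e]. If p is already spanned
   by that set, the closure is unchanged and [e] keeps its activity. The bound [c2] protects the
   dominance of the other elements of the column. *)
have persist x : x <= c2 ->
    (forall e, e != i -> z e < x - w (j, i) -> ~~ good (z e)) ->
    (forall q, q \in F -> act (vx x) q) /\ (forall q, q \in Q -> dom (vx x) q).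
  move=> xc Hx; split=> -[j' e] qF.
    have qp : (j', e) != (j, i) by apply: contraNneq pF => <-.
    have := av _ qF; apply: act_spn => /= e'; rewrite !inE /= !ffunE (negPf qp).
    case: ifP => [/eqP[Ej Ei]|_ h]; last by apply: spn_mem; rewrite inE.
    rewrite Ej Ei in qp qF * => lt; have ei : e != i by apply: contraNneq qp => ->.
    have := Hx e ei lt; rewrite negbK; apply: spnS; apply/subsetP => e1.
    by rewrite !inE => /andP[].
  have qp : (j', e) != (j, i) by apply: contraNneq pQ => <-.
  have /forallP D := dv _ qF; apply/forallP => j''; rewrite !ffunE (negPf qp).
  case: eqP => [[_ /= ei]|_]; last exact: D.
  by rewrite /= in D; have := D j1; rewrite ei -/c2; apply: le_trans.
(* The levels below [c2] at which p would be a nonloop. If there are none, p moves to [c2];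
   otherwise it moves to the lowest of them, below which [persist] applies. *)
pose G := [set e | [&& e != i, good (z e) & z e + w (j, i) < c2]].
have actx x : act (vx x) (j, i) = good (x - w (j, i)).
  rewrite /act /good; congr (~~ spn _ _ _); apply/setP => e; rewrite !inE !ffunE eqxx /=.
  case: (eqVneq e i) => [->|ei]; first by rewrite eqxx ltxx.
  by case: eqP => // -[/eqP]; rewrite (negPf ei).
have [G0|[e0 e0G]] := set_0Vmem G.
  right; have [|a d] := persist c2 (lexx _).
    move=> e ei lt; apply/negP => ge; have : e \in G by rewrite inE ei ge; lra.
    by rewrite G0 inE.
  exists (vx c2); split=> // q; rewrite !inE => /orP[/eqP ->|]; last exact: d.
  apply/forallP => j'; rewrite !ffunE eqxx /=; case: eqP => [//|].
  by move/eqP; rewrite xpair_eqE eqxx andbT => /j1max.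
left; have [e1 e1G e1min] := @arg_minP _ _ _ e0 (mem G) z e0G.
have /and3P[e1i ge1 lt1] : [&& e1 != i, good (z e1) & z e1 + w (j, i) < c2].
  by have : e1 \in G := e1G; rewrite inE.
have [|a d] := persist (z e1 + w (j, i)) (ltW lt1).
  move=> e ei lt; apply/negP => ge; have eG : e \in G by rewrite inE ei ge /=; lra.
  by have := e1min e eG; lra.
exists (vx (z e1 + w (j, i))); split=> // q; rewrite !inE => /orP[/eqP ->|]; last exact: a.
by rewrite actx addrK.
Qed.

(** The rank of the direct sum of the row matroids plus that of the partition matroid allowing one
    element per column. *)
Definition fcost T : nat := (\sum_(j < k) rk (M j) (row T j) + #|proj T|)%N.

Definition dind := dil fcost.

(** One element from each level is independent: an element of the lowest level is not spanned by the
    strictly higher ones. *)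
Lemma nval_rk (N : matroid 'I_n) (z : 'I_n -> R) (Y : {set 'I_n}) :
  (forall y, y \in Y -> ~~ spn N [set e | z y < z e] y) ->
  (nval Y z <= rk N Y)%N.
Proof.
move: {2}#|Y| (leqnn #|Y|) => m; elim: m Y => [|m IH] Y.
  by rewrite leqn0 cards_eq0 => /eqP -> _; apply: leq_trans (nval_card _ _) _; rewrite cards0.
move=> cY H; have [->|[y0 y0Y]] := set_0Vmem Y.
  by apply: leq_trans (nval_card _ _) _; rewrite cards0.
have [y yY ymin] := @arg_minP _ _ _ y0 (mem Y) z y0Y.
have {}yY : y \in Y := yY; pose Y' := [set x in Y | z y < z x].
have YY : Y' \subset Y by apply/subsetP => x; rewrite inE => /andP[].
have yY' : y \notin Y' by rewrite inE ltxx andbF.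
have cY' : (#|Y'| <= m)%N.
  rewrite -ltnS; apply: leq_trans cY; apply: proper_card; apply/properP; split=> //.
  by exists y.
have le1 : (nval Y z <= (nval Y' z).+1)%N.
  rewrite -[(nval Y' z).+1]/(size (z y :: undup [seq z x | x <- enum Y'])).
  apply: nval_le => x xY; rewrite inE; case: eqP => //= /eqP ne.
  by apply: nval_mem; rewrite inE xY lt_def ne (ymin x).
apply: leq_trans le1 _; apply: leq_trans (_ : (rk N (y |: Y') <= _)%N); last first.
  by apply: rkS; rewrite subUset sub1set yY.
rewrite rkU1; have -> : ~~ spn N Y' y.
  apply: contra (H _ yY); apply: spnS; apply/subsetP => x.
  by rewrite !inE => /andP[].
by rewrite addn1 ltnS; apply: IH => // x; move/(subsetP YY); apply: H.
Qed.

(** Genericity bounds the size of [T] strictly by two numbers of values. In a row, [v - w] takes at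
    most as many values as the rank, by [nval_rk]; and [v] takes one value per column, since
    dominating elements of one column have equal height. *)
Lemma Gam_dind S : generic_pair w -> Gam S S -> dind S.
Proof.
move=> gw [v [av dv]]; apply/dilP => T /subsetP TS T0.
apply: leq_trans (generic_count gw v T0) _; apply: leq_add.
  apply: leq_trans (nval_rows _ _) _; apply: leq_sum => j _.
  by apply: nval_rk => i; rewrite inE => /TS /av.
rewrite cardE; pose h i := if [pick p in T | p.2 == i] is Some p then v p else 0.
rewrite -(size_map h); apply: nval_le => p pT; apply/mapP; exists p.2.
  by rewrite mem_enum; apply: imset_f.
rewrite /h; case: pickP => [q /andP[qT /eqP qp]|/(_ p)]; last by rewrite /= pT eqxx.
have /forallP/(_ q.1) := dv _ (TS _ pT); have /forallP/(_ p.1) := dv _ (TS _ qT).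
move=> h2 h1; rewrite qp -surjective_pairing in h2; rewrite -qp -surjective_pairing in h1.
by apply/eqP; rewrite eq_le h1 h2.
Qed.

End Gam.

(** * The Dilworth truncation *)

Section Dilworth.
Local Open Scope nat_scope.
Variables (V : finType) (f : {set V} -> nat).
Hypothesis fS : forall A B : {set V}, A \subset B -> f A <= f B.
Hypothesis fU : forall A B : {set V}, f (A :|: B) + f (A :&: B) <= f A + f B.
Hypothesis f1 : forall x, f [set x] <= 2.
Implicit Types (S T A B X : {set V}) (x y p : V).

Lemma dilS S T : T \subset S -> dil f S -> dil f T.
Proof.
move=> TS /dilP H; apply/dilP => U UT; apply: H.
exact: subset_trans UT TS.
Qed.

Lemma dil_absorbed A X : (forall p, p \in X -> f (p |: A) = f A) ->
  f (A :|: X) = f A.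
Proof.
move: {2}#|X| (erefl #|X|) => m; elim: m X => [|m IH] X.
  by move/eqP; rewrite cards_eq0 => /eqP -> _; rewrite setU0.
move=> cX H; have [x xX] : exists x, x \in X by apply/card_gt0P; rewrite cX.
have E : f (A :|: (X :\ x)) = f A.
  apply: IH; first by move: cX; rewrite (cardsD1 x) xX => -[].
  by move=> y; rewrite inE => /andP[_]; apply: H.
apply/eqP; rewrite eqn_leq (fS (subsetUl _ _)) andbT.
rewrite -(setD1K xX) setUCA setUA.
have := fU (x |: A) (A :|: (X :\ x)); rewrite E (H _ xX) -setUA (setUA A) setUid setUA.
have : f A <= f ((x |: A) :&: (A :|: X :\ x)) by apply: fS; rewrite subsetI subsetUr subsetUl.
lia.
Qed.

Variable S : {set V}.
Hypothesis dS : dil f S.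

(** The case of equality in the defining inequality, up to integrality. Singletons of [S] are tight
    because [f] is at most 2 on them. *)
Definition tight T := [&& T \subset S, T != set0 & f T == #|T|.+1].

Lemma tightU A B : tight A -> tight B -> A :&: B != set0 -> tight (A :|: B).
Proof.
move=> /and3P[AS A0 /eqP fA] /and3P[BS B0 /eqP fB] I0.
have US : A :|: B \subset S by rewrite subUset AS BS.
have U0 : A :|: B != set0.
  by case/set0Pn: A0 => x xA; apply/set0Pn; exists x; rewrite inE xA.
apply/and3P; split=> //; rewrite eqn_leq (dilP _ _ dS) // andbT.
have := dilP _ _ dS (A :&: B) (subset_trans (subsetIl _ _) AS) I0.
have := fU A B; have := cardsUI A B; lia.
Qed.

Lemma tight1 x : x \in S -> tight [set x].
Proof.
move=> xS; have s0 : [set x] != set0 by apply/set0Pn; exists x; rewrite inE.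
have sS : [set x] \subset S by rewrite sub1set.
by rewrite /tight sS s0 eqn_leq cards1 f1 -[2](congr1 succn (cards1 x)) (dilP _ _ dS).
Qed.

(** The largest tight set through [x]; these sets partition [S]. *)
Definition tblock x := \bigcup_(T | tight T && (x \in T)) T.

Lemma tblock_max T x : tight T -> x \in T -> T \subset tblock x.
Proof. by move=> tT xT; apply: bigcup_sup; rewrite tT. Qed.

Lemma mem_tblock x : x \in S -> x \in tblock x.
Proof.
move=> xS; have /subsetP := tblock_max (tight1 xS) (set11 x).
by apply; rewrite inE.
Qed.

Lemma tblock_tight x : x \in S -> tight (tblock x).
Proof.
move=> xS; have E : tblock x = [set x] :|: tblock x.
  by apply/setP => y; rewrite !inE; case: eqP => // ->; rewrite mem_tblock.
suff : tight ([set x] :|: tblock x) && (x \in [set x] :|: tblock x) by rewrite -E => /andP[].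
rewrite /tblock; apply: (big_ind (fun A => tight ([set x] :|: A) && (x \in [set x] :|: A))).
- by rewrite setU0 set11 tight1.
- move=> A B /andP[tA xA] /andP[tB xB].
  have -> : [set x] :|: (A :|: B) = ([set x] :|: A) :|: ([set x] :|: B).
    by rewrite setUACA setUid.
  rewrite tightU //=; first by rewrite inE xA.
  by apply/set0Pn; exists x; rewrite inE xA.
- move=> A /andP[tA xA]; rewrite inE inE eqxx andbT.
  by have -> : [set x] :|: A = A by apply/setUidPr; rewrite sub1set.
Qed.

Lemma tblock_eq x y : x \in S -> y \in tblock x -> tblock y = tblock x.
Proof.
move=> xS yx; have tx := tblock_tight xS.
have yS : y \in S by case/and3P: tx => /subsetP/(_ _ yx).
have ty := tblock_tight yS.
have tU : tight (tblock x :|: tblock y).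
  by apply: tightU => //; apply/set0Pn; exists y; rewrite inE yx mem_tblock.
apply/eqP; rewrite eqEsubset; apply/andP; split.
  apply: subset_trans (subsetUr (tblock x) _) _; apply: tblock_max => //.
  by rewrite inE mem_tblock.
apply: subset_trans (subsetUl _ (tblock y)) _; apply: tblock_max => //.
by rewrite inE yx.
Qed.

Definition tblocks := [set tblock x | x in S].

Lemma tblocks_partition : partition tblocks S.
Proof.
apply/and3P; split.
- apply/eqP/setP => y; apply/bigcupP/idP => [[B /imsetP[x xS ->]]|yS].
    by case/and3P: (tblock_tight xS) => /subsetP sub _ _; apply: sub.
  by exists (tblock y); [apply: imset_f|apply: mem_tblock].
- apply/trivIsetP => A B /imsetP[x xS ->] /imsetP[y yS ->].
  apply: contraNT => /pred0Pn[z /= /andP[zx zy]].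
  by rewrite -(tblock_eq xS zx) -(tblock_eq yS zy).
- apply/negP => /imsetP[x xS E].
  by have := mem_tblock xS; rewrite -E inE.
Qed.

Lemma card_tblocks : #|S| = \sum_(B in tblocks) #|B|.
Proof. exact: card_partition tblocks_partition. Qed.

Lemma tblocks_tight B : B \in tblocks -> tight B.
Proof. by case/imsetP => x xS ->; apply: tblock_tight. Qed.

(** A subset violating independence consists of p and a tight set, which already absorbs p; by
    submodularity so does the block containing it. *)
Lemma tblock_absorb p : p \notin S -> 1 < f [set p] -> ~~ dil f (p |: S) ->
  exists2 B, B \in tblocks & f (p |: B) = f B.
Proof.
move=> pS fp; rewrite negb_forall => /existsP[T].
rewrite negb_imply -leqNgt => /andP[/andP[TS T0] le].
have pT : p \in T.
  apply: contraLR le => pT; rewrite -ltnNge (dilP _ _ dS) //.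
  apply/subsetP => x xT; have := subsetP TS _ xT; rewrite !inE.
  by case: eqP => // xp; rewrite -xp xT in pT.
have T'S : T :\ p \subset S.
  by apply/subsetP => x; rewrite !inE => /andP[xp /(subsetP TS)]; rewrite !inE (negPf xp).
have cT : #|T| = #|T :\ p|.+1 by rewrite (cardsD1 p) pT.
have [E|[x xT']] := set_0Vmem (T :\ p).
  have E1 : T = [set p] by rewrite -(setD1K pT) E setU0.
  by move: le; rewrite E1 cards1; lia.
have T'0 : T :\ p != set0 by apply/set0Pn; exists x.
have h1 := dilP _ _ dS _ T'S T'0; have h2 := fS (subsetDl T [set p]).
have tT' : tight (T :\ p) by rewrite /tight T'S T'0 eqn_leq h1 /=; lia.
have xS : x \in S by apply: (subsetP T'S).
exists (tblock x); first exact: imset_f.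
have sub := tblock_max tT' xT'.
have BS : tblock x \subset S by case/and3P: (tblock_tight xS).
apply/eqP; rewrite eqn_leq (fS (subsetUr _ _)) andbT.
have := fU T (tblock x).
have -> : T :|: tblock x = p |: tblock x.
  by rewrite -{1}(setD1K pT) -setUA (setUidPr sub).
have : f (T :\ p) <= f (T :&: tblock x) by apply: fS; rewrite subsetI sub subsetDl.
by clear -le cT h1; lia.
Qed.

(** If nothing can be added, every element of [S'] is absorbed by a block [B] of [S]. The elements
    absorbed by [B] have total value at most [f B], which is [#|B|] plus one, so independence of
    [S'] allows at most [#|B|] of them. Summing over the blocks bounds [#|S'|] by [#|S|]. *)
Lemma dil_augment S' : dil f S' -> #|S| < #|S'| ->
  exists2 p, p \in S' :\: S & dil f (p |: S).
Proof.
move=> dS' lt; apply/exists_inP; apply: contraLR lt; rewrite negb_exists_in => /forall_inP H.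
rewrite -leqNgt card_tblocks.
pose X B := [set p in S' | f (p |: B) == f B].
apply: (@leq_trans (\sum_(B in tblocks) #|X B|)).
  rewrite -sum1_card (eq_bigr (fun B => \sum_(p in S' | f (p |: B) == f B) 1)); last first.
    by move=> B _; rewrite -sum1_card; apply: eq_bigl => p; rewrite inE.
  rewrite (exchange_big_dep (mem S')) /=; last by move=> B p _ /andP[].
  apply: leq_sum => p pS'.
  have [B Bt E] : exists2 B, B \in tblocks & f (p |: B) = f B.
    have [pS|pS] := boolP (p \in S).
      exists (tblock p); first exact: imset_f.
      by rewrite (setUidPr _) // sub1set mem_tblock.
    apply: tblock_absorb => //; last by apply: H; rewrite inE pS.
    have := dilP _ _ dS' [set p]; rewrite cards1 sub1set; apply=> //.
    by apply/set0Pn; exists p; rewrite inE.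
  by rewrite (bigD1 B) ?pS' ?E ?eqxx ?Bt.
apply: leq_sum => B Bt; have /and3P[_ _ /eqP fB] := tblocks_tight Bt.
have [->|X0] := eqVneq (X B) set0; first by rewrite cards0.
rewrite -ltnS -fB; apply: (@leq_trans (f (X B))).
  by apply: (dilP _ _ dS') => //; apply/subsetP => p; rewrite inE => /andP[].
rewrite -(dil_absorbed (A := B) (X := X B)); first by apply: fS; apply: subsetUr.
by move=> p; rewrite inE => /andP[_ /eqP].
Qed.

End Dilworth.

(** * The truncation attached to the tuple, and its rank *)

Section DindMatroid.
Variables (k n : nat) (M : 'I_k -> matroid 'I_n).
Local Notation P := ('I_k * 'I_n)%type.
Implicit Types (S T A B : {set P}) (p : P).

Lemma mem_proj T i : (i \in proj T) = [exists j, (j, i) \in T].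
Proof.
apply/imsetP/existsP => [[[j i'] pT /= ->]|[j jT]]; first by exists j.
by exists (j, i).
Qed.

Lemma rowU A B j : row (A :|: B) j = row A j :|: row B j.
Proof. by apply/setP => i; rewrite !inE. Qed.

Lemma rowI A B j : row (A :&: B) j = row A j :&: row B j.
Proof. by apply/setP => i; rewrite !inE. Qed.

Lemma rowS A B j : A \subset B -> row A j \subset row B j.
Proof. by move=> /subsetP H; apply/subsetP => i; rewrite !inE => /H. Qed.

Lemma fcostS A B : A \subset B -> (fcost M A <= fcost M B)%N.
Proof.
move=> AB; apply: leq_add; last by apply/subset_leq_card/imsetS.
by apply: leq_sum => j _; apply/rkS/rowS.
Qed.

Lemma fcostU A B : (fcost M (A :|: B) + fcost M (A :&: B) <= fcost M A + fcost M B)%N.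
Proof.
rewrite /fcost addnACA [leqRHS]addnACA; apply: leq_add.
  rewrite -!big_split; apply: leq_sum => j _; rewrite rowU rowI; exact: rk_submod.
rewrite /proj imsetU -[leqRHS]cardsUI leq_add2l; apply: subset_leq_card.
by rewrite subsetI !imsetS ?subsetIl ?subsetIr.
Qed.

Lemma fcost1 p : fcost M [set p] = (rk (M p.1) [set p.2]).+1.
Proof.
rewrite /fcost /proj imset_set1 cards1 addn1; congr _.+1.
rewrite (bigD1 p.1) //= big1 ?addn0.
  by congr rk; apply/setP => i; rewrite !inE; case: p => j i'; rewrite xpair_eqE eqxx.
move=> j jp; have -> : row [set p] j = set0; last exact: rk0.
by apply/setP => i; rewrite !inE; case: p jp => j' i' /= jp; rewrite xpair_eqE (negPf jp).
Qed.

Lemma fcost1_le p : (fcost M [set p] <= 2)%N.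
Proof. by rewrite fcost1 ltnS (leq_trans (rk_le_card _ _)) // cards1. Qed.

Lemma dindS S T : T \subset S -> dind M S -> dind M T.
Proof. exact: dilS. Qed.

Lemma dind_augment S S' : dind M S -> dind M S' -> (#|S| < #|S'|)%N ->
  exists2 p, p \in S' :\: S & dind M (p |: S).
Proof. by move=> dS dS'; apply: (dil_augment fcostS fcostU fcost1_le dS dS'). Qed.

Lemma Posz_sum (I : finType) (Q : pred I) (F : I -> nat) :
  (\sum_(i | Q i) F i)%N%:Z = \sum_(i | Q i) (F i)%:Z.
Proof. exact: (big_morph Posz PoszD). Qed.

(** Split [S] by the blocks of columns: the part over [A] is independent, and its value is at most
    the rank sum of [A] plus [#|A|]. *)
Lemma dind_le_cost S (Pt : {set {set 'I_n}}) : dind M S -> partition Pt setT ->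
  #|S|%:Z <= n%:Z + rho_cost M Pt.
Proof.
move=> dS pt; have covn : (\sum_(A in Pt) #|A| = n)%N.
  by rewrite -(card_partition pt) cardsT card_ord.
have -> : #|S|%:Z = \sum_(A in Pt) #|[set p in S | p.2 \in A]|%:Z.
  rewrite -sum1_card -Posz_sum; congr (_%:Z).
  rewrite (eq_bigr (fun A : {set 'I_n} => \sum_(p in S | p.2 \in A) 1)%N); last first.
    by move=> A _; rewrite -sum1_card; apply: eq_bigl => p; rewrite inE.
  rewrite (exchange_big_dep (mem S)) /=; last by move=> B p _ /andP[].
  apply: eq_bigr => p pS; have /and3P[/eqP cov tI _] := pt.
  have ip : p.2 \in cover Pt by rewrite cov inE.
  rewrite (big_pred1 (pblock Pt p.2)) // => A; rewrite pS /=.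
  by apply/andP/eqP => [[APt iA]|->]; [rewrite (def_pblock tI APt iA)|rewrite pblock_mem ?mem_pblock].
have -> : n%:Z = \sum_(A in Pt) #|A|%:Z by rewrite -Posz_sum covn.
rewrite -big_split /=; apply: ler_sum => A APt.
set X := [set p in S | _].
have lt : (#|X| < \sum_(j < k) rk (M j) A + #|A|)%N.
  have [->|X0] := eqVneq X set0.
    rewrite cards0 addn_gt0 orbC card_gt0; case/and3P: pt => _ _ n0.
    by rewrite (contraNneq _ n0) // => <-.
  have XS : X \subset S by apply/subsetP => p; rewrite inE => /andP[].
  apply: leq_trans (dilP _ _ dS X XS X0) _; apply: leq_add.
    by apply: leq_sum => j _; apply: rkS; apply/subsetP => i; rewrite !inE => /andP[].
  apply: subset_leq_card; apply/subsetP => i /imsetP[p].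
  by rewrite inE => /andP[_ pA ->].
by move: lt; move: #|_| #|_| (\sum_(j < k) _)%N => a b c; lia.
Qed.

(** The column sets of the tight blocks of a maximal set attain the bound. Two blocks with a common
    column have a tight union, since the column count drops by at least one, so they coincide. By
    maximality a nonloop of any row is absorbed by a block, which puts its column into that block
    and makes the row of the block span it. *)
Lemma dind_cover S : no_common_loop M -> dind M S ->
  (forall p, p \notin S -> ~~ dind M (p |: S)) ->
  exists2 Pt : {set {set 'I_n}}, partition Pt setT & #|S|%:Z = n%:Z + rho_cost M Pt.
Proof.
move=> ncl dS mS; pose bl := tblocks (fcost M) S.
have tgt B : B \in bl -> tight (fcost M) S B.
  exact: (tblocks_tight fcostU fcost1_le dS).
have blP := tblocks_partition fcostU fcost1_le dS.
have uniqB B B' p : B \in bl -> B' \in bl -> p \in B -> p \in B' -> B = B'.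
  case/and3P: blP => _ tI _ Bb Bb' pB pB'.
  by rewrite -(def_pblock tI Bb pB) (def_pblock tI Bb' pB').
have dispr B B' i : B \in bl -> B' \in bl -> i \in proj B -> i \in proj B' -> B = B'.
  move=> Bb Bb' iB iB'; apply/eqP; case: (boolP (B :&: B' == set0)) => [/eqP E|/set0Pn[p]].
    have /and3P[BS B0 /eqP fB] := tgt _ Bb; have /and3P[BS' B0' /eqP fB'] := tgt _ Bb'.
    have lt : (#|proj (B :|: B')| < #|proj B| + #|proj B'|)%N.
      rewrite /proj imsetU -cardsUI -[X in (X < _)%N]addn0 ltn_add2l card_gt0.
      by apply/set0Pn; exists i; rewrite inE iB.
    have le : (\sum_(j < k) rk (M j) (row (B :|: B') j) <=
      \sum_(j < k) rk (M j) (row B j) + \sum_(j < k) rk (M j) (row B' j))%N.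
      rewrite -big_split; apply: leq_sum => j _; rewrite rowU /=.
      by apply: leq_trans (rk_submod _ _ _); apply: leq_addr.
    have cU : #|B :|: B'| = (#|B| + #|B'|)%N by rewrite -cardsUI E cards0 addn0.
    have US : B :|: B' \subset S by rewrite subUset BS BS'.
    have U0 : B :|: B' != set0.
      by case/set0Pn: B0 => x xB; apply/set0Pn; exists x; rewrite inE xB.
    have tU : tight (fcost M) S (B :|: B').
      rewrite /tight US U0 eqn_leq (dilP _ _ dS) // andbT cU.
      move: lt le fB fB'; rewrite /fcost; clear.
      do 3!move: (\sum_(j < k) _)%N => ?; do 5!move: #|_| => ?; lia.
    have /set0Pn[x xB] := B0; have /set0Pn[y yB'] := B0'.
    have xS : x \in S by apply: (subsetP BS).
    have yS : y \in S by apply: (subsetP BS').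
    have bx : B = tblock (fcost M) S x.
      apply: (@uniqB _ _ x) => //; first exact: imset_f.
      by apply: (mem_tblock fcost1_le dS).
    have by_ : B' = tblock (fcost M) S y.
      apply: (@uniqB _ _ y) => //; first exact: imset_f.
      by apply: (mem_tblock fcost1_le dS).
    rewrite bx by_ eq_sym (tblock_eq fcostU fcost1_le dS xS) //.
    have /subsetP := tblock_max tU (subsetP (subsetUl B B') _ xB); apply.
    by rewrite inE yB' orbT.
  by rewrite inE => /andP[pB pB']; apply/eqP/(uniqB _ _ p).
have absb j i : rk (M j) [set i] = 1%N ->
    exists2 B, B \in bl & fcost M ((j, i) |: B) = fcost M B.
  move=> r1; have [pS|pS] := boolP ((j, i) \in S).
    exists (tblock (fcost M) S (j, i)); first exact: imset_f.
    by rewrite (setUidPr _) // sub1set (mem_tblock fcost1_le dS).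
  by apply: (tblock_absorb fcostS fcostU fcost1_le dS pS); rewrite ?fcost1 /= ?r1 //; apply: mS.
have absb2 B j i : fcost M ((j, i) |: B) = fcost M B ->
    i \in proj B /\ spn (M j) (row B j) i.
  have le j' : (rk (M j') (row B j') <= rk (M j') (row ((j, i) |: B) j'))%N.
    by apply/rkS/rowS/subsetUr.
  have le2 : (#|proj B| <= #|proj ((j, i) |: B)|)%N.
    by apply/subset_leq_card/imsetS/subsetUr.
  have E1 : row ((j, i) |: B) j = i |: row B j.
    by apply/setP => e; rewrite !inE xpair_eqE eqxx.
  have E2 : proj ((j, i) |: B) = i |: proj B by rewrite /proj imsetU1.
  rewrite /fcost (bigD1 j) //= [in RHS](bigD1 j) //= E1 => E.
  have le3 : (\sum_(i0 < k | i0 != j) rk (M i0) (row B i0) <=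
          \sum_(i0 < k | i0 != j) rk (M i0) (row ((j, i) |: B) i0))%N.
    by apply: leq_sum => j' _; apply: le.
  move: E le3; rewrite rkU1 E2 cardsU1; clear.
  move: (\sum_(j < k | _) _)%N (\sum_(j < k | _) _)%N (rk _ _) #|_| => a b c d.
  by case: (spn _ _ _); case: (i \in _) => /=; lia.
have rk01 j i : rk (M j) [set i] = 1%N \/ spn (M j) set0 i.
  have := rkU1 (M j) set0 i; rewrite setU0 rk0 add0n => ->.
  by case: (spn _ _ _); [right|left].
pose Pt := [set proj B | B in bl].
have injp : {in bl &, injective (@proj k n)}.
  move=> B B' Bb Bb' E; have /and3P[_ /set0Pn[[j i] pB] _] := tgt _ Bb.
  have iB : i \in proj B by rewrite mem_proj; apply/existsP; exists j.
  by apply: (dispr _ _ i) => //; rewrite -E.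
have pt : partition Pt setT.
  apply/and3P; split.
  - apply/eqP/setP => i; rewrite inE; apply/bigcupP.
    have [j] := ncl i; rewrite loopsP; case: (rk01 j i) => [r1 _|-> //].
    have [B Bb /absb2[iB _]] := absb _ _ r1.
    by exists (proj B) => //; apply: imset_f.
  - apply/trivIsetP => A A' /imsetP[B Bb ->] /imsetP[B' Bb' ->].
    by apply: contraNT => /pred0Pn[i /= /andP[iB iB']]; rewrite (dispr _ _ i Bb Bb' iB iB').
  - apply/negP => /imsetP[B /tgt/and3P[_ /set0Pn[[j i] pB] _] E].
    have : i \in proj B by rewrite mem_proj; apply/existsP; exists j.
    by rewrite -E inE.
exists Pt => //; rewrite (card_tblocks fcostU fcost1_le dS).
have -> : n%:Z = \sum_(A in Pt) #|A|%:Z.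
  by rewrite -Posz_sum -(card_partition pt) cardsT card_ord.
rewrite /rho_cost !Posz_sum -big_split /= /Pt (big_imset _ injp) /=.
apply: eq_bigr => B Bb; have /and3P[_ _ /eqP fB] := tgt _ Bb.
suff -> : (\sum_(j < k) rk (M j) (proj B) = \sum_(j < k) rk (M j) (row B j))%N.
  by move: fB; rewrite /fcost; clear; move: (\sum_(j < k) _)%N #|_| #|_| => a b c; lia.
apply: eq_bigr => j _; have sub : row B j \subset proj B.
  by apply/subsetP => i; rewrite inE => pB; rewrite mem_proj; apply/existsP; exists j.
rewrite -{1}(setUidPr sub); apply: spn_setU => i iB.
have [r1|sp] := rk01 j i; last by apply: spnS sp; apply: sub0set.
have [B' Bb' /absb2[iB' sp]] := absb _ _ r1.
by rewrite (dispr _ _ i Bb Bb' iB iB').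
Qed.

Lemma dind0 : dind M set0.
Proof. by apply/dilP => T; rewrite subset0 => ->. Qed.

(** Every partition gives an upper bound, and for a maximal set one partition attains it; hence all
    maximal sets have the same size. *)
Lemma dind_rank : no_common_loop M -> exists r : nat,
  [/\ r%:Z = n%:Z + rho M setT, forall S, dind M S -> (#|S| <= r)%N
    & forall S, dind M S -> exists S', [/\ S \subset S', dind M S' & #|S'| = r]].
Proof.
move=> ncl.
have mx S : dind M S -> (forall p, p \notin S -> ~~ dind M (p |: S)) ->
    #|S|%:Z = n%:Z + rho M setT.
  move=> dS mS; have [Pt pt E] := dind_cover ncl dS mS.
  apply/eqP; rewrite eq_le; apply/andP; split; last first.
    by rewrite E lerD2l; apply: bigmin_le_cond.
  (* The partition into singletons is the starting value of the minimum in [rho]. *)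
  have p0 : partition [set [set x] | x in [set: 'I_n]] setT.
    apply/and3P; split.
    - apply/eqP/setP => i; rewrite inE; apply/bigcupP; exists [set i]; last by rewrite inE.
      exact: imset_f.
    - apply/trivIsetP => A A' /imsetP[x _ ->] /imsetP[y _ ->].
      by rewrite disjoints1 inE; apply: contraNN => /eqP ->.
    - by apply/negP => /imsetP[x _ E0]; have := set11 x; rewrite -E0 inE.
  rewrite /rho; apply: (big_ind (fun z => #|S|%:Z <= n%:Z + z)).
  - exact: dind_le_cost.
  - by move=> x y h1 h2; rewrite /Num.min; case: ifP.
  - by move=> Q; apply: dind_le_cost.
have ext S : dind M S -> exists S', [/\ S \subset S', dind M S'
    & forall p, p \notin S' -> ~~ dind M (p |: S')].
  move=> dS; have [S' /maxsetP[/= /andP[dS' SS'] mS'] _] :=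
    @maxset_exists _ (fun X => dind M X && (S \subset X)) S (introT andP (conj dS (subxx S))).
  exists S'; split=> // p pS'; apply/negP => d.
  have := mS' (p |: S'); rewrite d subsetUr (subset_trans SS') ?subsetUr // => /(_ isT isT) E.
  by rewrite -E !inE eqxx in pS'.
have [S0 [_ dS0 mS0]] := ext _ dind0.
exists #|S0|; split; first exact: mx.
  move=> S dS; have [S' [SS' dS' mS']] := ext S dS.
  apply: leq_trans (subset_leq_card SS') _.
  by have := mx _ dS0 mS0; rewrite -(mx _ dS' mS') => -[->].
move=> S dS; have [S' [SS' dS' mS']] := ext S dS; exists S'; split=> //.
by have := mx _ dS0 mS0; rewrite -(mx _ dS' mS') => -[->].
Qed.

End DindMatroid.

(** * Fourier-Motzkin elimination *)

Section FourierMotzkin.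
Variable R : realFieldType.
Implicit Types (x y : nat -> R) (C : seq ((nat -> R) * R)).

Definition upd x m (t : R) : nat -> R := fun i => if i == m then t else x i.

Definition lform m (a x : nat -> R) : R := \sum_(i < m) a i * x i.

Definition holds m x (c : (nat -> R) * R) : bool := c.2 <= lform m c.1 x.

Definition sat m C x : bool := all (holds m x) C.

Lemma lform_upd m a x t : lform m.+1 a (upd x m t) = lform m a x + a m * t.
Proof.
rewrite /lform big_ord_recr /= /upd eqxx; congr (_ + _); apply: eq_bigr => i _.
by rewrite ltn_eqF.
Qed.

Lemma interval_point (Lo Up : seq R) :
  (forall l u, l \in Lo -> u \in Up -> l <= u) ->
  exists t, (forall l, l \in Lo -> l <= t) /\ (forall u, u \in Up -> t <= u).
Proof.
case: Lo => [|l0 Lo] H.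
  elim: Up {H} => [|u Up [t [_ IH]]]; first by exists 0.
  exists (Num.min u t); split=> // v; rewrite inE => /orP[/eqP->|/IH]; rewrite ge_min.
    by rewrite lexx.
  by move=> ->; rewrite orbT.
exists (foldr Num.max l0 Lo); split=> [l|u uU].
  rewrite inE; elim: Lo {H} => [|a Lo IH] /=; first by rewrite orbF => /eqP ->.
  rewrite inE orbCA => /orP[/eqP ->|/IH le]; rewrite le_max ?lexx //.
  by rewrite le orbT.
elim: Lo H => [|a Lo IH] H /=; first by apply: H => //; rewrite inE.
rewrite ge_max H ?inE ?eqxx ?orbT //=; apply: IH => l u' lL; apply: H.
by move: lL; rewrite !inE => /orP[->|->] //; rewrite !orbT.
Qed.

(* Eliminating the coordinate [m]: the positive combinations of pairs of
   constraints in which it occurs with opposite signs. *)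
Definition elim m C : seq ((nat -> R) * R) :=
  [seq c <- C | c.1 m == 0] ++
  [seq (fun i => p.1 m * q.1 i - q.1 m * p.1 i, p.1 m * q.2 - q.1 m * p.2)
     | p <- [seq c <- C | 0 < c.1 m], q <- [seq c <- C | c.1 m < 0]].

Lemma lform_comb m (p q : R) (a b x : nat -> R) :
  lform m (fun i => p * a i - q * b i) x = p * lform m a x - q * lform m b x.
Proof.
rewrite /lform !mulr_sumr -sumrB; apply: eq_bigr => i _.
by rewrite mulrBl !mulrA.
Qed.

Lemma sat_elim m C x : sat m (elim m C) x <-> exists t, sat m.+1 C (upd x m t).
Proof.
have H (c : (nat -> R) * R) t : holds m.+1 (upd x m t) c = (c.2 - lform m c.1 x <= c.1 m * t).
  by rewrite /holds lform_upd; lra.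
split; last first.
  case=> t /allP sC; apply/allP => c; rewrite mem_cat => /orP[|].
    rewrite mem_filter => /andP[/eqP c0 cC]; have := sC _ cC; rewrite H c0 mul0r.
    by rewrite /holds subr_le0.
  case/allpairsP => -[p q] /= []; rewrite !mem_filter => /andP[p0 pC] /andP[q0 qC] ->.
  have := sC _ pC; have := sC _ qC; rewrite !H /holds /= lform_comb => h1 h2.
  have h3 : p.1 m * (q.2 - lform m q.1 x) <= p.1 m * (q.1 m * t) by rewrite ler_pM2l.
  have h4 : - q.1 m * (p.2 - lform m p.1 x) <= - q.1 m * (p.1 m * t).
    by rewrite ler_pM2l // oppr_gt0.
  have -> : p.1 m * q.2 - q.1 m * p.2 =
    p.1 m * (q.2 - lform m q.1 x) + (- q.1 m * (p.2 - lform m p.1 x))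
    + (p.1 m * lform m q.1 x - q.1 m * lform m p.1 x) by ring.
  rewrite gerDr; apply: le_trans (lerD h3 h4) _.
  by rewrite le_eqVlt; apply/orP; left; apply/eqP; ring.
move=> /allP sE.
case: (@interval_point
  [seq (c.2 - lform m c.1 x) / c.1 m | c <- C & 0 < c.1 m]
  [seq (c.2 - lform m c.1 x) / c.1 m | c <- C & c.1 m < 0]) => [l u|t [tL tU]].
  move=> /mapP[p]; rewrite mem_filter => /andP[p0 pC] ->.
  move=> /mapP[q]; rewrite mem_filter => /andP[q0 qC] ->.
  have := sE (fun i => p.1 m * q.1 i - q.1 m * p.1 i, p.1 m * q.2 - q.1 m * p.2).
  rewrite mem_cat orbC; have -> : (fun i => p.1 m * q.1 i - q.1 m * p.1 i,
      p.1 m * q.2 - q.1 m * p.2) \in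
      [seq (fun i => p.1 m * q.1 i - q.1 m * p.1 i, p.1 m * q.2 - q.1 m * p.2)
     | p <- [seq c <- C | 0 < c.1 m], q <- [seq c <- C | c.1 m < 0]].
    by apply/allpairsP; exists (p, q); rewrite !mem_filter p0 pC q0 qC.
  move=> /(_ isT); rewrite /holds /= lform_comb => h.
  rewrite ler_pdivrMr // mulrAC ler_ndivlMr //.
  by move: h; lra.
exists t; apply/allP => c cC; rewrite H; case: (ltgtP (c.1 m) 0) => c0.
- have cin : c \in [seq c <- C | c.1 m < 0] by rewrite mem_filter c0.
  have := tU _ (map_f _ cin).
  by rewrite ler_ndivlMr // mulrC.
- have cin : c \in [seq c <- C | 0 < c.1 m] by rewrite mem_filter c0.
  have := tL _ (map_f _ cin).
  by rewrite ler_pdivrMr // mulrC.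
- have := sE c; rewrite mem_cat mem_filter c0 eqxx cC /= => /(_ isT).
  by rewrite /holds mul0r; lra.
Qed.

Lemma eq_lform m a x y : (forall i, (i < m)%N -> x i = y i) -> lform m a x = lform m a y.
Proof. by move=> E; apply: eq_bigr => i _; rewrite E. Qed.

Lemma eq_sat m C x y : (forall i, (i < m)%N -> x i = y i) -> sat m C x = sat m C y.
Proof. by move=> E; apply: eq_all => c; rewrite /holds (eq_lform _ E). Qed.

Lemma sat_down m C : exists C', forall x, sat 1 C' x <->
  exists y, y 0%N = x 0%N /\ sat m.+1 C y.
Proof.
elim: m C => [|m IH] C.
  exists C => x; split=> [s|[y [E]]]; first by exists x.
  by rewrite (@eq_sat _ _ y x) // => -[].
have [C' H] := IH (elim m.+1 C); exists C' => x; rewrite H; split.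
  by case=> y [E /sat_elim[t s]]; exists (upd y m.+1 t).
case=> y [E s]; exists y; split=> //; apply/sat_elim; exists (y m.+1).
by rewrite (@eq_sat _ _ _ y) // => i _; rewrite /upd; case: eqP => // ->.
Qed.

Lemma seq_max a (s : seq R) : exists2 z, z \in a :: s & forall l, l \in a :: s -> l <= z.
Proof.
elim: s a => [|b s IH] a; first by exists a; rewrite ?inE // => l; rewrite inE => /eqP ->.
have [z zs zm] := IH b; exists (Num.max a z).
  by rewrite inE /Num.max; case: ifP; rewrite ?zs ?orbT ?eqxx.
by move=> l; rewrite inE le_max => /orP[/eqP ->|/zm ->]; rewrite ?lexx ?orbT.
Qed.

(** Projection to the objective coordinate leaves finitely many bounds on one number, and the
    largest lower bound is attained. *)
Lemma sat_min m C lo : (exists x, sat m.+1 C x) ->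
  (forall x, sat m.+1 C x -> lo <= x 0%N) ->
  exists2 x, sat m.+1 C x & forall y, sat m.+1 C y -> x 0%N <= y 0%N.
Proof.
move=> [x0 s0] bd; have [C' H] := sat_down m C.
have lf1 a x : lform 1 a x = a 0%N * x 0%N by rewrite /lform big_ord_recl big_ord0 addr0.
have sx0 : sat 1 C' x0 by apply/H; exists x0.
have cand z : (forall c, c \in C' -> 0 < c.1 0%N -> c.2 / c.1 0%N <= z) -> z <= x0 0%N ->
    exists2 x, sat m.+1 C x & x 0%N = z.
  move=> zL zx; have : sat 1 C' (fun=> z).
    apply/allP => c cC; rewrite /holds lf1; case: (ltgtP (c.1 0%N) 0) => c0.
    - apply: (le_trans (allP sx0 _ cC)); rewrite lf1 ler_nM2l //.
    - by rewrite -ler_pdivrMl // mulrC zL.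
    - by have := allP sx0 _ cC; rewrite /holds lf1 c0 !mul0r.
  by move/H => -[x [E s]]; exists x.
have [E|[c0 c0C]] : [seq c <- C' | 0 < c.1 0%N] = [::] \/ exists c, c \in [seq c <- C' | 0 < c.1 0%N].
  by case: [seq c <- C' | _] => [|c s]; [left|right; exists c; rewrite inE eqxx].
  (* Without a lower bound among the projected constraints a value below [lo] would be feasible. *)
  have [||x sx Ex] := cand (Num.min (x0 0%N) (lo - 1)).
  - move=> c cC c0; have : c \in [seq c <- C' | 0 < c.1 0%N] by rewrite mem_filter c0.
    by rewrite E.
  - by rewrite ge_min lexx.
  by have := bd _ sx; rewrite Ex le_min => /andP[_]; lra.
case E : [seq c.2 / c.1 0%N | c <- C' & 0 < c.1 0%N] => [|a s].
  by have := map_f (fun c : (nat -> R) * R => c.2 / c.1 0%N) c0C; rewrite E.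
have [z zs zm] := seq_max a s; rewrite -E in zs zm.
have {zs}[c1 c1C Ez] := mapP zs; move: c1C; rewrite mem_filter => /andP[c1p c1C].
have [||x sx Ex] := cand z.
- by move=> c cC cp; apply: zm; apply: map_f; rewrite mem_filter cp.
- by rewrite Ez ler_pdivrMr // mulrC -lf1; exact: (allP sx0).
exists x => // y sy; have : sat 1 C' y by apply/H; exists y.
by move/allP/(_ _ c1C); rewrite /holds lf1 Ex Ez ler_pdivrMr // mulrC.
Qed.

End FourierMotzkin.

(** * Minimising a maximum of affine functions *)

Section MaxAffine.
Variables (R : realFieldType) (V I : finType) (A : pred I).
Variables (coef : I -> V -> R) (cst : I -> R).

Lemma max_affine_min :
  (forall v : V -> R, (forall p, 0 <= v p) ->
     exists2 i, A i & 0 <= \sum_p coef i p * v p + cst i) ->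
  exists (v : V -> R) (y : R), [/\ forall p, 0 <= v p,
    forall i, A i -> \sum_p coef i p * v p + cst i <= y
    & forall v' y', (forall p, 0 <= v' p) ->
        (forall i, A i -> \sum_p coef i p * v' p + cst i <= y') -> y <= y'].
Proof.
move=> bd; pose N := #|V|.
(* Coordinate 0 holds the upper bound on all pieces and coordinate i + 1 the variable of rank i, so
   that minimising the maximum is a linear program. *)
pose lin (y0 : R) (c : V -> R) (i : nat) : R :=
  if i is i'.+1 then (if insub i' : option 'I_N is Some o then c (enum_val o) else 0) else y0.
have linE y0 c z : lform N.+1 (lin y0 c) z = y0 * z 0%N + \sum_p c p * z (enum_rank p).+1.
  rewrite /lform big_ord_recl /=; congr (_ + _).
  rewrite [RHS](reindex (@enum_val V V)) /=; last by apply: onW_bij; apply: enum_val_bij.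
  by apply: eq_bigr => o _; rewrite /bump /= add1n valK enum_valK.
pose C := [seq (lin 1 (fun p => - coef i p), cst i) | i <- enum A] ++
          [seq (lin 0 (fun q => (q == p)%:R), 0) | p <- enum V].
have linp z p : lform N.+1 (lin 0 (fun q => (q == p)%:R)) z = z (enum_rank p).+1.
  rewrite linE mul0r add0r (bigD1 p) //= eqxx mul1r big1 ?addr0 // => q /negPf ->.
  by rewrite mul0r.
have lini z i : lform N.+1 (lin 1 (fun p => - coef i p)) z =
    z 0%N - \sum_p coef i p * z (enum_rank p).+1.
  by rewrite linE mul1r -sumrN; congr (_ + _); apply: eq_bigr => q _; rewrite mulNr.
have satE z : sat N.+1 C z <-> (forall p : V, 0 <= z (enum_rank p).+1) /\
    (forall i, A i -> \sum_p coef i p * z (enum_rank p).+1 + cst i <= z 0%N).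
  rewrite /sat all_cat; split=> [/andP[/allP h1 /allP h2]|[h1 h2]].
    split=> [p|i Ai].
      by have := h2 _ (map_f _ (mem_enum V p)); rewrite /holds /= linp.
    have iA : i \in enum A by rewrite mem_enum.
    by have := h1 _ (map_f _ iA); rewrite /holds /= lini; lra.
  apply/andP; split; apply/allP => c /mapP[i]; rewrite ?mem_enum => iA ->; rewrite /holds /=.
    by rewrite lini; have := h2 i iA; lra.
  by rewrite linp.
pose mk (y : R) (v : V -> R) : nat -> R := lin y v.
have mkE y v p : mk y v (enum_rank p).+1 = v p by rewrite /mk /= valK enum_rankK.
have mkS y v : (forall i, \sum_p coef i p * mk y v (enum_rank p).+1 = \sum_p coef i p * v p).
  by move=> i; apply: eq_bigr => p _; rewrite mkE.
have [||z sz zm] := @sat_min R N C 0; last first.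
- have [h1 h2] := (satE z).1 sz.
  exists (fun p => z (enum_rank p).+1), (z 0%N); split=> // v' y' p' l'.
  have -> : y' = mk y' v' 0%N by [].
  by apply: zm; apply/satE; split=> [p|i Ai]; rewrite ?mkE // mkS; apply: l'.
- move=> z /satE[h1 h2]; have [i Ai le] := bd _ h1.
  exact: le_trans le (h2 i Ai).
- exists (mk (\sum_(i | A i) `|cst i|) (fun=> 0)); apply/satE; split=> [p|i Ai].
    by rewrite mkE.
  rewrite mkS big1 ?add0r => [|p _]; last by rewrite mulr0.
  rewrite /mk /= (bigD1 i) //= (le_trans (ler_norm _)) // lerDl.
  by apply: sumr_ge0 => j _.
Qed.

End MaxAffine.

Section LevelSums.
Variables (R : realFieldType) (V : finType) (S : {set V}) (a : V -> R).

(* Abel summation over the superlevel sets of [v] *)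
Lemma superlevel_sum (v : V -> R) : (forall p, 0 <= v p) ->
  (forall t, 0 < t -> [set p in S | t <= v p] != set0 ->
     1 <= \sum_(p in S | t <= v p) a p) ->
  forall q, q \in S -> v q <= \sum_(p in S) a p * v p.
Proof.
move: {2}#|[set p in S | 0 < v p]| (leqnn #|[set p in S | 0 < v p]|) => m.
elim: m v => [|m IH] v.
  rewrite leqn0 cards_eq0 => /eqP E v0 _ q qS.
  have vz p : p \in S -> v p = 0.
    move=> pS; apply/eqP; rewrite eq_le v0 andbT leNgt; apply/negP => lt.
    by have : p \in [set p in S | 0 < v p]; [rewrite inE pS|rewrite E inE].
  by rewrite vz // big1 // => p pS; rewrite vz // mulr0.
move=> cm v0 H q qS.
have [E|[p0 p0S]] := set_0Vmem [set p in S | 0 < v p].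
  by apply: IH => //; rewrite E cards0.
have [p1 p1S p1m] := @arg_minP _ _ _ p0 (mem [set p in S | 0 < v p]) v p0S.
have {}p1S : p1 \in [set p in S | 0 < v p] := p1S.
have /andP[p1S' p1pos] : (p1 \in S) && (0 < v p1) by move: p1S; rewrite inE.
pose d := v p1; pose v' p := if (p \in S) && (0 < v p) then v p - d else v p.
have dle p : p \in S -> 0 < v p -> d <= v p.
  by move=> pS pp; apply: (p1m p); change (p \in [set p in S | 0 < v p]); rewrite inE pS.
have v'0 p : 0 <= v' p.
  by rewrite /v'; case: ifP => // /andP[pS pp]; rewrite subr_ge0 dle.
have lev t p : 0 < t -> p \in S -> (t <= v' p) = (t + d <= v p).
  rewrite /v' => t0 pS; rewrite pS /=; case: ltP => pp; first by rewrite lerBrDr.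
  have dp : 0 < d := p1pos.
  by apply/idP/idP => h; exfalso; lra.
have le' := IH v' _ v'0 _ q qS.
have {}le' : v' q <= \sum_(p in S) a p * v' p.
  apply: le'.
    rewrite -ltnS; apply: leq_trans cm; apply: proper_card; apply/properP; split.
      apply/subsetP => p; rewrite !inE => /andP[pS]; rewrite pS /v' pS /=.
      by case: (ltP 0 (v p)) => // le; rewrite ltNge le.
    by exists p1; rewrite // inE /v' p1S' p1pos subrr ltxx.
  move=> t t0 ne; have -> : \sum_(p in S | t <= v' p) a p = \sum_(p in S | t + d <= v p) a p.
    by apply: eq_bigl => p; case: (boolP (p \in S)) => //= pS; rewrite lev.
  apply: H; first by rewrite addr_gt0.
  apply: contraNneq ne => E; apply/eqP/setP => p; move/setP/(_ p): E; rewrite !inE.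
  by case: (boolP (p \in S)) => //= pS; rewrite lev.
have -> : \sum_(p in S) a p * v p = \sum_(p in S) a p * v' p + d * \sum_(p in S | 0 < v p) a p.
  rewrite mulr_sumr big_mkcondr /= -big_split; apply: eq_bigr => p pS /=.
  by rewrite /v' pS /=; case: ifP => _; ring.
have le1 : d * 1 <= d * \sum_(p in S | 0 < v p) a p.
  rewrite ler_pM2l //; have -> : \sum_(p in S | 0 < v p) a p = \sum_(p in S | d <= v p) a p.
    apply: eq_bigl => p; case: (boolP (p \in S)) => //= pS.
    by apply/idP/idP => [/(dle _ pS)//|]; apply: lt_le_trans.
  by apply: H => //; apply/set0Pn; exists p1; rewrite inE p1S' lexx.
have : v q <= v' q + d.
  by rewrite /v'; case: ifP => [_|/negbT]; rewrite ?subrK // qS /= -leNgt; have : 0 < d := p1pos; lra.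
lra.
Qed.

End LevelSums.

Lemma min_pos (R : realFieldType) (I : finType) (g : I -> R) :
  exists2 d : R, 0 < d & forall i, 0 < g i -> d <= g i.
Proof.
exists (\big[Num.min/1]_(i | 0 < g i) g i).
  apply: (big_ind (fun x => 0 < x)) => // x y x0 y0.
  by rewrite /Num.min; case: ifP.
by move=> i gi; apply: bigmin_le_cond.
Qed.

(** * Heights realizing an independent set *)

Section DindGam.
Variables (R : realType) (k n : nat) (w : {ffun 'I_k * 'I_n -> R}).
Variable M : 'I_k -> matroid 'I_n.
Local Notation P := ('I_k * 'I_n)%type.

(* The heights [v] minimise [psi v = g1 (v + c) + g2 v - (1 + e) * sum v], where
   [g1] is the maximal weight of a row-wise independent set and [g2] the
   maximal weight of a transversal of the columns.  At a minimum every
   element of [S] is a nonloop (else raising it does not change [g1]) and is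
   maximal in its column (else raising it does not change [g2]). *)
Lemma dind_Gam (S : {set P}) : dind M S -> Gam w M S S.
Proof.
move=> dS.
have [->|[p0 p0S]] := set_0Vmem S.
  by exists 0; split=> p; rewrite inE.
(* [K] makes all [c p] positive. Elements outside [S] will be put at height [- c p]: their shifted
   height is [- K], strictly below that of every element of [S]. *)
pose K : R := 1 + \sum_p `|w p|; pose c p : R := K - w p.
have cp p : 0 < c p.
  have : `|w p| <= \sum_p `|w p| by rewrite (bigD1 p) //= lerDl sumr_ge0.
  by rewrite /c /K; have := ler_norm (w p); lra.
pose I := ({ffun 'I_k -> {set 'I_n}} * {ffun 'I_n -> 'I_k})%type.
pose A : pred I := fun b => [forall j, b.1 j \in bases (M j)].
(* The margin [e] is positive, so that a minimum has a piece through each element of [S], and at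
   most 1 over the size of [S], so that [psi] stays bounded below. *)
pose e : R := (#|{: P}|.+1%:R)^-1.
have e0 : 0 < e by rewrite invr_gt0 ltr0n.
pose ind1 (b : I) (p : P) := p.2 \in b.1 p.1.
pose ind2 (b : I) (p : P) := b.2 p.2 == p.1.
pose coef (b : I) p : R :=
  if p \in S then (ind1 b p)%:R + (ind2 b p)%:R - (1 + e) else 0.
pose cst (b : I) : R := \sum_(p in S | ind1 b p) c p.
pose psi b (v : P -> R) := \sum_p coef b p * v p + cst b.
pose x (v : P -> R) j : {ffun 'I_n -> R} :=
  [ffun i => if (j, i) \in S then v (j, i) + c (j, i) else 0].
have psiE b v : psi b v = \sum_j \sum_(i in b.1 j) x v j i
    + \sum_i (if (b.2 i, i) \in S then v (b.2 i, i) else 0) - (1 + e) * \sum_(p in S) v p.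
  have E1 : \sum_j \sum_(i in b.1 j) x v j i = \sum_(p in S | ind1 b p) v p + cst b.
    rewrite -big_split /= pair_big_dep /= [RHS]big_mkcond [LHS]big_mkcond /=.
    apply: eq_bigr => -[j i] _; rewrite /x ffunE /ind1 /=.
    by case: (i \in b.1 j); case: ((j, i) \in S).
  have E2 : \sum_i (if (b.2 i, i) \in S then v (b.2 i, i) else 0) = \sum_(p in S | ind2 b p) v p.
    rewrite [RHS]big_mkcond /= [RHS](eq_bigr (fun p : P => (fun j i =>
      if ((j, i) \in S) && (b.2 i == j) then v (j, i) else 0) p.1 p.2)); last by case.
    rewrite -(pair_bigA _ (fun j i => if ((j, i) \in S) && (b.2 i == j) then v (j, i) else 0)) /=.
    rewrite exchange_big; apply: eq_bigr => i _; rewrite (bigD1 (b.2 i)) //= eqxx andbT.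
    by rewrite big1 ?addr0 // => j ji; rewrite eq_sym (negPf ji) andbF.
  have E3 : \sum_p coef b p * v p = \sum_(p in S | ind1 b p) v p
      + \sum_(p in S | ind2 b p) v p - (1 + e) * \sum_(p in S) v p.
    rewrite (big_mkcond (fun p => (p \in S) && ind1 b p)).
    rewrite (big_mkcond (fun p => (p \in S) && ind2 b p)) (big_mkcond (fun p => p \in S)).
    rewrite mulr_sumr -big_split -sumrB /=; apply: eq_bigr => p _; rewrite /coef.
    by case: (p \in S); case: (ind1 b p); case: (ind2 b p) => /=; ring.
  by rewrite E1 E2 /psi E3; ring.
have bd v : (forall p, 0 <= v p) -> exists2 b, A b & 0 <= psi b v.
  move=> v0; pose z j : {ffun 'I_n -> R} := [ffun i => if (j, i) \in S then v (j, i) else 0].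
  have exB j : exists B, B \in initial (z j) (M j) by exact: initial_neq0.
  pose b1 := [ffun j => xchoose (exB j)].
  have b1P j : b1 j \in initial (z j) (M j) by rewrite ffunE; apply: (xchooseP (exB j)).
  pose b2 : {ffun 'I_n -> 'I_k} := [ffun i => [arg max_(j > p0.1) z j i]%O].
  have b2P i j : z j i <= z (b2 i) i by rewrite [b2 i]ffunE; case: (@arg_maxP _ _ _ p0.1 xpredT (fun j => z j i)) => // j' _; apply.
  exists (b1, b2); first by apply/forallP => j; apply: initialW (b1P j).
  pose b : I := (b1, b2).
  pose a p : R := (ind1 b p)%:R + (ind2 b p)%:R - 1.
  (* The bases and the choices in the columns are greedy for [v]. On a superlevel set [T] of [S]
     they attain the ranks and the number of columns, so independence says that [a] sums to at least
     1 there, and Abel summation applies. *)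
  have key q : q \in S -> v q <= \sum_(p in S) a p * v p.
    apply: superlevel_sum => // t t0 ne; pose T := [set p in S | t <= v p].
    have TS : T \subset S by apply/subsetP => p; rewrite inE => /andP[].
    have lt := dilP _ _ dS T TS ne.
    have -> : \sum_(p in S | t <= v p) a p = \sum_(p in T) a p.
      by apply: eq_bigl => p; rewrite inE.
    have S1 : \sum_(p in T) (ind1 b p)%:R = (\sum_j rk (M j) (row T j))%:R :> R.
      rewrite natr_sum big_mkcond /= (eq_bigr (fun p : P => (fun j i =>
        (((j, i) \in T) && (i \in b1 j))%:R) p.1 p.2)); last first.
        by case=> j i _; rewrite /ind1 /=; case: ifP.
      rewrite -(pair_bigA _ (fun j i => (((j, i) \in T) && (i \in b1 j))%:R)) /=.
      apply: eq_bigr => j _; rewrite -natr_sum; congr _%:R.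
      have Er : row T j = [set i | t <= z j i].
        apply/setP => i; rewrite !inE ffunE; case: ifP => //= _.
        by rewrite leNgt t0.
      rewrite Er -(@initial_super _ _ _ (z j) (b1 j) (fun y => t <= y)) //; last first.
        by move=> y y' h1 h2; apply: le_trans h2.
      rewrite -[[set e1 | _]]Er -sum1_card [RHS]big_mkcond /=; apply: eq_bigr => i _.
      by rewrite !inE andbC; case: ifP.
    have S2 : (#|proj T|)%:R <= \sum_(p in T) (ind2 b p)%:R :> R.
      rewrite -natr_sum ler_nat -sum1_card.
      rewrite [leqRHS](bigID (fun p => ind2 b p)) /= (leq_trans _ (leq_addr _ _)) //.
      rewrite [leqRHS](eq_bigr (fun=> 1%N)); last by move=> p /andP[_ ->].
      have inj : injective (fun i : 'I_n => (b2 i, i) : P) by move=> i i' [_ ->].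
      rewrite !sum1_card -(card_imset (mem (proj T)) inj).
      apply: subset_leq_card; apply/subsetP => p /imsetP[i]; rewrite mem_proj => /existsP[j jT] ->.
      rewrite unfold_in /= /ind2 /= eqxx andbT inE.
      have := b2P i j; move: jT; rewrite inE => /andP[jS tv].
      rewrite /z !ffunE jS; case: ifP => [_|_] le; first by rewrite (le_trans tv).
      by have := lt_le_trans t0 (le_trans tv le); rewrite ltxx.
    have S3 : \sum_(p in T) a p = \sum_(p in T) (ind1 b p)%:R + \sum_(p in T) (ind2 b p)%:R - #|T|%:R.
      by rewrite sumrB big_split /= -sum1_card natr_sum.
    rewrite S3 S1; move: lt; rewrite /fcost -(ler_nat R) -natr1 natrD.
    by move: S2; lra.
  have S4 : \sum_(p in S) v p * e <= \sum_(p in S) a p * v p.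
    pose s := \sum_(p in S) a p * v p; have s0 : 0 <= s by apply: le_trans (v0 p0) (key _ p0S).
    apply: le_trans (_ : \sum_(p in S) s * e <= _).
      by apply: ler_sum => p pS; rewrite ler_pM2r // key.
    rewrite sumr_const -mulrnAr -/s ler_piMr // -[e *+ _]mulr_natr mulrC ler_pdivrMr ?ltr0n //.
    by rewrite mul1r ler_nat (leq_trans (max_card _)).
  have -> : psi (b1, b2) v = \sum_(p in S) a p * v p - \sum_(p in S) v p * e + cst b.
    rewrite /psi; congr (_ + _); rewrite -sumrB [RHS]big_mkcond /=.
    by apply: eq_bigr => p _; rewrite /coef /a -/b; case: ifP => _; ring.
  by rewrite addr_ge0 ?subr_ge0 // sumr_ge0 // => p _; apply/ltW/cp.
have [v [y [v0 vy ymin]]] := max_affine_min bd.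
(* [d] is at most the gap between [y] and any smaller piece. Raising one height in [S] by [d] adds
   [d (1 - e)] to a piece containing the element in both senses, and at most [- d e] to any other.
   Without an attaining piece of the first kind the maximum would therefore drop by [d e]. *)
have [d d0 dP] := min_pos (fun b : I => y - psi b v).
have de0 : 0 < d * e by rewrite mulr_gt0.
have tightp p : p \in S -> exists b, [/\ A b, psi b v = y, ind1 b p & ind2 b p].
  move=> pS; apply: contrapT => H.
  suff : y <= y - d * e by lra.
  apply: (ymin (fun q => v q + (if q == p then d else 0))) => [q|b Ab].
    by rewrite addr_ge0 //; case: ifP => // _; apply: ltW.
  have -> : \sum_q coef b q * (v q + (if q == p then d else 0)) + cst b = psi b v + d * coef b p.
    rewrite /psi addrAC; congr (_ + _).
    rewrite (eq_bigr (fun q => coef b q * v q + (if q == p then d * coef b p else 0))); last first.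
      by move=> q _; rewrite mulrDr; case: eqP => [->|_]; rewrite ?mulr0 // mulrC [d * _]mulrC [v _ * _]mulrC.
    by rewrite big_split /= -[X in _ + X]big_mkcond big_pred1_eq.
  rewrite /coef pS; have le : psi b v <= y := vy b Ab.
  have [E|ne] := eqVneq (psi b v) y.
    have : ~~ (ind1 b p && ind2 b p) by apply/negP => /andP[i1 i2]; apply: H; exists b.
    by rewrite E; case: (ind1 b p); case: (ind2 b p) => //= _; rewrite ?mulr0n ?mulr1n; lra.
  have /dP le2 : 0 < y - psi b v by rewrite subr_gt0 lt_neqAle ne.
  have h1 : (ind1 b p)%:R <= 1 :> R by case: (ind1 b p).
  have h2 : (ind2 b p)%:R <= 1 :> R by case: (ind2 b p).
  have : d * ((ind1 b p)%:R + (ind2 b p)%:R - (1 + e)) <= d * (1 - e) by rewrite ler_pM2l //; lra.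
  by lra.
exists [ffun q => if q \in S then v q else - c q]; split=> p pS.
  have [b [Ab tb i1 i2]] := tightp p pS.
  rewrite /act; have -> : above_row w [ffun q => if q \in S then v q else - c q] p
      = above (x v p.1) p.2.
    apply/setP => i; rewrite !inE !ffunE -surjective_pairing pS /c.
    case: ifP => _; first by apply/idP/idP; lra.
    by apply/idP/idP; have := v0 p; have := cp p; rewrite /c; lra.
  rewrite -nonloopP /loops inE negbK; apply/bigcupP; exists (b.1 p.1) => //.
  rewrite inE (forallP Ab) /=; apply/forall_inP => B' bB'.
  (* Replacing one row of an attaining piece by another basis cannot increase the value, so that row
     is a basis of maximal weight. *)
  pose b' : I := ([ffun j => if j == p.1 then B' else b.1 j], b.2).
  have Ab' : A b' by apply/forallP => j; rewrite ffunE; case: eqP => [->|_] //; apply: (forallP Ab).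
  have := vy b' Ab'; rewrite -/(psi b' v) -tb !psiE (bigD1 p.1) //= [in leRHS](bigD1 p.1) //=.
  rewrite ffunE eqxx (eq_bigr (fun j => \sum_(i in b.1 j) x v j i)); last first.
    by move=> j jp; rewrite ffunE (negPf jp).
  by rewrite !lerD2r.
have [b [Ab tb i1 /eqP i2]] := tightp p pS.
apply/forallP => j; rewrite !ffunE pS; case: ifP => jS; last first.
  by have := v0 p; have := cp (j, p.2); lra.
pose b' : I := (b.1, [ffun i => if i == p.2 then j else b.2 i]).
have := vy b' Ab; rewrite -/(psi b' v) -tb !psiE (bigD1 p.2) //= [in leRHS](bigD1 p.2) //=.
rewrite ffunE eqxx jS i2 -surjective_pairing pS.
rewrite (eq_bigr (fun i => if (b.2 i, i) \in S then v (b.2 i, i) else 0)); last first.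
  by move=> i ip; rewrite ffunE (negPf ip).
by lra.
Qed.

End DindGam.

(** * Regular sequences *)

Section WeaklyRegular.
Variable A : comNzRingType.
Implicit Types (I J : A -> Prop) (x y z : A) (ys zs : seq A).

Definition nzd y I : Prop := forall f, I (y * f) -> I f.

Definition adj I y : A -> Prop := fun x => exists a c, I a /\ x = a + y * c.

(** Weak regularity on A/I, phrased with predicates instead of quotient rings. Properness enters
    later, when the sequence lies in a prime ideal. *)
Fixpoint wreg I ys : Prop :=
  if ys is y :: ys' then nzd y I /\ wreg (adj I y) ys' else True.

Definition capI I J : A -> Prop := fun x => I x /\ J x.
Definition addI I J : A -> Prop := fun x => exists a b, [/\ I a, J b & x = a + b].
Definition colonI I y : A -> Prop := fun x => I (y * x).

Lemma ideal0 I : ideal I -> I 0. Proof. by case. Qed.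
Lemma idealD I x y : ideal I -> I x -> I y -> I (x + y). Proof. by case=> _ H _; apply: H. Qed.
Lemma idealM I x y : ideal I -> I y -> I (x * y). Proof. by case=> _ _ H; apply: H. Qed.
Lemma idealN I x : ideal I -> I x -> I (- x).
Proof. by move=> iI Ix; rewrite -mulN1r; apply: idealM. Qed.
Lemma idealB I x y : ideal I -> I x -> I y -> I (x - y).
Proof. by move=> iI Ix Iy; apply: idealD => //; apply: idealN. Qed.
Lemma idealMr I x y : ideal I -> I x -> I (x * y).
Proof. by move=> iI Ix; rewrite mulrC; apply: idealM. Qed.
Lemma ideal_sum I (T : Type) (r : seq T) (P : pred T) (F : T -> A) :
  ideal I -> (forall i, P i -> I (F i)) -> I (\sum_(i <- r | P i) F i).
Proof.
move=> iI H; apply: (big_ind I) => //; first exact: ideal0.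
by move=> x y; apply: idealD.
Qed.
Lemma ideal_cong I x y : ideal I -> I (x - y) -> I x <-> I y.
Proof.
move=> iI h; split=> [Ix|Iy]; last by rewrite -(subrK y x); apply: idealD.
by rewrite -[y](subKr x); apply: idealB.
Qed.

Lemma adj_ideal I y : ideal I -> ideal (adj I y).
Proof.
move=> iI; split.
- by exists 0, 0; rewrite mulr0 addr0; split=> //; apply: ideal0.
- move=> _ _ [a [c [Ia ->]]] [a' [c' [Ia' ->]]]; exists (a + a'), (c + c').
  by split; [apply: idealD|ring].
- move=> b _ [a [c [Ia ->]]]; exists (b * a), (b * c); split; [exact: idealM|ring].
Qed.

Lemma adjW I y x : I x -> adj I y x.
Proof. by move=> Ix; exists x, 0; rewrite mulr0 addr0. Qed.

Lemma adj_self I y : ideal I -> adj I y y.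
Proof. by move=> iI; exists 0, 1; rewrite mulr1 add0r; split=> //; apply: ideal0. Qed.

Lemma wreg_ext I J ys : (forall x, I x <-> J x) -> wreg I ys -> wreg J ys.
Proof.
elim: ys I J => //= y ys IH I J E [n w]; split; first by move=> f /E /n /E.
by apply: IH w => x; split=> -[a [c [h ->]]]; exists a, c; split=> //; apply/E.
Qed.

Lemma wreg_all I ys : (forall x, I x) -> wreg I ys.
Proof.
elim: ys I => //= y ys IH I H; split; first by move=> f _; apply: H.
by apply: IH => x; apply: adjW.
Qed.

Lemma wreg_cong I ys zs : ideal I -> size ys = size zs ->
  (forall i, (i < size ys)%N -> I (nth 0 ys i - nth 0 zs i)) -> wreg I zs -> wreg I ys.
Proof.
elim: ys zs I => [|y ys IH] [|z zs] I iI //= [sz] H [n w].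
have Iyz : I (y - z) := H 0%N isT; split.
  move=> f; have E : I (y * f - z * f) by rewrite -mulrBl; apply: idealMr.
  by move=> /(ideal_cong iI E); apply: n.
apply: (IH zs) => //; first exact: adj_ideal.
  by move=> i lti; apply: adjW; apply: (H i.+1).
apply: wreg_ext w => x; split=> -[a [c [Ia ->]]].
  exists (a - (y - z) * c), c; split; [apply: idealB => //; exact: idealMr|ring].
exists (a + (y - z) * c), c; split; [apply: idealD => //; exact: idealMr|ring].
Qed.

(** The exact sequence from A/(I cap J) through the sum of A/I and A/J to A/(I + J): an element
    regular on both ends is regular in the middle, and its regularity on the right end keeps the
    sequence exact after dividing by it. *)
Lemma wreg_cap_add I J ys : ideal I -> ideal J ->
  wreg (capI I J) ys -> wreg (addI I J) ys -> wreg I ys.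
Proof.
move=> iI iJ; suff H : wreg (capI I J) ys -> wreg (addI I J) ys -> wreg I ys /\ wreg J ys.
  by move=> h1 h2; case: (H h1 h2).
elim: ys I J iI iJ => // y ys IH I J iI iJ /= [nc wc] [na wa].
have nI : nzd y I.
  move=> f If; have [|a [b [Ia Jb E]]] := na f.
    by exists (y * f), 0; rewrite addr0; split=> //; apply: ideal0.
  have : capI I J (y * b).
    split; last exact: idealM.
    have -> : y * b = y * f - y * a by rewrite E; ring.
    by apply: idealB => //; apply: idealM.
  by move/nc => [Ib _]; rewrite E; apply: idealD.
have nJ : nzd y J.
  move=> f Jf; have [|a [b [Ia Jb E]]] := na f.
    by exists 0, (y * f); rewrite add0r; split=> //; apply: ideal0.
  have : capI I J (y * a).
    split; first exact: idealM.
    have -> : y * a = y * f - y * b by rewrite E; ring.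
    by apply: idealB => //; apply: idealM.
  by move/nc => [_ Ja]; rewrite E; apply: idealD.
have [||||wI wJ] := IH (adj I y) (adj J y).
- exact: adj_ideal.
- exact: adj_ideal.
- apply: wreg_ext wc => x; split.
    move=> [a [c [[Ia Ja] ->]]]; split; exists a, c; split=> //.
  move=> [[a [c [Ia E1]]] [b [d [Jb E2]]]].
  have : addI I J (y * (d - c)).
    exists a, (- b); split=> //; first exact: idealN.
    have -> : y * (d - c) = (b + y * d) - (a + y * c) + a - b by ring.
    by rewrite -E1 -E2; ring.
  move/na => [a' [b' [Ia' Jb' E3]]].
  have Ed : d = c + a' + b' by rewrite -addrA -E3; ring.
  exists (a - y * a'), (c + a'); split; last by rewrite E1; ring.
  split; first by apply: idealB => //; apply: idealM.
  have -> : a - y * a' = b + y * b'.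
    have -> : a = b + y * d - y * c by rewrite -E2 E1; ring.
    by rewrite Ed; ring.
  by apply: idealD => //; apply: idealM.
- apply: wreg_ext wa => x; split.
    move=> [_ [c [[a [b [Ia Jb ->]]] ->]]]; exists (a + y * c), b.
    by split; [exists a, c|apply: adjW|ring].
  move=> [_ [_ [[a [c [Ia ->]]] [b [d [Jb ->]]] ->]]].
  by exists (a + b), (c + d); split; [exists a, b|ring].
by split; split.
Qed.

(** The same argument for the exact sequence from A/(I : x) through A/I to A/(I + x). *)
Lemma wreg_colon I x ys : ideal I ->
  wreg (colonI I x) ys -> wreg (adj I x) ys -> wreg I ys.
Proof.
elim: ys I => // y ys IH I iI /= [nc wc] [na wa]; split.
  move=> f If; have [|i [g [Ii E]]] := na f; first exact: adjW.
  have : colonI I x (y * g).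
    rewrite /colonI; have -> : x * (y * g) = y * f - y * i by rewrite E; ring.
    by apply: idealB => //; apply: idealM.
  by move/nc => h; rewrite E; apply: idealD.
apply: IH; first exact: adj_ideal.
  apply: wreg_ext wc => g; split.
    move=> [a [c [Ia ->]]]; exists (x * a), (x * c); split=> //; ring.
  move=> [i [h [Ii E]]].
  have /na[i' [h' [Ii' E']]] : adj I x (y * h).
    by exists (- i), g; split; [apply: idealN|rewrite E; ring].
  exists (g - y * h'), h'; split; last by ring.
  rewrite /colonI; have -> : x * (g - y * h') = i + y * i'.
    by rewrite mulrBr E E'; ring.
  by apply: idealD => //; apply: idealM.
apply: wreg_ext wa => g; split; move=> [_ [c [[a [d [Ia ->]]] ->]]].
  by exists (a + y * c), d; split; [exists a, c|ring].
by exists (a + x * c), d; split; [exists a, c|ring].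
Qed.

(* [h i.+1 = k i.+1 + x * h i], so the two sequences agree modulo [h d]. *)
Lemma wreg_shift I (h k : nat -> A) x d m : ideal I -> I (h d) ->
  (forall i, h i.+1 = k i.+1 + x * h i) ->
  wreg I [seq k i | i <- iota d.+1 m] -> wreg I [seq h i | i <- iota d.+1 m].
Proof.
move=> iI Id H; elim: m d I iI Id => //= m IH d I iI Id [n w].
have E : I (h d.+1 - k d.+1) by rewrite H addrAC subrr add0r; apply: idealM.
split.
  move=> f; have E2 : I (h d.+1 * f - k d.+1 * f) by rewrite -mulrBl; apply: idealMr.
  by move=> /(ideal_cong iI E2); apply: n.
apply: IH; [exact: adj_ideal|exact: adj_self|].
apply: wreg_ext w => z; split=> -[a [c [Ia ->]]].
  exists (a - (h d.+1 - k d.+1) * c), c; split; [apply: idealB => //; exact: idealMr|ring].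
exists (a + (h d.+1 - k d.+1) * c), c; split; [apply: idealD => //; exact: idealMr|ring].
Qed.

(* complete homogeneous symmetric polynomials *)
Fixpoint hsym (l : seq A) : nat -> A :=
  if l is x :: l' then
    fix h d := if d is d'.+1 then hsym l' d + x * h d' else 1
  else fun d => (d == 0%N)%:R.

Lemma hsym_cons x l d : hsym (x :: l) d.+1 = hsym l d.+1 + x * hsym (x :: l) d.
Proof. by []. Qed.

Lemma hsym0 l : hsym l 0 = 1. Proof. by case: l. Qed.

End WeaklyRegular.

Arguments hsym : simpl never.

Lemma hsym_rmorph (A B : comNzRingType) (phi : {rmorphism A -> B}) l d :
  phi (hsym l d) = hsym [seq phi x | x <- l] d.
Proof.
elim: l d => [|x l IH] d; first by rewrite /hsym /= rmorph_nat.
elim: d => [|d IHd]; first by rewrite !hsym0 rmorph1.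
by rewrite hsym_cons rmorphD rmorphM IH IHd.
Qed.

Section Transport.
Variables (A B : comNzRingType) (phi : {rmorphism A -> B}).

(** As [phi] is surjective modulo [J], it identifies A modulo the preimage with B/J. *)
Lemma wreg_preim (J : B -> Prop) ys : ideal J ->
  (forall b, exists s, J (b - phi s)) ->
  wreg J [seq phi y | y <- ys] -> wreg (fun x => J (phi x)) ys.
Proof.
move=> iJ sj; elim: ys J iJ sj => //= y ys IH J iJ sj [n w]; split.
  by move=> f; rewrite rmorphM => /n.
have sj' b : exists s, adj J (phi y) (b - phi s).
  by have [s h] := sj b; exists s; apply: adjW.
have := IH _ (adj_ideal (phi y) iJ) sj' w.
apply: wreg_ext => f; split.
  move=> [j [b [Jj E]]]; have [s Js] := sj b.
  exists (f - y * s), s; split; last by ring.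
  rewrite rmorphB rmorphM E; have -> : j + phi y * b - phi y * phi s = j + phi y * (b - phi s) by ring.
  by apply: idealD => //; apply: idealM.
by move=> [a [c [Ja ->]]]; exists (phi a), (phi c); rewrite rmorphD rmorphM.
Qed.

End Transport.

(** * Regular sequences in polynomial extensions *)

Section PolyExtension.
Variable B : comNzRingType.
Implicit Types (I : B -> Prop) (q Y : {poly B}).

Definition polyI I : {poly B} -> Prop := fun q => forall i, I q`_i.

Lemma polyI_ideal I : ideal I -> ideal (polyI I).
Proof.
move=> iI; split.
- by move=> i; rewrite coef0; apply: ideal0.
- by move=> p q Ip Iq i; rewrite coefD; apply: idealD.
- move=> a q Iq i; rewrite coefM; apply: ideal_sum => // j _; exact: idealM.
Qed.

(* compare the highest coefficients outside [I] *)
Lemma monic_top I Y c a m : ideal I -> Y \is monic -> polyI I a ->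
  (forall i, (m <= i)%N -> I (a + Y * c)`_i) ->
  forall i, (m <= i + (size Y).-1)%N -> I c`_i.
Proof.
move=> iI mY Ia H; pose D := (size Y).-1.
have sY : size Y = D.+1 by rewrite prednK // size_poly_gt0 monic_neq0.
have step t : forall i, (size c <= i + t)%N -> (m <= i + D)%N -> I c`_i.
  elim: t => [|t IH] i; first by rewrite addn0 => /(nth_default 0) -> _; apply: ideal0.
  move=> le mi; have := H _ mi; rewrite coefD coefMr => h.
  have := idealB iI h (Ia (i + D)%N); rewrite addrAC subrr add0r.
  have iD : (i < (i + D).+1)%N by rewrite ltnS leq_addr.
  rewrite (bigD1 (Ordinal iD)) //= addKn.
  have -> : Y`_D = 1 by move: mY; rewrite monicE lead_coefE sY => /eqP.
  rewrite mul1r => h2; rewrite -[c`_i](addrK (\sum_(j < (i + D).+1 | j != Ordinal iD) Y`_(i + D - j) * c`_j)).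
  apply: idealB => //; apply: ideal_sum => // j ji.
  have [lt|ge] := ltnP j i.
    rewrite [Y`_ _]nth_default ?mul0r; first exact: ideal0.
    by rewrite sY; lia.
  apply: idealM => //; have lt : (i < j)%N.
    by rewrite ltn_neqAle ge andbT eq_sym; move: ji; rewrite -val_eqE.
  by apply: IH; lia.
by move=> i; apply: (step (size c)); rewrite leq_addl.
Qed.

Lemma nzd_monic I Y : ideal I -> Y \is monic -> nzd Y (polyI I).
Proof.
move=> iI mY q H i; apply: (@monic_top I Y q 0 0) => //.
  by move=> j; rewrite coef0; apply: ideal0.
by move=> j _; rewrite add0r.
Qed.

(** Division by the monic [Y] makes B[X]/(Y) free over B, so a regular sequence on B/I stays regular
    modulo [I] and [Y]. *)
Lemma wreg_polyI I Y zs : ideal I -> Y \is monic -> wreg I zs ->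
  wreg (adj (polyI I) Y) [seq z%:P | z <- zs].
Proof.
move=> iI mY; pose D := (size Y).-1.
have sY : size Y = D.+1 by rewrite prednK // size_poly_gt0 monic_neq0.
elim: zs I iI => //= z zs IH I iI [n w]; split.
  move=> q [a [c [Ia E]]].
  have Eq := Pdiv.RingMonic.rdivp_eq mY q.
  set q1 := Pdiv.Ring.rdivp q Y in Eq; set r := Pdiv.Ring.rmodp q Y in Eq.
  have sr : (size r <= D)%N.
    by rewrite -ltnS -sY Pdiv.Ring.ltn_rmodp monic_neq0.
  have Er : z%:P * r = a + Y * (c - z%:P * q1).
    have -> : r = q - q1 * Y by rewrite {1}Eq; ring.
    by rewrite mulrBr E; ring.
  have Ic : polyI I (c - z%:P * q1).
    move=> i; apply: (@monic_top I Y _ a D) => //; last by rewrite leq_addl.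
    move=> j Dj; rewrite -Er coefCM nth_default ?mulr0; first exact: ideal0.
    exact: leq_trans sr Dj.
  have Ir : polyI I r.
    move=> i; apply: n; rewrite -coefCM Er coefD; apply: idealD => //.
    by apply: (idealM _ (polyI_ideal iI)).
  by exists r, q1; split=> //; rewrite {1}Eq; ring.
have := IH _ (adj_ideal z iI) w; apply: wreg_ext => f; split.
  move=> [a [c [Ia ->]]].
  have [a1 [c1 [Ia1 Ea]]] : exists a1 c1, polyI I a1 /\ a = a1 + z%:P * c1.
    have H0 i : {ac : B * B | I ac.1 /\ a`_i = ac.1 + z * ac.2}.
      by apply: cid; have [x [y [Ix E]]] := Ia i; exists (x, y).
    pose c1 := \poly_(i < size a) (projT1 (H0 i)).2.
    exists (a - z%:P * c1), c1; split; last by rewrite subrK.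
    move=> i; rewrite coefB coefCM coef_poly; case: ltnP => lti.
      by case: (projT2 (H0 i)) => h {1}->; rewrite addrK.
    by rewrite mulr0 subr0 nth_default //; apply: ideal0.
  exists (a1 + Y * c), c1; split; last by rewrite Ea; ring.
  by exists a1, c.
move=> [_ [c [[a [d [Ia ->]]] ->]]]; exists (a + z%:P * c), d; split; last by ring.
move=> i; rewrite coefD coefCM; exists a`_i, c`_i; split=> //.
Qed.

Lemma size_hsym_monic (g : {poly B}) (us : seq B) d : g \is monic -> (1 < size g)%N ->
  hsym (g :: [seq u%:P | u <- us]) d \is monic /\
  size (hsym (g :: [seq u%:P | u <- us]) d) = (d * (size g).-1).+1.
Proof.
move=> mg sg; elim: d => [|d [mh sh]]; first by rewrite hsym0 monic1 size_poly1.
have E : hsym [seq u%:P | u <- us] d.+1 = (hsym us d.+1)%:P :> {poly B}.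
  by rewrite -(hsym_rmorph (polyC : {rmorphism B -> {poly B}})).
have sgh : size (g * hsym (g :: [seq u%:P | u <- us]) d) = (d.+1 * (size g).-1).+1.
  rewrite size_monicM ?monic_neq0 // sh; move: sg; case: (size g) => //= a _; lia.
have lt : (size (hsym [seq u%:P | u <- us] d.+1 : {poly B}) <
    size (g * hsym (g :: [seq u%:P | u <- us]) d)%R)%N.
  rewrite E sgh (leq_ltn_trans (size_polyC_leq1 _)) // ltnS muln_gt0 /=.
  by move: sg; case: (size g) => [|[]].
rewrite hsym_cons addrC; split; last by rewrite size_polyDl.
by rewrite monicE lead_coefDl // -monicE monicMl.
Qed.

End PolyExtension.

(** * Stanley-Reisner ideals and the case of a simplex *)

Section SquareFree.
Variables (kk : fieldType) (V : finType).
Local Notation N := #|V|.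
Local Notation S := {mpoly kk[N]}.
Implicit Types (m : 'X_{1..N}) (f : S) (X : {set V} -> bool) (F G : {set V}) (p : V).

Definition msup m : {set V} := [set x | m (enum_rank x) != 0%N].

(** The Stanley-Reisner ideal through coefficients: no monomial of [f] is supported on a face.
    Unions, intersections, stars and deletions of complexes then translate monomial by monomial;
    without any face the ideal is the whole ring. *)
Definition SR X f : Prop := forall m, X (msup m) -> f@_m = 0.

Definition down X : Prop := forall F G, F \subset G -> X G -> X F.

Lemma msupD m1 m2 : msup (m1 + m2)%MM = msup m1 :|: msup m2.
Proof. by apply/setP => x; rewrite !inE mnmDE addn_eq0 negb_and. Qed.

Lemma msupU p : msup U_(enum_rank p)%MM = [set p].
Proof.
apply/setP => x; rewrite !inE mnm1E (inj_eq enum_rank_inj) [x == p]eq_sym.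
by case: (p == x).
Qed.

Lemma SR_ideal X : down X -> ideal (SR X).
Proof.
move=> dX; split.
- by move=> m _; rewrite mcoeff0.
- by move=> f g If Ig m Xm; rewrite mcoeffD If ?Ig ?addr0.
- move=> a f If m Xm; rewrite mcoeffM; apply: big1 => -[k1 k2] /= /eqP; move: (bmnm k1) (bmnm k2) => {}k1 {}k2 E.
  rewrite (If k2) ?mulr0 //; apply: dX Xm; rewrite E msupD; exact: subsetUr.
Qed.

Definition mpart (P : pred 'X_{1..N}) f : S :=
  \sum_(m <- msupp f | P m) f@_m *: 'X_[m].

Lemma mcoeff_part P f m : (mpart P f)@_m = if P m then f@_m else 0.
Proof.
rewrite /mpart raddf_sum /=; have E m' : (f@_m' *: 'X_[m'] : S)@_m = f@_m' * (m' == m)%:R.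
  by rewrite mcoeffZ mcoeffX.
rewrite (eq_bigr _ (fun m' _ => E m')).
have [mf|mf] := boolP (m \in msupp f).
  rewrite big_mkcond (bigD1_seq m) ?msupp_uniq //= eqxx mulr1 big1 ?addr0 //.
  by move=> m' ne; rewrite (negPf ne) mulr0 if_same.
rewrite memN_msupp_eq0 // if_same big_seq_cond big1 // => m' /andP[m'f _].
by case: eqP => [E'|]; rewrite ?mulr0 // E' (negPf mf) in m'f *.
Qed.

Lemma SR_cap X Y f : SR (fun F => X F || Y F) f <-> capI (SR X) (SR Y) f.
Proof.
split=> [H|[HX HY] m /orP[/HX|/HY] //].
by split=> m h; apply: H; rewrite h ?orbT.
Qed.

Lemma SR_add X Y f : SR (fun F => X F && Y F) f <-> addI (SR X) (SR Y) f.
Proof.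
split=> [H|[a [b [Xa Yb ->]]] m /andP[Xm Ym]]; last by rewrite mcoeffD Xa ?Yb ?addr0.
exists (mpart (fun m => ~~ X (msup m)) f), (mpart (fun m => X (msup m)) f); split.
- by move=> m Xm; rewrite mcoeff_part Xm.
- by move=> m Ym; rewrite mcoeff_part; case: ifP => // Xm; apply: H; rewrite Xm.
- by apply/mpolyP => m; rewrite mcoeffD !mcoeff_part; case: (X _); rewrite ?addr0 ?add0r.
Qed.

Local Notation "''x_' p" := ('X_(enum_rank p) : S) (at level 8, p at level 2).

Lemma mcoeff_xM p f m : ('x_p * f)@_(U_(enum_rank p) + m)%MM = f@_m.
Proof. by rewrite mulrC; exact: mcoeffMX. Qed.

(** The colon by a variable belongs to the star of the vertex, and adjoining the variable to its
    deletion; with [wreg_colon] this allows induction on the vertices. *)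
Lemma SR_colon X p f : SR (fun F => X (p |: F)) f <-> colonI (SR X) 'x_p f.
Proof.
split=> [H m Xm|H m Xm]; last first.
  by rewrite -(mcoeff_xM p); apply: H; rewrite msupD msupU.
rewrite mcoeffM big1 // => -[k1 k2] /= /eqP; move: (bmnm k1) (bmnm k2) => {}k1 {}k2 E; rewrite mcoeffX.
case: eqP => [Ek|]; last by rewrite mul0r.
rewrite (H k2) ?mulr0 //; have := Xm; rewrite E -Ek msupD msupU.
by [].
Qed.

Lemma mpart_xM (f : S) p : (forall m, m (enum_rank p) = 0%N -> f@_m = 0) ->
  exists g, f = 'x_p * g.
Proof.
move=> H; exists (\sum_(m <- msupp f) f@_m *: 'X_[(m - U_(enum_rank p))%MM]).
rewrite {1}[f]mpolyE mulr_sumr big_seq [RHS]big_seq; apply: eq_bigr => m mf.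
rewrite -scalerAr -mpolyXD; congr (_ *: 'X_[_]).
rewrite addmC submK //; apply/mnm_lepP => i; rewrite mnm1E; case: eqP => //= <-.
rewrite lt0n; apply: contraTneq mf => /H E; rewrite -mcoeff_eq0 E.
by rewrite eqxx.
Qed.

Lemma SR_adj X p f : SR (fun F => X F && (p \notin F)) f <-> adj (SR X) 'x_p f.
Proof.
split=> [H|[a [g [Xa ->]]] m /andP[Xm pm]].
  have [|g Eg] := @mpart_xM (mpart (fun m => m (enum_rank p) != 0%N) f) p.
    by move=> m E; rewrite mcoeff_part E eqxx.
  exists (mpart (fun m => m (enum_rank p) == 0%N) f), g; split.
    move=> m Xm; rewrite mcoeff_part; case: eqP => // E.
    by apply: H; rewrite Xm inE E eqxx.
  rewrite -Eg; apply/mpolyP => m; rewrite mcoeffD !mcoeff_part.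
  by case: eqP; rewrite ?addr0 ?add0r.
rewrite mcoeffD Xa // add0r mcoeffM big1 // => -[k1 k2] /= /eqP; move: (bmnm k1) (bmnm k2) => {}k1 {}k2 E.
rewrite mcoeffX; case: eqP => [Ek|]; last by rewrite mul0r.
by move: pm; rewrite E -Ek msupD msupU !inE eqxx.
Qed.

Lemma SR_x X p : ~~ X [set p] -> down X -> SR X 'x_p.
Proof.
move=> nX dX m Xm; rewrite mcoeffX; case: eqP => // E; case/negP: nX.
by apply: dX Xm; rewrite -E msupU.
Qed.

Section OneVariable.
Variable x : V.

(** Separates one variable: a polynomial is rewritten as one in ['X] whose coefficients no longer
    involve [x], though they are kept in the same ring [S]. *)
Definition tauh (i : 'I_N) : {poly S} := if i == enum_rank x then 'X else ('X_i)%:P.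
Definition tau : {rmorphism S -> {poly S}} := mmap (polyC \o @mpolyC N kk) tauh.

Lemma tau_x : tau 'x_x = 'X.
Proof. by rewrite /tau /= mmapX mmap1U /tauh eqxx. Qed.

Lemma tau_y p : p != x -> tau 'x_p = ('x_p)%:P.
Proof.
move=> px; rewrite /tau /= mmapX mmap1U /tauh; case: eqP => // /enum_rank_inj E.
by rewrite E eqxx in px.
Qed.

Lemma tau_C c : tau c%:MP = c%:MP%:P.
Proof. by rewrite /tau /= mmapC. Qed.

Definition mzero m : 'X_{1..N} := [multinom if i == enum_rank x then 0%N else m i | i < N].

Lemma tau_X m : tau 'X_[m] = 'X^(m (enum_rank x)) * ('X_[mzero m])%:P.
Proof.
rewrite /tau /= mmapX /mmap1 (bigD1 (enum_rank x)) //= {1}/tauh eqxx; congr (_ * _).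
rewrite mpolyXE_id rmorph_prod /= [RHS](bigD1 (enum_rank x)) //= mnmE eqxx expr0 polyC1 mul1r.
by apply: eq_bigr => i ix; rewrite /tauh (negPf ix) mnmE (negPf ix) rmorphXn.
Qed.

Lemma tau_coef f i m : ((tau f)`_i)@_m =
  if m (enum_rank x) == 0%N then f@_(m + U_(enum_rank x) *+ i)%MM else 0.
Proof.
rewrite {1}[f]mpolyE rmorph_sum /= coef_sum raddf_sum /=.
have E m' : ((tau (f@_m' *: 'X_[m']))`_i)@_m = f@_m' *
    ((m' (enum_rank x) == i) && (mzero m' == m))%:R.
  rewrite -mul_mpolyC rmorphM tau_C tau_X coefCM mcoeffCM; congr (_ * _).
  rewrite coefXnM coefC subn_eq0; by case: ltngtP => _; rewrite ?mcoeff0 ?mcoeffX.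
rewrite (eq_bigr _ (fun m' _ => E m')).
have [m0|m0] := eqVneq (m (enum_rank x)) 0%N; last first.
  rewrite big1 // => m' _; case: eqP; rewrite /= ?mulr0 // => _.
  by case: eqP => [Em|]; rewrite ?mulr0 // -Em mnmE eqxx in m0 *.
have Ec m' : (m' (enum_rank x) == i) && (mzero m' == m) =
    (m' == (m + U_(enum_rank x) *+ i)%MM).
  apply/andP/eqP => [[/eqP <- /eqP <-]|->].
    apply/mnmP => j; rewrite mnmDE mulmnE mnm1E mnmE eq_sym.
    by case: eqP => [->|_]; rewrite ?mul1n ?mul0n ?addn0.
  split; first by rewrite mnmDE mulmnE mnm1E eqxx m0 mul1n.
  apply/eqP/mnmP => j; rewrite mnmE; case: eqP => [->//|/eqP ne].
  by rewrite mnmDE mulmnE mnm1E eq_sym (negPf ne) addn0.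
rewrite (eq_bigr (fun m' => f@_m' * (m' == (m + U_(enum_rank x) *+ i)%MM)%:R)); last first.
  by move=> m' _; rewrite Ec.
set m1 := (m + _)%MM; have [mf|mf] := boolP (m1 \in msupp f).
  rewrite (bigD1_seq m1) ?msupp_uniq //= eqxx mulr1 big1 ?addr0 //.
  by move=> m' ne; rewrite (negPf ne) mulr0.
rewrite memN_msupp_eq0 // big_seq big1 // => m' m'f.
by case: eqP => [E'|]; rewrite ?mulr0 // E' (negPf mf) in m'f *.
Qed.

End OneVariable.

Variable g : {poly kk}.
Hypotheses (mg : g \is monic) (sg : (1 < size g)%N) (g0 : g`_0 = 0).

(** Substitution of [g] adapts the sequence to an arbitrary maximal ideal; the zero constant term of
    [g] keeps the images of ghost vertices in the ideal. *)
Definition uvar p : S := (map_poly (@mpolyC N kk) g).['x_p].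

Lemma uvar_dvd p : exists f, uvar p = 'x_p * f.
Proof.
have /factor_theorem[q Eq] : root g 0 by rewrite /root horner_coef0 g0.
exists (map_poly (@mpolyC N kk) q).['x_p].
by rewrite /uvar Eq rmorphM hornerM /= rmorphB /= map_polyX map_polyC /= !hornerE mpolyC0 subr0 mulrC.
Qed.

Lemma uvar_SR X p : ~~ X [set p] -> down X -> SR X (uvar p).
Proof.
by move=> nX dX; have [f ->] := uvar_dvd p; apply: (idealMr _ (SR_ideal dX)); apply: SR_x.
Qed.

Lemma hsym_SR X (l : seq V) d : down X ->
  SR X (hsym [seq uvar p | p <- l] d - hsym [seq uvar p | p <- l & X [set p]] d).
Proof.
move=> dX; have iI := SR_ideal dX; elim: l d => [|p l IH] d; first by rewrite subrr; apply: ideal0.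
elim: d => [|d IHd]; first by rewrite !hsym0 subrr; apply: ideal0.
rewrite [X in SR _ (X - _)]hsym_cons /=; case: ifP => Xp /=.
  rewrite /= Xp /= in IHd; rewrite hsym_cons.
  have E (a b c a' b' : S) : a + c * b - (a' + c * b') = a - a' + c * (b - b') by ring.
  by rewrite E; apply: (idealD iI) => //; apply: (idealM _ iI).
rewrite addrAC; rewrite /= Xp in IHd; apply: (idealD iI) => //; apply: (idealMr _ iI).
by apply: uvar_SR; rewrite ?Xp.
Qed.

Definition simplex (l : seq V) (F : {set V}) : bool := [forall p in F, p \in l].

Lemma simplex_down l : down (simplex l).
Proof.
by move=> F G /subsetP FG /forall_inP H; apply/forall_inP => p /FG /H.
Qed.

Lemma tau_uvar x p : tau x (uvar p) = if p == x then map_poly (@mpolyC N kk) g else (uvar p)%:P.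
Proof.
rewrite /uvar -horner_map /= -map_poly_comp /=.
have E1 : map_poly (tau x \o @mpolyC N kk) g = map_poly (polyC \o @mpolyC N kk) g.
  by apply: eq_map_poly => c /=; rewrite tau_C.
rewrite E1 map_poly_comp; case: eqP => [->|/eqP px]; last by rewrite tau_y // horner_map.
rewrite tau_x; set q := map_poly _ g.
by rewrite -[RHS]comp_polyXr.
Qed.

(** The first polynomial is monic in the variable of the head of the list. Modulo it, the recursion
    of [hsym] identifies the later ones with those in the remaining variables, one degree higher;
    hence the arbitrary starting degree [d]. *)
Lemma wreg_simplex (l : seq V) d : uniq l ->
  wreg (SR (simplex l)) [seq hsym [seq uvar p | p <- l] i | i <- iota d (size l)].
Proof.
elim: l d => // x l IH d /= /andP[xl ul].
have dl := @simplex_down l; have iI := SR_ideal dl.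
have mgx : map_poly (@mpolyC N kk) g \is monic by rewrite map_monic.
have sgx : (1 < size (map_poly (@mpolyC N kk) g))%N.
  by rewrite size_map_poly_id0 // (monicP mg) mpolyC1 oner_eq0.
have xI : SR (simplex l) 'x_x.
  apply: SR_x => //; apply/negP => /forall_inP/(_ x (set11 x)).
  by rewrite (negPf xl).
have nx m : simplex l (msup m) -> m (enum_rank x) = 0%N.
  move=> /forall_inP sm; apply/eqP; apply: contraNT xl => h.
  by apply: sm; rewrite inE.
have sj q : exists s, polyI (SR (simplex l)) (q - tau x s).
  have iP := polyI_ideal iI.
  elim/poly_ind: q => [|q b [s Hs]].
    by exists 0; rewrite rmorph0 subr0; apply: ideal0.
  exists (s * 'x_x + mpart (fun m => m (enum_rank x) == 0%N) b).
  rewrite (rmorphD (tau x)) (rmorphM (tau x)) tau_x.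
  have E (a1 a2 a3 c1 c2 : {poly S}) :
    a1 * a3 + c1 - (a2 * a3 + c2) = (a1 - a2) * a3 + (c1 - c2) by ring.
  rewrite E; apply: (idealD iP); first exact: (idealMr _ iP).
  move=> i m sm; rewrite coefB mcoeffB coefC tau_coef nx // eqxx mcoeff_part.
  rewrite mnmDE mulmnE mnm1E eqxx mul1n nx // add0n.
  case: eqP => [->|_]; last by rewrite mcoeff0 subr0.
  by rewrite mulm0n addm0 subrr.
have sE f : SR (simplex (x :: l)) f <-> polyI (SR (simplex l)) (tau x f).
  split=> [H i m sm|H m sm].
    rewrite tau_coef nx // eqxx; apply: H; rewrite msupD.
    apply/forall_inP => p; rewrite !inE => /orP[h|].
      by rewrite (forall_inP sm) ?orbT // inE.
    rewrite mulmnE mnm1E (inj_eq enum_rank_inj) muln_eq0 negb_or => /andP[h _].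
    by move: h; rewrite [p == x]eq_sym; case: (x == p).
  have -> : m = (mzero x m + U_(enum_rank x) *+ m (enum_rank x))%MM.
    apply/mnmP => j; rewrite mnmDE mulmnE mnm1E mnmE eq_sym.
    by case: eqP => [->|_]; rewrite ?mul1n ?mul0n ?addn0.
  have := H (m (enum_rank x)) (mzero x m); rewrite tau_coef mnmE eqxx /=; apply.
  apply/forall_inP => p; rewrite inE mnmE (inj_eq enum_rank_inj).
  case: (eqVneq p x) => [//|px] h; have := forall_inP sm p.
  by rewrite !inE h (negPf px) => /(_ isT).
change (wreg (SR (simplex (x :: l)))
  [seq hsym (uvar x :: [seq uvar p | p <- l]) i | i <- iota d (size l).+1]).
apply: (wreg_ext (fun f => iff_sym (sE f))); apply: wreg_preim => //.
  exact: polyI_ideal.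
rewrite -map_comp.
have -> : [seq (tau x \o hsym (uvar x :: [seq uvar p | p <- l])) i | i <- iota d (size l).+1] =
    [seq hsym (map_poly (@mpolyC N kk) g :: [seq u%:P | u <- [seq uvar p | p <- l]]) i
      | i <- iota d (size l).+1].
  apply: eq_map => i; rewrite /= hsym_rmorph /= tau_uvar eqxx; congr (hsym (_ :: _) i).
  rewrite -!map_comp; apply/eq_in_map => p pl /=; rewrite tau_uvar.
  by case: eqP => // px; rewrite -px pl in xl.
set Y := map_poly _ g; set us := [seq uvar p | p <- l].
have [mY _] := size_hsym_monic us d mgx sgx.
rewrite /=; split; first exact: nzd_monic.
apply: (@wreg_shift _ _ _ (fun i => (hsym us i)%:P) Y) => //.
- by apply: adj_ideal; apply: polyI_ideal.
- by apply: adj_self; apply: polyI_ideal.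
- by move=> i; rewrite (hsym_rmorph (polyC : {rmorphism S -> {poly S}})) hsym_cons.
have -> : [seq (hsym us i)%:P | i <- iota d.+1 (size l)] =
    [seq z%:P | z <- [seq hsym us i | i <- iota d.+1 (size l)]] by rewrite -map_comp.
exact: (wreg_polyI iI mY (IH d.+1 ul)).
Qed.

End SquareFree.

(** * Matroid complexes *)

Section Augmenting.
Variables (kk : fieldType) (V : finType).
Implicit Types (X : {set V} -> bool) (S T L : {set V}) (p q : V).

Definition augmenting X : Prop := forall S T, X S -> X T -> (#|S| < #|T|)%N ->
  exists2 p, p \in T :\: S & X (p |: S).

Definition has_rank X (r : nat) : Prop :=
  (exists2 S, X S & #|S| = r) /\ (forall S, X S -> (#|S| <= r)%N).

Lemma augment_to X r S : augmenting X -> has_rank X r -> X S ->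
  exists T, [/\ S \subset T, X T & #|T| = r].
Proof.
move=> aX [[B XB cB] mx]; move: {2}(r - #|S|)%N (erefl (r - #|S|)%N) => m.
elim: m S => [|m IH] S E XS.
  exists S; split=> //; apply/eqP; rewrite eqn_leq mx //= -subn_eq0 E //.
have [|p pBS Xp] := aX _ _ XS XB; first by rewrite cB; lia.
have pS : p \notin S by move: pBS; rewrite inE => /andP[].
have [|//|T [ST XT cT]] := IH (p |: S); first by rewrite cardsU1 pS; lia.
by exists T; split=> //; apply: subset_trans ST; apply: subsetUr.
Qed.

Lemma star_down X L : down X -> down (fun S => X (L :|: S)).
Proof. by move=> dX F G FG; apply: dX; apply: setUS. Qed.

(** If [L :|: T] is not larger than [L :|: S], then [T] contains more elements of [L] than [S] does,
    and any element of [L] can be added freely. *)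
Lemma star_augmenting X L : down X -> augmenting X -> augmenting (fun S => X (L :|: S)).
Proof.
move=> dX aX S T XS XT lt.
have [lt2|ge2] := ltnP #|L :|: S| #|L :|: T|.
  have [p] := aX _ _ XS XT lt2; rewrite !inE negb_or => /andP[/andP[pL pS] /orP[|pT]].
    by rewrite (negPf pL).
  by move=> Xp; exists p; [rewrite inE pS|rewrite setUCA].
have : (#|S :&: L| < #|T :&: L|)%N.
  have := cardsUI L S; have := cardsUI L T; rewrite ![_ :&: L]setIC; lia.
move=> lt3; have /subsetPn[p] : ~~ (T :&: L \subset S :&: L).
  by apply: contraTN lt3 => /subset_leq_card; rewrite -leqNgt.
rewrite !inE => /andP[pT pL]; rewrite pL andbT => pS; exists p; first by rewrite inE pS.
by rewrite setUCA (setUidPr _) // sub1set inE pL.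
Qed.

Lemma star_rank X L r : down X -> augmenting X -> has_rank X r -> X L ->
  has_rank (fun S => X (L :|: S)) r.
Proof.
move=> dX aX hX XL; have [T [LT XT cT]] := augment_to aX hX XL; split.
  by exists T => //; rewrite (setUidPr LT).
move=> S /hX.2; apply: leq_trans; apply: subset_leq_card; exact: subsetUr.
Qed.

Variable g : {poly kk}.
Hypotheses (mg : g \is monic) (sg : (1 < size g)%N) (g0 : g`_0 = 0).

Definition hseq (r : nat) : seq {mpoly kk[#|V|]} :=
  [seq hsym [seq uvar g p | p <- enum V] i | i <- iota 1 r].

(** Induction on the vertices that are not coloops, collected in [mob]. The star and the deletion of
    such a vertex are matroid complexes of the same rank with fewer of them; when none is left, the
    complex is a simplex. *)
Lemma augmenting_wreg X r : down X -> augmenting X -> has_rank X r ->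
  wreg (@SR kk V X) (hseq r).
Proof.
pose mob X := [set p | X [set p] && [exists S, X S && ~~ X (p |: S)]].
move: {2}#|mob X| (leqnn #|mob X|) => m; elim: m X => [|m IH] X cm dX aX hX.
  have X0 : X set0.
    by case: hX => -[S XS _] _; apply: dX XS; apply: sub0set.
  have col p S : X [set p] -> X S -> X (p |: S).
    move=> Xp XS; have /existsPn/(_ S) : ~~ [exists S, X S && ~~ X (p |: S)].
      apply/negP => E; have : p \in mob X by rewrite inE Xp.
      by move: cm; rewrite leqn0 cards_eq0 => /eqP ->; rewrite inE.
    by rewrite XS negbK.
  pose l := [seq p <- enum V | X [set p]].
  have XE S : X S = simplex l S.
    apply/idP/forall_inP => [XS p pS|H].
      by rewrite mem_filter mem_enum andbT; apply: dX XS; rewrite sub1set.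
    have {}H p : p \in S -> X [set p] by move/H; rewrite mem_filter => /andP[].
    move: {2}#|S| (erefl #|S|) => c; elim: c S H => [|c IHc] S H E.
      by move/eqP: E; rewrite cards_eq0 => /eqP ->.
    have [p pS] : exists p, p \in S by apply/card_gt0P; rewrite E.
    rewrite -(setD1K pS); apply: col; first exact: H.
    apply: IHc; first by move=> q; rewrite inE => /andP[_ /H].
    by move: E; rewrite (cardsD1 p) pS => -[].
  have ul : uniq l by rewrite filter_uniq ?enum_uniq.
  have rl : r = size l.
    case: hX => -[S XS cS] mx; apply/eqP; rewrite eqn_leq; apply/andP; split.
      rewrite -cS cardE; apply: uniq_leq_size; first exact: enum_uniq.
      by move=> p; rewrite mem_enum; move: XS; rewrite XE => /forall_inP; apply.
    have := mx [set p in l]; rewrite cardsE (card_uniqP ul); apply.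
    by rewrite XE; apply/forall_inP => p; rewrite inE.
  apply: (@wreg_cong _ _ _ [seq hsym [seq uvar g p | p <- l] i | i <- iota 1 (size l)]).
  - exact: SR_ideal.
  - by rewrite !size_map !size_iota rl.
  - move=> i; rewrite size_map size_iota => lti.
    rewrite !(nth_map 0%N) ?size_iota -?rl //; exact: hsym_SR.
  - have := wreg_simplex mg sg 1 ul; apply: wreg_ext => f.
    by split=> H m' h; apply: H; rewrite ?XE // -XE.
have [E|[p]] := set_0Vmem (mob X); first by apply: IH; rewrite ?E ?cards0.
rewrite inE => /andP[Xp /existsP[S0 /andP[XS0 nX]]].
have iI := @SR_ideal kk V X dX.
have mobp : p \in mob X by rewrite inE Xp; apply/existsP; exists S0; rewrite XS0.
have sm X' : mob X' \subset mob X -> p \notin mob X' -> (#|mob X'| <= m)%N.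
  move=> s np; rewrite -ltnS; apply: leq_trans cm; apply: proper_card.
  by apply/properP; split=> //; exists p.
apply: (@wreg_colon _ _ 'X_(enum_rank p)) => //.
  apply: (wreg_ext (fun f => SR_colon _ _ f)); apply: IH.
  - apply: sm.
      apply/subsetP => q; rewrite !inE => /andP[Xq /existsP[S /andP[XS nS]]].
      rewrite (dX _ _ _ Xq) ?subsetUr //=; apply/existsP; exists (p |: S).
      by rewrite XS setUCA nS.
    apply/negP; rewrite inE => /andP[_ /existsP[S /andP[XS]]].
    by rewrite setUA setUid XS.
  - exact: star_down.
  - exact: star_augmenting.
  - exact: star_rank.
apply: (wreg_ext (fun f => SR_adj _ _ f)); apply: IH.
- apply: sm.
    apply/subsetP => q; rewrite !inE => /andP[/andP[Xq pq] /existsP[S /andP[/andP[XS pS] nS]]].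
    rewrite Xq; apply/existsP; exists S; rewrite XS /=; apply: contra nS => ->.
    by rewrite /= !inE negb_or pq.
  by rewrite !inE eqxx !andbF.
- by move=> F G /subsetP FG /andP[XG pG]; rewrite (dX F G) //=; [apply: contra pG => /FG|apply/subsetP].
- move=> S T /andP[XS pS] /andP[XT pT] lt; have [q qT Xq] := aX _ _ XS XT lt.
  exists q => //; rewrite Xq !inE negb_or pS andbT.
  by apply: contraNneq pT => ->; move: qT; rewrite inE => /andP[].
- case: hX => hb mx; split; last by move=> S /andP[/mx].
  have [T [ST XT cT]] := augment_to aX (conj hb mx) XS0.
  exists T => //; rewrite XT; apply: contra nX => pT; apply: dX XT.
  by rewrite subUset sub1set pT.
Qed.

End Augmenting.

(** * Regularity for the external activity complex *)

Section ExtWreg.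
Variables (kk : fieldType) (R : realType) (k n : nat).
Variables (w : {ffun 'I_k * 'I_n -> R}) (M : 'I_k -> matroid 'I_n).
Hypotheses (k1 : (1 < k)%N) (gw : generic_pair w).
Local Notation P := ('I_k * 'I_n)%type.
Implicit Types (S L Q : {set P}) (p : P).

Variable g : {poly kk}.
Hypotheses (mg : g \is monic) (sg : (1 < size g)%N) (g0 : g`_0 = 0).
Variable r : nat.
Hypothesis hr : has_rank (dind M) r.

(** [L] collects the vertices whose star has been taken, [Q] the elements still forced to dominate.
    [Q] full and [L] empty is the external activity complex; [Q] empty gives a star in the
    truncation. *)
Definition theta Q L S : bool := `[< Gam w M (S :|: L) (S :|: L :|: Q) >].

Lemma theta_down Q L : down (theta Q L).
Proof.
move=> F G FG /asboolP H; apply/asboolP; apply: Gam_sub H.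
  exact: setSU.
by apply: setSU; apply: setSU.
Qed.

Lemma Gam_dindE S : Gam w M S S <-> dind M S.
Proof. by split; [apply: Gam_dind|apply: dind_Gam]. Qed.

Lemma dind_augmenting : augmenting (dind M).
Proof. by move=> S T; apply: dind_augment. Qed.

Lemma dind_down : down (dind M).
Proof. by move=> S T; apply: dindS. Qed.

(** Release an element p of [Q]. The complex [ta], where p is required to be active instead of
    dominating, has union [theta Q' L] with [theta Q L] by [Gam_extend], and intersection
    [theta Q' (p |: L)] by [Gam_meet]. Both results have smaller [Q], and [wreg_cap_add] gives
    regularity for [theta Q L]. *)
Lemma theta_wreg Q L : wreg (@SR kk _ (theta Q L)) (@hseq kk _ g r).
Proof.
move: {2}#|Q| (leqnn #|Q|) => m; elim: m Q L => [|m IH] Q L cQ.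
  move: cQ; rewrite leqn0 cards_eq0 => /eqP ->.
  have tE S : theta set0 L S = dind M (L :|: S).
    by rewrite /theta setU0 setUC; apply/asboolP/idP => /Gam_dindE.
  have ext (f : {mpoly kk[#|{: P}|]}) : SR (fun S => dind M (L :|: S)) f <-> SR (theta set0 L) f.
    by split=> H m'; [rewrite tE|rewrite -tE]; apply: H.
  apply: (wreg_ext ext).
  have [dL|ndL] := boolP (dind M L).
    apply: augmenting_wreg => //.
    - exact: star_down dind_down.
    - exact: star_augmenting dind_down dind_augmenting.
    - exact: star_rank dind_down dind_augmenting _ dL.
  apply: wreg_all => f m' h; case/negP: ndL; apply: dindS h; exact: subsetUl.
have [QL|[p pQL]] : (Q \subset L) \/ exists p, p \in Q :\: L.
  case: (set_0Vmem (Q :\: L)) => [/eqP|[p pp]]; last by right; exists p.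
  by rewrite setD_eq0; left.
  have ext (f : {mpoly kk[#|{: P}|]}) : SR (theta set0 L) f <-> SR (theta Q L) f.
    have E S : theta set0 L S = theta Q L S by rewrite /theta setU0 -setUA (setUidPl QL).
    by split=> H m' h; apply: H; rewrite ?E // -E.
  by apply: (wreg_ext ext); apply: IH; rewrite cards0.
move: pQL; rewrite inE => /andP[pL pQ]; pose Q' := Q :\ p.
pose ta S : bool := `[< Gam w M (S :|: (p |: L)) (S :|: L :|: Q') >].
have ta_down : down ta.
  move=> F G FG /asboolP H; apply/asboolP; apply: Gam_sub H.
    exact: setSU.
  by apply: setSU; apply: setSU.
have cQ' : (#|Q'| <= m)%N by move: cQ; rewrite (cardsD1 p) pQ.
have EQ : Q = p |: Q' by rewrite setD1K.
have cupE S : theta Q L S || ta S = theta Q' L S.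
  apply/orP/asboolP => [[/asboolP H|/asboolP H]|H].
  - by apply: Gam_sub H => //; apply: setUS; apply: subsetDl.
  - by apply: Gam_sub H => //; apply: setUS; apply: subsetUr.
  have [pS|pS] := boolP (p \in S).
    left; apply/asboolP; apply: Gam_sub H => //.
    rewrite EQ setUCA subUset sub1set subxx andbT !inE pS //.
  have [||h|h] := Gam_extend k1 (_ : p \notin S :|: L) (_ : p \notin S :|: L :|: Q') H.
  - by rewrite !inE negb_or pS.
  - by rewrite !inE !negb_or pS pL eqxx.
  - by right; apply/asboolP; rewrite setUCA.
  - by left; apply/asboolP; rewrite EQ setUCA.
have capE S : theta Q L S && ta S = theta Q' (p |: L) S.
  apply/andP/asboolP => [[/asboolP h1 /asboolP h2]|H].
    have -> : S :|: (p |: L) :|: Q' = p |: (S :|: L :|: Q') by rewrite (setUCA S) -setUA.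
    rewrite (setUCA S); apply: Gam_meet; first by rewrite -(setUCA S).
    by rewrite setUCA -EQ.
  split; apply/asboolP; apply: Gam_sub H.
  - by apply: setUS; apply: subsetUr.
  - apply/subsetP => x; rewrite EQ !inE.
    by case: (x \in S); case: (x \in L); case: (x == p).
  - by [].
  - by rewrite (setUCA S) -!setUA subsetUr.
apply: (@wreg_cap_add _ _ (SR ta)).
- exact: SR_ideal (@theta_down Q L).
- exact: SR_ideal.
- apply: wreg_ext (IH Q' L cQ') => f; rewrite -SR_cap.
  by split=> H m'; [rewrite cupE|rewrite -cupE]; apply: H.
- apply: wreg_ext (IH Q' (p |: L) cQ') => f; rewrite -SR_add.
  by split=> H m'; [rewrite capE|rewrite -capE]; apply: H.
Qed.

Lemma ext_wreg : wreg (SR (fun F => F \in faces (ext_complex w M))) (@hseq kk _ g r).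
Proof.
apply: wreg_ext (theta_wreg setT set0) => f.
have E F : theta setT set0 F = (F \in ext_faces w M).
  rewrite /theta setU0 setUT; apply/asboolP/idP.
    by move=> h; apply/(ext_facesE w M F (ltnW k1)).
  by move/(ext_facesE w M F (ltnW k1)).
by split=> H m; [rewrite -[_ \in _]E|rewrite E]; apply: H.
Qed.

Lemma ext_faces_dind F : F \in ext_faces w M -> dind M F.
Proof.
move=> /(ext_facesE w M F (ltnW k1)) H; apply: Gam_dind gw _.
by apply: Gam_sub H => //; apply: subsetT.
Qed.

End ExtWreg.

(** * Dimension and depth *)

Section PrimeChains.
Variable A : comNzRingType.
Implicit Types (I J Q : A -> Prop) (s x y : A).

(** Zorn's lemma: an ideal containing [J] and maximal among those avoiding the products of a power
    of [s] with an element outside [I] is prime, since these products form a multiplicative set. *)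
Lemma prime_avoid I J s : prime_ideal I -> ideal J ->
  (forall n y, J (s ^+ n * y) -> I y) ->
  exists Q, [/\ prime_ideal Q, forall x, J x -> Q x, forall x, Q x -> I x & ~ Q s].
Proof.
move=> [iI nI1 pI] iJ av.
pose good Q := [/\ ideal Q, forall x, J x -> Q x & forall n y, Q (s ^+ n * y) -> I y].
pose T := {Q | good Q}; pose t0 : T := exist _ J (And3 iJ (fun x h => h) av).
pose R (a b : T) : bool := `[< forall x, sval a x -> sval b x >].
have [|a b c /asboolP h1 /asboolP h2|C totC|[Q [iQ JQ avQ]] Qmax] := @classical_sets.ZL_preorder T t0 R.
- by move=> a; apply/asboolP.
- by apply/asboolP => x /h1 /h2.
- have [[a Ca]|nC] := pselect (exists a, C a); last first.
    by exists t0 => b Cb; case: nC; exists b.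
  pose U x := exists b, C b /\ sval b x.
  have gU : good U.
    split.
    - split; first by exists a; split=> //; case: (svalP a) => -[].
        move=> x y [b [Cb bx]] [c [Cc cy]].
        case: (totC b c Cb Cc) => /asboolP h.
          by exists c; split=> //; case: (svalP c) => -[_ hD _] _ _; apply: hD => //; apply: h.
        by exists b; split=> //; case: (svalP b) => -[_ hD _] _ _; apply: hD => //; apply: h.
      move=> z x [b [Cb bx]]; exists b; split=> //.
      by case: (svalP b) => -[_ _ hM] _ _; apply: hM.
    - by move=> x Jx; exists a; split=> //; case: (svalP a) => _ h _; apply: h.
    - by move=> n y [b [_]]; case: (svalP b) => _ _ h /h.
  exists (exist _ U gU) => b Cb; apply/asboolP => x bx /=; by exists b.
have sub x : Q x -> I x by move=> Qx; apply: (avQ 0%N); rewrite expr0 mul1r.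
have big x : ~ Q x -> exists n y, adj Q x (s ^+ n * y) /\ ~ I y.
  move=> nQx; apply: contrapT => H.
  have g' : good (adj Q x).
    split; [exact: adj_ideal|by move=> y /JQ; apply: adjW|].
    by move=> n y h; apply: contrapT => nIy; apply: H; exists n, y.
  have := Qmax (exist _ _ g'); rewrite /R /= => /(_ _)/asboolP h; apply: nQx; apply: h.
    by apply/asboolP => y /=; apply: adjW.
  exact: adj_self.
exists Q; split=> //; last by move=> Qs; apply: nI1; apply: (avQ 1%N); rewrite expr1 mulr1.
split=> //; first by move/sub.
move=> x y Qxy; apply: contrapT => /Decidable.not_or[/big[n [z [[a [c [Qa E]]] nIz]]]].
move=> /big[m [z' [[a' [c' [Qa' E']]] nIz']]].
have : I (z * z').
  apply: (avQ (n + m)%N); have -> : s ^+ (n + m) * (z * z') = (s ^+ n * z) * (s ^+ m * z').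
    by rewrite exprD; ring.
  rewrite E E'; have -> : (a + x * c) * (a' + y * c') =
    a' * a + (y * c') * a + (x * c) * a' + (c * c') * (x * y) by ring.
  by do 3!(apply: (idealD iQ); last exact: (idealM _ iQ)); apply: (idealM _ iQ).
by case/pI.
Qed.

Lemma generated_ideal (zs : seq A) : ideal (generated zs).
Proof.
split.
- by exists (fun=> 0); rewrite big1 // => i _; rewrite mul0r.
- move=> _ _ [c ->] [d ->]; exists (fun i => c i + d i); rewrite -big_split.
  by apply: eq_bigr => i _; rewrite mulrDl.
- move=> a _ [c ->]; exists (fun i => a * c i); rewrite mulr_sumr.
  by apply: eq_bigr => i _; rewrite mulrA.
Qed.

Lemma generated_sub (zs : seq A) I x : ideal I -> (forall z, z \in zs -> I z) ->
  generated zs x -> I x.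
Proof.
move=> iI H [c ->]; apply: ideal_sum => // i _; apply: (idealM _ iI); apply: H.
exact: mem_nth.
Qed.

(** The last element is regular modulo the others, so some prime inside [I] contains the others and
    omits it; the chain continues inside that prime. *)
Lemma regular_chain (zs : seq A) I : prime_ideal I -> regular_sequence zs ->
  (forall z, z \in zs -> I z) -> prime_chain I (size zs).
Proof.
elim/last_ind: zs I => [|zs y IH] I pI.
  by move=> _ _; exists (fun=> I); split.
move=> [_ reg] H; have [iI nI1 _] := pI.
have iJ := generated_ideal zs.
have Hz z : z \in zs -> I z by move=> zz; apply: H; rewrite mem_rcons inE zz orbT.
have sub x : generated zs x -> I x by apply: generated_sub.
have av n x : generated zs (y ^+ n * x) -> I x.
  move=> h; apply: sub; elim: n h => [|n IHn]; first by rewrite expr0 mul1r.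
  rewrite exprS -mulrA => h; apply: IHn.
  have := reg (size zs) (y ^+ n * x); rewrite size_rcons ltnSn nth_rcons ltnn eqxx.
  by rewrite -cats1 take_size_cat //; apply.
have [Q [pQ JQ QI nQ]] := prime_avoid pI iJ av.
have gen_mem z : z \in zs -> generated zs z.
  move=> /(nthP 0)[i lti <-]; exists (fun j => (j == i)%:R).
  rewrite (bigD1 (Ordinal lti)) //= eqxx mul1r big1 ?addr0 // => j ji.
  by rewrite -[(_ == i)]/(j == Ordinal lti) (negPf ji) mul0r.
have [||P [Pp Pinc Pl]] := IH Q pQ.
- split; first by move/sub/nI1.
  move=> i x lti; have := reg i x; rewrite size_rcons (ltn_trans lti) // nth_rcons lti.
  by rewrite -cats1 takel_cat ?(ltnW lti) //; apply.
- by move=> z /gen_mem /JQ.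
exists (fun i => if (i <= size zs)%N then P i else I); rewrite size_rcons; split.
- by move=> i _; case: ifP => // le; apply: Pp.
- move=> i; rewrite ltnS => le; rewrite le; case: ltnP => [lt|ge]; first exact: Pinc.
  have /eqP -> : i == size zs by rewrite eqn_leq le ge.
  split; first by move=> x /Pl /QI.
  exists y; split; first by apply: H; rewrite mem_rcons inE eqxx.
  by move/Pl.
- by rewrite ltnn.
Qed.

Variables (kk : fieldType) (iota : {rmorphism kk -> A}).

(* Divide by the least power of [x 0] that occurs and pass from [P 0] to [P 1]. *)
Lemma chain_monomials (e : nat) (P : nat -> A -> Prop) (x : nat -> A)
    (T : finType) (c : T -> kk) (m : T -> nat -> nat) :
  (forall i, (i <= e)%N -> prime_ideal (P i)) ->
  (forall i, (i < e)%N -> forall y, P i y -> P i.+1 y) ->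
  (forall i, (i < e)%N -> P i.+1 (x i) /\ ~ P i (x i)) ->
  (forall a b, c a != 0 -> c b != 0 -> (forall i, (i < e)%N -> m a i = m b i) -> a = b) ->
  P 0%N (\sum_a iota (c a) * \prod_(i < e) x i ^+ m a i) -> forall a, c a = 0.
Proof.
elim: e P x c m => [|e IH] P x c m Pp Pinc Px inj Ps a.
  apply/eqP/negPn/negP => ca; have [iP nP _] := Pp 0%N isT; apply: nP.
  move: Ps; rewrite (bigD1 a) //= big_ord0 mulr1 big1 ?addr0.
    move=> h; have := idealM (iota (c a)^-1) iP h.
    by rewrite -rmorphM mulVf // rmorph1.
  move=> b ba; have [->|cb] := eqVneq (c b) 0; first by rewrite rmorph0 mul0r.
  by rewrite (inj _ _ cb ca) ?eqxx in ba.
apply/eqP/negPn/negP => ca.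
have [a0 ca0 a0m] := @arg_minnP _ a (fun a => c a != 0) (fun a => m a 0%N) ca.
have [iP0 _ pP0] := Pp 0%N isT; have [iP1 _ _] := Pp 1%N isT.
have [Px1 nPx0] := Px 0%N isT.
pose S := \sum_b iota (c b) * (x 0%N ^+ (m b 0%N - m a0 0%N) * \prod_(i < e) x i.+1 ^+ m b i.+1).
have ES : \sum_b iota (c b) * \prod_(i < e.+1) x i ^+ m b i = x 0%N ^+ m a0 0%N * S.
  rewrite /S mulr_sumr; apply: eq_bigr => b _; rewrite big_ord_recl /=.
  have [->|cb] := eqVneq (c b) 0; first by rewrite rmorph0 !mul0r mulr0.
  by rewrite [in RHS]mulrCA [x 0%N ^+ m a0 0%N * _]mulrA -exprD subnKC ?a0m.
have PS : P 0%N S.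
  move: Ps; rewrite ES; elim: (m a0 0%N) => [|q IHq]; first by rewrite expr0 mul1r.
  by rewrite exprS -mulrA => /pP0[/nPx0|].
have PS1 : P 1%N S by apply: Pinc.
pose c' b := if m b 0%N == m a0 0%N then c b else 0.
have c'c b : c' b != 0 -> c b != 0 /\ m b 0%N = m a0 0%N.
  by rewrite /c'; case: (eqVneq (m b 0%N) (m a0 0%N)) => // _; rewrite eqxx.
suff H : forall b, c' b = 0 by have := H a0; rewrite /c' eqxx => /eqP E; rewrite E in ca0.
apply: (IH (fun i => P i.+1) (fun i => x i.+1) c' (fun b i => m b i.+1)).
- by move=> i le; apply: Pp.
- by move=> i lt; apply: Pinc.
- by move=> i lt; apply: Px.
- move=> b1 b2 /c'c[cb1 e1] /c'c[cb2 e2] E; apply: inj => // -[|i] lt; first by rewrite e1 e2.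
  exact: E.
- have ED : S = \sum_b iota (c' b) * \prod_(i < e) x i.+1 ^+ m b i.+1
   + \sum_b (if c' b == c b then 0 else iota (c b) * (x 0%N ^+ (m b 0%N - m a0 0%N) * \prod_(i < e) x i.+1 ^+ m b i.+1)).
  rewrite -big_split; apply: eq_bigr => b _ /=; rewrite /c'; case: (m b 0%N =P m a0 0%N) => [->|ne].
    by rewrite eqxx subnn expr0 mul1r addr0.
  case: eqP => [<-|_]; first by rewrite rmorph0 !mul0r addr0.
  by rewrite rmorph0 mul0r add0r.
  have dS : P 1%N (S - \sum_b iota (c' b) * \prod_(i < e) x i.+1 ^+ m b i.+1); last first.
    exact: (ideal_cong iP1 dS).1 PS1.
  rewrite ED addrAC subrr add0r; apply: ideal_sum => // b _; case: ifP => [_|ne]; first exact: ideal0.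
  apply: (idealM _ iP1); apply: (idealMr _ iP1).
  have cb : c b != 0 by apply: contraFN ne => /eqP cb0; rewrite /c' cb0 if_same.
  have lt : (m a0 0%N < m b 0%N)%N.
    rewrite ltn_neqAle a0m // andbT; apply: contraFN ne => /eqP E; rewrite /c' E eqxx //.
  by rewrite -(subnSK lt) exprS; apply: (idealMr _ iP1).
Qed.

End PrimeChains.

Lemma mpoly_hom_ext (kk : fieldType) (n : nat) (B : comNzRingType)
    (f g : {rmorphism {mpoly kk[n]} -> B}) :
  (forall c, f c%:MP = g c%:MP) -> (forall i, f 'X_i = g 'X_i) -> f =1 g.
Proof.
move=> HC HX p; rewrite [p]mpolyE !rmorph_sum; apply: eq_bigr => m _.
rewrite -mul_mpolyC !rmorphM HC; congr (_ * _).
by rewrite mpolyXE_id !rmorph_prod; apply: eq_bigr => i _; rewrite !rmorphXn HX.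
Qed.

Lemma poly_nonunit (R : idomainType) (q u : {poly R}) : (1 < size q)%N -> q * u <> 1.
Proof.
move=> sq E; have q0 : q != 0 by rewrite -size_poly_gt0 ltnW.
have u0 : u != 0.
  by apply/eqP => u0; move/eqP: E; rewrite u0 mulr0 eq_sym oner_eq0.
have := congr1 (size \o polyseq) E; rewrite /= size_mul // size_poly1.
move: sq; rewrite -size_poly_gt0 in u0; move: u0.
by move: (size q) (size u) => a b; lia.
Qed.

(** * Zariski's lemma *)

Section Zariski.
Variables (kk : fieldType) (V : finType) (K : comNzRingType).
Local Notation S := {mpoly kk[#|V|]}.
Variable ev : {rmorphism S -> K}.
Hypothesis ev_surj : forall z, exists f, z = ev f.
Hypothesis Kinv : forall z : K, z != 0 -> exists y, z * y = 1.
Implicit Types (J : {set V}) (p : V).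
Local Notation tau := (tau kk).
Local Notation "''x_' p" := ('X_(enum_rank p) : S) (at level 8, p at level 2).

Lemma Kdom (z y : K) : z * y = 0 -> z = 0 \/ y = 0.
Proof.
move=> E; have [->|/Kinv[z' Ez]] := eqVneq z 0; [by left|right].
by rewrite -[y]mul1r -Ez mulrAC E mul0r.
Qed.

Lemma Kprod_neq0 (I : finType) (F : I -> K) :
  (forall i, F i != 0) -> \prod_i F i != 0.
Proof.
move=> H; elim: (index_enum _) => [|i r IH]; first by rewrite big_nil oner_neq0.
rewrite big_cons; apply/eqP => /Kdom[/eqP|/eqP]; first by rewrite (negPf (H i)).
by rewrite (negPf IH).
Qed.

(** Setting the variables outside [J] to zero represents the polynomial ring on [J] by an
    endomorphism of [S]. *)
Definition keep_var J (i : 'I_#|V|) : S := if enum_val i \in J then 'X_i else 0.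
Definition keep J : {rmorphism S -> S} := mmap (@mpolyC _ kk) (keep_var J).

Lemma keepC J c : keep J c%:MP = c%:MP.
Proof. by rewrite /keep /= mmapC. Qed.

Lemma keepX J p : keep J 'x_p = if p \in J then 'x_p else 0.
Proof. by rewrite /keep /= mmapX mmap1U /keep_var enum_rankK. Qed.

Lemma mpoly_ext (B : comNzRingType) (f g : {rmorphism S -> B}) :
  (forall c, f c%:MP = g c%:MP) -> (forall p, f 'x_p = g 'x_p) -> f =1 g.
Proof.
move=> HC HX; apply: mpoly_hom_ext => // i.
by rewrite -[i]enum_valK; apply: HX.
Qed.

Lemma tauK p (f : S) : (tau p f).['x_p] = f.
Proof.
apply: (mpoly_ext (f := horner_eval 'x_p \o tau p) (g := idfun)) => [c|q] /=.
  by rewrite /horner_eval tau_C hornerC.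
rewrite /horner_eval; have [->|qp] := eqVneq q p; first by rewrite tau_x hornerX.
by rewrite tau_y // hornerC.
Qed.

Lemma tau_neq0 p (f : S) : f != 0 -> tau p f != 0.
Proof. by apply: contraNneq => E; rewrite -(tauK p f) E horner0. Qed.

Lemma ev_tau p (f : S) : ev f = (map_poly ev (tau p f)).[ev 'x_p].
Proof.
apply: (mpoly_ext (g := horner_eval (ev 'x_p) \o (map_poly ev \o tau p))) => [c|q] /=.
  by rewrite /horner_eval tau_C map_polyC hornerC.
rewrite /horner_eval; have [->|qp] := eqVneq q p.
  by rewrite tau_x map_polyX hornerX.
by rewrite tau_y // map_polyC hornerC.
Qed.

Lemma tau_keep J p (f : S) a : p \notin J ->
  keep J (tau p (keep (p |: J) f))`_a = (tau p (keep (p |: J) f))`_a.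
Proof.
move=> pJ.
have E : (map_poly (keep J) \o (tau p \o keep (p |: J))) =1 (tau p \o keep (p |: J)); last first.
  transitivity ((map_poly (keep J) (tau p (keep (p |: J) f)))`_a); first by rewrite coef_map.
  by have := E f; rewrite /= => ->.
apply: mpoly_ext => [c|q] /=.
  by rewrite keepC tau_C map_polyC /= keepC.
rewrite keepX !inE; have [->|qp] /= := eqVneq q p; first by rewrite tau_x map_polyX.
case: ifP => qJ; last by rewrite !rmorph0.
by rewrite tau_y // map_polyC /= keepX qJ.
Qed.

Definition algindep J : Prop := forall f, ev (keep J f) = 0 -> keep J f = 0.

Lemma keep0E (f : S) : keep set0 f = (meval (fun=> 0) f)%:MP.
Proof.
apply: (mpoly_ext (g := @mpolyC _ kk \o meval (fun=> 0))) => [c|q] /=.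
  by rewrite keepC mevalC.
by rewrite keepX inE mevalXU mpolyC0.
Qed.

Lemma algindep0 : algindep set0.
Proof.
move=> f; rewrite keep0E; set c := meval _ f; have [->|c0] := eqVneq c 0.
  by rewrite mpolyC0.
move=> E; have := oner_neq0 K; rewrite -(rmorph1 ev) -mpolyC1 -(mulVf c0) mpolyCM rmorphM E mulr0.
by rewrite eqxx.
Qed.

Lemma max_algindep : exists2 J, algindep J & forall p, p \notin J -> ~ algindep (p |: J).
Proof.
have [J /maxsetP[/asboolP iJ mJ] _] :=
  @maxset_exists _ (fun J => `[< algindep J >]) set0 (asboolT algindep0).
exists J => // p pJ /asboolP h; have E := mJ _ h (subsetUr _ _).
by rewrite -E !inE eqxx in pJ.
Qed.

Section MaxIndep.
Variable J : {set V}.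
Hypotheses (iJ : algindep J) (mJ : forall p, p \notin J -> ~ algindep (p |: J)).

Lemma dependence p : p \notin J -> exists h : {poly S}, [/\ h != 0,
  forall a, keep J h`_a = h`_a & (map_poly ev h).[ev 'x_p] = 0].
Proof.
move=> pJ; have /existsNP[f /not_implyP[E f0]] := mJ pJ.
exists (tau p (keep (p |: J) f)); split.
- by apply: tau_neq0; apply/eqP.
- by move=> a; apply: tau_keep.
- by rewrite -ev_tau.
Qed.

Lemma keep_nonunit j (C U : S) : j \in J -> C != 0 -> (1 + 'x_j * C) * U <> 1.
Proof.
move=> jJ C0 E; have tC : tau j C != 0 by apply: tau_neq0.
have sX : (1 < size ('X * tau j C)%R)%N.
  by rewrite mulrC size_mulX // ltnS size_poly_gt0.
have Et : tau j (1 + 'x_j * C) = 'X * tau j C + 1.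
  by rewrite rmorphD rmorphM rmorph1 tau_x addrC.
have sP : size (tau j (1 + 'x_j * C)) = size ('X * tau j C).
  by rewrite Et size_polyDl // size_poly1.
apply: (@poly_nonunit _ (tau j (1 + 'x_j * C)) (tau j U)); first by rewrite sP.
by rewrite -rmorphM E rmorph1.
Qed.

(** If j is in [J], then K is integral over the polynomial ring on [J] with the product C of the
    leading coefficients inverted. The inverse of [1 + x_j C] in the field K satisfies a monic
    equation; clearing denominators, [1 + x_j C] divides a power of C. But it is coprime to C and
    not a unit. *)
Lemma max_algindep_empty : J = set0.
Proof.
apply/eqP/negPn/negP => /set0Pn[j jJ].
have [evJ evJE] : exists g : {rmorphism S -> K}, forall f, g f = ev (keep J f).
  by exists (ev \o keep J).
have H p : {h : {poly S} | p \notin J -> [/\ h != 0,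
  forall a, keep J h`_a = h`_a & (map_poly ev h).[ev 'x_p] = 0]}.
  apply: cid; have [pJ|pJ] := boolP (p \in J); first by exists 0.
  by have [h Hh] := dependence pJ; exists h.
pose c p : S := if p \in J then 1 else lead_coef (sval (H p)).
have cJ p : evJ (c p) != 0.
  rewrite /c; case: ifPn => pJ; first by rewrite rmorph1 oner_neq0.
  have [h0 hk _] := svalP (H p) pJ; apply/eqP; rewrite evJE => /iJ; rewrite lead_coefE hk -lead_coefE.
  by move/eqP; rewrite lead_coef_eq0 (negPf h0).
pose C := \prod_p c p.
have CJ : evJ C != 0.
  by rewrite /C rmorph_prod; apply: Kprod_neq0.
have [w Cw] := Kinv CJ.
(* The localization at C is represented by polynomials in one further variable, evaluated at the
   inverse [w] of C. *)
have [RtoK RE] : exists g : {rmorphism {poly S} -> K}, forall q, g q = (map_poly evJ q).[w].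
  by exists (horner_eval w \o map_poly evJ).
have RC f : RtoK f%:P = evJ f by rewrite RE map_polyC hornerC.
have RX : RtoK 'X = w by rewrite RE map_polyX hornerX.
have iy p : integralOver RtoK (ev 'x_p).
  have [pJ|pJ] := boolP (p \in J).
    have -> : ev 'x_p = RtoK ('x_p)%:P by rewrite RC evJE keepX pJ.
    exact: integral_id.
  have [h0 hk hr] := svalP (H p) pJ; set h := sval (H p) in h0 hk hr.
  pose rest := \prod_(q | q != p) c q.
  have CE : C = c p * rest by rewrite /C (bigD1 p).
  have cpE : evJ (c p) = ev (lead_coef h).
    by rewrite /c ifN // evJE lead_coefE hk.
  pose w' := RtoK ('X * rest%:P).
  have w'E : w' * ev (lead_coef h) = 1.
    by rewrite -cpE /w' rmorphM RX RC mulrAC -mulrA -rmorphM -CE mulrC.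
  have lh : ev (lead_coef h) != 0 by rewrite -cpE cJ.
  apply: (@integral_root_monic _ _ _ _ (w' *: map_poly ev h)).
  - have sh : size (w' *: map_poly ev h) = size h.
      apply/eqP; rewrite eqn_leq (leq_trans (size_scale_leq _ _)) ?size_poly //=.
      rewrite -[leqLHS](@prednK (size h)) ?size_poly_gt0 // ltnNge; apply/negP => le.
      have /eqP := nth_default 0 le.
      by rewrite coefZ coef_map -lead_coefE w'E oner_eq0.
    by rewrite monicE lead_coefE sh coefZ coef_map -lead_coefE w'E.
  - by rewrite /root hornerZ hr mulr0.
  - apply/integral_poly => a; rewrite coefZ coef_map -hk.
    have -> : w' * ev (keep J h`_a) = RtoK ('X * rest%:P * (h`_a)%:P) by rewrite rmorphM RC evJE.
    exact: integral_id.
have ia z : integralOver RtoK z.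
  have [f ->] := ev_surj z; rewrite [f]mpolyE rmorph_sum.
  apply: big_ind; [exact: integral0|exact: integral_add|move=> m _].
  rewrite -mul_mpolyC rmorphM; apply: integral_mul.
    have -> : ev (f@_m)%:MP = RtoK (f@_m)%:MP%:P by rewrite RC evJE keepC.
    exact: integral_id.
  rewrite mpolyXE_id rmorph_prod; apply: big_ind; [exact: integral1|exact: integral_mul|move=> i _].
  rewrite rmorphXn -[i]enum_valK; elim: (m _) => [|d IH]; first by rewrite expr0; exact: integral1.
  by rewrite exprS; apply: integral_mul.
pose C' := keep J C.
have C'0 : C' != 0 by apply: contraNneq CJ; rewrite evJE -/C' => ->; rewrite rmorph0.
pose P0 := 1 + 'x_j * C; pose P := keep J P0.
have PE : P = 1 + 'x_j * C' by rewrite /P /P0 rmorphD rmorphM rmorph1 keepX jJ.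
have PU U : P * U <> 1 by rewrite PE; apply: keep_nonunit.
have pp0 : evJ P0 != 0.
  apply/negP => /eqP; rewrite evJE => /iJ; rewrite -/P PE => E.
  have := congr1 (fun f : S => (tau j f).[0]) E.
  rewrite /= rmorphD rmorph1 rmorphM tau_x rmorph0 horner0 hornerD hornerM hornerX mul0r addr0 hornerC.
  by move/eqP; rewrite oner_eq0.
have [v Ev] := Kinv pp0.
have [q mq rq] := ia v.
pose d := (size q).-1.
have sq : size q = d.+1 by rewrite prednK // size_poly_gt0 monic_neq0.
pose s := \sum_(a < d) q`_a * P0%:P ^+ (d - a.+1).
(* The monic equation of the inverse [v], multiplied by the d-th power of [P0]. *)
have R0 : RtoK (1 + P0%:P * s) = 0.
  have : (map_poly RtoK q).[v] * RtoK (P0%:P) ^+ d = 0 by rewrite (eqP rq) mul0r.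
  have sm : size (map_poly RtoK q) = d.+1 by rewrite size_map_poly_id0 // (monicP mq) rmorph1 oner_neq0.
  rewrite horner_coef sm mulr_suml big_ord_recr /= coef_map /=.
  have Eq1 : RtoK q`_d = 1.
    have -> : q`_d = lead_coef q by rewrite lead_coefE sq.
    by rewrite (monicP mq) rmorph1.
  rewrite [X in _ + X * _ * _]Eq1 mul1r -exprMn RC [v * _]mulrC Ev expr1n => E.
  rewrite rmorphD rmorph1 -E addrC; congr (_ + _).
  rewrite /s rmorphM rmorph_sum mulr_sumr; apply: eq_bigr => a _.
  rewrite rmorphM rmorphXn RC coef_map.
  have -> : evJ P0 ^+ d = evJ P0 ^+ a * evJ P0 ^+ (d - a) by rewrite -exprD subnKC // ltnW.
  have -> : evJ P0 ^+ (d - a) = evJ P0 * evJ P0 ^+ (d - a.+1) by rewrite -exprS -subSn // subSS.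
  rewrite -mulrA [v ^+ a * _]mulrA -exprMn [v * _]mulrC Ev expr1n mul1r.
  by rewrite mulrCA.
pose D := size s.
have [t Et] : exists t, C' ^+ D + P * t = 0.
  exists (\sum_(a < D) keep J s`_a * C' ^+ (D - a)).
  have E : evJ C ^+ D * RtoK (1 + P0%:P * s) = evJ (C ^+ D + P0 * \sum_(a < D) s`_a * C ^+ (D - a)).
    rewrite [RtoK _]rmorphD rmorph1 [RtoK (_ * _)]rmorphM RC mulrDr mulr1.
    rewrite [RHS]rmorphD [evJ (C ^+ D)]rmorphXn; congr (_ + _).
    rewrite rmorphM mulrCA; congr (_ * _).
    rewrite RE horner_coef [RHS]rmorph_sum mulr_sumr.
    rewrite (big_ord_widen D (fun a => evJ C ^+ D * ((map_poly evJ s)`_a * w ^+ a))); last exact: size_poly.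
    rewrite big_mkcond; apply: eq_bigr => a _; rewrite coef_map /=.
    have Ew : evJ C ^+ D * (evJ s`_a * w ^+ a) = evJ (s`_a * C ^+ (D - a)).
      have {1}-> : D = ((D - a) + a)%N by rewrite subnK // ltnW.
      rewrite rmorphM rmorphXn exprD -mulrA [evJ C ^+ a * _]mulrCA -exprMn Cw expr1n mulr1.
      by rewrite mulrC.
    case: ifPn => [_|]; first exact: Ew.
    rewrite -leqNgt => le; have : (map_poly evJ s)`_a = 0 by apply: nth_default.
    by rewrite coef_map /= => E0; rewrite -Ew E0 mul0r mulr0.
  have := iJ; move=> /(_ (C ^+ D + P0 * \sum_(a < D) s`_a * C ^+ (D - a))).
  rewrite -evJE -E R0 mulr0 => /(_ erefl).
  rewrite rmorphD rmorphXn rmorphM rmorph_sum -/C' -/P => Ek.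
  rewrite -[RHS]Ek; congr (_ + _ * _).
  by apply: eq_bigr => a _; rewrite rmorphM rmorphXn.
(* Modulo P, the product [x_j C'] is -1 while a power of [C'] is 0; hence a sign is a multiple of P,
   and P would be a unit. *)
have [u Eu] : exists u, ('x_j * C') ^+ D = (-1) ^+ D + P * u.
  elim: D {Et} => [|e [u IH]]; first by exists 0; rewrite !expr0 mulr0 addr0.
  exists ((-1) ^+ e + ('x_j * C') * u); rewrite exprS IH PE exprS; ring.
have F : (-1) ^+ D = P * (- u - 'x_j ^+ D * t).
  have -> : (-1) ^+ D = ('x_j * C') ^+ D - P * u by rewrite Eu addrK.
  have -> : ('x_j * C') ^+ D = - ('x_j ^+ D * (P * t)).
    by rewrite exprMn -mulrN; congr (_ * _); apply/eqP; rewrite -addr_eq0 Et.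
  by rewrite mulrBr mulrN mulrCA addrC.
apply: (PU ((- u - 'x_j ^+ D * t) * (-1) ^+ D)).
by rewrite mulrA -F -exprMn mulrNN mulr1 expr1n.
Qed.

End MaxIndep.

Lemma zariski p : exists2 q : {poly kk}, q \is monic &
  ev (map_poly (@mpolyC _ kk) q).['x_p] = 0.
Proof.
have [J iJ mJ] := max_algindep; have E := max_algindep_empty iJ mJ.
rewrite {}E in iJ mJ; have [h [h0 hk hr]] := dependence mJ (negbT (in_set0 p)).
pose q : {poly kk} := map_poly (meval (fun=> 0)) h.
have qh : map_poly (@mpolyC _ kk) q = h.
  apply/polyP => a; rewrite coef_map coef_map /= -keep0E; exact: hk.
have q0 : q != 0 by apply: contraNneq h0 => E; rewrite -qh E rmorph0.
exists ((lead_coef q)^-1 *: q).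
  by rewrite monicE lead_coefZ mulVf // lead_coef_eq0.
rewrite linearZ /= hornerZ rmorphM qh.
by rewrite -horner_map hr mulr0.
Qed.

End Zariski.

Lemma mpoly_supp_span (kk : fieldType) (n : nat) (I : finType) (c : I -> {mpoly kk[n]})
    (G : finType) (mon : G -> 'X_{1..n}) :
  (#|G| < #|I|)%N -> exists2 a : I -> kk, (exists i, a i != 0) &
    forall g, (\sum_i a i *: c i)@_(mon g) = 0.
Proof.
move=> lt; pose Mx : 'M[kk]_(#|I|, #|G|) := \matrix_(i, g) (c (enum_val i))@_(mon (enum_val g)).
have : kermx Mx != 0.
  by rewrite -mxrank_eq0 mxrank_ker subn_eq0 -ltnNge (leq_ltn_trans (rank_leq_col _)).
case/matrix0Pn => i [j Kij]; exists (fun x => kermx Mx i (enum_rank x)).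
  by exists (enum_val j); rewrite enum_valK.
move=> g; have := congr1 (fun B : 'M_(_, _) => B i (enum_rank g)) (mulmx_ker Mx).
rewrite !mxE => <-; rewrite raddf_sum (reindex (@enum_val I I)) /=; last first.
  by apply: onW_bij; apply: enum_val_bij.
by apply: eq_bigr => l _; rewrite mcoeffZ enum_valK; congr (_ * _); rewrite mxE enum_rankK.
Qed.

(** * Cohen-Macaulayness and dimension of Stanley-Reisner rings *)

Section StanleyReisner.
Variables (kk : fieldType) (V : finType) (D : complex V).
Local Notation S := {mpoly kk[#|V|]}.
Local Notation A := (stanley_reisner kk D).
Local Notation X := (fun F => F \in faces D).

Lemma faces_down : down X.
Proof. by move=> F G; apply: faces_sub. Qed.

Lemma sr_monomialE (F : {set V}) :
  sr_monomial kk F = 'X_[\sum_(x in F) U_(enum_rank x)].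
Proof.
symmetry; apply: (big_morph (fun m : 'X_{1..#|V|} => 'X_[m] : S)); last exact: mpolyX0.
exact: mpolyXD.
Qed.

Lemma msup_sum (F : {set V}) : msup (\sum_(x in F) U_(enum_rank x))%MM = F.
Proof.
apply/setP => x; rewrite inE mnm_sumE; apply/idP/idP => [|xF]; last first.
  by rewrite (bigD1 x) //= mnm1E eqxx.
apply: contraNT => xF; apply/eqP; apply: big1 => y yF.
by rewrite mnm1E (inj_eq enum_rank_inj); case: eqP => // E; rewrite -E yF in xF.
Qed.

Lemma sr_idealE (f : S) : (f \in sr_ideal D) <-> SR X f.
Proof.
split=> [/asboolP[h ->] m mD|H].
  rewrite raddf_sum big1 // => F FD /=; rewrite mcoeffM big1 // => -[k1 k2] /= /eqP.
  move: (bmnm k1) (bmnm k2) => {}k1 {}k2 E; rewrite sr_monomialE mcoeffX.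
  case: eqP => [Ek|]; last by rewrite mulr0.
  have : F \in faces D by apply: faces_down mD; rewrite E -Ek msupD msup_sum subsetUr.
  by move: FD; rewrite inE => /negPf ->.
apply/asboolP.
exists (fun F => \sum_(m <- msupp f | msup m == F) f@_m *: 'X_[(m - \sum_(x in F) U_(enum_rank x))%MM]).
have E m : m \in msupp f -> f@_m *: 'X_[m] =
    f@_m *: 'X_[(m - \sum_(x in msup m) U_(enum_rank x))%MM] * sr_monomial kk (msup m) :> S.
  move=> mf; rewrite sr_monomialE -scalerAl -mpolyXD; congr (_ *: 'X_[_]).
  rewrite submK //; apply/mnm_lepP => i; rewrite mnm_sumE -[i]enum_valK.
  have [xm|xm] := boolP (enum_val i \in msup m).
    rewrite (bigD1 (enum_val i)) //= mnm1E eqxx big1 ?addn0.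
      by move: xm; rewrite inE lt0n.
    by move=> y /andP[_ yi]; rewrite mnm1E (inj_eq enum_rank_inj) (negPf yi).
  rewrite big1 // => y ym; rewrite mnm1E (inj_eq enum_rank_inj).
  by case: eqP => // E; rewrite -E ym in xm.
have nX m : m \in msupp f -> msup m \notin faces D.
  by move=> mf; apply/negP => /H E0; move: mf; rewrite mcoeff_msupp E0 eqxx.
rewrite {1}[f]mpolyE [RHS](eq_bigr (fun F => \sum_(m <- msupp f | msup m == F)
  f@_m *: 'X_[(m - \sum_(x in msup m) U_(enum_rank x))%MM] * sr_monomial kk (msup m))); last first.
  by move=> F _; rewrite mulr_suml; apply: eq_bigr => m /eqP <-.
rewrite [RHS](exchange_big_dep xpredT) //= big_seq [RHS]big_seq; apply: eq_bigr => m mf.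
rewrite (big_pred1 (msup m)) ?E // => F; rewrite /= inE eq_sym.
by case: eqP => [->|]; rewrite ?andbF // nX.
Qed.

Lemma srpi_spec : {g : {rmorphism S -> A} | forall f, g f = (\pi_A f)%qT}.
Proof. by exists (\pi_A)%qT. Qed.

Definition srpi : {rmorphism S -> A} := sval srpi_spec.

Lemma srpiE f : srpi f = (\pi_A f)%qT.
Proof. exact: (svalP srpi_spec). Qed.

Lemma srpi_eq0 f : srpi f = 0 <-> SR X f.
Proof.
rewrite -sr_idealE.
have E : (f - 0 \in sr_ideal D) = ((\pi_A f)%qT == (\pi_A 0)%qT) by rewrite Quotient.idealrBE.
rewrite subr0 -!srpiE rmorph0 in E; rewrite E.
by split=> [->|/eqP].
Qed.

Lemma srpi_surj a : exists f, a = srpi f.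
Proof. by exists (repr a); rewrite srpiE reprK. Qed.

Definition degle (d : nat) (f : S) : bool := (msize f <= d.+1)%N.

Lemma degleM a b f g : degle a f -> degle b g -> degle (a + b) (f * g).
Proof.
rewrite /degle => h1 h2.
have [->|f0] := eqVneq f 0; first by rewrite mul0r msize0.
have [->|g0] := eqVneq g 0; first by rewrite mulr0 msize0.
rewrite msizeM //; clear -h1 h2.
by apply: leq_trans (_ : ((a.+1 + b.+1).-1 <= _)%N); [rewrite -!subn1 leq_sub2r // leq_add|rewrite addSn addnS].
Qed.

Lemma degleX a f n : degle a f -> degle (a * n) (f ^+ n).
Proof.
move=> h; elim: n => [|n IH]; first by rewrite muln0 expr0 /degle msize1.
by rewrite exprS mulnS; apply: degleM.
Qed.

Lemma degle_prod (e : nat) (F : 'I_e -> S) b : (forall i, degle b (F i)) ->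
  degle (e * b) (\prod_(i < e) F i).
Proof.
elim: e F => [|e IH] F H; first by rewrite big_ord0 /degle msize1.
by rewrite big_ord_recl mulSn; apply: degleM => //; apply: IH.
Qed.

Section DimensionBound.
Variable r : nat.
Hypothesis Xr : forall F, F \in faces D -> (#|F| <= r)%N.

(** A monomial is determined by its support, which is a face, and by at most [r] exponents. *)
Lemma card_supported B : (#|{: {m : 'X_{1..#|V| < B.+1} | msup m \in faces D}}| <=
  #|{: {set V}}| * B.+1 ^ r)%N.
Proof.
pose G := {m : 'X_{1..#|V| < B.+1} | msup m \in faces D}.
pose vals (g : G) := [seq bmnm (val g) (enum_rank x) | x <- enum (msup (val g))].
pose h (g : G) := (msup (val g), [ffun i : 'I_r => inord (nth 0%N (vals g) i) : 'I_B.+1]).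
have bd (g : G) i : (bmnm (val g) i < B.+1)%N.
  have := bmdeg (val g); apply: leq_ltn_trans; rewrite mdegE (bigD1 i) //=; exact: leq_addr.
have ih : injective h.
  move=> g1 g2 [E1 /ffunP E2]; apply: val_inj; apply: val_inj; apply/mnmP => i.
  rewrite -[i]enum_valK; set x := enum_val i.
  have [xm|xm] := boolP (x \in msup (val g1)); last first.
    have := xm; rewrite E1; move: xm; rewrite !inE !negbK => /eqP e1 /eqP e2.
    by rewrite -[LHS]/(bmnm (val g1) _) e1 -[RHS]/(bmnm (val g2) _) e2.
  have lx : (index x (enum (msup (val g1))) < size (enum (msup (val g1))))%N by rewrite index_mem mem_enum.
  have lr : (index x (enum (msup (val g1))) < r)%N.
    by apply: leq_trans lx _; rewrite -cardE; apply: Xr; apply: (valP g1).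
  have := E2 (Ordinal lr); rewrite !ffunE => /(congr1 val) /=.
  rewrite !inordK ?(nth_map x) //; last first.
  - by rewrite -E1.
  - by rewrite -E1.
  by rewrite -E1 nth_index ?mem_enum.
by have := leq_card h ih; rewrite card_prod card_ffun !card_ord.
Qed.

(** A chain of length e gives e elements whose monomials are linearly independent modulo the bottom
    prime. With exponents up to t there are (t + 1)^e of them, of degree at most e c t, while only
    O(t^r) monomials of that degree are supported on faces. *)
Lemma chain_bound (I : A -> Prop) e : prime_chain I e -> (e <= r)%N.
Proof.
case=> P [Pp Pinc _]; rewrite leqNgt; apply/negP => re.
have Hx i : {f : S | (i < e)%N -> P i.+1 (srpi f) /\ ~ P i (srpi f)}.
  apply: cid; case: (ltnP i e) => [lt|]; last by exists 0.
  by have [_ [y Hy]] := Pinc i lt; have [f E] := srpi_surj y; exists f; rewrite -E.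
pose f i := sval (Hx i); pose c := (\sum_(i < e) msize (f i))%N.
have fc (i : 'I_e) : degle c (f i).
  by rewrite /degle ltnW // ltnS /c (bigD1 i) //= leq_addr.
have key t : (t.+1 ^ e <= #|{: {set V}}| * (e * (c * t)).+1 ^ r)%N.
  set B := (e * (c * t))%N; rewrite leqNgt; apply/negP => lt.
  pose T := {ffun 'I_e -> 'I_t.+1}; pose m (a : T) i := oapp (fun o => nat_of_ord (a o)) 0%N (insub i : option 'I_e).
  have mE (a : T) (i : 'I_e) : m a i = a i by rewrite /m valK.
  pose C (a : T) : S := \prod_(i < e) f i ^+ m a i.
  have cT : #|{: T}| = (t.+1 ^ e)%N by rewrite card_ffun !card_ord.
  have lt2 : (#|{: {m : 'X_{1..#|V| < B.+1} | msup m \in faces D}}| < #|{: T}|)%N.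
    by rewrite cT; apply: leq_ltn_trans (card_supported B) lt.
  have [a [b ab] a0] := mpoly_supp_span C
    (fun g : {m : 'X_{1..#|V| < B.+1} | msup m \in faces D} => bmnm (val g)) lt2.
  have dC x : degle B (C x).
    by apply: degle_prod => i; rewrite mE; apply: (leq_trans (degleX _ (fc i)));
      rewrite ltnS leq_mul2l -ltnS ltn_ord orbT.
  have z : SR X (\sum_x a x *: C x).
    move=> m' Xm; case: (ltnP (mdeg m') B.+1) => dm.
      exact: (a0 (exist _ (BMultinom dm) Xm)).
    rewrite raddf_sum big1 // => x _ /=; rewrite mcoeffZ memN_msupp_eq0 ?mulr0 //.
    by apply: msize_mdeg_ge; apply: leq_trans (dC x) dm.
  have := @chain_monomials A kk (srpi \o @mpolyC _ kk) e P (fun i => srpi (f i)) T a m.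
  move=> H; move/eqP: ab; apply; apply: H.
  - exact: Pp.
  - by move=> i lt'; case: (Pinc i lt').
  - by move=> i lt'; apply: (svalP (Hx i)).
  - move=> x y _ _ E; apply/ffunP => i; apply: val_inj; rewrite /= -!mE; exact: E.
  - have [iP _ _] := Pp 0%N isT.
    have -> : \sum_x (srpi \o @mpolyC _ kk) (a x) * \prod_(i < e) srpi (f i) ^+ m x i =
        srpi (\sum_x a x *: C x).
      rewrite rmorph_sum; apply: eq_bigr => x _; rewrite -mul_mpolyC rmorphM; congr (_ * _).
      by rewrite rmorph_prod; apply: eq_bigr => i _; rewrite rmorphXn.
    by have /srpi_eq0 -> := z; apply: ideal0.
(* The choice t = Z absorbs the constants: [key] becomes (Z + 1)^e <= Z (Z + 1)^r < (Z + 1)^(r +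
   1). *)
pose Z := (#|{: {set V}}| * (e * c).+1 ^ r)%N.
have := key Z; apply/negP; rewrite -ltnNge.
apply: (@leq_ltn_trans (Z * Z.+1 ^ r)).
  rewrite /Z -mulnA leq_mul2l -expnMn; apply/orP; right.
  have [->|r0] := posnP r; first by rewrite !expn0.
  rewrite leq_exp2r //.
  by rewrite mulSn mulnS mulnA; move: (e * c)%N (_ * _ ^ r)%N => x y; lia.
apply: (@leq_trans (Z.+1 ^ r.+1)); last by rewrite leq_pexp2l.
by rewrite expnS ltn_mul2r ltnSn expn_gt0.
Qed.

End DimensionBound.

Section WeaklyRegularQuotient.
Variable zs : seq S.
Hypothesis wzs : wreg (SR X) zs.

Lemma wreg_image (J : A -> Prop) (ys : seq S) :
  wreg (fun f => J (srpi f)) ys -> wreg J [seq srpi y | y <- ys].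
Proof.
elim: ys J => //= y ys IH J [n w]; split.
  by move=> a; have [f ->] := srpi_surj a; rewrite -rmorphM => /n.
apply: IH; apply: wreg_ext w => f; split.
  by move=> [a [c [Ja ->]]]; exists (srpi a), (srpi c); rewrite rmorphD rmorphM.
move=> [a [c [Ja E]]]; have [c' Ec] := srpi_surj c.
exists (f - y * c'), c'; split; last by rewrite subrK.
by rewrite rmorphB rmorphM -Ec E addrK.
Qed.

(** Unfolds nested uses of [adj] into ideals generated by initial segments, the form in which
    [regular_sequence] is stated. *)
Lemma wreg_generated (J : A -> Prop) (ys : seq A) : ideal J -> wreg J ys ->
  forall i x, (i < size ys)%N ->
  (exists2 a, J a & generated (take i ys) (ys`_i * x - a)) ->
  exists2 a, J a & generated (take i ys) (x - a).
Proof.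
have gen0 b : generated [::] b <-> b = 0 :> A.
  split=> [[c ->]|->]; first by rewrite big_ord0.
  by exists (fun=> 0); rewrite big_ord0.
have genS z (s : seq A) b : generated (z :: s) b <-> exists c, generated s (b - z * c).
  split=> [[c ->]|[c [d E]]].
    exists (c 0%N), (fun i => c i.+1); rewrite big_ord_recl /= [c 0%N * z]mulrC addrAC subrr add0r.
    by apply: eq_bigr.
  exists (fun i => if i is i'.+1 then d i' else c); rewrite big_ord_recl /= -[LHS](subrK (z * c)) E.
  by rewrite addrC mulrC; congr (_ + _); apply: eq_bigr.
elim: ys J => //= z ys IH J iJ [n w] [|i] x /= lti [a Ja].
  move/gen0/eqP; rewrite subr_eq0 => /eqP E; exists x; last by apply/gen0; rewrite subrr.
  by apply: n; rewrite E.
move/genS => [c g]; have [|b [d [e [Jd Eb]]] gb] := IH _ (adj_ideal z iJ) w i x lti.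
  by exists (a + z * c); [exists a, c|rewrite opprD addrA].
exists d => //; apply/genS; exists e; by rewrite -addrA -opprD -Eb.
Qed.

Lemma wreg_regular_sequence (I : A -> Prop) : prime_ideal I ->
  (forall z, z \in zs -> I (srpi z)) -> regular_sequence [seq srpi z | z <- zs].
Proof.
move=> [iI nI1 _] H.
have Hm z : z \in [seq srpi z | z <- zs] -> I z by move=> /mapP[f fz ->]; apply: H.
split; first by move/(generated_sub iI Hm)/nI1.
move=> i x lti g.
have w0 : wreg (fun a : A => a = 0) [seq srpi z | z <- zs].
  by apply: wreg_image; apply: wreg_ext wzs => f; rewrite srpi_eq0.
have i0 : ideal (fun a : A => a = 0).
  by split=> // [a b -> ->|a b ->]; rewrite ?addr0 ?mulr0.
have [|a -> //] := wreg_generated i0 w0 lti (x := x); last by rewrite subr0.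
by exists 0 => //; rewrite subr0.
Qed.

End WeaklyRegularQuotient.

Section Residue.
Variable mx : A -> Prop.
Hypothesis mmx : maximal_ideal mx.

Definition mxpred : {pred A} := fun x => `[< mx x >].

Lemma mxpredP : idealr_closed mxpred.
Proof.
case: mmx => -[m0 mD mM] m1 _; split.
- exact/asboolP.
- by apply/negP => /asboolP.
- by move=> a x y /asboolP mx_x /asboolP mx_y; apply/asboolP; apply: mD => //; apply: mM.
Qed.

HB.instance Definition _ := isIdealr.Build A mxpred mxpredP.

Local Notation K := ({ideal_quot mxpred} : comNzRingType).

Lemma res_spec : {g : {rmorphism A -> K} | forall a, g a = (\pi_K a)%qT}.
Proof. by exists (\pi_K)%qT. Qed.

Definition res : {rmorphism A -> K} := sval res_spec.

Lemma resE a : res a = (\pi_K a)%qT.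
Proof. exact: (svalP res_spec). Qed.

Lemma res_eq0 a : res a = 0 <-> mx a.
Proof.
have E : (a - 0 \in mxpred) = ((\pi_K a)%qT == (\pi_K 0)%qT) by rewrite Quotient.idealrBE.
have -> : mx a <-> a \in mxpred by split=> [h|/asboolP//]; apply/asboolP.
rewrite subr0 -!resE rmorph0 in E; rewrite E.
by split=> [->|/eqP].
Qed.

Lemma res_surj (z : K) : exists a, z = res a.
Proof. by exists (repr z); rewrite resE reprK. Qed.

Lemma res_inv (z : K) : z != 0 -> exists y, z * y = 1.
Proof.
have [a ->] := res_surj z; move=> /eqP na; case: mmx => iM nM1 mM.
have [|[a1 [c [ma E]]]|h] := mM (adj mx a) (adj_ideal a iM).
- by move=> x; apply: adjW.
- exists (res c); have := congr1 res E.
  by rewrite rmorph1 rmorphD rmorphM (res_eq0 a1).2 // add0r => <-.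
- by case: na; apply/res_eq0; apply: h; apply: adj_self.
Qed.

Lemma maximal_prime : prime_ideal mx.
Proof.
case: mmx => iM nM1 mM; split=> // x y /res_eq0; rewrite rmorphM => /(Kdom res_inv).
by case=> /res_eq0; [left|right].
Qed.

(* The same polynomial [g] is used for all the variables. *)
Lemma common_polynomial : exists g : {poly kk}, [/\ g \is monic, (1 < size g)%N, g`_0 = 0
  & forall p, mx (srpi (uvar g p))].
Proof.
pose ev : {rmorphism S -> K} := res \o srpi.
have ev_surj z : exists f, z = ev f.
  by have [a ->] := res_surj z; have [f ->] := srpi_surj a; exists f.
have H p : {q : {poly kk} | q \is monic /\ ev (map_poly (@mpolyC _ kk) q).['X_(enum_rank p)] = 0}.
  by apply: cid; have [q mq Eq] := zariski ev_surj res_inv p; exists q.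
pose G := \prod_p sval (H p).
have mG : G \is monic by apply: monic_prod => p _; case: (svalP (H p)).
(* [G] multiplies monic equations of all the coordinates in the residue field; the factor ['X]
   provides the zero constant term and a positive degree. *)
exists ('X * G); split.
- by rewrite monicMl ?monicX.
- by rewrite mulrC size_mulX ?monic_neq0 // ltnS size_poly_gt0 monic_neq0.
- by rewrite mulrC coefMX.
- move=> p; apply/res_eq0; rewrite /uvar /G (bigD1 p) //= mulrCA rmorphM hornerM.
  case: (svalP (H p)) => _; rewrite /ev /= => E.
  by rewrite !rmorphM E mul0r.
Qed.

End Residue.

Lemma uvarX (p : V) : uvar ('X : {poly kk}) p = 'X_(enum_rank p) :> S.
Proof. by rewrite /uvar map_polyX hornerX. Qed.

Lemma hsym_mem (B : comNzRingType) (J : B -> Prop) (l : seq B) d : ideal J ->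
  (forall x, x \in l -> J x) -> J (hsym l d.+1).
Proof.
move=> iJ; elim: l => [|x l IH] H; first exact: ideal0.
rewrite hsym_cons; apply: (idealD iJ).
  by apply: IH => y yl; apply: H; rewrite inE yl orbT.
by apply: (idealMr _ iJ); apply: H; rewrite inE eqxx.
Qed.

Lemma hseq_mem (J : A -> Prop) g r z : ideal J -> (forall p, J (srpi (uvar g p))) ->
  z \in hseq V g r -> J (srpi z).
Proof.
move=> iJ H /mapP[[|i]]; rewrite mem_iota // => _ ->; rewrite hsym_rmorph.
by apply: hsym_mem => // x /mapP[y /mapP[p _ ->] ->].
Qed.

(** The adapted sequence lies in the maximal ideal, so depth and height are at least [r]. Since
    regular sequences yield prime chains, [chain_bound] bounds both from above. *)
Theorem cohen_macaulay_wreg r : (forall F, F \in faces D -> (#|F| <= r)%N) ->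
  (forall g : {poly kk}, g \is monic -> (1 < size g)%N -> g`_0 = 0 -> wreg (SR X) (hseq V g r)) ->
  cohen_macaulay A.
Proof.
move=> Xr W mx mmx; have pm := maximal_prime mmx; have [iM _ _] := pm.
have [g [mg sg g0 Hg]] := common_polynomial mmx.
have rs := wreg_regular_sequence (W g mg sg g0) pm (fun z => @hseq_mem mx g r z iM Hg).
have sz : size [seq srpi z | z <- hseq V g r] = r by rewrite !size_map size_iota.
have mem z : z \in [seq srpi z | z <- hseq V g r] -> mx z.
  by move=> /mapP[f fz ->]; apply: hseq_mem fz.
exists r; split; split.
- by have := regular_chain pm rs mem; rewrite sz.
- by move=> e; apply: chain_bound.
- by exists [seq srpi z | z <- hseq V g r].
- by move=> e [s [<- rs' mem']]; have := regular_chain pm rs' mem'; apply: chain_bound.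
Qed.

(** At the ideal of the origin the sequence produces a prime chain of length [r]; applying
    [chain_bound] with the largest face size as the bound shows that this size is at least [r]. *)
Theorem cdim_wreg r : (forall F, F \in faces D -> (#|F| <= r)%N) ->
  wreg (SR X) (hseq V ('X : {poly kk}) r) -> cdim D = r%:Z - 1.
Proof.
move=> Xr W; rewrite /cdim; congr (_%:Z - 1); apply/eqP; rewrite eqn_leq.
apply/andP; split; first by apply/bigmax_leqP.
pose mx : A -> Prop := fun a => exists f, a = srpi f /\ f@_0 = 0.
have mxE f : mx (srpi f) <-> f@_0 = 0.
  split=> [[f' [E f0]]|]; last by exists f.
  have : SR X (f - f') by apply/srpi_eq0; rewrite rmorphB E subrr.
  move/(_ 0%MM); rewrite mcoeffB f0 subr0; apply.
  have -> : msup (0%MM : 'X_{1..#|V|}) = set0 by apply/setP => x; rewrite !inE mnm0E eqxx.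
  exact: faces0.
have pm : prime_ideal mx.
  have c0 (p q : S) : (p * q)@_0 = p@_0 * q@_0.
    exact: (rmorphM (mcoeff 0%MM : {rmorphism S -> kk})).
  split.
  - split.
    + by exists 0; rewrite rmorph0 mcoeff0.
    + by move=> x y [f [-> f0]] [h [-> h0]]; rewrite -rmorphD; apply/mxE; rewrite mcoeffD f0 h0 addr0.
    + move=> a x [f [-> f0]]; have [h ->] := srpi_surj a.
      by rewrite -rmorphM; apply/mxE; rewrite c0 f0 mulr0.
  - by rewrite -(rmorph1 srpi) => /mxE; rewrite mcoeff1 eqxx => /eqP; rewrite oner_eq0.
  - move=> x y; have [f ->] := srpi_surj x; have [h ->] := srpi_surj y.
    rewrite -rmorphM => /mxE; rewrite c0 => /eqP; rewrite mulf_eq0.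
    by case/orP => /eqP/mxE; [left|right].
have Hg p : mx (srpi (uvar ('X : {poly kk}) p)).
  by apply/mxE; rewrite uvarX mcoeffX mnm1_eq0.
have [iM _ _] := pm.
have rs := wreg_regular_sequence W pm (fun z => @hseq_mem mx 'X r z iM Hg).
have := regular_chain pm rs _; rewrite !size_map size_iota => H.
have {}H : prime_chain mx r.
  by apply: H => z /mapP[f fz ->]; apply: (hseq_mem iM Hg fz).
apply: (chain_bound _ H) => F FD.
by rewrite (bigD1 F) //= leq_maxl.
Qed.

End StanleyReisner.

(** * Euler characteristic of polyhedra *)

Section EulerMeasure.
Variables (R : realFieldType) (B : finType) (Z : zmodType).
Implicit Types (x y : nat -> R).

(** The closed intervals, possibly empty or unbounded. Nonempty ones are given Euler characteristic
    1, half-lines and the line included. *)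
Definition tame (I : R -> Prop) : Prop :=
  [/\ forall s t u, I s -> I u -> s <= t <= u -> I t,
      forall h, ~ I h -> exists2 e, 0 < e & forall d, 0 < d <= e -> ~ I (h + d)
    & forall t, I t -> (forall u, t <= u -> I u) \/ exists2 h, I h & forall u, I u -> u <= h].

Lemma common_bound (P : B -> R -> Prop) :
  (forall b, exists2 e, 0 < e & forall d, 0 < d <= e -> P b d) ->
  exists2 e, 0 < e & forall b, P b e.
Proof.
move=> H; have /fin_all_exists2[e e0 He] : forall b, exists2 e, 0 < e & forall d, 0 < d <= e -> P b d by [].
have [d d0 dH] : exists2 d, 0 < d & forall b, d <= e b.
  by have [d d0 dH] := min_pos e; exists d => // b; apply: dH.
by exists d => // b; apply: He; rewrite d0 dH.
Qed.

(* With h running over the right endpoints, 1_I(h) - 1_I(h + e) counts the right endpoint of a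
   bounded interval I once; a large T0 accounts for the unbounded ones. *)
Lemma tame_sum (a : B -> Z) (I : B -> R -> Prop) : (forall b, tame (I b)) ->
  (forall t, \sum_b a b *+ `[< I b t >] = 0) -> \sum_b a b *+ `[< exists t, I b t >] = 0.
Proof.
move=> tI S0.
have /fin_all_exists[h Hh] b : exists h : R, (exists t, I b t) ->
    (forall u, h <= u -> I b u) \/ (I b h /\ forall u, I b u -> u <= h).
  case: (pselect (exists t, I b t)) => [[t It]|N]; last by exists 0 => /N.
  have [_ _ /(_ t It)[U|[h Ih hm]]] := tI b; first by exists t => _; left.
  by exists h => _; right.
pose Hs : seq R := undup [seq h b | b <- enum B].
have hH b : h b \in Hs by rewrite mem_undup map_f // mem_enum.
have [T0 HT] : exists T0 : R, forall b, h b < T0.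
  exists (1 + \sum_b `|h b|) => b; rewrite (bigD1 b) //=.
  have := ler_norm (h b).
  have : 0 <= \sum_(i | i != b) `|h i| by apply: sumr_ge0.
  lra.
have [e e0 He] : exists2 e, 0 < e & forall b (i : seq_sub Hs), let g := ssval i in
    (I b g -> (exists u, I b u /\ g < u) -> I b (g + e)) /\ (~ I b g -> ~ I b (g + e)).
  have [b|e e0 He] := @common_bound (fun b e => forall i : seq_sub Hs, let g := ssval i in
    (I b g -> (exists u, I b u /\ g < u) -> I b (g + e)) /\ (~ I b g -> ~ I b (g + e))); last by exists e.
  have [cv cl _] := tI b.
  suff : forall s : seq R, exists2 e, 0 < e & forall d, 0 < d <= e -> forall g, g \in s ->
     (I b g -> (exists u, I b u /\ g < u) -> I b (g + d)) /\ (~ I b g -> ~ I b (g + d)).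
    move=> /(_ Hs)[e e0 He]; exists e => // d dd i; exact: (He d dd _ (ssvalP i)).
  elim=> [|g s [e e0 IH]]; first by exists 1 => //.
  have [e1 e10 He1] : exists2 e1, 0 < e1 & forall d, 0 < d <= e1 ->
     (I b g -> (exists u, I b u /\ g < u) -> I b (g + d)) /\ (~ I b g -> ~ I b (g + d)).
    case: (pselect (I b g)) => Ig; last first.
      by have [e1 e10 H1] := cl _ Ig; exists e1 => // d /H1.
    case: (pselect (exists u, I b u /\ g < u)) => [[u [Iu gu]]|N]; last by exists 1.
    exists (u - g); first by rewrite subr_gt0.
    move=> d /andP[d0 du]; split=> // _ _; apply: (cv g _ u) => //; lra.
  exists (Num.min e e1); first by rewrite lt_min e0 e10.
  move=> d /andP[d0]; rewrite le_min => /andP[de de1] g'; rewrite inE => /orP[/eqP ->|gs].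
    by apply: He1; rewrite d0.
  by apply: IH => //; rewrite d0.
have key b : a b *+ `[< exists t, I b t >] = a b *+ `[< I b T0 >] +
    \sum_(g <- Hs) (a b *+ `[< I b g >] - a b *+ `[< I b (g + e) >]).
  have [cv _ _] := tI b.
  have Hg g : g \in Hs -> (I b g -> (exists u, I b u /\ g < u) -> I b (g + e)) /\ (~ I b g -> ~ I b (g + e)).
    by move=> gH; have := He b (SeqSub gH).
  have same g : (I b g <-> I b (g + e)) -> a b *+ `[< I b g >] - a b *+ `[< I b (g + e) >] = 0.
    by move=> E; rewrite (asbool_equiv_eq E) subrr.
  have Te g : I b (g + e) -> g \in Hs -> I b g.
    by move=> Ig gH; apply: contrapT => N; case: (Hg g gH) => _ /(_ N).
  case: (pselect (exists t, I b t)) => [ex|N]; last first.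
    rewrite asboolF // asboolF ?add0r; last by move=> It; apply: N; exists T0.
    by rewrite big1 ?addr0 // => g _; apply: same; split=> Ig; case: N; eexists; exact: Ig.
  rewrite (asboolT ex); have [U|[Ih hm]] := Hh b ex.
    have IT : I b T0 by apply/U/ltW.
    rewrite (asboolT IT) big1_seq ?addr0 // => g /andP[_ gH]; apply: same; split=> [Ig|/Te]; last exact.
    case: (Hg g gH) => + _; apply=> //; exists (Num.max (g + 1) (h b)); split.
      by apply: U; rewrite le_max lexx orbT.
    by rewrite lt_max ltrDl ltr01.
  have NT : ~ I b T0 by move=> /hm; rewrite leNgt HT.
  rewrite (asboolF NT) add0r (bigD1_seq (h b)) ?undup_uniq ?hH //= (asboolT Ih) asboolF; last first.
    by move=> /hm; rewrite gerDl leNgt e0.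
  rewrite subr0 big1_seq ?addr0 // => g /andP[gh gH]; apply: same; split=> [Ig|/Te]; last exact.
  case: (Hg g gH) => + _; apply=> //; exists (h b); split=> //.
  by rewrite lt_neqAle gh hm.
under eq_bigr => b _ do rewrite key.
rewrite big_split /= S0 add0r exchange_big /= big1 // => g _.
by rewrite sumrB !S0 subrr.
Qed.

Fixpoint good m (X : (nat -> R) -> Prop) : Prop :=
  if m is m'.+1 then
    (forall x, tame (fun t => X (upd x m' t))) /\ good m' (fun x => exists t, X (upd x m' t))
  else forall x y, X x -> X y.

Lemma upd_id x m : upd x m (x m) = x.
Proof. by apply: funext => i; rewrite /upd; case: eqP => // ->. Qed.

(** Integration over one coordinate at a time: [tame_sum] carries a relation between indicator
    functions to their projections, down to dimension 0. *)
Lemma euler_good m (a : B -> Z) (X : B -> (nat -> R) -> Prop) : (forall b, good m (X b)) ->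
  (forall x, \sum_b a b *+ `[< X b x >] = 0) -> \sum_b a b *+ `[< exists x, X b x >] = 0.
Proof.
elim: m X => [|m IH] X gX S0.
  rewrite -[RHS](S0 (fun=> 0)); apply: eq_bigr => b _; congr (_ *+ nat_of_bool _).
  by apply: asbool_equiv_eq; split=> [[x]|]; [apply: gX|exists (fun=> 0)].
rewrite -[RHS](IH (fun b x => exists t, X b (upd x m t))).
- apply: eq_bigr => b _; congr (_ *+ nat_of_bool _); apply: asbool_equiv_eq.
  split=> [[x Xx]|[x [t Xt]]]; last by eexists; exact: Xt.
  by exists x, (x m); rewrite upd_id.
- by move=> b; case: (gX b).
- by move=> x; apply: tame_sum => // b; case: (gX b).
Qed.

Definition upoly m (X : (nat -> R) -> Prop) : Prop :=
  exists L : seq (seq ((nat -> R) * R)), forall x, X x <-> has (fun C => sat m C x) L.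

Lemma upoly_proj m X : upoly m.+1 X -> upoly m (fun x => exists t, X (upd x m t)).
Proof.
move=> [L HL]; exists [seq elim m C | C <- L] => x; rewrite has_map; split.
  move=> [t /HL/hasP[C CL s]]; apply/hasP; exists C => //=.
  by apply/sat_elim; exists t.
by move=> /hasP[C CL /sat_elim[t s]]; exists t; apply/HL/hasP; exists C.
Qed.

Lemma sat_fibre_convex m C x s t u : sat m.+1 C (upd x m s) -> sat m.+1 C (upd x m u) ->
  s <= t <= u -> sat m.+1 C (upd x m t).
Proof.
move=> /allP Cs /allP Cu /andP[st tu]; apply/allP => c cC.
have := Cs c cC; have := Cu c cC; rewrite /holds !lform_upd.
have [cm|cm] := leP 0 (c.1 m) => [_ H|H _]; apply: (le_trans H); rewrite lerD2l.
  by rewrite ler_wpM2l.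
by rewrite ler_wnM2l // ltW.
Qed.

(** Violated weak inequalities stay violated a little to the right, and a fibre bounded above has a
    largest point among those of finitely many polyhedra. Interval fibres are the one property that
    a union of polyhedra may lack. *)
Lemma upoly_tame m X : upoly m.+1 X ->
  (forall x s t u, X (upd x m s) -> X (upd x m u) -> s <= t <= u -> X (upd x m t)) ->
  forall x, tame (fun t => X (upd x m t)).
Proof.
move=> [L HL] cv x; split=> [s t u|h Nh|t Xt]; first exact: cv.
  have {Nh} : ~~ has (fun C => sat m.+1 C (upd x m h)) L by apply/negP => /HL.
  suff H : ~~ has (fun C => sat m.+1 C (upd x m h)) L -> exists2 e, 0 < e & forall d, 0 < d <= e ->
      ~~ has (fun C => sat m.+1 C (upd x m (h + d))) L.
    by move=> /H[e e0 He]; exists e => // d /He/negP N /HL.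
  elim: L {HL cv} => [|C L IH] /=; first by exists 1.
  rewrite negb_or => /andP[NC /IH[e e0 He]].
  move: NC; rewrite -has_predC => /hasP[c cC /=]; rewrite /holds lform_upd -ltNge => lt.
  pose e1 := (c.2 - (lform m c.1 x + c.1 m * h)) / (1 + `|c.1 m|).
  have n0 : 0 < 1 + `|c.1 m| by have := normr_ge0 (c.1 m); lra.
  have e10 : 0 < e1 by rewrite divr_gt0 // subr_gt0.
  exists (Num.min e e1); first by rewrite lt_min e0 e10.
  move=> d /andP[d0]; rewrite le_min => /andP[de de1]; rewrite negb_or He ?d0 // andbT.
  rewrite -has_predC; apply/hasP; exists c => //=; rewrite /holds lform_upd -ltNge.
  have : d * (1 + `|c.1 m|) <= c.2 - (lform m c.1 x + c.1 m * h) by rewrite -ler_pdivlMr.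
  have : c.1 m * d <= `|c.1 m| * d by rewrite ler_wpM2r ?ler_norm // ltW.
  by rewrite mulrDr mulrDr mulr1 [d * _]mulrC; move: (c.1 m * d) (`|_| * d) => A D; lra.
have one (C : seq ((nat -> R) * R)) s : sat m.+1 C (upd x m s) ->
   (forall u, s <= u -> sat m.+1 C (upd x m u)) \/
   (exists2 h, s <= h & sat m.+1 C (upd x m h) /\ forall u, sat m.+1 C (upd x m u) -> u <= h).
  elim: C => [|c C IH]; first by left.
  move=> /= /andP[hc Cs]; move: (IH Cs) => {}IH.
  have [cm|cm] := leP 0 (c.1 m).
    have up u : s <= u -> holds m.+1 (upd x m u) c.
      move: hc; rewrite /holds !lform_upd => hc su; apply: (le_trans hc).
      by rewrite lerD2l ler_wpM2l.
    case: IH => [H|[h sh [hh Hh]]]; first by left=> u su; rewrite up ?H.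
    by right; exists h => //; split; [rewrite up ?hh|move=> u /andP[_ /Hh]].
  pose b := (c.2 - lform m c.1 x) / c.1 m.
  have hb u : holds m.+1 (upd x m u) c = (u <= b).
    by rewrite /holds lform_upd -lerBlDl ler_ndivlMr // mulrC.
  rewrite hb in hc.
  case: IH => [H|[h sh [hh Hh]]].
    by right; exists b => //; split; [rewrite hb lexx H|move=> u; rewrite hb => /andP[]].
  case: (leP h b) => hb'.
    by right; exists h => //; split; [rewrite hb hb' hh|move=> u /andP[_ /Hh]].
  right; exists b => //; split; last by move=> u; rewrite hb => /andP[].
  by rewrite hb lexx /=; apply: (sat_fibre_convex Cs hh); rewrite hc ltW.
have [[C CL Cs] bd] : (exists2 C, C \in L & sat m.+1 C (upd x m t)) /\ True.
  by split=> //; move/HL: Xt => /hasP[C]; exists C.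
pose E C s := forall u, s <= u -> sat m.+1 C (upd x m u).
case: (pselect (exists C s, C \in L /\ E C s /\ X (upd x m s))) => [[C' [s [C'L [EC Xs]]]]|N].
  left=> u tu; apply: (cv x t u (Num.max u s)) => //; last by rewrite tu le_max lexx.
  by apply/HL/hasP; exists C' => //; apply: EC; rewrite le_max lexx orbT.
right.
have [z [Xz Hz]] : exists z, X (upd x m z) /\ forall C' u, C' \in L -> sat m.+1 C' (upd x m u) -> u <= z.
  have sub : {subset L <= L} by [].
  elim: {1 3}L sub => [|C' L' IH] sub; first by exists t.
  have [|z [Xz Hz]] := IH; first by move=> D DL; apply: sub; rewrite inE DL orbT.
  have C'L : C' \in L by apply: sub; rewrite inE eqxx.
  case: (pselect (exists s, sat m.+1 C' (upd x m s))) => [[s ss]|N']; last first.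
    exists z; split=> // D u; rewrite inE => /orP[/eqP -> su|]; last exact: Hz.
    by case: N'; exists u.
  have Xs : X (upd x m s) by apply/HL/hasP; exists C'.
  case: (one C' s ss) => [EC|[h sh [hh Hh]]]; first by case: N; exists C', s.
  exists (Num.max z h); split.
    by rewrite /Num.max; case: ifP => _ //; apply/HL/hasP; exists C'.
  move=> D u; rewrite inE le_max => /orP[/eqP -> /Hh ->|DL /(Hz _ _ DL) ->//]; exact: orbT.
exists z => // u /HL/hasP[C' C'L]; exact: Hz.
Qed.

Lemma upoly_sat m C : upoly m (fun x => sat m C x).
Proof. by exists [:: C] => x; rewrite /= orbF. Qed.

Lemma upoly0 (X : (nat -> R) -> Prop) : upoly 0 X -> forall x y, X x -> X y.
Proof.
move=> [L HL] x y /HL h; apply/HL; move: h; congr (is_true _); apply: eq_has => C.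
exact: eq_sat.
Qed.

(* hereditary fibre convexity is all that is needed besides polyhedrality *)
Fixpoint fibre_convex m (X : (nat -> R) -> Prop) : Prop :=
  if m is m'.+1 then
    (forall x s t u, X (upd x m' s) -> X (upd x m' u) -> s <= t <= u -> X (upd x m' t))
    /\ fibre_convex m' (fun x => exists t, X (upd x m' t))
  else True.

Lemma upoly_good m X : upoly m X -> fibre_convex m X -> good m X.
Proof.
elim: m X => [|m IH] X uX; first by move=> _; apply: upoly0.
by move=> [cX pX]; split; [apply: upoly_tame|apply: IH => //; apply: upoly_proj].
Qed.

Definition convex (X : (nat -> R) -> Prop) := forall x y l,
  X x -> X y -> 0 <= l <= 1 -> X (fun i => l * x i + (1 - l) * y i).

Lemma convex_fibre m X : convex X -> fibre_convex m X.
Proof.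
elim: m X => [|m IH] X cX //; split=> [x s t u Xs Xu /andP[st tu]|].
  have [E|ne] := eqVneq s u.
    by have -> : t = s by apply/eqP; rewrite eq_le st E tu.
  have su : 0 < u - s by rewrite subr_gt0 lt_neqAle ne (le_trans st).
  pose l := (u - t) / (u - s).
  have := cX _ _ l Xs Xu; have -> : (fun i => l * upd x m s i + (1 - l) * upd x m u i) = upd x m t.
    apply: funext => i; rewrite /upd; case: eqP => _; last by ring.
    by rewrite /l; field; rewrite gt_eqF.
  apply; apply/andP; split; first by rewrite divr_ge0 ?subr_ge0 // (le_trans st).
  by rewrite ler_pdivrMr // mul1r lerB.
apply: IH => x y l [s Xs] [t Xt] l01; exists (l * s + (1 - l) * t).
have := cX _ _ l Xs Xt l01; congr X; apply: funext => i; rewrite /upd.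
by case: eqP.
Qed.

(** Tropical convexity with shifts of one sign. The heights for which given elements are nonloops
    form such a set, in general not a convex one; it still has interval fibres, and so do its
    projections. *)
Definition minplus (X : (nat -> R) -> Prop) := forall x y s,
  X x -> X y -> 0 <= s -> X (fun i => Num.min (x i) (y i + s)).

Lemma minplus_fibre m X : minplus X -> fibre_convex m X.
Proof.
elim: m X => [|m IH] X cX //; split=> [x s t u Xs Xu /andP[st tu]|].
  have := cX _ _ (t - s) Xu Xs; rewrite subr_ge0 => /(_ st); congr X; apply: funext => i.
  rewrite /upd; case: eqP => _; first by rewrite addrC subrK min_r.
  by rewrite min_l // lerDl subr_ge0.
apply: IH => x y d [s Xs] [t Xt] d0; exists (Num.min s (t + d)).
have := cX _ _ d Xs Xt d0; congr X; apply: funext => i; rewrite /upd.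
by case: eqP.
Qed.

End EulerMeasure.

(** * Sums over the flags *)

Section DirectedCycles.
Variables (V X : finType) (tl hd : X -> V).
Implicit Types G C : {set X}.

(** A balanced edge set, i.e. an edge-disjoint union of directed cycles; sums and products of a
    vertex function over tails and over heads agree. *)
Definition cyc G : bool := perm_eq [seq tl e | e <- enum G] [seq hd e | e <- enum G].

Lemma cyc_big (T : Type) (idx : T) (op : Monoid.com_law idx) (g : V -> T) G : cyc G ->
  \big[op/idx]_(e in G) g (tl e) = \big[op/idx]_(e in G) g (hd e).
Proof.
move=> cG; rewrite -[LHS]big_enum -[RHS]big_enum /=.
by rewrite -(big_map tl xpredT g) -(big_map hd xpredT g); apply: perm_big.
Qed.

(* a minimal nonempty set stable under a successor map is permuted by it *)
Lemma stable_cyc C : C != set0 -> (forall e, e \in C -> exists2 f, f \in C & tl f = hd e) ->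
  exists2 G : {set X}, G \subset C & (G != set0) && cyc G.
Proof.
move=> C0 H; have /fin_all_exists[s Hs] e : exists f, e \in C -> f \in C /\ tl f = hd e.
  by case: (boolP (e \in C)) => [/H[f fC E]|_]; [exists f|exists e].
pose st (G : {set X}) := [&& G != set0, G \subset C & s @: G \subset G].
have stC : st C.
  rewrite /st C0 subxx; apply/subsetP => _ /imsetP[e eC ->].
  by have [] := Hs e eC.
have [G /andP[/and3P[G0 GC sG] mG]] : exists G, st G && [forall G', st G' ==> (#|G| <= #|G'|)%N].
  case: (arg_minnP (fun G => #|G|) stC) => G stG mG; exists G; rewrite stG.
  by apply/forallP => G'; apply/implyP; apply: mG.
have stI : st (s @: G).
  rewrite /st (subset_trans sG GC) imsetS // !andbT.
  by have [x xG] := set0Pn _ G0; apply/set0Pn; exists (s x); apply: imset_f.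
have E : s @: G = G.
  by apply/eqP; rewrite eqEcard sG; move/forallP/(_ (s @: G)): mG; rewrite stI.
have inj : {in G &, injective s} by apply/imset_injP; rewrite E.
exists G => //; rewrite G0 /cyc perm_sym.
have -> : [seq hd e | e <- enum G] = [seq tl e | e <- [seq s e | e <- enum G]].
  rewrite -map_comp; apply/eq_in_map => e; rewrite mem_enum => eG /=.
  by have [] := Hs e (subsetP GC _ eG).
apply: perm_map; apply: uniq_perm; rewrite ?enum_uniq //.
  by rewrite map_inj_in_uniq ?enum_uniq // => x y; rewrite !mem_enum; apply: inj.
move=> x; rewrite mem_enum -{2}E; apply/mapP/imsetP => [[y]|[y]]; rewrite ?mem_enum => yG ->.
  by exists y.
by exists y; rewrite ?mem_enum.
Qed.

End DirectedCycles.

(** * Difference constraints on a directed graph *)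

Section CyclicSystems.
Variables (R : realFieldType) (F : fieldType) (V X : finType).
Variables (tl hd : X -> V) (rev : X -> X) (bd : X -> R) (t : V -> F).
Hypotheses (revK : involutive rev) (tl_rev : forall x, tl (rev x) = hd x)
  (bd_rev : forall x, bd (rev x) = - bd x) (rev_neq : forall x, rev x != x)
  (t0 : forall i, t i != 0) (tinj : injective t) (tlhd : forall x, tl x != hd x).
Implicit Types (G C I : {set X}) (u : V -> R) (c : X -> R).

Lemma hd_rev x : hd (rev x) = tl x.
Proof. by rewrite -tl_rev revK. Qed.

Definition slack u x : R := u (tl x) - u (hd x) - bd x.

Definition feas C I : Prop := exists u,
  (forall x, x \in C -> 0 <= slack u x) /\ (forall x, x \in I -> slack u x = 0).

Definition ratio x : F := t (hd x) / t (tl x).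

(** The Euler integral over u of a product of step functions, one for each constraint: 0 for
    negative slack, 1 for positive slack and 1/(1 - ratio) for slack zero. The last value is written
    as 1 + ratio/(1 - ratio) and the product is expanded over sets of tight constraints. *)
Definition Lam C : F :=
  \sum_(I : {set X} | (I \subset C) && `[< feas C I >]) \prod_(x in I) (ratio x / (1 - ratio x)).

Definition oriented C : bool := [forall x in C, rev x \notin C].

Hypothesis tight_free : forall G, G != set0 -> oriented G -> cyc tl hd G ->
  ~ exists u, forall x, x \in G -> slack u x = 0.

Lemma slack_rev u x : slack u (rev x) = - slack u x.
Proof. by rewrite /slack tl_rev hd_rev bd_rev; lra. Qed.

Lemma ratio_neq1 x : 1 - ratio x != 0.
Proof.
rewrite subr_eq0 eq_sym; apply/eqP => E; have := tlhd x; rewrite eq_sym => /eqP; apply.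
by apply: tinj; rewrite -[LHS](divfK (t0 (tl x))) -/(ratio x) E mul1r.
Qed.

Lemma ratio_rev x : ratio (rev x) = (ratio x)^-1.
Proof. by rewrite /ratio tl_rev hd_rev invf_div. Qed.

Lemma orientedS C C' : C' \subset C -> oriented C -> oriented C'.
Proof.
move=> /subsetP s /forall_inP H; apply/forall_inP => x /s /H; apply: contra; exact: s.
Qed.

Definition flip e C : {set X} := rev e |: (C :\ e).

Lemma oriented_flip e C : e \in C -> oriented C -> oriented (flip e C).
Proof.
move=> eC /forall_inP H; apply/forall_inP => x; rewrite !inE => /orP[/eqP ->|/andP[xe xC]].
  by rewrite revK eqxx /= orbF eq_sym rev_neq.
by rewrite (inj_eq (can_inj revK)) (negbTE xe) /= (negbTE (H x xC)) andbF.
Qed.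

Lemma feas_split C e I : e \in C -> rev e \notin C -> e \notin I ->
  (feas (C :\ e) I <-> feas C I \/ feas (flip e C) I) /\
  (feas C (e |: I) <-> feas C I /\ feas (flip e C) I).
Proof.
move=> eC reC eI.
have reC' x : x \in flip e C -> x = rev e \/ x \in C /\ x != e.
  by rewrite !inE => /orP[/eqP|/andP[? ?]]; [left|right].
split; split.
- move=> [u [uC uI]]; have [s|s] := leP 0 (slack u e); [left|right]; exists u; split=> // x xC.
    by have [->//|xe] := eqVneq x e; apply: uC; rewrite !inE xe.
  case: (reC' x xC) => [->|[xC' xe]]; first by rewrite slack_rev oppr_ge0 ltW.
  by apply: uC; rewrite !inE xe.
- case=> -[u [uC uI]]; exists u; split=> // x; rewrite !inE => /andP[xe xC]; apply: uC => //.
  by rewrite !inE xe xC orbT.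
- move=> [u [uC uI]]; split; exists u; split=> // x xI; try by apply: uI; rewrite inE xI orbT.
  case: (reC' x xI) => [->|[xC' xe]]; last exact: uC.
  by rewrite slack_rev uI ?oppr0 // inE inE eqxx.
move=> [[u [uC uI]] [v [vC vI]]].
have ue := uC e eC; have ve : slack v e <= 0.
  by rewrite -oppr_ge0 -slack_rev; apply: vC; rewrite !inE eqxx.
have [a [a0 Ha]] : exists a, 0 <= a <= 1 /\ a * slack u e + (1 - a) * slack v e = 0.
  have [z|nz] := eqVneq (slack u e) 0; first by exists 1; rewrite z; split; lra.
  have p : 0 < slack u e - slack v e by have : 0 < slack u e by [rewrite lt_neqAle eq_sym nz]; lra.
  exists (- slack v e / (slack u e - slack v e)); split.
    apply/andP; split; first by rewrite divr_ge0 ?oppr_ge0 // ltW.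
    by rewrite ler_pdivrMr // mul1r lerDr.
  by field; rewrite gt_eqF.
have sl x : slack (fun i => a * u i + (1 - a) * v i) x = a * slack u x + (1 - a) * slack v x.
  by rewrite /slack; ring.
have /andP[a0' a1] := a0; rewrite -subr_ge0 in a1.
exists (fun i => a * u i + (1 - a) * v i); split=> x; rewrite sl.
  have [->|xe] := eqVneq x e; first by rewrite Ha.
  by move=> xC; rewrite addr_ge0 // mulr_ge0 ?uC ?vC // !inE xe xC orbT.
by rewrite !inE => /orP[/eqP ->//|xI]; rewrite uI // vI // !mulr0 addr0.
Qed.

Lemma sum_subset1 C e (P : {set X} -> bool) (f : {set X} -> F) : e \in C ->
  \sum_(I : {set X} | (I \subset C) && P I) f I =
  \sum_(I : {set X} | (I \subset C :\ e) && P I) f I + \sum_(I : {set X} | (I \subset C :\ e) && P (e |: I)) f (e |: I).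
Proof.
move=> eC; rewrite (bigID (fun I : {set X} => e \notin I)) /=; congr (_ + _).
  by apply: eq_bigl => I; rewrite subsetD1 -!andbA; congr (_ && _); rewrite andbC.
rewrite (reindex_onto (fun I => e |: I) (fun I => I :\ e)) /=; last first.
  by move=> I /andP[_ /negPn eI]; rewrite setD1K.
apply: eq_bigl => I; rewrite subsetD1 subUset sub1set eC /= inE inE eqxx /= andbT.

have -> : ((e |: I) :\ e == I) = (e \notin I).
  case: (boolP (e \in I)) => eI; last by rewrite setU1K // eqxx.
  by apply/negP => /eqP/setP/(_ e); rewrite !inE eqxx eI.
by rewrite -!andbA; congr (_ && _); rewrite andbC.
Qed.

Lemma setD1_flip C e : rev e \notin C -> flip e C :\ rev e = C :\ e.
Proof. by move=> reC; rewrite setU1K // !inE (negbTE reC) andbF. Qed.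

(** Cutting along [e]: the weights that the common wall gets in the two halves sum to -1, which is
    the correction term in inclusion-exclusion for Euler characteristics. *)
Lemma Lam_cut C e : e \in C -> oriented C -> Lam (C :\ e) = Lam C + Lam (flip e C).
Proof.
move=> eC oC; have reC : rev e \notin C by move/forall_inP: oC; apply.
rewrite [Lam C](sum_subset1 (fun I => `[< feas C I >]) _ eC).
rewrite [Lam (flip e C)](@sum_subset1 _ (rev e) (fun I => `[< feas (flip e C) I >])); last by rewrite !inE eqxx.
rewrite setD1_flip // [Lam _](eq_bigl (fun I : {set X} => (I \subset C :\ e) && `[< feas (C :\ e) I >])) //.
rewrite !big_mkcondr /= -!big_split /=; apply: eq_bigr => I IC.
have eI : e \notin I by move: IC; rewrite subsetD1 => /andP[].
have reI : rev e \notin I.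
  by apply: contra reC => reI; move/subsetP: IC => /(_ _ reI); rewrite inE => /andP[].
have [H1 H2] := feas_split eC reC eI.
have H3 : feas (flip e C) (rev e |: I) <-> feas C (e |: I).
  have tt u : (forall x, x \in rev e |: I -> slack u x = 0) <-> (forall x, x \in e |: I -> slack u x = 0).
    split=> H x; rewrite !inE => /orP[/eqP ->|xI]; try by apply: H; rewrite inE xI orbT.
      by rewrite -[e]revK slack_rev H ?oppr0 // inE inE eqxx.
    by rewrite slack_rev H ?oppr0 // inE inE eqxx.
  split=> -[u [uC uI]].
    exists u; split; last exact/tt.
    move=> x xC; have [->|xe] := eqVneq x e; first by have /tt -> := uI; rewrite ?lexx // !inE eqxx.
    by apply: uC; rewrite !inE xe xC orbT.
  exists u; split; last exact/tt.
  move=> x; rewrite !inE => /orP[/eqP ->|/andP[_ /uC]//].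
  by rewrite slack_rev uI ?oppr0 ?lexx // inE inE eqxx.
rewrite !big_setU1 //=; set w := \prod_(x in I) _.
rewrite (asbool_equiv_eq H1) (asbool_equiv_eq H2) (asbool_equiv_eq H3) (asbool_equiv_eq H2).
have E : ratio e / (1 - ratio e) + ratio (rev e) / (1 - ratio (rev e)) = -1.
  have := ratio_neq1 e; have := ratio_neq1 (rev e); rewrite ratio_rev.
  have r0 : ratio e != 0 by rewrite mulf_neq0 ?invr_eq0.
  move: r0; move: (ratio e) => r r0 h1 h2; field; rewrite r0 h2 /=.
  by rewrite andbT -opprB oppr_eq0.
rewrite asbool_or asbool_and; case: `[< feas C I >]; case: `[< feas (flip e C) I >] => /=;
  rewrite ?addr0 ?add0r //.
rewrite addrACA -mulrDl E mulN1r; ring.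
Qed.

Lemma card_flip C e : e \in C -> rev e \notin C -> #|flip e C| = #|C|.
Proof.
by move=> eC reC; rewrite cardsU1 !inE (negbTE reC) andbF /= (cardsD1 e C) eC.
Qed.

Definition relation C c : Prop := forall u, \sum_(x in C) c x * (u (tl x) - u (hd x)) = 0.

Lemma relation_flip C e c : e \in C -> rev e \notin C -> (forall x, c (rev x) = - c x) ->
  relation C c -> relation (flip e C) c.
Proof.
move=> eC reC ac rc u; rewrite -[RHS](rc u) big_setU1 /=; last by rewrite !inE (negbTE reC) andbF.
by rewrite [RHS](big_setD1 e) //= tl_rev hd_rev ac; congr (_ + _); ring.
Qed.

Lemma relation_cyc C c : relation C c -> (forall x, x \in C -> 0 <= c x) ->
  (exists2 x, x \in C & c x != 0) ->
  exists2 G : {set X}, G \subset [set x in C | 0 < c x] & (G != set0) && cyc tl hd G.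
Proof.
move=> rc c0 [x xC cx]; apply: stable_cyc.
  by apply/set0Pn; exists x; rewrite inE xC lt_neqAle eq_sym cx c0.
move=> e; rewrite inE => /andP[eC ce]; apply: contrapT => N.
have := rc (fun i => (i == hd e)%:R); apply/eqP; rewrite lt_eqF //.
rewrite (bigD1 e) //= eqxx (negbTE (tlhd e)) sub0r mulrN1.
have : \sum_(i in C | i != e) c i * ((tl i == hd e)%:R - (hd i == hd e)%:R) <= 0 :> R.
  apply: sumr_le0 => i /andP[iC _]; have [E|_] := eqVneq (tl i) (hd e).
    have : ~ 0 < c i by move=> ci; apply: N; exists i; rewrite // inE iC.
    move/negP; rewrite -leNgt => ci.
    have -> : c i = 0 by apply/eqP; rewrite eq_le ci c0.
    by rewrite mul0r.
  by rewrite sub0r mulrN oppr_le0 mulr_ge0 ?c0 // ler0n.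
lra.
Qed.

Lemma solve_slack C : (forall c, relation C c -> forall x, x \in C -> c x = 0) ->
  exists u, forall x, x \in C -> slack u x = 0.
Proof.
move=> H; pose E (a : 'I_#|C|) : X := enum_val a.
pose A : 'M[R]_(#|C|, #|V|) := \matrix_(a, i) ((enum_val i == tl (E a))%:R - (enum_val i == hd (E a))%:R).
have AE (u : V -> R) a : \sum_i A a i * u (enum_val i) = u (tl (E a)) - u (hd (E a)).
  rewrite (eq_bigr (fun i => ((enum_val i == tl (E a))%:R - (enum_val i == hd (E a))%:R) * u (enum_val i))).
    rewrite -(big_enum_val (fun i => ((i == tl (E a))%:R - (i == hd (E a))%:R) * u i)) /=.
    have one v : \sum_i (i == v)%:R * u i = u v.
      by rewrite (bigD1 v) //= eqxx mul1r big1 ?addr0 // => i /negbTE ->; rewrite mul0r.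
    by rewrite -!one -sumrB; apply: eq_bigr => i _; rewrite mulrBl.
  by move=> i _; rewrite mxE.
case: (boolP (row_free A)) => [fA|].
  pose U : 'cV[R]_#|V| := pinvmx A *m (\col_a bd (E a)).
  exists (fun v => U (enum_rank v) 0) => x xC.
  pose a := enum_rank_in xC x; have Ea : E a = x by rewrite /E enum_rankK_in.
  rewrite /slack -Ea -(AE (fun v => U (enum_rank v) 0)) (eq_bigr (fun i => A a i * U i 0)) => [|i _]; last by rewrite enum_valK.
  have -> : \sum_i A a i * U i 0 = (A *m U) a 0 by rewrite mxE.
  by rewrite mulmxA mulmxVp // mul1mx mxE subrr.
rewrite -kermx_eq0 => /rowV0Pn[v /sub_kermxP vA v0].
case/negP: v0; apply/eqP/rowP => a; rewrite mxE.
pose c x := \sum_a v 0 a * (E a == x)%:R.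
have cE b : c (E b) = v 0 b.
  rewrite /c (bigD1 b) //= eqxx mulr1 big1 ?addr0 // => i ib.
  by rewrite (inj_eq enum_val_inj) (negbTE ib) mulr0.
rewrite -cE; apply: (H c); last exact: enum_valP.
move=> u; rewrite (big_enum_val (fun x => c x * (u (tl x) - u (hd x)))) /=.
under eq_bigr => i _ do rewrite -/(E i) cE -AE mulr_sumr.
rewrite exchange_big big1 //= => i _.
have := congr1 (fun B : 'rV_#|V| => B 0 i) vA; rewrite !mxE => Z.
rewrite (eq_bigr (fun b => v 0 b * A b i * u (enum_val i))) => [|b _]; last by rewrite mulrA.
by rewrite -mulr_suml Z mul0r.
Qed.

Lemma sum_subset_prod C G (z : X -> F) : G \subset C ->
  \sum_(I : {set X} | (I \subset C) && (G \subset I)) \prod_(x in I) z x =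
  \prod_(x in G) z x * \prod_(x in C :\: G) (1 + z x).
Proof.
move=> GC; pose f x := if x \in C then z x else 0; pose g x : F := (x \notin G)%:R.
have -> : \prod_(x in G) z x * \prod_(x in C :\: G) (1 + z x) = \prod_x (f x + g x).
  rewrite [RHS](bigID (mem G)) /=; congr (_ * _).
    apply: eq_bigr => x xG; by rewrite /f /g (subsetP GC _ xG) xG addr0.
  rewrite [RHS](bigID (mem C)) /= [X in _ * X]big1 ?mulr1; last first.
    by move=> x /andP[xG xC]; rewrite /f /g (negbTE xC) xG add0r.
  rewrite (eq_bigl (fun x => (x \notin G) && (x \in C))); last by move=> x; rewrite inE.
  by apply: eq_bigr => x /andP[xG xC]; rewrite /f /g xG xC addrC.
rewrite bigA_distr [RHS](bigID (fun I : {set X} => (I \subset C) && (G \subset I))) /=.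
rewrite [X in _ + X]big1 ?addr0 => [|I].
  apply: eq_bigr => I /andP[IC GI]; rewrite [RHS](bigID (mem I)) /= [X in _ * X]big1 ?mulr1.
    by apply: eq_bigr => x xI; rewrite xI /f (subsetP IC).
  by move=> x xI; rewrite (negbTE xI) /g (contra (subsetP GI x)).
rewrite negb_and => /orP[/subsetPn[x xI xC]|/subsetPn[x xG xI]]; apply/eqP/prodf_eq0; exists x => //.
  by rewrite xI /f (negbTE xC).
by rewrite (negbTE xI) /g xG.
Qed.

Lemma cyc_slack G u v : cyc tl hd G -> \sum_(x in G) slack u x = \sum_(x in G) slack v x.
Proof.
move=> cG; have H f : \sum_(x in G) slack f x = - \sum_(x in G) bd x.
  by rewrite sumrB sumrB (cyc_big _ f cG) subrr sub0r.
by rewrite !H.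
Qed.

Lemma Lam_feas C : Lam C <> 0 -> exists u, forall x, x \in C -> 0 <= slack u x.
Proof.
move=> L0; apply: contrapT => N; apply: L0; rewrite /Lam big_pred0 // => I.
apply/negP => /andP[_ /asboolP[u [uC _]]]; apply: N; by exists u.
Qed.

(** Apart from the cycle the constraints are independent, so a subset can be made tight exactly when
    it does not contain [G]. The sum then has the factor 1 minus the product of the ratios around
    [G], which is 0. *)
Lemma Lam_unicyclic C G f : oriented C -> G \subset C -> f \in G -> cyc tl hd G ->
  (forall c, relation (C :\ f) c -> forall x, x \in C :\ f -> c x = 0) -> Lam C = 0.
Proof.
move=> oC GC fG cG ind; apply: contrapT => L0.
have [u0 u0C] := Lam_feas L0; apply: L0.
have fC := subsetP GC _ fG.
have rG : forall u : V -> R, \sum_(x in G) (u (tl x) - u (hd x)) = 0.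
  by move=> u; rewrite sumrB (cyc_big _ u cG) subrr.
have fe (I : {set X}) : I \subset C -> `[< feas C I >] = ~~ (G \subset I).
  move=> IC; apply/asboolP/idP => [[u [_ uI]]|/subsetPn[g gG gI]].
    apply/negP => /subsetP GI; case: (@tight_free G); rewrite ?(orientedS GC) //.
      by apply/set0Pn; exists f.
    by exists u => x /GI/uI.
  have gC := subsetP GC _ gG.
  have [c rc x xC|u Hu] := @solve_slack (C :\ g).
    pose K := if f == g then 0 else c f.
    pose c' y := (if y == g then 0 else c y) - K * (y \in G)%:R.
    have c'f : c' f = 0 by rewrite /c' /K fG mulr1 subrr.
    have rc' : relation (C :\ f) c'.
      move=> u; have -> : \sum_(y in C :\ f) c' y * (u (tl y) - u (hd y)) = \sum_(y in C) c' y * (u (tl y) - u (hd y)).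
        by rewrite [RHS](big_setD1 f) //= c'f mul0r add0r.
      rewrite (eq_bigr (fun y => (if y == g then 0 else c y) * (u (tl y) - u (hd y)) -
         K * ((y \in G)%:R * (u (tl y) - u (hd y))))); last by move=> y _; rewrite /c'; ring.
      rewrite sumrB -mulr_sumr [X in K * X](big_setID G) /= (setIidPr GC) [X in K * (_ + X)]big1 ?addr0; last first.
        by move=> y; rewrite inE => /andP[/negbTE -> _]; rewrite mul0r.
      rewrite [X in K * X](eq_bigr (fun y => u (tl y) - u (hd y))) => [|y ->]; last by rewrite mul1r.
      rewrite rG mulr0 subr0 (big_setD1 g) //= eqxx mul0r add0r -[RHS](rc u).
      by apply: eq_bigr => y; rewrite !inE => /andP[/negbTE ->].
    have K0 : K = 0.
      rewrite /K; case: eqP => // /eqP fg.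
      have := ind c' rc' g; rewrite !inE eq_sym fg gC => /(_ isT).
      rewrite /c' eqxx gG mulr1 /K (negbTE fg) sub0r => /eqP; by rewrite oppr_eq0 => /eqP.
    move: (xC); rewrite !inE => /andP[xg xC'].
    have [E|xf] := eqVneq x f; first by move: K0; rewrite /K -E (negbTE xg).
    by have := ind c' rc' x; rewrite !inE xf xC' /c' (negbTE xg) K0 mul0r subr0; apply.
  have ug : 0 <= slack u g.
    have <- : \sum_(x in G) slack u x = slack u g.
      rewrite (bigD1 g) //= big1 ?addr0 // => x /andP[xG xg]; apply: Hu.
      by rewrite !inE xg (subsetP GC).
    by rewrite (cyc_slack u u0) //; apply: sumr_ge0 => x xG; apply/u0C/(subsetP GC).
  exists u; split=> x xI.
    by have [->//|xg] := eqVneq x g; rewrite Hu // !inE xg.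
  by apply: Hu; rewrite !inE (subsetP IC) // andbT; apply: contraNneq gI => <-.
rewrite /Lam (eq_bigl (fun I : {set X} => (I \subset C) && ~~ (G \subset I))); last first.
  by move=> I; case: (boolP (I \subset C)) => //= IC; rewrite fe.
have T := @sum_subset_prod C set0 (fun x => ratio x / (1 - ratio x)) (sub0set _).
have S := @sum_subset_prod C G (fun x => ratio x / (1 - ratio x)) GC.
have P1 (x : X) : 1 + ratio x / (1 - ratio x) = (1 - ratio x)^-1.
  by have := ratio_neq1 x; move: (ratio x) => r r1; field.
move: T; rewrite big_set0 mul1r setD0 (bigID (fun I : {set X} => G \subset I)) /= => T.
have -> : \sum_(I : {set X} | (I \subset C) && ~~ (G \subset I)) \prod_(x in I) (ratio x / (1 - ratio x)) =
   \prod_(x in C) (1 + ratio x / (1 - ratio x)) - \prod_(x in G) (ratio x / (1 - ratio x)) *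
     \prod_(x in C :\: G) (1 + ratio x / (1 - ratio x)).
  rewrite -S -T [X in X - _](_ : _ = \sum_(I : {set X} | (I \subset C) && (G \subset I)) \prod_(x in I) (ratio x / (1 - ratio x)) +
      \sum_(I : {set X} | (I \subset C) && ~~ (G \subset I)) \prod_(x in I) (ratio x / (1 - ratio x))).
    by rewrite addrC addKr.
  by congr (_ + _); apply: eq_bigl => I; rewrite sub0set andbT.
rewrite [X in X - _](big_setID G) /= (setIidPr GC) -mulrBl big_split /=.
have -> : \prod_(x in G) ratio x = 1.
  rewrite prodf_div (cyc_big _ t cG) divff // prodf_seq_neq0; by apply/allP => x _; rewrite t0 implybT.
rewrite mul1r (eq_bigr _ (fun x _ => P1 x)) subrr mul0r //.
Qed.

(** Suppose the value is nonzero. Flipping an edge whose complement still contains a cycle only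
    changes the sign, since by induction the system without that edge has value 0. A second relation
    [c] makes such flips possible, at the edges outside [G] with [c] negative and then at all edges
    of [G] in increasing order of [c]: subtracting a multiple of the cycle from [c] gives a
    nonnegative relation vanishing at the next edge, hence a cycle avoiding it. In the end a system
    containing [G] and one containing its reversal are both feasible. The sum of the slacks around
    [G] does not depend on u, so it is 0 and [G] is tight, against [tight_free]. *)
Lemma Lam_cyclic C G : oriented C -> G \subset C -> G != set0 -> cyc tl hd G -> Lam C = 0.
Proof.
move: {2}#|C|.+1 (ltnSn #|C|) => N; elim: N C G => // N IH C G CN oC GC G0 cG.
apply: contrapT => L0; have [f fG] := set0Pn _ G0.
have fC := subsetP GC _ fG.
case: (pselect (forall c, relation (C :\ f) c -> forall x, x \in C :\ f -> c x = 0)) => [H|].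
  by apply: L0; apply: (Lam_unicyclic oC GC fG).
move=> /existsNP[c0 /not_implyP[rc0 /existsNP[x0 /not_implyP[x0C /eqP cx0]]]].
(* [c] and the indicator [sg] of the cycle are made antisymmetric under reversal, so that they
   remain relations after a flip. *)
pose c x := (if x \in C :\ f then c0 x else 0) - (if rev x \in C :\ f then c0 (rev x) else 0).
pose sg x : R := (x \in G)%:R - (rev x \in G)%:R.
have ac x : c (rev x) = - c x by rewrite /c revK opprB.
have as_ x : sg (rev x) = - sg x by rewrite /sg revK opprB.
have noC x : x \in C -> rev x \notin C by move/forall_inP: oC; apply.
have cf : c f = 0 by rewrite /c !inE eqxx /= (negbTE (noC f fC)) andbF subrr.
have rcC : relation C c.
  move=> u; rewrite -[RHS](rc0 u) (big_setD1 f) //= cf mul0r add0r; apply: eq_bigr => x xC.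
  move: (xC); rewrite !inE => /andP[_ xC']; rewrite /c xC !inE (negbTE (noC x xC')) andbF subr0 //.
have rsC : relation C sg.
  move=> u; rewrite (big_setID G) /= (setIidPr GC) [X in _ + X]big1 ?addr0 => [|x]; last first.
    rewrite inE => /andP[xG xC]; rewrite /sg (negbTE xG) sub0r.
    have /negbTE -> : rev x \notin G by apply: contra (noC x xC); apply: (subsetP GC).
    by rewrite oppr0 mul0r.
  rewrite (eq_bigr (fun x => u (tl x) - u (hd x))) => [|x xG]; last first.
    rewrite /sg xG; have /negbTE -> : rev x \notin G by apply: contra (noC x (subsetP GC _ xG)); apply: (subsetP GC).
    by rewrite subr0 mul1r.
  by rewrite sumrB (cyc_big _ u cG) subrr.
pose inv (D : {set X}) := [/\ oriented D, #|D| = #|C|, Lam D <> 0, relation D c /\ relation D sg &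
  (exists2 x, x \in D & c x != 0) /\ forall x, x \in G -> x \in D \/ rev x \in D].
have inv_flip (D : {set X}) e : e \in D -> inv D ->
    (exists G' : {set X}, [/\ G' \subset D :\ e, G' != set0 & cyc tl hd G']) -> inv (flip e D).
  move=> eD [oD cD LD [rc rs] [[x xD cx] GD]] [G' [GD' G'0 cG']].
  have reD : rev e \notin D by move/forall_inP: oD; apply.
  split.
  - exact: oriented_flip.
  - by rewrite card_flip.
  - move=> L; apply: LD; have := Lam_cut eD oD; rewrite L addr0 => <-.
    apply: (IH _ G') => //; last by apply: orientedS oD; apply: subsetDl.
    by move: CN; rewrite -cD (cardsD1 e D) eD add1n !ltnS.
  - by split; apply: relation_flip.
  split.
    have [E|xe] := eqVneq x e; last by exists x => //; rewrite !inE xe xD orbT.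
    by exists (rev e); rewrite ?inE ?eqxx // ac -E oppr_eq0.
  move=> y /GD[yD|yD].
    have [->|ye] := eqVneq y e; first by right; rewrite !inE eqxx.
    by left; rewrite !inE ye yD orbT.
  have [E|ye] := eqVneq (rev y) e; first by left; rewrite !inE -E revK eqxx.
  by right; rewrite !inE ye yD orbT.
have [C1 [invC1 GC1 C1c]] : exists C1 : {set X}, [/\ inv C1, G \subset C1 &
    forall x, x \in C1 -> sg x = 0 -> 0 <= c x].
  have : exists D, inv D /\ G \subset D.
    exists C; split=> //; split=> //; split; last by move=> x xG; left; apply: (subsetP GC).
    exists x0; first by move: x0C; rewrite inE => /andP[].
    rewrite /c x0C; move: (x0C); rewrite !inE => /andP[_ x0C'].
    by rewrite (negbTE (noC _ x0C')) andbF subr0.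
  move=> [D [iD GD]]; move: {2}#|[set x in D | (sg x == 0) && (c x < 0)]|.+1
    (ltnSn #|[set x in D | (sg x == 0) && (c x < 0)]|) => m.
  elim: m D iD GD => // m IHm D iD GD; rewrite ltnS => mD.
  have [E|[e]] := set_0Vmem [set x in D | (sg x == 0) && (c x < 0)].
    exists D; split=> // x xD s0; rewrite leNgt; apply/negP => cx.
    by have := in_set0 x; rewrite -E inE xD s0 eqxx cx.
  rewrite inE => /and3P[eD /eqP se ce].
  have [oD _ _ _ _] := iD.
  have reD : rev e \notin D by move/forall_inP: oD; apply.
  have eG : e \notin G.
    apply/negP => eG; have /negP : rev e \notin G by apply: contra reD; apply: (subsetP GD).
    by move: se; rewrite /sg eG; case: (rev e \in G) => // /eqP; rewrite subr0 oner_eq0.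
  apply: (IHm (flip e D)).
  - apply: inv_flip => //; exists G; split=> //.
    apply/subsetP => x xG; rewrite !inE (subsetP GD) // andbT; by apply: contraNneq eG => <-.
  - apply/subsetP => x xG; rewrite !inE (subsetP GD) // andbT orbC; case: eqP => //= E.
    by rewrite -E xG in eG.
  apply: leq_trans mD; apply: proper_card; apply/properP; split.
    apply/subsetP => x; rewrite !inE => /andP[/orP[/eqP ->|/andP[_ ->]//]].
    by rewrite ac; lra.
  exists e; first by rewrite inE eD se eqxx ce.
  by rewrite !inE eqxx /= eq_sym (negbTE (rev_neq e)).
have [D [iD GD]] : exists D, inv D /\ forall x, x \in G -> rev x \in D.
  suff : forall m (D : {set X}), (#|D :&: G| <= m)%N -> inv D ->
      (forall x, x \in D -> sg x = 0 -> 0 <= c x) ->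
      (forall x y, x \in G -> x \notin D -> y \in G -> y \in D -> c x <= c y) ->
      exists D, inv D /\ forall x, x \in G -> rev x \in D.
    move=> /(_ _ C1 (leqnn _) invC1 C1c); apply => x y xG.
    by rewrite (subsetP GC1).
  elim=> [|m IHm] D; first rewrite leqn0 cards_eq0 => /eqP DG iD _ _.
    exists D; split=> // x xG; have [_ _ _ _ [_ /(_ x xG)[xD|//]]] := iD.
    by have := in_set0 x; rewrite -DG inE xD xG.
  move=> DG iD Dc Dle; have [E|[e1 e1DG]] := set_0Vmem (D :&: G).
    by apply: (IHm D) => //; rewrite E cards0.
  have [e eDG emin] : exists2 e, e \in D :&: G & forall y, y \in D :&: G -> c e <= c y.
    by case: (arg_minP c e1DG) => e; exists e.
  move: eDG; rewrite inE => /andP[eD eG].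
  have [oD _ _ [rc rs] [[x1 x1D cx1] GD]] := iD.
  have nD x : x \in D -> rev x \notin D by move/forall_inP: oD; apply.
  have nG x : x \in G -> rev x \notin G.
    by move=> xG; apply: contra (noC x (subsetP GC _ xG)); apply: (subsetP GC).
  have sG x : x \in G -> sg x = 1 by move=> xG; rewrite /sg xG (negbTE (nG x xG)) subr0.
  pose g x := c x - c e * sg x.
  have rg : relation D g.
    move=> u; rewrite (eq_bigr (fun x => c x * (u (tl x) - u (hd x)) - c e * (sg x * (u (tl x) - u (hd x))))).
      by rewrite sumrB -mulr_sumr rc rs mulr0 subrr.
    by move=> x _; rewrite /g; ring.
  have g0 x : x \in D -> 0 <= g x.
    move=> xD; case: (boolP (x \in G)) => xG.
      by rewrite /g sG // mulr1 subr_ge0 emin // inE xD xG.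
    case: (boolP (rev x \in G)) => rxG.
      have -> : g x = c e - c (rev x) by rewrite /g -[sg x]opprK -as_ (sG _ rxG) ac; ring.
      by rewrite subr_ge0 Dle // nD.
    have s0 : sg x = 0 by rewrite /sg (negbTE xG) (negbTE rxG) subrr.
    by rewrite /g s0 mulr0 subr0 Dc.
  have gn : exists2 x, x \in D & g x != 0.
    apply: contrapT => Ng; have gz x : x \in D -> c x = c e * sg x.
      by move=> xD; apply/eqP; rewrite -subr_eq0; apply/negPn/negP => gx; apply: Ng; exists x.
    have ce0 : c e = 0.
      case: (GD f fG) => fD; have := gz _ fD; rewrite ?ac ?as_ sG // cf; lra.
    by move: cx1; rewrite gz // ce0 mul0r eqxx.
  have [G' GG' /andP[G'0 cG']] := relation_cyc rg g0 gn.
  apply: (IHm (flip e D)).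
  - rewrite -[(_ <= _)%N]ltnS; apply: leq_trans DG; apply: proper_card; apply/properP; split.
      apply/subsetP => x; rewrite !inE => /andP[/orP[/eqP ->|/andP[_ ->] ->//]].
      by rewrite (negbTE (nG e eG)).
    exists e; first by rewrite inE eD eG.
    by rewrite !inE eqxx /= eq_sym (negbTE (rev_neq e)).
  - apply: inv_flip => //; exists G'; split=> //; apply: subset_trans GG' _.
    apply/subsetP => x; rewrite !inE => /andP[-> gx]; rewrite andbT; apply: contraTneq gx => ->.
    by rewrite /g sG // mulr1 subrr ltxx.
  - move=> x; rewrite !inE => /orP[/eqP ->|/andP[_ xD]]; last exact: Dc.
    by rewrite as_ sG // => /eqP; rewrite oppr_eq0 oner_eq0.
  - move=> x y xG xD yG; rewrite inE => /orP[/set1P E|yD'].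
      by have := nG e eG; rewrite -E yG.
    have /andP[ye yD] : (y != e) && (y \in D) by move: yD'; rewrite !inE.
    have [->|xe] := eqVneq x e; first by apply: emin; rewrite inE yD yG.
    apply: Dle => //; apply: contra xD => xD; by rewrite !inE xe xD orbT.
have [_ _ /Lam_feas[u uD] _ _] := iD; have [_ _ /Lam_feas[v vC] _ _] := invC1.
have le0 : \sum_(x in G) slack v x <= 0.
  rewrite (cyc_slack v u) //; apply: sumr_le0 => x xG.
  by rewrite -oppr_ge0 -slack_rev; apply/uD/GD.
apply: (tight_free G0 (orientedS GC oC) cG); exists v.
have v0 x : x \in G -> 0 <= slack v x by move=> xG; apply/vC/(subsetP GC1).
move=> x xG; apply/eqP; rewrite eq_le v0 // andbT; apply: le_trans le0.
rewrite (bigD1 x) //= lerDl; by apply: sumr_ge0 => y /andP[/v0].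
Qed.

End CyclicSystems.

(** * Orderings built by insertion *)

Section Insertions.
Variable T : eqType.
Implicit Types (x : T) (s l : seq T).

Fixpoint insertions x s : seq (seq T) :=
  if s is y :: s' then (x :: s) :: [seq y :: l | l <- insertions x s'] else [:: [:: x]].

(** The head is inserted last, so a sum over all orderings becomes an iterated sum over the places
    of one element, the shape in which it telescopes. *)
Fixpoint insertion_perms s : seq (seq T) :=
  if s is x :: s' then flatten [seq insertions x l | l <- insertion_perms s'] else [:: [::]].

Lemma mem_insertions x s l : l \in insertions x s -> perm_eq l (x :: s).
Proof.
elim: s l => [|y s IH] l /=; first by rewrite inE => /eqP ->.
rewrite inE => /orP[/eqP -> //|/mapP[l' /IH H ->]].
apply: (@perm_trans _ (y :: x :: s)); first by rewrite perm_cons.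
by rewrite -[y :: x :: s]/([:: y] ++ [:: x] ++ s) perm_catCA.
Qed.

Lemma insertions_rem x l : x \in l -> l \in insertions x (rem x l).
Proof.
elim: l => // y l IH; rewrite inE /=; have [-> _|xy /= xl] := eqVneq y x.
  by case: l {IH} => [|z l]; rewrite /= inE eqxx.
by rewrite inE map_f ?orbT // IH.
Qed.

Lemma insertions_inj x s s' l : x \notin s -> x \notin s' ->
  l \in insertions x s -> l \in insertions x s' -> s = s'.
Proof.
have R s1 : x \notin s1 -> l \in insertions x s1 -> rem x l = s1.
  elim: s1 l {s s'} => [|y s IH] l /=; first by rewrite inE => _ /eqP -> /=; rewrite eqxx.
  rewrite !inE negb_or => /andP[xy xs] /orP[/eqP ->|/mapP[l' l's ->]] /=; first by rewrite eqxx.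
  by rewrite eq_sym (negbTE xy) IH.
by move=> xs xs' /(R _ xs) <- /(R _ xs').
Qed.

Lemma insertions_uniq x s : x \notin s -> uniq (insertions x s).
Proof.
elim: s => //= y s IH; rewrite inE negb_or => /andP[xy xs].
rewrite map_inj_uniq ?IH ?andbT //; last by move=> a b [].
by apply/mapP => -[l _ [E _]]; rewrite E eqxx in xy.
Qed.

Lemma mem_insertion_perms s l : uniq s -> (l \in insertion_perms s) = perm_eq l s.
Proof.
elim: s l => [|x s IH] l /=; first by rewrite inE => _; apply/eqP/perm_nilP.
move=> /andP[xs us]; apply/flatten_mapP/idP => [[l' ls ll]|pl].
  by apply: perm_trans (mem_insertions ll) _; rewrite perm_cons -IH.
have xl : x \in l by rewrite (perm_mem pl) inE eqxx.
exists (rem x l); last exact: insertions_rem.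
by rewrite IH // -(perm_cons x) -(permPl (perm_to_rem xl)).
Qed.

Lemma insertion_perms_uniq s : uniq s -> uniq (insertion_perms s).
Proof.
elim: s => //= x s IH /andP[xs us].
have : {subset insertion_perms s <= insertion_perms s} by [].
move: (IH us); elim: {-3}(insertion_perms s) => //= l L IHL /andP[lL uL] sub.
have xl l1 : l1 \in l :: L -> x \notin l1.
  by move=> /sub; rewrite mem_insertion_perms // => /perm_mem ->.
rewrite cat_uniq insertions_uniq ?xl ?inE ?eqxx // IHL ?andbT //; last first.
  by move=> l1 l1L; apply: sub; rewrite inE l1L orbT.
apply/hasPn => m /flatten_mapP[l' l'L ml']; apply/negP => ml.
by move: lL; rewrite (insertions_inj (xl l _) (xl l' _) ml ml') ?l'L // inE ?eqxx ?l'L ?orbT.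
Qed.

End Insertions.

(** * Resolving the ties of a height vector *)

Section Telescoping.
Variables (R : realDomainType) (F : fieldType) (T : finType) (M : matroid T).
Variables (V : F) (t : T -> F) (v : T -> R).
Hypotheses (t0 : forall i, t i != 0) (tinj : injective t).
Implicit Types (A : {set T}) (x y z : T) (s l : seq T).

(** The product over the elements rejected by the greedy algorithm in the order [s], started from
    [A]. *)
Fixpoint nonbasis A s : F :=
  if s is y :: s' then (if spn M A y then 1 - V * t y else 1) * nonbasis (y |: A) s' else 1.

(** Only orderings that descend along [v] survive; a tie is weighted by the geometric series that
    makes the sum over its orderings telescope. *)
Definition step y z : F :=
  if v y < v z then 0 else if v z < v y then 1 else (1 - t z / t y)^-1.

Definition first_step (p : option T) z : F := if p is Some y then step y z else 1.

Fixpoint steps (p : option T) s : F :=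
  if s is z :: s' then first_step p z * steps (Some z) s' else 1.

Lemma spn_exchange A x z : ~~ spn M A z -> spn M (x |: A) z -> spn M (z |: A) x.
Proof.
rewrite /spn => nz /eqP E; rewrite setUCA eqn_leq; apply/andP; split; last by rewrite rkS // setUCA subsetUr.
by rewrite E !rkU1 leq_add2l /spn nz leq_b1.
Qed.

Lemma nonbasis_spn A x s : spn M A x -> nonbasis (x |: A) s = nonbasis A s.
Proof.
elim: s A => //= y s IH A xA; congr (_ * _); last first.
  by rewrite setUCA IH //; apply: spnS xA; apply: subsetUr.
suff -> : spn M (x |: A) y = spn M A y by [].
apply/idP/idP; last by apply: spnS; apply: subsetUr.
by apply: spn_trans => e; rewrite !inE => /orP[/eqP ->|/spn_mem].
Qed.

Lemma steps_asc y z s : z \in s -> v y < v z -> steps (Some y) s = 0.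
Proof.
elim: s y => //= a s IH y; rewrite inE => /orP[/eqP <- yz|zs yz].
  by rewrite /step yz mul0r.
rewrite /step; case: ifP => [_|/negbT]; first by rewrite mul0r.
by rewrite -leNgt => ay; rewrite (IH a) ?mulr0 // (le_lt_trans ay).
Qed.

Section Insert.
Variable x : T.

(** The value of [step y x] at a tie. *)
Definition gap y : F := t y / (t y - t x).

Definition start (p : option T) : F :=
  if p is Some y then if v x < v y then 1 else gap y else 1.

Definition after (p : option T) : bool := if p is Some y then (v x <= v y) && (y != x) else true.

Lemma tB y : y != x -> t y - t x != 0.
Proof. by rewrite subr_eq0 (inj_eq tinj). Qed.

Lemma first_step_x p : after p -> first_step p x = start p.
Proof.
case: p => //= y /andP[xy /tB yx]; rewrite /step ltNge xy /=; case: ifP => //= _.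
by rewrite /gap; field; rewrite t0 yx.
Qed.

(** A partial fraction identity: putting x between two neighbours contributes a difference of
    boundary terms. *)
Lemma step_insert p z : after p -> p != Some z -> z != x -> v z = v x ->
  first_step p x * step x z = (start p - gap z) * first_step p z.
Proof.
move=> ap pz zx vz; rewrite first_step_x // /step vz ltxx.
have tz := tB zx; have tz' : t x - t z != 0 by rewrite -opprB oppr_eq0.
case: p ap pz => [y|] /=; last by move=> _ _; rewrite /gap; field; rewrite tz t0 tz'.
move=> /andP[xy yx] yz; have ty := tB yx.
rewrite /step vz [v y < v x]ltNge xy /=; case: ifP => _; first by rewrite /gap; field; rewrite tz t0 tz'.
have tyz : t y - t z != 0 by rewrite subr_eq0 (inj_eq tinj); apply: contraNneq yz => ->.
by rewrite /gap; field; rewrite tyz tz t0 tz' ty t0.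
Qed.

Lemma gap_identity z : z != x -> (1 - V * t z) * (1 - gap z) + (1 - V * t x) * gap z = 1.
Proof. by move=> /tB zx; rewrite /gap; field. Qed.

(** Among elements tied with x the insertions telescope. The order of x and a neighbour z affects
    the greedy choice only when they are parallel over [A]; [gap_identity] balances that case. *)
Lemma insert_block A p s : after p -> uniq (oapp (fun y => y :: s) s p) -> x \notin s -> (forall z, z \in s -> v z = v x) ->
  \sum_(l <- insertions x s) nonbasis A l * steps p l =
  steps p s * (if spn M A x then (1 - V * t x) * start p * nonbasis A s
               else nonbasis A s + (start p - 1) * nonbasis (x |: A) s).
Proof.
elim: s A p => [|z s IH] A p ap.
  by move=> _ _ _; rewrite big_seq1 /= first_step_x //; case: ifP => _; ring.
move=> us; have uz : uniq (z :: s) by case: (p) us => //= y /andP[].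
have pz : p != Some z.
  by case: (p) us => //= y /andP[+ _]; apply: contraNneq => -[->]; rewrite inE eqxx.
rewrite inE negb_or => /andP[xz xs] vs; have zx : z != x by rewrite eq_sym.
have vz : v z = v x by apply: vs; rewrite inE eqxx.
rewrite big_cons big_map; set front := (X in X + _).
have -> : front = (if spn M A x then 1 - V * t x else 1) * nonbasis (x |: A) (z :: s) *
     ((start p - gap z) * first_step p z * steps (Some z) s).
  by rewrite -step_insert // /front /=; ring.
rewrite (eq_bigr (fun l => (if spn M A z then 1 - V * t z else 1) * first_step p z *
    (nonbasis (z |: A) l * steps (Some z) l))) => [|l _]; last by rewrite /=; ring.
rewrite -mulr_sumr IH //; last 2 first.
- by rewrite /= vz lexx.
- by move=> y ys; apply: vs; rewrite inE ys orbT.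
have -> : start (Some z) = gap z by rewrite /= vz ltxx.
have := gap_identity zx; rewrite [x |: (z |: A)]setUCA /=.
case: (boolP (spn M A x)) => [xA _|xA gi].
  have xA' : spn M (z |: A) x by apply: spnS xA; apply: subsetUr.
  rewrite xA' [z |: (x |: A)]setUCA (nonbasis_spn s xA').
  have -> : spn M (x |: A) z = spn M A z.
    apply/idP/idP; last by apply: spnS; apply: subsetUr.
    by apply: spn_trans => e; rewrite !inE => /orP[/eqP ->|/spn_mem].
  ring.
case: (boolP (spn M (z |: A) x)) => [xA'|xA'].
  have /negbTE -> : ~~ spn M A z.
    apply: contra xA => zA; apply: spn_trans xA' => e; rewrite !inE => /orP[/eqP -> //|].
    exact: spn_mem.
  have -> : spn M (x |: A) z.
    by apply: spn_exchange.
  rewrite [z |: (x |: A)]setUCA (nonbasis_spn s xA').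
  move: (nonbasis (z |: A) s) (steps (Some z) s) (first_step p z) (start p) (gap z) gi => N S f g h gi.
  have -> : (1 - V * t x) * h = 1 - (1 - V * t z) * (1 - h) by apply: (canRL (addrK _)); rewrite addrC.
  ring.
have -> : spn M (x |: A) z = spn M A z.
  apply/idP/idP; last by apply: spnS; apply: subsetUr.
  by apply: contraLR => zA; apply: contra xA' => /(spn_exchange zA).
ring.
Qed.

(** No element is lower than x, so x has to follow every strictly higher one; what remains is a
    block of ties. *)
Lemma insert_sum A p s : (if p is Some y then v x < v y else true) -> uniq s -> x \notin s ->
  (forall z, z \in s -> v x <= v z) ->
  \sum_(l <- insertions x s) nonbasis A l * steps p l =
  steps p s * nonbasis A s * (if spn M (A :|: [set z in s | v x < v z]) x then 1 - V * t x else 1).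
Proof.
elim: s A p => [|z s IH] A p ap.
  move=> _ _ _; have -> : [set z in [::] | v x < v z] = set0 by apply/setP => z; rewrite !inE.
  have ap' : after p.
    by case: p ap => //= y xy; rewrite ltW //=; apply: contraTneq xy => ->; rewrite ltxx.
  rewrite setU0 insert_block //; last by case: (p).
  have -> : start p = 1 by case: (p) ap => //= y ->.
  by case: ifP => _; ring.
move=> uz; have /andP[_ us] := uz; rewrite inE negb_or => /andP[xz xs] vs.
have ap' : after p.
  by case: p ap => //= y xy; rewrite ltW //=; apply: contraTneq xy => ->; rewrite ltxx.
have sp : start p = 1 by case: p ap {ap'} => //= y ->.
have : v x <= v z by apply: vs; rewrite inE eqxx.
have vs' y : y \in s -> v x <= v y by move=> ys; apply: vs; rewrite inE ys orbT.
rewrite le_eqVlt => /orP[/eqP vz|vz]; last first.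
  rewrite /= big_cons big_map /= /step vz mul0r !mulr0 add0r.
  rewrite (eq_bigr (fun l => (if spn M A z then 1 - V * t z else 1) * first_step p z *
    (nonbasis (z |: A) l * steps (Some z) l))) => [|l _]; last by rewrite mulrACA.
  rewrite -mulr_sumr IH //.
  have -> : (z |: A) :|: [set z in s | v x < v z] = A :|: [set z0 in z :: s | v x < v z0].
    apply/setP => y; rewrite !inE; have [->|] := eqVneq y z; first by rewrite vz orbT.
    by [].
  by case: (spn M A z); case: (spn M _ x); ring.
case: (boolP (has (fun y => v x < v y) s)) => [/hasP[y ys xy]|N].
  have -> : steps p (z :: s) = 0 by rewrite /= (steps_asc ys) ?mulr0 // -vz.
  rewrite !mul0r /= big_cons big_map big1_seq => [|l /andP[_ /mem_insertions pl]].
    by rewrite /= (steps_asc ys) -?vz // !mulr0 add0r.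
  have yl : y \in l by rewrite (perm_mem pl) inE ys orbT.
  by rewrite /= (steps_asc yl) -?vz // !mulr0.
have E y : y \in z :: s -> v y = v x.
  rewrite inE => /orP[/eqP -> //|ys]; apply/eqP; rewrite eq_le vs' // andbT leNgt.
  by move/hasPn: N => /(_ y ys).
have up : uniq (oapp (fun y => y :: z :: s) (z :: s) p).
  case: (p) ap => [y xy|_] //; apply/andP; split=> //.
  by apply: contraTN xy => /E ->; rewrite ltxx.
rewrite insert_block //; last by rewrite inE negb_or xz.
have -> : [set z0 in z :: s | v x < v z0] = set0.
  by apply/setP => y; rewrite in_set in_set0; apply/negP => /andP[/E ->]; rewrite ltxx.
by rewrite setU0 sp; case: ifP => _; ring.
Qed.

End Insert.

(** The elements are inserted from the highest to the lowest, and each contributes its factor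
    exactly when the strictly higher ones span it, i.e. when it is a loop of the initial matroid. *)
Lemma telescope_perms s : uniq s -> sorted (fun x y => v x <= v y) s ->
  \sum_(l <- insertion_perms s) nonbasis set0 l * steps None l =
  \prod_(i <- s) (if spn M [set e in s | v i < v e] i then 1 - V * t i else 1).
Proof.
elim: s => [|x s IH] /=; first by rewrite big_seq1 big_nil mulr1.
move=> /andP[xs us] ps; have {}ps' : all (fun y => v x <= v y) s.
  by apply: order_path_min ps => a b c; apply: le_trans.
have vs y : y \in s -> v x <= v y by move=> ys; move/allP: ps'; apply.
rewrite big_flatten big_map big_cons.
have Ex : [set e in x :: s | v x < v e] = [set z in s | v x < v z].
  by apply/setP => y; rewrite !inE; have [->|//] := eqVneq y x; rewrite ltxx !andbF.
rewrite (eq_big_seq (fun l => (if spn M [set z in s | v x < v z] x then 1 - V * t x else 1) *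
    (nonbasis set0 l * steps None l))).
  rewrite -mulr_sumr IH ?(path_sorted ps) // Ex; congr (_ * _); apply: eq_big_seq => i si.
  congr (if spn M _ i then _ else _); apply/setP => y; rewrite !inE.
  by have [->|//] := eqVneq y x; rewrite ltNge vs // !andbF.
move=> l; rewrite mem_insertion_perms // => pl.
rewrite insert_sum ?(perm_uniq pl) ?(perm_mem pl) //; last by move=> z; rewrite (perm_mem pl); apply: vs.
have -> : set0 :|: [set z in l | v x < v z] = [set z in s | v x < v z].
  by apply/setP => y; rewrite !inE (perm_mem pl).
ring.
Qed.

End Telescoping.

(** * The constraints of k orderings *)

Section ChainSystem.
Variables (R : realType) (F : fieldType) (k m : nat) (w : {ffun 'I_k * 'I_m.+1 -> R}).
Variables (t : 'I_m.+1 -> F) (sg : {ffun 'I_k -> {perm 'I_m.+1}}).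
Hypotheses (kp : (0 < k)%N) (gw : generic_pair w) (t0 : forall i, t i != 0) (tinj : injective t).
Local Notation X := ('I_k * 'I_m * bool)%type.
Implicit Types (G : {set X}) (x : X).

Definition lo (a : 'I_m) : 'I_m.+1 := widen_ord (leqnSn m) a.
Definition hi (a : 'I_m) : 'I_m.+1 := lift ord0 a.

(** An edge (j, a, b) compares the neighbours in places a and a + 1 of the j-th ordering; for b true
    it runs from the earlier to the later one. *)
Definition etl x : 'I_m.+1 := sg x.1.1 (if x.2 then lo x.1.2 else hi x.1.2).
Definition ehd x : 'I_m.+1 := sg x.1.1 (if x.2 then hi x.1.2 else lo x.1.2).
Definition erev x : X := (x.1, ~~ x.2).
Definition ebd x : R := w (x.1.1, etl x) - w (x.1.1, ehd x).

(* The directed edges of all chains, pointing downwards. *)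
Definition edges : {set X} := [set x | x.2].

Lemma lo_neq_hi a : lo a != hi a.
Proof. by rewrite -val_eqE /= /bump leq0n add1n neq_ltn ltnSn. Qed.

Lemma erevK : involutive erev.
Proof. by case=> x b; rewrite /erev /= negbK. Qed.

Lemma etl_rev x : etl (erev x) = ehd x.
Proof. by case: x => x []. Qed.

Lemma ehd_erev x : ehd (erev x) = etl x.
Proof. by case: x => x []. Qed.

Lemma ebd_rev x : ebd (erev x) = - ebd x.
Proof. by rewrite /ebd etl_rev ehd_erev opprB. Qed.

Lemma erev_neq x : erev x != x.
Proof. by case: x => x []; rewrite /erev /= xpair_eqE eqxx. Qed.

Lemma etl_neq x : etl x != ehd x.
Proof.
by rewrite /etl /ehd (inj_eq perm_inj); case: x.2; rewrite // ?lo_neq_hi // eq_sym lo_neq_hi.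
Qed.

Lemma edges_oriented : oriented erev edges.
Proof. by apply/forall_inP => x; rewrite !inE /= => xt; rewrite xt. Qed.

(** Each equality between neighbours lets the later one be discarded without losing a value. *)
Lemma nval_chain (u : 'I_m.+1 -> R) (Y : {set 'I_m.+1}) (s : {perm 'I_m.+1}) (A : {set 'I_m}) :
  (forall a, a \in A -> [/\ s (lo a) \in Y, s (hi a) \in Y & u (s (lo a)) = u (s (hi a))]) ->
  (nval Y u + #|A| <= #|Y|)%N.
Proof.
move=> HA; pose H := [set s (hi a) | a in A].
have cH : #|H| = #|A|.
  by rewrite card_in_imset // => a b _ _ /perm_inj/lift_inj.
have HY : H \subset Y by apply/subsetP => _ /imsetP[a /HA[_ ? _] ->].
have <- : (#|Y :\: H| + #|H| = #|Y|)%N by rewrite cardsD (setIidPr HY) subnK // subset_leq_card.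
rewrite cH leq_add2r; have -> : #|Y :\: H| = size [seq u y | y <- enum (Y :\: H)].
  by rewrite size_map cardE.
apply: nval_le => y yY.
have Py : (y \in Y) && (u y == u y) by rewrite yY eqxx.
case: (@arg_minnP _ y (fun z => (z \in Y) && (u z == u y)) (fun z => nat_of_ord ((s^-1)%g z)) Py).
move=> z /andP[zY /eqP uz] zm.
rewrite -uz map_f // mem_enum inE zY andbT; apply/negP => /imsetP[a aA za].
have [lY _ E] := HA a aA; have := zm (s (lo a)); rewrite lY E -za uz eqxx permK => /(_ isT).
by rewrite za permK /= /bump leq0n add1n ltnn.
Qed.

(** On the vertex set Y of a tight balanced set G every edge saves a value in its row, so the rows
    have at most k |Y| - |G| values in all. As |Y| <= |G|, this contradicts [generic_count1]. *)
Lemma chains_tight_free G : G != set0 -> oriented erev G -> cyc etl ehd G ->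
  ~ exists u, forall x, x \in G -> slack etl ehd ebd u x = 0.
Proof.
move=> G0 oG cG [u uG]; pose Y := etl @: G.
have Yh x : x \in G -> ehd x \in Y.
  move=> xG; have : ehd x \in [seq ehd e | e <- enum G] by rewrite map_f // mem_enum.
  rewrite -(perm_mem cG) => /mapP[e]; rewrite mem_enum => eG ->; exact: imset_f.
pose A j := [set a | ((j, a, true) \in G) || ((j, a, false) \in G)].
have nv j : (nval Y (fun i => (u i - w (j, i))%R) + #|A j| <= #|Y|)%N.
  apply: (@nval_chain _ _ (sg j)) => a; rewrite inE => /orP[] xG.
    have := imset_f etl xG; have := Yh _ xG; have := uG _ xG.
    rewrite /slack /ebd /etl /ehd /= => E -> ->; split=> //; lra.
  have := imset_f etl xG; have := Yh _ xG; have := uG _ xG.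
  rewrite /slack /ebd /etl /ehd /= => E -> ->; split=> //; lra.
have Y0 : Y != set0 by have [x xG] := set0Pn _ G0; apply/set0Pn; exists (etl x); apply: imset_f.
have := generic_count1 gw [ffun i => u i] kp Y0.
apply/negP; rewrite -leqNgt.
have cA : (\sum_j #|A j| = #|G|)%N.
  have -> : #|G| = #|(fun x : X => x.1) @: G|.
    rewrite card_in_imset // => -[e b] [e' b'] eG e'G /= E.
    move: E eG e'G => <- eG e'G; congr (_, _); apply/eqP; apply: contraTT e'G => bb.
    have -> : (e, b') = erev (e, b) by rewrite /erev /=; congr (_, _); case: b b' bb {eG} => [] [].
    by move/forall_inP: oG; apply.
  rewrite -sum1_card (partition_big (fun y : 'I_k * 'I_m => y.1) xpredT) //=.
  apply: eq_bigr => j _; rewrite sum1_card.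
  have -> : #|A j| = #|(fun a => (j, a)) @: A j| by rewrite card_imset // => a b [].
  apply: eq_card => -[j' a]; rewrite unfold_in /=; apply/imsetP/andP.
    move=> [b bA [-> ->]]; split=> //; move: bA; rewrite inE => /orP[] xG; apply/imsetP.
      by exists (j, b, true).
    by exists (j, b, false).
  move=> [/imsetP[[e []] eG /= E] /eqP jE]; exists a; rewrite ?jE // inE -jE E eG ?orbT //.
have YG : (#|Y| <= #|G|)%N by apply: leq_imset_card.
have : (\sum_j (nval Y (fun i => (u i - w (j, i))%R) + #|A j|) <= \sum_(j < k) #|Y|)%N by apply: leq_sum.
rewrite big_split /= cA sum_nat_const card_ord => le.
have -> : (\sum_(i < k) nval Y (fun i0 => ([ffun i1 => u i1] i0 - w (i, i0))%R) =
  \sum_(i < k) nval Y (fun i0 => (u i0 - w (i, i0))%R))%N.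
  by apply: eq_bigr => j _; apply: eq_nval => i _; rewrite ffunE.
by apply: leq_trans le; rewrite leq_add2l.
Qed.

Definition lam := Lam etl ehd ebd t edges.

(** The localization denominator of the fixed point of [s], whose tangent characters are the
    t_{s(a)}/t_{s(a+1)}. *)
Definition chamber (s : {perm 'I_m.+1}) : F := \prod_(a < m) (1 - t (s (hi a)) / t (s (lo a)))^-1.

(** Some neighbours in one ordering are inverted in the other. With the segment of the other
    ordering between them they form a directed cycle, and [Lam_cyclic] applies. *)
Lemma lam_neq j j' : sg j != sg j' -> lam = 0.
Proof.
move=> ne.
have [a Ha] : exists a, ((sg j')^-1%g (sg j (hi a)) < (sg j')^-1%g (sg j (lo a)))%N.
  apply: contrapT => N; case/eqP: ne; apply/permP.
  (* A permutation that increases at every pair of neighbours is the identity. *)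
  pose f i : 'I_m.+1 := (sg j')^-1%g (sg j i).
  have fm b d : (b + d <= m)%N -> (f (inord b) + d <= f (inord (b + d)))%N.
    elim: d => [|d IH] bd; first by rewrite !addn0.
    rewrite addnS in bd; have := IH (ltnW bd) => {}IH.
    rewrite !addnS; apply: (leq_ltn_trans IH).
    have -> : inord (b + d) = lo (Ordinal bd) by apply: val_inj; rewrite /= inordK // ltnS ltnW.
    have -> : inord (b + d).+1 = hi (Ordinal bd).
      by apply: val_inj; rewrite /= inordK //= /bump leq0n add1n.
    rewrite ltn_neqAle leqNgt; apply/andP; split; last by apply/negP => H; apply: N; eexists; exact: H.
    by rewrite (inj_eq val_inj) !(inj_eq perm_inj) lo_neq_hi.
  have fid i : f i = i.
    apply: val_inj; apply/eqP; rewrite eqn_leq; apply/andP; split.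
      have im : (i <= m)%N by rewrite -ltnS ltn_ord.
      have := fm i (m - i)%N; rewrite subnKC // inord_val => /(_ (leqnn _)) H.
      have := ltn_ord (f (inord m)); rewrite ltnS => H2; have := leq_trans H H2.
      by rewrite -[X in (_ <= X)%N -> _](subnKC im) leq_add2r.
    have := fm 0%N i; rewrite add0n inord_val -ltnS ltn_ord => /(_ isT).
    by apply: leq_trans; rewrite leq_addl.
  by move=> i; rewrite -[i in RHS]fid /f permKV.
set y := (sg j')^-1%g _ in Ha; set x := (sg j')^-1%g _ in Ha.
pose e0 : X := (j, a, true).
pose G1 := [set (j', c, true) | c : 'I_m & (y <= c < x)%N].
pose G := e0 |: G1.
have te0 : etl e0 = sg j' x by rewrite /etl /= /x permKV.
have he0 : ehd e0 = sg j' y by rewrite /ehd /= /y permKV.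
have t1 z : z \in G1 -> etl z != sg j' x.
  by case/imsetP => c; rewrite inE => /andP[_ cx] -> /=; rewrite /etl /= (inj_eq perm_inj) -val_eqE /= ltn_eqF.
have h1 z : z \in G1 -> ehd z != sg j' y.
  case/imsetP => c; rewrite inE => /andP[yc _] -> /=; rewrite /ehd /= (inj_eq perm_inj) -val_eqE /=.
  by rewrite /bump leq0n add1n gtn_eqF // ltnS.
have it1 : {in G1 &, injective etl}.
  by move=> _ _ /imsetP[c _ ->] /imsetP[d _ ->]; rewrite /etl /= => /perm_inj/(congr1 val)/= /val_inj ->.
have ih1 : {in G1 &, injective ehd}.
  by move=> _ _ /imsetP[c _ ->] /imsetP[d _ ->]; rewrite /ehd /= => /perm_inj/lift_inj ->.
apply: (Lam_cyclic erevK etl_rev ebd_rev erev_neq t0 tinj etl_neq chains_tight_free (G := G)).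
- exact: edges_oriented.
- by apply/subsetP => z; rewrite !inE => /orP[/eqP -> //|/imsetP[c _ ->]].
- by apply/set0Pn; exists e0; rewrite !inE eqxx.
apply: uniq_perm.
- rewrite map_inj_in_uniq ?enum_uniq // => z1 z2; rewrite !mem_enum /G ![_ \in _ |: _]in_setU1.
  move=> /predU1P[->|z1G] /predU1P[->|z2G] //; rewrite ?te0.
  + by move/eqP; rewrite eq_sym (negbTE (t1 _ z2G)).
  + by move/eqP; rewrite (negbTE (t1 _ z1G)).
  exact: it1.
- rewrite map_inj_in_uniq ?enum_uniq // => z1 z2; rewrite !mem_enum /G ![_ \in _ |: _]in_setU1.
  move=> /predU1P[->|z1G] /predU1P[->|z2G] //; rewrite ?he0.
  + by move/eqP; rewrite eq_sym (negbTE (h1 _ z2G)).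
  + by move/eqP; rewrite (negbTE (h1 _ z1G)).
  exact: ih1.
move=> z; transitivity ((y <= (sg j')^-1%g z)%N && ((sg j')^-1%g z <= x)%N).
  apply/mapP/andP => [[e]|[yz]].
    rewrite mem_enum in_setU1 => /predU1P[->|/imsetP[c + ->]] ->; first by rewrite te0 permK leqnn ltnW.
    by rewrite inE => /andP[yc cx]; rewrite /etl /= permK /= yc ltnW.
  rewrite leq_eqVlt => /orP[/eqP zx|zx].
    by exists e0; rewrite ?mem_enum ?setU11 // te0 -(val_inj zx) permKV.
  have zm : ((sg j')^-1%g z < m)%N by apply: leq_trans zx _; rewrite -ltnS ltn_ord.
  exists (j', Ordinal zm, true); last by rewrite /etl /= -[z in LHS](permKV (sg j')); congr (sg j' _); apply: val_inj.
  by rewrite mem_enum in_setU1; apply/orP; right; apply: imset_f; rewrite inE /= yz.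
symmetry; apply/mapP/andP => [[e]|[]].
  rewrite mem_enum in_setU1 => /predU1P[->|/imsetP[c + ->]] ->; first by rewrite he0 permK leqnn ltnW.
  by rewrite inE => /andP[yc cx]; rewrite /ehd /= permK /= /bump leq0n add1n cx ltnW.
rewrite leq_eqVlt => /orP[/eqP yz|yz] zx.
  by exists e0; rewrite ?mem_enum ?setU11 // he0 (val_inj yz) permKV.
have zm : (((sg j')^-1%g z).-1 < m)%N.
  by rewrite -ltnS prednK ?ltn_ord // (leq_ltn_trans _ yz).
have E : (((sg j')^-1%g z).-1.+1 = (sg j')^-1%g z)%N by rewrite prednK // (leq_ltn_trans _ yz).
exists (j', Ordinal zm, true); last first.
  rewrite /ehd /= -[z in LHS](permKV (sg j')); congr (sg j' _); apply: val_inj.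
  by rewrite /= /bump leq0n add1n E.
rewrite mem_enum in_setU1; apply/orP; right; apply: imset_f; rewrite inE /=.
by rewrite -[X in _ && X]/(((sg j')^-1%g z).-1.+1 <= x)%N E zx andbT -ltnS E.
Qed.

(** The k constraints on one pair of neighbours are parallel, and only one with the largest bound
    can be tight. It is unique by genericity, since two equal bounds would give a tight cycle of
    length two. The remaining m constraints are independent and the sum factors. *)
Lemma lam_eq s : (forall j, sg j = s) -> lam = chamber s.
Proof.
move=> sE; pose b j a : R := w (j, s (lo a)) - w (j, s (hi a)).
pose j0 : 'I_k := Ordinal kp.
pose best a : 'I_k := [arg max_(j > j0) b j a]%O.
have bestP a j : b j a <= b (best a) a by rewrite /best; case: arg_maxP => // i _; apply.
pose J : {set X} := [set (best a, a, true) | a : 'I_m].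
have JE : J \subset edges by apply/subsetP => _ /imsetP[a _ ->]; rewrite inE.
have ebdE j a : ebd (j, a, true) = b j a by rewrite /ebd /etl /ehd /= sE.
have uniqb j a : b j a = b (best a) a -> j = best a.
  move=> E; apply/eqP/negPn/negP => ne.
  pose e1 : X := (j, a, true); pose e2 : X := (best a, a, false).
  case: (@chains_tight_free [set e1; e2]).
  - by apply/set0Pn; exists e1; rewrite !inE eqxx.
  - apply/forall_inP => x; rewrite !inE => /orP[] /eqP ->; rewrite /erev /e1 /e2 /= !xpair_eqE /=.
      by rewrite (negbTE ne) /= andbF.
    by rewrite eq_sym (negbTE ne) /= andbF.
  - have E12 : e1 \notin [set e2] by rewrite inE /e1 /e2 !xpair_eqE andbF.
    have pe : perm_eq (enum [set e1; e2]) [:: e1; e2].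
      apply: uniq_perm; rewrite ?enum_uniq //=; first by rewrite inE andbT -in_set1.
      by move=> x; rewrite mem_enum !inE.
    rewrite /cyc (permPl (perm_map _ pe)) perm_sym (permPl (perm_map _ pe)) /= /etl /ehd /= !sE.
    by rewrite -cat1s -[X in perm_eq _ X]cat1s perm_catC.
  exists (fun i => if ((s^-1)%g i <= a)%N then b j a else 0) => x.
  rewrite !inE => /orP[] /eqP ->; rewrite /slack /ebd /etl /ehd /= !sE !permK /= /bump leq0n add1n leqnn ltnn.
    by rewrite subr0 subrr.
  by rewrite E /b; lra.
rewrite /lam /Lam.
rewrite (eq_bigl (fun I : {set X} => (I \subset J) && (set0 \subset I))); last first.
  move=> I; rewrite sub0set andbT; apply/andP/idP => [[IE /asboolP[u [uC uI]]]|IJ].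
    apply/subsetP => -[[j a] c] xI; have := subsetP IE _ xI; rewrite inE /= => c1.
    move: xI; rewrite c1 => xI; apply/imsetP; exists a => //; congr (_, _, _); apply: uniqb.
    have := uI _ xI; have := uC (best a, a, true); rewrite inE => /(_ isT).
    rewrite /slack !ebdE /etl /ehd /= !sE => h1 h2.
    apply/eqP; rewrite eq_le bestP /=; lra.
  split; first exact: subset_trans IJ JE.
  apply/asboolP; exists (fun i => - \sum_(c < m | (c < (s^-1)%g i)%N) b (best c) c).
  have sl j a : slack etl ehd ebd (fun i => - \sum_(c < m | (c < (s^-1)%g i)%N) b (best c) c) (j, a, true) =
      b (best a) a - b j a.
    rewrite /slack ebdE /etl /ehd /= sE !permK /= /bump leq0n add1n.
    rewrite [X in _ - - X](_ : _ = b (best a) a + \sum_(c < m | (c < a)%N) b (best c) c).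
      by rewrite opprK addrCA addNr addr0.
    rewrite (bigD1 a) ?ltnS //=; congr (_ + _); apply: eq_bigl => c; rewrite ltnS leq_eqVlt -val_eqE /=; case: ltngtP => //=; by rewrite ?andbF ?andbT.
  split=> x xI.
    move: xI; rewrite inE; case: x => [[j a] c] /= ->; rewrite sl subr_ge0; exact: bestP.
  by have /imsetP[a _ ->] := subsetP IJ _ xI; rewrite sl subrr.
rewrite sum_subset_prod ?sub0set // big_set0 mul1r setD0 big_imset /=; last by move=> a c _ _ [].
apply: eq_bigr => a _.
have := ratio_neq1 t0 tinj etl_neq (best a, a, true).
rewrite /ratio /etl /ehd /= !sE; move: (_ / _) => r r1; by field.
Qed.

End ChainSystem.

Section UpolyClosure.
Variables (R : realFieldType) (m : nat).
Implicit Types X Y : (nat -> R) -> Prop.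

Lemma upoly_iff X Y : (forall x, X x <-> Y x) -> upoly m X -> upoly m Y.
Proof. by move=> E [L HL]; exists L => x; split=> [/E/HL|/HL/E]. Qed.

Lemma upoly_bool (b : bool) : upoly m (fun _ : nat -> R => b).
Proof. by exists (if b then [:: [::]] else [::]) => x; case: b. Qed.

Lemma upoly_and X Y : upoly m X -> upoly m Y -> upoly m (fun x => X x /\ Y x).
Proof.
move=> [L HL] [K HK]; exists [seq C ++ D | C <- L, D <- K] => x; rewrite HL HK.
split=> [[/hasP[C CL sC] /hasP[D DK sD]]|/hasP[E /allpairsP[[C D] /= [CL DK ->]]]].
  apply/hasP; exists (C ++ D); first by apply/allpairsP; exists (C, D).
  by rewrite /sat all_cat; apply/andP.
rewrite /sat all_cat => /andP[sC sD].
by split; apply/hasP; [exists C|exists D].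
Qed.

Lemma upoly_or X Y : upoly m X -> upoly m Y -> upoly m (fun x => X x \/ Y x).
Proof.
move=> [L HL] [K HK]; exists (L ++ K) => x; rewrite has_cat HL HK.
by split=> [[->//|->]|/orP//]; rewrite orbT.
Qed.

Lemma upoly_all (T : finType) (X : T -> (nat -> R) -> Prop) :
  (forall i, upoly m (X i)) -> upoly m (fun x => forall i, X i x).
Proof.
move=> H; apply: (@upoly_iff (fun x => forall i, i \in enum T -> X i x)).
  by move=> x; split=> Hx i; [apply: Hx; rewrite mem_enum|].
elim: (enum T) => [|i s IH].
  by apply: upoly_iff (upoly_bool true).
apply: upoly_iff (upoly_and (H i) IH) => x; split=> [[Xi Xs] j|Hx].
  by rewrite inE => /orP[/eqP -> //|/Xs].
by split=> [|j js]; apply: Hx; rewrite inE ?eqxx ?js ?orbT.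
Qed.

Lemma upoly_ex (T : finType) (X : T -> (nat -> R) -> Prop) :
  (forall i, upoly m (X i)) -> upoly m (fun x => exists i, X i x).
Proof.
move=> H; apply: (@upoly_iff (fun x => exists2 i, i \in enum T & X i x)).
  by move=> x; split=> [[i _ Xi]|[i Xi]]; exists i => //; rewrite mem_enum.
elim: (enum T) => [|i s IH].
  by apply: upoly_iff (upoly_bool false) => x; split=> // -[].
apply: upoly_iff (upoly_or (H i) IH) => x; split=> [[Xi|[j js Xj]]|[j]].
- by exists i => //; rewrite inE eqxx.
- by exists j => //; rewrite inE js orbT.
by rewrite inE => /orP[/eqP ->|js]; [left|right; exists j].
Qed.

Lemma upoly_diff (e i : 'I_m) (c : R) : upoly m (fun x => c <= x i - x e).
Proof.
exists [:: [:: ((fun a : nat => (a == i :> nat)%:R - (a == e :> nat)%:R), c)]] => x.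
have one (j : 'I_m) : \sum_(a < m) (a == j :> nat)%:R * x a = x j.
  by rewrite (bigD1 j) //= eqxx mul1r big1 ?addr0 // => a /negbTE; rewrite -val_eqE => ->; rewrite mul0r.
rewrite /sat /= orbF andbT /holds /=; suff -> : lform m (fun a => (a == i :> nat)%:R - (a == e :> nat)%:R) x = x i - x e by [].
by rewrite /lform -!one -sumrB; apply: eq_bigr => a _; rewrite mulrBl.
Qed.

Lemma upoly_diff0 (e i : 'I_m) (c : R) : upoly m (fun x => x i - x e - c = 0).
Proof.
apply: upoly_iff (upoly_and (upoly_diff e i c) (upoly_diff i e (- c))) => x; split.
  by move=> [h1 h2]; apply/eqP; rewrite eq_le; apply/andP; split; lra.
by move/eqP; rewrite eq_le => /andP[h1 h2]; split; lra.
Qed.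

End UpolyClosure.

(** * The face sum as a sum over orderings *)

Section Localization.
Variables (R : realType) (F : fieldType) (k m : nat) (w : {ffun 'I_k * 'I_m.+1 -> R}).
Variables (M : 'I_k -> matroid 'I_m.+1) (V : 'I_k -> F) (t : 'I_m.+1 -> F).
Hypotheses (kp : (0 < k)%N) (gw : generic_pair w) (t0 : forall i, t i != 0) (tinj : injective t).
Local Notation P := ('I_k * 'I_m.+1)%type.
Local Notation X := ('I_k * 'I_m * bool)%type.
Local Notation charts := {ffun 'I_k -> {perm 'I_m.+1}}.

Definition shifted (u : 'I_m.+1 -> R) (j : 'I_k) i : R := u i - w (j, i).

Definition active u (p : P) : bool :=
  ~~ spn (M p.1) [set e | shifted u p.1 p.2 < shifted u p.1 e] p.2.

Definition ordering (s : {perm 'I_m.+1}) : seq 'I_m.+1 := [seq s i | i <- enum 'I_m.+1].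

Definition face_term (G : {set P}) : F :=
  \prod_(p in G) (V p.1 * t p.2) * \prod_(p in ~: G) (1 - V p.1 * t p.2).

Lemma sum_face_term (A : {set P}) :
  \sum_(G : {set P} | G \subset A) face_term G = \prod_(p in ~: A) (1 - V p.1 * t p.2).
Proof.
rewrite (eq_bigr (fun G : {set P} => \prod_p (if p \in G then V p.1 * t p.2 else 1 - V p.1 * t p.2))); last first.
  move=> G _; rewrite /face_term [RHS](bigID (mem G)) /=; congr (_ * _); first by apply: eq_bigr => p ->.
  by rewrite (eq_bigl (fun p => p \notin G)) => [|p]; [apply: eq_bigr => p /negbTE ->|rewrite inE].
pose f (p : P) := if p \in A then V p.1 * t p.2 else 0.
have -> : \prod_(p in ~: A) (1 - V p.1 * t p.2) = \prod_p (f p + (1 - V p.1 * t p.2)).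
  rewrite [RHS](bigID (mem A)) /= [X in _ = X * _]big1 => [|p pA]; last by rewrite /f pA addrC subrK.
  rewrite mul1r; apply: eq_big => p; first by rewrite inE.
  by rewrite /f inE => /negbTE ->; rewrite add0r.
rewrite bigA_distr [RHS](bigID (fun G : {set P} => G \subset A)) /= [X in _ + X]big1 ?addr0.
  apply: eq_bigr => G /subsetP GA; apply: eq_bigr => p _; case: ifP => // /GA pA.
  by rewrite /f pA.
move=> G /subsetPn[p pG pA]; apply/eqP/prodf_eq0; exists p => //.
by rewrite pG /f (negbTE pA).
Qed.

Lemma ordering_perms (f : seq 'I_m.+1 -> F) l : perm_eq l (enum 'I_m.+1) ->
  \sum_(s <- insertion_perms l) f s = \sum_(s : {perm 'I_m.+1}) f (ordering s).
Proof.
move=> pl; have ul : uniq l by rewrite (perm_uniq pl) enum_uniq.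
transitivity (\sum_(s <- [seq ordering s | s <- enum {: {perm 'I_m.+1}}]) f s); last first.
  by rewrite big_map big_enum.
apply: perm_big; apply: uniq_perm; first exact: insertion_perms_uniq.
  rewrite map_inj_uniq ?enum_uniq // => s s' E; apply/permP => i.
  by have /eq_in_map := E; apply; rewrite mem_enum.
move=> s; rewrite mem_insertion_perms //; apply/idP/mapP => [ps|[g _ ->]].
  have ps' : perm_eq s (enum 'I_m.+1) by apply: perm_trans ps pl.
  have us : uniq s by rewrite (perm_uniq ps') enum_uniq.
  have ss : size s = m.+1 by rewrite (perm_size ps') size_enum_ord.
  have gi : injective (fun i : 'I_m.+1 => nth ord0 s i).
    by move=> i i' /eqP; rewrite nth_uniq ?ss ?ltn_ord // => /eqP/val_inj.
  exists (perm gi); first by rewrite mem_enum.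
  apply: (@eq_from_nth _ ord0); first by rewrite size_map size_enum_ord.
  move=> a; rewrite ss => am; rewrite (nth_map ord0) ?size_enum_ord // permE.
  by rewrite nth_enum_ord.
apply: (@perm_trans _ (enum 'I_m.+1)); last by rewrite perm_sym.
apply: uniq_perm; rewrite ?enum_uniq //.
  by rewrite map_inj_uniq ?enum_uniq //; apply: perm_inj.
by move=> i; rewrite mem_enum; apply/mapP; exists (g^-1 i)%g; rewrite ?mem_enum ?permKV.
Qed.

Lemma steps_nth (v : 'I_m.+1 -> R) x0 y l :
  steps t v (Some y) l = \prod_(a < size l) step t v (nth x0 (y :: l) a) (nth x0 l a).
Proof.
elim: l y => [|z l IH] y; first by rewrite big_ord0.
by rewrite /= big_ord_recl /= IH.
Qed.

Lemma steps_ordering (v : 'I_m.+1 -> R) (s : {perm 'I_m.+1}) :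
  steps t v None (ordering s) = \prod_(a < m) step t v (s (lo a)) (s (hi a)).
Proof.
have so : size (ordering s) = m.+1 by rewrite size_map size_enum_ord.
case E : (ordering s) => [|y l]; first by move: so; rewrite E.
have sl : size l = m by move: so; rewrite E => -[].
rewrite /= mul1r (steps_nth _ ord0); rewrite -E.
have nE (i : 'I_m.+1) : nth ord0 (ordering s) i = s i.
  by rewrite (nth_map ord0) ?size_enum_ord // nth_ord_enum.
transitivity (\prod_(a < m) step t v (nth ord0 (ordering s) a) (nth ord0 l a)).
  by rewrite sl.
apply: eq_bigr => a _; congr (step _ _ _ _); first by rewrite -(nE (lo a)).
by rewrite -(nE (hi a)) E.
Qed.

(** The factor at a tie is 1 + ratio/(1 - ratio). Expanding writes the product as a combination of
    indicator functions of closed polyhedra, to which the Euler characteristic applies. *)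
Lemma prod_steps (sg : charts) (u : 'I_m.+1 -> R) :
  \prod_j steps t (shifted u j) None (ordering (sg j)) =
  \sum_(I : {set X} | I \subset edges k m)
    (\prod_(x in I) (ratio (etl sg) (ehd sg) t x / (1 - ratio (etl sg) (ehd sg) t x))) *+
    `[< (forall x, x \in edges k m -> 0 <= slack (etl sg) (ehd sg) (ebd w sg) u x) /\
        (forall x, x \in I -> slack (etl sg) (ehd sg) (ebd w sg) u x = 0) >].
Proof.
have slE j a : slack (etl sg) (ehd sg) (ebd w sg) u (j, a, true) =
    shifted u j (sg j (lo a)) - shifted u j (sg j (hi a)).
  by rewrite /slack /ebd /etl /ehd /shifted /=; ring.
have -> : \prod_j steps t (shifted u j) None (ordering (sg j)) =
   \prod_(x in edges k m) step t (shifted u x.1.1) (sg x.1.1 (lo x.1.2)) (sg x.1.1 (hi x.1.2)).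
  under eq_bigr => j _ do rewrite steps_ordering.
  rewrite pair_bigA /= [RHS](reindex_onto (fun x => (x, true)) (fun x : X => x.1)) /=; last first.
    by move=> [x b]; rewrite inE /= => ->.
  by apply: eq_bigl => x; rewrite inE eqxx.
case: (pselect (forall x, x \in edges k m -> 0 <= slack (etl sg) (ehd sg) (ebd w sg) u x)) => [pos|N]; last first.
  rewrite [RHS]big1 => [|I _]; last by rewrite asboolF // => -[].
  move/existsNP: N => [[[j a] b] /not_implyP[xe /negP]]; rewrite -ltNge => neg.
  apply/eqP/prodf_eq0; exists (j, a, b) => //; move: xe neg; rewrite inE /= => ->.
  by rewrite slE subr_lt0 /step => ->.
pose Ti := [set x in edges k m | slack (etl sg) (ehd sg) (ebd w sg) u x == 0].
have TE : Ti \subset edges k m by apply/subsetP => x; rewrite inE => /andP[].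
transitivity (\sum_(I : {set X} | (I \subset Ti) && (set0 \subset I))
    \prod_(x in I) (ratio (etl sg) (ehd sg) t x / (1 - ratio (etl sg) (ehd sg) t x))).
  rewrite sum_subset_prod ?sub0set // big_set0 mul1r setD0.
  rewrite (bigID (fun x => slack (etl sg) (ehd sg) (ebd w sg) u x == 0)) /=.
  rewrite [X in _ * X]big1 ?mulr1.
    apply: eq_big => [x|x /andP[xe /eqP]]; first by rewrite !inE.
    have := @ratio_neq1 F _ _ _ _ t t0 tinj (@etl_neq k m sg) x.
    move: x xe => [[j a] b]; rewrite inE /= => ->; rewrite slE /ratio /etl /ehd /= => r1 /eqP.
    rewrite subr_eq0 => /eqP E; rewrite /step E ltxx; move: r1; move: (_ / _) => r r1.
    by field.
  move=> [[j a] b] /andP[]; rewrite inE /= => -> ne.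
  have := pos (j, a, true); rewrite inE => /(_ isT); rewrite le_eqVlt eq_sym (negbTE ne) /=.
  by rewrite slE subr_gt0 /step => lt; rewrite ltNge (ltW lt) /= lt.
rewrite [RHS](bigID (fun I : {set X} => I \subset Ti)) /= [X in _ = _ + X]big1 ?addr0; last first.
  move=> I /andP[IE /subsetPn[x xI xT]]; rewrite asboolF // => -[_ /(_ x xI) z].
  by move/negP: xT; apply; rewrite inE (subsetP IE) //= z.
apply: eq_big => [I|I /andP[IT _]].
  by rewrite sub0set andbT; apply/idP/andP => [IT|[]//]; split=> //; apply: subset_trans IT TE.
rewrite asboolT //; split=> // x xI; have := subsetP IT _ xI.
by rewrite inE => /andP[_ /eqP].
Qed.

(** For fixed u the faces inside the active set sum to the product of 1 - V_j t_i over the inactive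
    elements. [telescope_perms] expands this row by row, and distributing over the rows yields
    tuples of orderings. *)
Lemma local_identity (u : 'I_m.+1 -> R) :
  \sum_(G : {set P}) face_term G *+ `[< forall p, p \in G -> active u p >] =
  \sum_(sg : charts) (\prod_j nonbasis (M j) (V j) t set0 (ordering (sg j))) *
    \prod_j steps t (shifted u j) None (ordering (sg j)).
Proof.
pose A := [set p | active u p].
have -> : \sum_(G : {set P}) face_term G *+ `[< forall p, p \in G -> active u p >] =
    \sum_(G : {set P} | G \subset A) face_term G.
  rewrite [RHS]big_mkcond; apply: eq_bigr => G _.
  have -> : `[< forall p, p \in G -> active u p >] = (G \subset A).
    apply/asboolP/subsetP => H p /H; by rewrite inE.
  by case: ifP; rewrite ?mulr0n ?mulr1n.
rewrite sum_face_term.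
under [RHS]eq_bigr => sg _ do rewrite -big_split /=.
rewrite -(bigA_distr_bigA (fun j s => nonbasis (M j) (V j) t set0 (ordering s) *
    steps t (shifted u j) None (ordering s))).
rewrite (eq_bigl (fun p => ~~ active u p)); last by move=> p; rewrite !inE.
rewrite big_mkcond /= -(pair_bigA _ (fun j i => if ~~ active u (j, i) then 1 - V j * t i else 1)) /=.
apply: eq_bigr => j _; pose l := sort (fun x y => shifted u j x <= shifted u j y) (enum 'I_m.+1).
have pl : perm_eq l (enum 'I_m.+1) by rewrite perm_sort.
rewrite -(ordering_perms (fun s => nonbasis (M j) (V j) t set0 s * steps t (shifted u j) None s) pl).
rewrite telescope_perms ?(perm_uniq pl) ?enum_uniq //; last first.
  by apply: sort_sorted => x y; apply: le_total.
rewrite (perm_big _ pl) /= big_enum /=; apply: eq_bigr => i _; rewrite negbK /=.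
congr (if spn _ _ _ then _ else _); apply/setP => e; rewrite !inE (perm_mem pl) mem_enum //.
Qed.

(** Fixing a set that contains everything above an element but does not span it gives a polyhedron;
    the union of these is stable under the operation of [minplus]. *)
Lemma good_active (G : {set P}) :
  good m.+1 (fun x => forall p, p \in G -> active (fun i : 'I_m.+1 => x i) p).
Proof.
apply: upoly_good.
  pose T := {p : P | p \in G}.
  apply: (@upoly_iff _ _ (fun x => forall p : T, exists S : {set 'I_m.+1},
    ~~ spn (M (val p).1) S (val p).2 /\ forall e, (e \in S) \/
      (- (w ((val p).1, e) - w (val p)) <= x (val p).2 - x e))).
    move=> x; split=> [H p pG|H p].
      have [S [nS Sx]] := H (exist _ p pG); apply: contra nS => /= sp.
      apply: spn_trans sp => e; rewrite inE => lt; apply: spn_mem.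
      have [//|] := Sx e; move: lt; rewrite /shifted /= -surjective_pairing.
      set a := x _; set b := x _; move: (w _) (w _) => c d; lra.
    exists [set e | shifted (fun i : 'I_m.+1 => x i) (val p).1 (val p).2 < shifted (fun i : 'I_m.+1 => x i) (val p).1 e].
    split; first exact: (H (val p) (valP p)).
    move=> e; rewrite inE; have [lt|le] := ltP; first by left.
    right; move: le; rewrite /shifted -surjective_pairing.
    set a := x _; set b := x _; move: (w _) (w _) => c d; lra.
  apply: upoly_all => p; apply: upoly_ex => S; apply: upoly_and; first exact: upoly_bool.
  apply: upoly_all => e; apply: upoly_or; first exact: upoly_bool.
  exact: upoly_diff.
apply: minplus_fibre => x y s Hx Hy s0 p pG.
have [le|lt] := leP (x p.2) (y p.2 + s).
  apply: contra (Hx p pG); apply: spnS; apply/subsetP => e; rewrite !inE /shifted (min_l le).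
  by move=> lt; apply: lt_le_trans lt _; rewrite lerD2r ge_min lexx.
apply: contra (Hy p pG); apply: spnS; apply/subsetP => e; rewrite !inE /shifted (min_r (ltW lt)).
have : Num.min (x e) (y e + s) <= y e + s by rewrite ge_min lexx orbT.
by move: (Num.min (x e) _) (w _) (w _) => a b c; lra.
Qed.

Lemma good_chains (sg : charts) (I : {set X}) :
  good m.+1 (fun x => (forall e, e \in edges k m -> 0 <= slack (etl sg) (ehd sg) (ebd w sg) (fun i : 'I_m.+1 => x i) e) /\
    (forall e, e \in I -> slack (etl sg) (ehd sg) (ebd w sg) (fun i : 'I_m.+1 => x i) e = 0)).
Proof.
apply: upoly_good.
  apply: upoly_and; last first.
    pose T := {e : X | e \in I}.
    apply: (@upoly_iff _ _ (fun x => forall e : T, x (etl sg (val e)) - x (ehd sg (val e)) - ebd w sg (val e) = 0)).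
      by move=> x; split=> [H e eI|H e]; [apply: (H (exist _ e eI))|apply: H; apply: valP].
    by apply: upoly_all => e; apply: upoly_diff0.
  pose T := {e : X | e \in edges k m}.
  apply: (@upoly_iff _ _ (fun x => forall e : T, ebd w sg (val e) <= x (etl sg (val e)) - x (ehd sg (val e)))).
    move=> x; split=> [H e eI|H e]; first by rewrite subr_ge0; apply: (H (exist _ e eI)).
    by rewrite -subr_ge0; apply: (H (val e) (valP e)).
  by apply: upoly_all => e; apply: upoly_diff.
apply: convex_fibre => x y l [x1 x2] [y1 y2] /andP[l0 l1].
have E e : slack (etl sg) (ehd sg) (ebd w sg) (fun i : 'I_m.+1 => l * x i + (1 - l) * y i) e =
   l * slack (etl sg) (ehd sg) (ebd w sg) (fun i : 'I_m.+1 => x i) e +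
   (1 - l) * slack (etl sg) (ehd sg) (ebd w sg) (fun i : 'I_m.+1 => y i) e.
  by rewrite /slack; ring.
split=> e eI; rewrite E; last by rewrite x2 // y2 // !mulr0 addr0.
by rewrite addr_ge0 // mulr_ge0 ?x1 ?y1 // subr_ge0.
Qed.

Lemma activeE (u : {ffun 'I_m.+1 -> R}) p :
  active u p = (p.2 \notin loops (initial (u - weight w p.1) (M p.1))).
Proof.
rewrite nonloopP /active; congr (~~ spn _ _ _); apply/setP => e.
by rewrite !inE !ffunE; case: p.
Qed.

(** Integration of [local_identity] over u turns the left side into the sum over the faces and the
    right side into a sum of the numbers [lam], which vanish off the diagonal. *)
Lemma ext_localization :
  \sum_(G in ext_faces w M) face_term G =
  \sum_(s : {perm 'I_m.+1}) (\prod_j nonbasis (M j) (V j) t set0 (ordering s)) * chamber t s.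
Proof.
pose N (sg : charts) := \prod_j nonbasis (M j) (V j) t set0 (ordering (sg j)).
pose W (sg : charts) (I : {set X}) :=
  \prod_(x in I) (ratio (etl sg) (ehd sg) t x / (1 - ratio (etl sg) (ehd sg) t x)).
(* One index type for the sets on both sides, so that [euler_good] applies to their difference. *)
pose Bt : finType := ({set P} + charts * {set X})%type.
pose a (b : Bt) : F := match b with inl G => face_term G
  | inr (sg, K) => if K \subset edges k m then - (N sg * W sg K) else 0 end.
pose D (b : Bt) (x : nat -> R) : Prop := match b with
  | inl G => forall p, p \in G -> active (fun i : 'I_m.+1 => x i) p
  | inr (sg, K) => (forall e, e \in edges k m -> 0 <= slack (etl sg) (ehd sg) (ebd w sg) (fun i : 'I_m.+1 => x i) e) /\
    (forall e, e \in K -> slack (etl sg) (ehd sg) (ebd w sg) (fun i : 'I_m.+1 => x i) e = 0) end.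
have gD b : good m.+1 (D b) by case: b => [G|[sg I]]; [apply: good_active|apply: good_chains].
have spl (c : Bt -> bool) : \sum_b a b *+ c b = \sum_G face_term G *+ c (inl G) -
    \sum_(sg : charts) N sg * \sum_(I : {set X} | I \subset edges k m) W sg I *+ c (inr (sg, I)).
  rewrite big_sumType /=; congr (_ + _); rewrite -sumrN.
  transitivity (\sum_(sg : charts) \sum_(I : {set X})
      (if I \subset edges k m then - (N sg * W sg I) else 0) *+ c (inr (sg, I))).
    by rewrite pair_bigA; apply: eq_bigr => -[].
  apply: eq_bigr => sg _; rewrite mulr_sumr -sumrN [RHS]big_mkcond; apply: eq_bigr => I _.
  by case: ifP => _; rewrite ?mul0rn // mulNrn mulrnAr.
have := euler_good gD (a := a); rewrite spl => /(_ _)/eqP; rewrite subr_eq0 => H.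
have {}H : \sum_G face_term G *+ `[< exists x, D (inl G) x >] =
   \sum_(sg : charts) N sg * \sum_(I : {set X} | I \subset edges k m) W sg I *+ `[< exists x, D (inr (sg, I)) x >].
  apply/eqP/H => x; rewrite spl; apply/eqP; rewrite subr_eq0; apply/eqP.
  rewrite (local_identity (fun i : 'I_m.+1 => x i)); apply: eq_bigr => sg _; congr (_ * _).
  exact: prod_steps.
have -> : \sum_(G in ext_faces w M) face_term G = \sum_G face_term G *+ `[< exists x, D (inl G) x >].
  rewrite big_mkcond; apply: eq_bigr => G _; rewrite inE.
  have -> : `[< ext_face w M G >] = `[< exists x, D (inl G) x >].
    apply: asbool_equiv_eq; split=> [[u Hu]|[x Hx]].
      exists (fun a => u (inord a)) => p pG.
      have -> : (fun i : 'I_m.+1 => u (inord i)) = u by apply: funext => i; rewrite inord_val.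
      by rewrite activeE Hu.
    exists [ffun i : 'I_m.+1 => x i] => p pG; rewrite -activeE.
    have -> : ([ffun i : 'I_m.+1 => x i] : {ffun 'I_m.+1 -> R}) = (fun i : 'I_m.+1 => x i) :> (_ -> _).
      by apply: funext => i; rewrite ffunE.
    exact: Hx.
  by case: ifP.
rewrite H; pose j0 : 'I_k := Ordinal kp.
have LE (sg : charts) : \sum_(I : {set X} | I \subset edges k m) W sg I *+ `[< exists x, D (inr (sg, I)) x >] = lam w t sg.
  rewrite /lam /Lam big_mkcondr /=; apply: eq_bigr => I _.
  have -> : `[< exists x, D (inr (sg, I)) x >] = `[< feas (etl sg) (ehd sg) (ebd w sg) (edges k m) I >].
    apply: asbool_equiv_eq; split=> [[x Hx]|[u Hu]]; first by exists (fun i : 'I_m.+1 => x i).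
    exists (fun a => u (inord a)); rewrite /D.
    by have -> : (fun i : 'I_m.+1 => u (inord i)) = u by apply: funext => i; rewrite inord_val.
  by case: ifP.
under eq_bigr => sg _ do rewrite LE.
rewrite (bigID (fun sg : charts => sg == [ffun=> sg j0])) /= [X in _ + X]big1 ?addr0; last first.
  move=> sg ne; have [j /eqP jj] : exists j, sg j <> sg j0.
    apply/existsNP => E; case/eqP: ne; apply/ffunP => j; rewrite ffunE; exact: E.
  by rewrite (@lam_neq _ _ _ _ w t sg kp gw t0 tinj _ _ jj) mulr0.
rewrite (reindex_onto (fun s => [ffun=> s]) (fun sg : charts => sg j0)) /=; last by move=> sg /eqP.
apply: eq_big => [s|s _]; first by rewrite !ffunE !eqxx.
rewrite (@lam_eq _ _ _ _ w t _ kp gw t0 tinj s) => [|j]; last by rewrite ffunE.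
by congr (_ * _); apply: eq_bigr => j _; rewrite ffunE.
Qed.

End Localization.

(** * Formal sums over cones *)

Section FormalSums.
Variables (F : fieldType) (n : nat).
Local Notation char := {ffun 'I_n -> int}.
Variable Q : char -> F.
Hypotheses (Q0 : Q 0 = 1) (QD : forall a b, Q (a + b) = Q a * Q b).
Implicit Types (f g : char -> F) (a b c : char).

Lemma QN a : Q (- a) = (Q a)^-1.
Proof.
have E : Q (- a) * Q a = 1 by rewrite -QD addNr Q0.
have /unitrP : exists y, y * Q a = 1 /\ Q a * y = 1 by exists (Q (- a)); rewrite [Q a * _]mulrC E.
by move=> u; rewrite -[LHS](mulrK u) E mul1r.
Qed.

Lemma Q_neq0 a : Q a != 0.
Proof.
apply/eqP => E; have := QD (- a) a.
by rewrite addNr Q0 E mulr0 => /eqP; rewrite oner_eq0.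
Qed.

(** [Q] is evaluated at [- a] because the function t^a has weight -a. *)
Definition fin_sum f (x : F) : Prop :=
  exists2 S : seq char, uniq S & (forall a, f a != 0 -> a \in S) /\ x = \sum_(a <- S) f a * Q (- a).

Lemma fin_sum_sub f (S T : seq char) : uniq S -> uniq T -> {subset S <= T} ->
  (forall a, f a != 0 -> a \in S) -> \sum_(a <- T) f a * Q (- a) = \sum_(a <- S) f a * Q (- a).
Proof.
move=> uS uT ST fS; rewrite (bigID (mem S)) /= [X in _ + X]big1 ?addr0 => [|a aS]; last first.
  have [->|/fS aS'] := eqVneq (f a) 0; first by rewrite mul0r.
  by rewrite aS' in aS.
rewrite -big_filter; apply: perm_big; apply: uniq_perm; rewrite ?filter_uniq //.
by move=> a; rewrite mem_filter; case: (boolP (a \in S)) => //= /ST ->.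
Qed.

Lemma fin_sum_on f x (T : seq char) : fin_sum f x -> uniq T ->
  (forall a, f a != 0 -> a \in T) -> x = \sum_(a <- T) f a * Q (- a).
Proof.
move=> [S uS [fS ->]] uT fT; pose Z := undup (S ++ T).
rewrite -(@fin_sum_sub f S Z) ?undup_uniq // ?(@fin_sum_sub f T Z) ?undup_uniq //.
  by move=> a aT; rewrite mem_undup mem_cat aT orbT.
by move=> a aT; rewrite mem_undup mem_cat aT.
Qed.

Lemma fin_sum_uniq f x y : fin_sum f x -> fin_sum f y -> x = y.
Proof. by move=> fx [S uS [fS ->]]; apply: (fin_sum_on fx). Qed.

Lemma fin_sumD f g x y : fin_sum f x -> fin_sum g y -> fin_sum (fun a => f a + g a) (x + y).
Proof.
move=> fx gy; have [S uS [fS _]] := fx; have [T uT [gT _]] := gy.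
pose Z := undup (S ++ T).
have fZ a : f a != 0 -> a \in Z by move/fS; rewrite mem_undup mem_cat => ->.
have gZ a : g a != 0 -> a \in Z by move/gT; rewrite mem_undup mem_cat orbC => ->.
exists Z; first exact: undup_uniq.
split.
  move=> a; have [->|/fZ //] := eqVneq (f a) 0; rewrite add0r; exact: gZ.
rewrite (fin_sum_on fx _ fZ) ?undup_uniq // (fin_sum_on gy _ gZ) ?undup_uniq // -big_split /=.
by apply: eq_bigr => a _; rewrite mulrDl.
Qed.

Lemma fin_sum_shift f x b : fin_sum f x -> fin_sum (fun a => f (a + b)) (Q b * x).
Proof.
move=> [S uS [fS ->]]; exists [seq a - b | a <- S]; first by rewrite map_inj_uniq //; apply: addIr.
split; first by move=> a /fS H; apply/mapP; exists (a + b); rewrite ?addrK.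
rewrite big_map mulr_sumr; apply: eq_bigr => a _.
by rewrite subrK opprB QD; ring.
Qed.

Lemma fin_sumZ f x (k : F) : fin_sum f x -> fin_sum (fun a => k * f a) (k * x).
Proof.
move=> [S uS [fS ->]]; exists S => //; split.
  by move=> a H; apply: fS; apply: contraNneq H => ->; rewrite mulr0.
by rewrite mulr_sumr; apply: eq_bigr => a _; rewrite mulrA.
Qed.

(** On formal sums this is multiplication by 1 - Q b. *)
Definition dif b f : char -> F := fun a => f a - f (a + b).

Lemma fin_sum_dif f x b : fin_sum f x -> fin_sum (dif b f) ((1 - Q b) * x).
Proof.
move=> fx; have := fin_sumD fx (fin_sumZ (-1) (fin_sum_shift b fx)).
have -> : x + -1 * (Q b * x) = (1 - Q b) * x by ring.
by move=> [S uS [H ->]]; exists S => //; split=> [a|];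
  [rewrite /dif => h; apply: H; rewrite mulN1r|apply: eq_bigr => a _; rewrite /dif mulN1r].
Qed.

Definition difs (s : seq char) f := foldr dif f s.

Lemma difC b c f : dif b (dif c f) = dif c (dif b f).
Proof. by apply: funext => a; rewrite /dif [a + c + b]addrAC; ring. Qed.

Lemma dif_difs b s f : dif b (difs s f) = difs s (dif b f).
Proof. by elim: s => //= c s IH; rewrite difC IH. Qed.

Lemma difs_cat s s' f : difs (s ++ s') f = difs s (difs s' f).
Proof. by rewrite /difs foldr_cat. Qed.

Lemma difs_catC s s' f : difs (s ++ s') f = difs (s' ++ s) f.
Proof.
elim: s s' => [|b s IH] s'; first by rewrite cats0.
by rewrite /= IH !difs_cat /= !dif_difs.
Qed.

Lemma difsD s f g : difs s (fun a => f a + g a) = fun a => difs s f a + difs s g a.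
Proof. by elim: s => //= b s ->; apply: funext => a; rewrite /dif; ring. Qed.

Lemma difsZ s k f : difs s (fun a => k * f a) = fun a => k * difs s f a.
Proof. by elim: s => //= b s ->; apply: funext => a; rewrite /dif; ring. Qed.

Lemma difs_shift s b f : difs s (fun a => f (a + b)) = fun a => difs s f (a + b).
Proof. by elim: s => //= c s ->; apply: funext => a; rewrite /dif addrAC. Qed.

Definition factor (s : seq char) : F := \prod_(b <- s) (1 - Q b).

Lemma fin_sum_difs s f x : fin_sum f x -> fin_sum (difs s f) (factor s * x).
Proof.
move=> fx; elim: s => [|b s IH]; first by rewrite /factor big_nil mul1r.
by rewrite /factor big_cons -mulrA; apply: fin_sum_dif.
Qed.

(* [x] is the rational function represented by the formal sum of the f(a) Q(-a). *)
Definition rat_sum f (x : F) : Prop :=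
  exists2 s : seq char, all (fun b => Q b != 1) s & fin_sum (difs s f) (factor s * x).

Lemma factor_neq0 s : all (fun b => Q b != 1) s -> factor s != 0.
Proof.
move=> /allP H; rewrite /factor prodf_seq_neq0; apply/allP => b bs.
by rewrite /= subr_eq0 eq_sym H.
Qed.

(** Multiplication by the factors 1 - Q b is injective on values, so a finite formal sum represents
    only its own value. This justifies computing it through infinite cones. *)
Lemma rat_sum_uniq f x y : rat_sum f x -> fin_sum f y -> x = y.
Proof.
move=> [s /factor_neq0 s0 fx] /(fin_sum_difs s)/(fin_sum_uniq fx); exact: mulfI.
Qed.

Lemma rat_sumD f g x y : rat_sum f x -> rat_sum g y -> rat_sum (fun a => f a + g a) (x + y).
Proof.
move=> [s s1 fx] [r r1 gy]; exists (s ++ r); first by rewrite all_cat s1.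
rewrite difsD mulrDr /factor big_cat /=; apply: fin_sumD.
  by rewrite difs_catC difs_cat mulrAC mulrC; apply: fin_sum_difs.
by rewrite difs_cat -mulrA; apply: fin_sum_difs.
Qed.

Lemma rat_sumZ f x k : rat_sum f x -> rat_sum (fun a => k * f a) (k * x).
Proof. by move=> [s s1 fx]; exists s; rewrite // difsZ mulrCA; apply: fin_sumZ. Qed.

Lemma rat_sum_shift f x b : rat_sum f x -> rat_sum (fun a => f (a + b)) (Q b * x).
Proof. by move=> [s s1 fx]; exists s; rewrite // difs_shift mulrCA; apply: fin_sum_shift. Qed.

Lemma rat_sum0 : rat_sum (fun=> 0) 0.
Proof.
exists [::] => //; exists [::] => //; split; first by move=> a; rewrite eqxx.
by rewrite big_nil mulr0.
Qed.

Lemma rat_sum_sum (I : Type) (r : seq I) (P : pred I) (f : I -> char -> F) (x : I -> F) :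
  (forall i, P i -> rat_sum (f i) (x i)) ->
  rat_sum (fun a => \sum_(i <- r | P i) f i a) (\sum_(i <- r | P i) x i).
Proof.
move=> H; elim: r => [|i r IH].
  by rewrite big_nil; have -> : (fun a => \sum_(i <- [::] | P i) f i a) = fun=> 0
    by [apply: funext => a; rewrite big_nil]; apply: rat_sum0.
have -> : (fun a => \sum_(j <- i :: r | P j) f j a) = fun a => (if P i then f i a else 0) + \sum_(j <- r | P j) f j a.
  by apply: funext => a; rewrite big_cons; case: ifP; rewrite ?add0r.
rewrite big_cons; case: ifP => Pi.
  exact: rat_sumD (H i Pi) IH.
have -> : (fun a => 0 + \sum_(j <- r | P j) f j a) = fun a => \sum_(j <- r | P j) f j a.
  by apply: funext => a; rewrite add0r.
exact: IH.
Qed.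

(* a formal sum invariant under a nontrivial translation represents zero *)
Lemma rat_sum_periodic f b : Q b != 1 -> (forall a, f (a + b) = f a) -> rat_sum f 0.
Proof.
move=> b1 fb; exists [:: b]; first by rewrite /= b1.
rewrite mulr0 /=; exists [::] => //; split; last by rewrite big_nil.
by move=> a; rewrite /dif fb subrr eqxx.
Qed.

End FormalSums.

(** * Dual cones of the charts *)

Section ConeSums.
Variables (F : fieldType) (m : nat).
Local Notation char := {ffun 'I_m.+1 -> int}.
Local Notation chart := {perm 'I_m.+1}.
Variable t : 'I_m.+1 -> F.
Hypotheses (t0 : forall i, t i != 0) (tinj : injective t).
Implicit Types (a b : char) (s : chart).

Definition qchar a : F := \prod_i t i ^ a i.

Lemma qchar0 : qchar 0 = 1.
Proof. by rewrite /qchar big1 // => i _; rewrite ffunE expr0z. Qed.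

Lemma qcharD a b : qchar (a + b) = qchar a * qchar b.
Proof. by rewrite /qchar -big_split /=; apply: eq_bigr => i _; rewrite ffunE expfzDr. Qed.

Definition prefix s (c : nat) : {set 'I_m.+1} := [set s i | i : 'I_m.+1 & (i < c)%N].

(** The generators of the dual cone of the chart; [partial_root] is their duality with the rays. *)
Definition root s (c : 'I_m) : char := coord_char (s (lo c)) - coord_char (s (hi c)).

Lemma qchar_coord i : qchar (coord_char i) = t i.
Proof.
rewrite /qchar (bigD1 i) //= ffunE eqxx big1 ?mulr1 => [|j ji]; first by rewrite -[1]/(1%:Z) expr1z.
by rewrite ffunE eq_sym (negbTE ji) expr0z.
Qed.

Lemma qchar_root s c : qchar (- root s c) = t (s (hi c)) / t (s (lo c)).
Proof. by rewrite opprB qcharD (QN qchar0 qcharD) !qchar_coord. Qed.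

Lemma root_neq1 s c : qchar (- root s c) != 1.
Proof.
rewrite qchar_root; apply: contraTneq (lo_neq_hi c) => E; rewrite negbK.
by rewrite -(inj_eq (@perm_inj _ s)) eq_sym -(inj_eq tinj) -[t (s (hi c))](divfK (t0 (s (lo c)))) E mul1r.
Qed.

Definition partial s (c : nat) a : int := \sum_(i in prefix s c) a i.

Lemma mem_prefix s c x : (x \in prefix s c) = ((s^-1)%g x < c)%N.
Proof.
apply/imsetP/idP => [[y + ->]|xc]; first by rewrite inE permK.
by exists ((s^-1)%g x); rewrite ?inE ?permKV.
Qed.

Lemma card_prefix s c : (c <= m.+1)%N -> #|prefix s c| = c.
Proof.
move=> cm; rewrite card_imset; last exact: perm_inj.
have wi : injective (widen_ord cm) by move=> x y /(congr1 val)/= /val_inj.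
rewrite -[RHS](card_ord c) -[RHS](card_image wi).
apply: eq_card => x; rewrite inE; apply/idP/imageP => [xc|[y _ ->]]; last exact: (ltn_ord y).
by exists (Ordinal xc) => //; apply: val_inj.
Qed.

Lemma partial_ord s c a : partial s c a = \sum_(i < m.+1 | (i < c)%N) a (s i).
Proof.
rewrite /partial big_imset /=; last by move=> x y _ _; apply: perm_inj.
by apply: eq_bigl => i; rewrite inE.
Qed.

Lemma partialB s c a b : partial s c (a - b) = partial s c a - partial s c b.
Proof. by rewrite /partial -sumrB; apply: eq_bigr => i _; rewrite !ffunE. Qed.

Lemma partial_root s c d : partial s d (root s c) = ((d == c.+1 :> nat)%N)%:R.
Proof.
have cc e : partial s d (coord_char (s e)) = ((e < d)%N)%:R.
  rewrite partial_ord; case: (boolP (e < d)%N) => ed.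
    rewrite (bigD1 e) //= ffunE eqxx big1 ?addr0 // => i /andP[_ ie].
    by rewrite ffunE (inj_eq perm_inj) eq_sym (negbTE ie).
  by rewrite big1 // => i id; rewrite ffunE (inj_eq perm_inj); case: eqP => // E; rewrite E id in ed.
rewrite /root partialB !cc /= /bump leq0n add1n.
have -> : (c < d)%N = (c.+1 < d)%N || (d == c.+1) by rewrite leq_eqVlt orbC eq_sym.
by case: eqP => [->|_]; [rewrite ltnn orbT subr0|rewrite orbF subrr].
Qed.

Lemma sum_root s c a : \sum_i (a - root s c) i = \sum_i a i.
Proof.
have T (b : char) : \sum_i b i = partial s m.+1 b.
  rewrite partial_ord (reindex_inj (@perm_inj _ s)) /=.
  by apply: eq_bigl => i; rewrite ltn_ord.
rewrite !T partialB partial_root eqSS gtn_eqF ?subr0 //; exact: ltn_ord.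
Qed.

Lemma rays_prefix s (S : {set 'I_m.+1}) :
  (S \in rays s) = [exists c : 'I_m, S == prefix s c.+1].
Proof.
apply/imsetP/existsP => [[c]|[c /eqP ->]].
  rewrite inE => c0 ->; have cm : (c.-1 < m)%N by case: c c0 => -[|c].
  by exists (Ordinal cm); apply/eqP; rewrite /= prednK.
by exists (hi c) => //; rewrite inE.
Qed.

Definition partially_tight (D : {set 'I_m}) s a : bool :=
  (\sum_i a i == 0) && [forall c : 'I_m, if c \in D then partial s c.+1 a == 0 else 0 <= partial s c.+1 a].

Lemma dual_cone1 s a : dual_cone [set s] a = partially_tight set0 s a.
Proof.
rewrite /dual_cone big_set1 /partially_tight; congr (_ && _).
apply/forall_inP/forallP => [H c|H S].
  by rewrite inE; apply: H; rewrite rays_prefix; apply/existsP; exists c.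
by rewrite rays_prefix => /existsP[c /eqP ->]; have := H c; rewrite inE.
Qed.

Lemma partially_tight_dif (D : {set 'I_m}) s c a : c \notin D ->
  (partially_tight D s a)%:R - (partially_tight D s (a - root s c))%:R =
  (partially_tight (c |: D) s a)%:R :> F.
Proof.
move=> cD; pose rest := [forall d : 'I_m, (d != c) ==> (if d \in D then partial s d.+1 a == 0 else 0 <= partial s d.+1 a)].
have sr := sum_root s c a.
have E1 : partially_tight D s a = [&& \sum_i a i == 0, rest & 0 <= partial s c.+1 a].
  congr (_ && _); apply/forallP/andP => [H|[/forallP H Hc] d].
    split; last by have := H c; rewrite (negbTE cD).
    by apply/forallP => d; rewrite H implybT.
  by have [->|dc] := eqVneq d c; [rewrite (negbTE cD)|have := H d; rewrite dc].
have E2 : partially_tight D s (a - root s c) = [&& \sum_i a i == 0, rest & 1 <= partial s c.+1 a].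
  rewrite /partially_tight sr; congr (_ && _); apply/forallP/andP => [H|[/forallP H Hc] d].
    split; last by have := H c; rewrite (negbTE cD) partialB partial_root eqxx subr_ge0.
    apply/forallP => d; apply/implyP => dc; have := H d; rewrite partialB partial_root eqSS.
    by rewrite (negbTE (_ : (d != c :> nat))) ?subr0.
  rewrite partialB partial_root eqSS; have [->|dc] := eqVneq d c.
    by rewrite (negbTE cD) eqxx subr_ge0.
  by have := H d; rewrite dc (negbTE (_ : (d != c :> nat))) ?subr0.
have E3 : partially_tight (c |: D) s a = [&& \sum_i a i == 0, rest & partial s c.+1 a == 0].
  congr (_ && _); apply/forallP/andP => [H|[/forallP H Hc] d].
    split; last by have := H c; rewrite setU11.
    by apply/forallP => d; apply/implyP => dc; have := H d; rewrite !inE (negbTE dc).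
  rewrite !inE; have [->|dc] := eqVneq d c; first by [].
  by have := H d; rewrite dc.
rewrite E1 E2 E3; case: (_ == 0) => /=; last by rewrite subrr.
case: (rest) => /=; last by rewrite subrr.
move: (partial s c.+1 a) => z; case: (ltgtP 0 z) => [zn|zp|<-]; last by rewrite subr0.
  have -> : 1 <= z by lia.
  by rewrite subrr.
have /negbTE -> : ~~ (1 <= z) by lia.
by rewrite subrr.
Qed.

(** Subtracting the translate by one root turns one inequality of the cone into an equality; after
    all m differences only the origin is left. *)
Lemma rat_sum_chamber s : rat_sum qchar (fun a => (dual_cone [set s] a)%:R) (chamber t s).
Proof.
pose l : seq char := [seq - root s c | c <- enum 'I_m].
exists l; first by apply/allP => _ /mapP[c _ ->]; apply: root_neq1.
have key (r : seq 'I_m) : uniq r -> difs [seq - root s c | c <- r] (fun a => (dual_cone [set s] a)%:R : F) =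
    fun a => (partially_tight [set c in r] s a)%:R.
  elim: r => [|c r IH] /=.
    by move=> _; apply: funext => a; rewrite dual_cone1; congr (partially_tight _ _ _)%:R.
  move=> /andP[cr ur]; rewrite IH //; apply: funext => a.
  rewrite /dif partially_tight_dif ?inE //; congr (partially_tight _ _ _)%:R.
  by apply/setP => d; rewrite !inE.
rewrite key ?enum_uniq //.
have tE a : partially_tight [set c in enum 'I_m] s a = (a == 0).
  apply/andP/eqP => [[/eqP sa /forallP H]|->]; last first.
    split; first by rewrite big1 // => i _; rewrite ffunE.
    by apply/forallP => c; rewrite inE mem_enum /= /partial big1 // => i _; rewrite ffunE.
  have P0 c : (c <= m.+1)%N -> partial s c a = 0.
    rewrite leq_eqVlt => /orP[/eqP ->|].
      rewrite partial_ord -[RHS]sa [RHS](reindex_inj (@perm_inj _ s)) /=.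
      by apply: eq_bigl => i; rewrite ltn_ord.
    case: c => [_|c]; first by rewrite partial_ord big_pred0.
    by rewrite ltnS => cm; have := H (Ordinal cm); rewrite inE mem_enum => /eqP.
  apply/ffunP => i; rewrite -[i](permKV s) ffunE; move: ((s^-1)%g i) => j.
  have := P0 j.+1 (ltn_ord j); rewrite partial_ord (bigD1 j) ?ltnS //=.
  rewrite (eq_bigl (fun i : 'I_m.+1 => (i < j)%N)); first by rewrite -partial_ord P0 ?addr0 // ltnW.
  by move=> e; rewrite ltnS leq_eqVlt -val_eqE /=; case: ltngtP; rewrite ?andbF ?andbT.
exists [:: 0] => //; split.
  by move=> a; rewrite tE inE; case: (a == 0); rewrite ?eqxx.
rewrite big_seq1 tE eqxx oppr0 qchar0 mulr1 /factor big_map big_enum /= /chamber -big_split /= big1 //.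
move=> c _; rewrite qchar_root divff // subr_eq0 eq_sym -qchar_root; exact: root_neq1.
Qed.

(** Some ray of one chart is not common to all, so the cone is invariant under translation by the
    root dual to it. *)
Lemma rat_sum_flat (I : {set chart}) s s' : s \in I -> s' \in I -> s != s' ->
  rat_sum qchar (fun a => (dual_cone I a)%:R) 0.
Proof.
move=> sI s'I ne.
have [c Hc] : exists c : 'I_m, prefix s c.+1 \notin rays s'.
  apply/existsP; rewrite -negb_forall; apply: contra ne => /forallP H.
  have E c : (c <= m.+1)%N -> prefix s c = prefix s' c.
    rewrite leq_eqVlt => /orP[/eqP ->|].
      apply/setP => x; apply/imsetP/imsetP => _.
        by exists ((s'^-1)%g x); rewrite ?inE ?ltn_ord // permKV.
      by exists ((s^-1)%g x); rewrite ?inE ?ltn_ord // permKV.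
    case: c => [_|c]; first by apply/setP => x; apply/imsetP/imsetP => -[y]; rewrite inE.
    rewrite ltnS => cm; have := H (Ordinal cm); rewrite rays_prefix => /existsP[d /eqP E].
    have := congr1 (fun A : {set 'I_m.+1} => #|A|) E; rewrite !card_prefix //= ?ltnS // 1?ltnW // => -[cd].
    by rewrite [LHS]E -cd.
  apply/eqP/permP => i.
  have si : s i \in prefix s' i.+1 by rewrite -E //; apply/imsetP; exists i; rewrite ?inE.
  have nsi : s i \notin prefix s' i.
    rewrite -E 1?ltnW //; apply/imsetP => -[y]; rewrite inE => yi /perm_inj E'.
    by rewrite E' ltnn in yi.
  move/imsetP: si => [y]; rewrite inE ltnS leq_eqVlt => /orP[/eqP/val_inj -> //|yi] E'.
  by case/imsetP: nsi; exists y; rewrite ?inE.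
apply: (rat_sum_periodic (b := - root s c)); first exact: root_neq1.
move=> a; congr (_ : bool)%:R; rewrite /dual_cone.
rewrite sum_root; congr (_ && _); apply: eq_forallb_in => S /bigcapP HS.
have := HS s sI; rewrite rays_prefix => /existsP[d /eqP SE].
rewrite -[\sum_(i in S) (a - root s c) i]/(\sum_(i in S) (a - root s c) i) SE -!/(partial s d.+1 _) partialB partial_root eqSS.
have /negbTE -> : (d != c :> nat) by apply: contraNneq Hc => /val_inj <-; rewrite -SE HS.
by rewrite subr0.
Qed.

End ConeSums.

(** * Cech cohomology *)

Section AbstractCech.
Variables (kk : fieldType) (T J : finType) (o : T) (cf : T -> T -> J -> J -> kk).
Variable gd : {set T} -> T -> J -> bool.
Hypotheses (cf1 : forall s a b, cf s s a b = (a == b)%:R)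
  (cfM : forall s t u a c, \sum_b cf s t a b * cf t u b c = cf s u a c)
  (cf_gd : forall (I : {set T}) s t a b, cf s t a b != 0 -> s \in I -> t \in I -> gd I t b -> gd I s a)
  (gdS : forall (I I' : {set T}) s a, I \subset I' -> s \in I -> gd I s a -> gd I' s a).
Local Notation sec := {ffun J -> kk^o}.
Local Notation coch := {ffun {set T} -> sec}.
Implicit Types (I : {set T}) (s t : T) (v : sec) (x y : coch).

Definition coords s v : sec := [ffun a => \sum_b cf s o a b * v b].

Lemma coords_linear s : linear (coords s).
Proof.
move=> k v v'; apply/ffunP => a; rewrite !ffunE scaler_sumr -big_split /=.
by apply: eq_bigr => b _; rewrite !ffunE mulrDr; congr (_ + _); rewrite mulrCA.
Qed.

Lemma coords_chart s t v a : coords s v a = \sum_b cf s t a b * coords t v b.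
Proof.
rewrite ffunE; under [RHS]eq_bigr => b _ do rewrite ffunE mulr_sumr.
rewrite exchange_big /=; apply: eq_bigr => c _; rewrite -(cfM s t o a c) mulr_suml.
by apply: eq_bigr => b _; rewrite mulrA.
Qed.

(** The empty set of charts carries only the zero section, so cochains start with single charts. *)
Definition secs I v : Prop := if I == set0 then v = 0
  else forall s, s \in I -> forall a, coords s v a != 0 -> gd I s a.

Lemma secs_one I s v : s \in I -> (forall a, coords s v a != 0 -> gd I s a) -> secs I v.
Proof.
move=> sI H; rewrite /secs ifF; last by apply/negbTE/set0Pn; exists s.
move=> t tI a; rewrite (coords_chart t s) => nz.
have [b] : exists b, cf t s a b * coords s v b != 0.
  apply/existsP; rewrite -negb_forall; apply: contra nz => /forallP Z.
  by rewrite big1 // => b _; apply/eqP.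
by rewrite mulf_eq0 negb_or => /andP[c1 c2]; apply: cf_gd c1 tI sI (H b c2).
Qed.

Lemma secsS I I' v : I \subset I' -> secs I v -> secs I' v.
Proof.
move=> II; case: (eqVneq I set0) => [->|/set0Pn[s sI]]; rewrite {1}/secs ?eqxx.
  move=> ->; rewrite /secs; case: ifP => // _ s _ a.
  by rewrite ffunE big1 ?eqxx // => b _; rewrite ffunE mulr0.
rewrite ifF; last by apply/negbTE/set0Pn; exists s.
by move=> H; apply: (@secs_one _ s); [apply: (subsetP II)|move=> a /(H s sI)/gdS; apply].
Qed.

Lemma secs_lin I k v v' : secs I v -> secs I v' -> secs I (k *: v + v').
Proof.
rewrite /secs; case: ifP => [_ -> ->|_ H H' s sI a]; first by rewrite scaler0 addr0.
have -> : coords s (k *: v + v') a = k * coords s v a + coords s v' a by rewrite coords_linear !ffunE.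
case: (eqVneq (coords s v a) 0) => [->|/(H s sI) //].
by rewrite mulr0 add0r; apply: H'.
Qed.

Lemma secs0 I : secs I 0.
Proof.
rewrite /secs; case: ifP => // _ s _ a.
by rewrite ffunE big1 ?eqxx // => b _; rewrite ffunE mulr0.
Qed.

Definition sgn s I : kk := (-1) ^+ #|[set t in I | (enum_rank t < enum_rank s)%N]|.

Definition delta x : coch := [ffun I : {set T} => \sum_(s in I) sgn s I *: x (I :\ s)].

Lemma delta_linear : linear delta.
Proof.
move=> k x y; apply/ffunP => I; rewrite !ffunE scaler_sumr -big_split /=.
by apply: eq_bigr => s _; rewrite !ffunE scalerDr !scalerA mulrC.
Qed.

HB.instance Definition _ := GRing.isLinear.Build kk coch coch _ delta delta_linear.

Lemma sgnK s I : sgn s I * sgn s I = 1.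
Proof. by rewrite /sgn -expr2 sqrr_sign. Qed.

Lemma sgn_swap s t I : s != t -> s \in I -> t \in I ->
  sgn t I * sgn s (I :\ t) = - (sgn s I * sgn t (I :\ s)).
Proof.
move=> st sI tI.
have D r q : q \in I -> q != r -> sgn r I = sgn r (I :\ q) * (-1) ^+ (enum_rank q < enum_rank r)%N.
  move=> qI qr; rewrite /sgn -exprD (cardsD1 q) inE qI /= addnC.
  congr (_ ^+ (_ + _)%N); apply: eq_card => z; rewrite !inE; by case: (z == q).
rewrite (D t s) // (D s t) 1?eq_sym //.
have : (enum_rank s != enum_rank t :> nat) by rewrite (inj_eq val_inj) (inj_eq enum_rank_inj).
case: ltngtP => // _ _; rewrite ?expr0 ?expr1; ring.
Qed.

Lemma delta_delta x : delta (delta x) = 0.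
Proof.
apply/ffunP => I; rewrite !ffunE.
have -> : \sum_(s in I) sgn s I *: delta x (I :\ s) =
    \sum_(p : T * T | [&& p.1 \in I, p.2 \in I & p.1 != p.2]) (sgn p.1 I * sgn p.2 (I :\ p.1)) *: x (I :\ p.1 :\ p.2).
  rewrite -(pair_big_dep (fun s => s \in I) (fun s t => (t \in I) && (s != t))
    (fun s t => (sgn s I * sgn t (I :\ s)) *: x (I :\ s :\ t))) /=.
  apply: eq_bigr => s sI; rewrite ffunE scaler_sumr; apply: eq_big => t; last by rewrite scalerA.
  by rewrite !inE andbC eq_sym.
rewrite (bigID (fun p : T * T => (enum_rank p.1 < enum_rank p.2)%N)) /= addrC.
rewrite (reindex_inj (h := fun p : T * T => (p.2, p.1))) /=; last by move=> [a b] [a' b'] [-> ->].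
rewrite (eq_bigl (fun p : T * T => [&& p.1 \in I, p.2 \in I & p.1 != p.2] && (enum_rank p.1 < enum_rank p.2)%N)).
  rewrite -big_split big1 //= => -[s t] /andP[/and3P[/= sI tI st] _].
  rewrite sgn_swap // scaleNr; have -> : I :\ t :\ s = I :\ s :\ t by apply/setP => z; rewrite !inE andbCA.
  by rewrite addNr.
move=> [s t] /=; rewrite andbCA eq_sym; case: eqVneq => [->|st]; rewrite ?andbF //= -leqNgt leq_eqVlt.
by rewrite (inj_eq val_inj) (inj_eq enum_rank_inj) (negbTE st).
Qed.

Definition deg q x : Prop := forall I, if #|I| == q then secs I (x I) else x I = 0.

Lemma deg_lin q k x y : deg q x -> deg q y -> deg q (k *: x + y).
Proof.
move=> dx dy I; have := dx I; have := dy I; case: ifP => _; rewrite !ffunE.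
  by move=> sy sx; apply: secs_lin.
by move=> -> ->; rewrite scaler0 addr0.
Qed.

Lemma deg0 q : deg q 0.
Proof. by move=> I; case: ifP => _; rewrite !ffunE //; apply: secs0. Qed.

Lemma deg_delta q x : deg q x -> deg q.+1 (delta x).
Proof.
move=> dx I; have cI s : s \in I -> (#|I :\ s| == q) = (#|I| == q.+1).
  by move=> sI; rewrite (cardsD1 s I) sI.
case: ifP => Iq; rewrite ffunE; last first.
  by rewrite big1 // => s sI; have := dx (I :\ s); rewrite cI // Iq => ->; rewrite scaler0.
apply: (big_ind (secs I)) => [|u v su sv|s sI]; first exact: secs0.
  by rewrite -[u]scale1r; apply: secs_lin.
rewrite -[_ *: _]addr0; apply: secs_lin; last exact: secs0.
by apply: (@secsS (I :\ s)); rewrite ?subD1set //; have := dx (I :\ s); rewrite cI // Iq.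
Qed.

Lemma coords_inj s v : (forall a, coords s v a = 0) -> v = 0.
Proof.
move=> H; apply/ffunP => a; rewrite ffunE.
have -> : v a = coords o v a.
  by rewrite ffunE (bigD1 a) //= cf1 eqxx mul1r big1 ?addr0 // => b /negbTE ba; rewrite cf1 eq_sym ba mul0r.
by rewrite (coords_chart o s) big1 // => b _; rewrite H mulr0.
Qed.

Section Acyclic.
Variables (pos : T -> nat) (mv : T -> T).
Hypotheses (pos0 : forall I s a, pos s = 0%N -> s \in I -> (forall t, t \in I -> pos t = 0%N) -> ~~ gd I s a)
  (mv_pos : forall s, (0 < pos s)%N -> (pos (mv s) < pos s)%N)
  (mv_gd : forall I s a, (0 < pos s)%N -> s \in I -> (forall t, t \in I -> (pos t <= pos s)%N) ->
     gd (mv s |: I) s a -> gd I s a).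

(* The charts are added one by one in the order given by [pos]; when [s] is added, inserting
   [mv s] contracts the new part of the complex. *)
Lemma cech_acyclic q x : deg q.+1 x -> delta x = 0 -> exists2 y, deg q y & x = delta y.
Proof.
move=> dx zx.
have step n : (n <= #|T|)%N -> exists D : {set T}, [/\ #|D| = n,
    forall s t, s \in D -> (pos t < pos s)%N -> t \in D &
    exists2 y, deg q y & forall I, I \subset D -> (x - delta y) I = 0].
  elim: n => [|n IH] nT.
    exists set0; split=> [|s t|]; [by rewrite cards0|by rewrite inE|].
    exists 0; first exact: deg0.
    move=> I; rewrite subset0 => /eqP ->; rewrite linear0 subr0.
    by have := dx set0; rewrite cards0.
  have [D [cD down [y dy Hy]]] := IH (ltnW nT).
  have [s0 s0D] : exists s0, s0 \in ~: D.
    by apply/set0Pn; rewrite -card_gt0 cardsCs setCK subn_gt0 cD.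
  have [s sD smin] : exists2 s, s \in ~: D & forall t, t \in ~: D -> (pos s <= pos t)%N.
    by case: (arg_minnP pos s0D) => s; exists s.
  have nsD : s \notin D by rewrite inE in sD.
  have le t : t \in s |: D -> (pos t <= pos s)%N.
    rewrite !inE => /orP[/eqP -> //|tD]; rewrite leqNgt; apply: contra nsD; exact: down.
  exists (s |: D); split; first by rewrite cardsU1 nsD cD.
    move=> r t /le rs tr; rewrite !inE orbC; apply/orP; left; apply/negPn/negP => tD.
    by have := smin t; rewrite inE tD leqNgt (leq_trans tr rs) => /(_ isT).
  set z := x - delta y in Hy.
  have dz : deg q.+1 z by rewrite /z addrC -scaleN1r; apply: deg_lin => //; apply: deg_delta.
  have zz : delta z = 0 by rewrite linearB /= zx delta_delta subr0.
  suff [h dh Hh] : exists2 h, deg q h & forall I, I \subset s |: D -> (z - delta h) I = 0.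
    exists (1 *: y + h); first exact: deg_lin.
    by move=> I /Hh; rewrite scale1r linearD opprD addrA.
  have split_D (I : {set T}) : I \subset s |: D -> s \notin I -> I \subset D.
    by move=> /subsetP ID sI; apply/subsetP => t tI; have := ID t tI; rewrite !inE => /orP[/eqP E|//]; rewrite -E tI in sI.
  (* At position 0 there are no sections on the new sets, so nothing has to be corrected. *)
  have [p0|p0] := posnP (pos s).
    exists 0; first exact: deg0.
    move=> I ID; rewrite linear0 subr0; have [sI|sI] := boolP (s \in I); last exact/Hy/split_D.
    have := dz I; case: ifP => // _; rewrite /secs ifF; last by apply/negbTE/set0Pn; exists s.
    move=> H; apply: (@coords_inj s) => a; apply/eqP/negPn/negP => /(H s sI).
    apply/negP/pos0 => // t tI; apply/eqP; rewrite -leqn0 -p0; apply: le; exact: (subsetP ID).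
  set m := mv s; have mD : m \in D.
    by apply/negPn/negP => mD; have := smin m; rewrite inE mD leqNgt mv_pos // => /(_ isT).
  have ms : m != s by apply: contraNneq nsD => <-.
  (* The contraction inserts [m] into the sets that contain the new chart [s] but not [m]; by
     [mv_gd] a section on the larger set is one on the smaller set as well. *)
  pose h : coch := [ffun L : {set T} => if [&& s \in L, L \subset s |: D & m \notin L]
    then sgn m (m |: L) *: z (m |: L) else 0].
  have hE (L : {set T}) : h L = if [&& s \in L, L \subset s |: D & m \notin L]
      then sgn m (m |: L) *: z (m |: L) else 0 by rewrite ffunE.
  exists h.
    move=> L; rewrite hE; case: (boolP [&& _, _ & _]) => [/and3P[sL LD mL]|_]; last first.
      by case: ifP => // _; apply: secs0.
    have := dz (m |: L); rewrite cardsU1 mL eqSS; case: ifP => [_ sz|_ ->]; last by rewrite scaler0.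
    rewrite -[_ *: _]addr0; apply: secs_lin; last exact: secs0.
    apply: (@secs_one _ s) => // a nz; apply: mv_gd => //; first by move=> t tL; apply/le/(subsetP LD).
    move: sz; rewrite /secs ifF; last by apply/negbTE/set0Pn; exists s; rewrite !inE sL orbT.
    by apply => //; rewrite inE sL orbT.
  move=> I ID; have -> : (z - delta h) I = z I - delta h I by rewrite !ffunE.
  have [sI|sI] := boolP (s \in I); last first.
    rewrite Hy ?split_D // ffunE big1 ?subrr // => t tI.
    by rewrite hE !inE (negbTE sI) andbF /= scaler0.
  have [mI|mI] := boolP (m \in I).
    rewrite [delta h I]ffunE (bigD1 m) //= big1 ?addr0 => [|t /andP[tI tm]]; last first.
      by rewrite hE !inE (eq_sym m t) (negbTE tm) mI /= !andbF scaler0.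
    rewrite hE !inE eq_sym ms sI eqxx /= andbT (subset_trans (subD1set _ _) ID) setD1K //.
    by rewrite scalerA sgnK scale1r subrr.
  have : delta z (m |: I) = 0 by rewrite zz ffunE.
  rewrite [delta z _]ffunE big_setU1 //= setU1K // (bigD1 s) //= (Hy ((m |: I) :\ s)); last first.
    apply/subsetP => t; rewrite !inE => /andP[ts /orP[/eqP -> //|tI]].
    by have := subsetP ID t tI; rewrite !inE (negbTE ts).
  rewrite scaler0 add0r => E.
  have {E} -> : z I = - \sum_(t in I | t != s) (sgn m (m |: I) * sgn t (m |: I)) *: z ((m |: I) :\ t).
    rewrite -[LHS]scale1r -(sgnK m (m |: I)) -scalerA.
    move/eqP: E; rewrite addr_eq0 => /eqP ->; rewrite scalerN scaler_sumr; congr (- _).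
    by apply: eq_bigr => t _; rewrite scalerA.
  rewrite [delta h I]ffunE [X in _ - X](bigD1 s) //= hE !inE eqxx /= scaler0 add0r -opprD -big_split big1 ?oppr0 //= => t /andP[tI ts].
  have tm : t != m by apply: contraNneq mI => <-.
  rewrite hE !inE eq_sym ts sI /= (subset_trans (subD1set _ _) ID) (negbTE mI) andbF /=.
  have -> : m |: (I :\ t) = (m |: I) :\ t.
    by apply/setP => r; rewrite !inE; case: (eqVneq r m) => [->|] //=; rewrite eq_sym tm.
  rewrite scalerA -scalerDl.
  have := @sgn_swap m t (m |: I); rewrite eq_sym tm !inE eqxx tI orbT => /(_ isT isT isT).
  rewrite setU1K // => sw.
  have -> : sgn t I = - (sgn m (m |: I) * sgn t (m |: I) * sgn m ((m |: I) :\ t)).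
    by rewrite -mulrA sw mulrN opprK mulrA sgnK mul1r.
  by rewrite mulNr -!mulrA sgnK mulr1 addrN scale0r.
have [D [cD _ [y dy Hy]]] := step #|T| (leqnn _).
exists y => //; apply/eqP; rewrite -subr_eq0; apply/eqP/ffunP => I; rewrite Hy ?ffunE //.
by apply/subsetP => t _; have /eqP -> : D == setT by rewrite eqEcard subsetT cardsT cD /=.
Qed.

End Acyclic.

Definition chart_of I : T := odflt o [pick s in I].

Lemma chart_of_in I : I != set0 -> chart_of I \in I.
Proof.
by case/set0Pn => s sI; rewrite /chart_of; case: pickP => [//|/(_ s)]; rewrite sI.
Qed.

(** They index a basis of the cochains: a section on [I] is given by its coordinates in the frame of
    one chosen chart of [I]. *)
Definition good_pairs q : {set {set T} * J} :=
  [set p : {set T} * J | [&& #|p.1| == q, p.1 != set0 & gd p.1 (chart_of p.1) p.2]].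

Definition elementary (p : {set T} * J) : coch :=
  [ffun I => if I == p.1 then [ffun b => cf o (chart_of p.1) b p.2] else 0].

Lemma coords_elementary I p a :
  coords (chart_of I) (elementary p I) a = ((I, a) == p)%:R.
Proof.
rewrite ffunE; case: p => I' a' /=; rewrite xpair_eqE; case: (eqVneq I I') => [->|II] /=.
  rewrite (eq_bigr (fun b => cf (chart_of I') o a b * cf o (chart_of I') b a')).
    by rewrite cfM cf1.
  by move=> b _; rewrite !ffunE eqxx ffunE.
by rewrite big1 // => b _; rewrite !ffunE (negbTE II) ffunE mulr0.
Qed.

Lemma deg_elementary q p : p \in good_pairs q -> deg q (elementary p).
Proof.
rewrite inE => /and3P[/eqP c p0 g] I; have [E|Ip] := eqVneq I p.1; last first.
  rewrite ffunE (negbTE Ip); case: ifP => // _; exact: secs0.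
rewrite E c eqxx; apply: secs_one (chart_of_in p0) _ => a.
rewrite coords_elementary; case: ((p.1, a) =P p) => [pE _|_]; last by rewrite mulr0n eqxx.
by rewrite -pE in g *.
Qed.

Definition evalc I (a : J) x : kk^o := coords (chart_of I) (x I) a.

Lemma evalc_linear I a : linear (evalc I a).
Proof.
move=> k x y; rewrite /evalc; have -> : (k *: x + y) I = k *: x I + y I by rewrite !ffunE.
by rewrite coords_linear !ffunE.
Qed.

HB.instance Definition _ I a := GRing.isLinear.Build kk coch kk^o _ (evalc I a) (evalc_linear I a).

Definition elementaries q := [tuple elementary (enum_val i) | i < #|good_pairs q|].

Lemma elementariesE q (i : 'I_#|good_pairs q|) : (elementaries q)`_i = elementary (enum_val i).
Proof. by rewrite -tnth_nth tnth_mktuple. Qed.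

Definition Uv q : {vspace coch} := <<elementaries q>>.

Lemma evalc_sum I a q (k : 'I_#|good_pairs q| -> kk) :
  evalc I a (\sum_i k i *: (elementaries q)`_i) = \sum_i k i * ((I, a) == enum_val i)%:R.
Proof.
rewrite linear_sum; apply: eq_bigr => i _; rewrite linearZ; congr (_ * _).
by rewrite elementariesE; apply: coords_elementary.
Qed.

Lemma mem_Uv q x : x \in Uv q <-> deg q x.
Proof.
split=> [/coord_span ->|dx].
  apply: (big_ind (deg q)) => [|u v du dv|i _]; first exact: deg0.
    by rewrite -[u]scale1r; apply: deg_lin.
  rewrite -[_ *: _]addr0; apply: deg_lin; last exact: deg0.
  by rewrite elementariesE; apply/deg_elementary/enum_valP.
pose k (i : 'I_#|good_pairs q|) := evalc (enum_val i).1 (enum_val i).2 x.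
suff -> : x = \sum_i k i *: (elementaries q)`_i.
  by apply: memv_suml => i _; apply: memvZ; apply: memv_span; rewrite mem_nth // size_tuple.
set y := \sum_i _; apply/eqP; rewrite -subr_eq0; apply/eqP/ffunP => I; rewrite [RHS]ffunE.
apply: (@coords_inj (chart_of I)) => a; rewrite -[LHS]/(evalc I a (x - y)) linearB /= evalc_sum.
case: (boolP ((I, a) \in good_pairs q)) => [pg|pg].
  rewrite (bigD1 (enum_rank_in pg (I, a))) //= enum_rankK_in // eqxx mulr1 big1 ?addr0 => [|i ne].
    by rewrite /k enum_rankK_in // subrr.
  by case: eqP => [E|_]; rewrite ?mulr0 //; case/eqP: ne; apply: enum_val_inj; rewrite enum_rankK_in.
rewrite big1 ?subr0 => [|i _]; last first.
  by case: eqP => [E|_]; rewrite ?mulr0 //; move: pg; rewrite E enum_valP.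
apply/eqP/negPn/negP => nz; move/negP: pg; apply; rewrite inE /=; have := dx I.
have x0 : x I <> 0.
  by move=> E; case/eqP: nz; rewrite /evalc E ffunE big1 // => b _; rewrite ffunE mulr0.
case: ifP => //= _; rewrite /secs; case: eqP => //= /eqP I0 H.
by apply: H nz; apply: chart_of_in.
Qed.

Lemma dim_Uv q : \dim (Uv q) = #|good_pairs q|.
Proof.
have : free (elementaries q).
  apply/freeP => k E i; have := evalc_sum (enum_val i).1 (enum_val i).2 k.
  rewrite E linear0 -surjective_pairing (bigD1 i) //= eqxx mulr1 big1 ?addr0 // => j ji.
  by rewrite (inj_eq enum_val_inj) eq_sym (negbTE ji) mulr0.
by rewrite /free size_tuple => /eqP.
Qed.

Definition dlt : 'Hom(coch, coch) := linfun delta.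

(** The index [q] is the number of charts, one more than the cohomological degree. *)
Definition Zv q : {vspace coch} := (Uv q :&: lker dlt)%VS.
Definition Bv q : {vspace coch} := (dlt @: Uv q.-1)%VS.
Definition Hv q : {vspace coch} := (Zv q :\: Bv q)%VS.

Lemma mem_Zv q x : x \in Zv q <-> deg q x /\ delta x = 0.
Proof.
rewrite memv_cap memv_ker lfunE /=; split=> [/andP[/mem_Uv dx /eqP]|[/mem_Uv -> ->]] //.
by rewrite eqxx.
Qed.

Lemma mem_Bv q x : x \in Bv q.+1 <-> exists2 y, deg q y & x = delta y.
Proof.
split=> [/memv_imgP[y /mem_Uv dy ->]|[y /mem_Uv dy ->]]; first by exists y; rewrite // lfunE.
by have := memv_img dlt dy; rewrite lfunE.
Qed.

Lemma Bv_sub q : (Bv q.+1 <= Zv q.+1)%VS.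
Proof.
by apply/subvP => x /mem_Bv[y dy ->]; apply/mem_Zv; split; [apply: deg_delta|apply: delta_delta].
Qed.

Lemma dim_Hv q : (\dim (Hv q.+1) + \dim (Bv q.+1) = \dim (Zv q.+1))%N.
Proof. by rewrite addnC -(dimv_cap_compl (Zv q.+1) (Bv q.+1)) (capv_idPr (Bv_sub q)). Qed.

Lemma dim_Zv q : (\dim (Zv q) + \dim (Bv q.+1) = #|good_pairs q|)%N.
Proof. by rewrite -dim_Uv; apply: limg_ker_dim. Qed.

(** By rank-nullity the dimensions of the coboundaries telescope; they vanish at both ends. *)
Lemma euler_Hv :
  \sum_(p < #|T|) (-1) ^+ p * (\dim (Hv p.+1))%:Z = \sum_(p < #|T|) (-1) ^+ p * #|good_pairs p.+1|%:Z :> int.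
Proof.
have Bdim q : (#|good_pairs q| = 0 -> \dim (Bv q.+1) = 0)%N by have := dim_Zv q; lia.
have B1 : \dim (Bv 1) = 0%N.
  by apply: Bdim; apply: eq_card0 => p; rewrite inE cards_eq0; case: eqP.
have BN : \dim (Bv #|T|.+1) = 0%N.
  apply/eqP; rewrite -leqn0; apply: leq_trans (dimvS (subv_trans (Bv_sub _) (capvSl _ _))) _.
  rewrite dim_Uv leqn0; apply/eqP/eq_card0 => p; rewrite inE; case: eqP => // E.
  by have := max_card p.1; rewrite E ltnn.
have key N : \sum_(p < N) (-1) ^+ p * (\dim (Hv p.+1))%:Z + (\dim (Bv 1))%:Z =
    \sum_(p < N) (-1) ^+ p * #|good_pairs p.+1|%:Z + (-1) ^+ N * (\dim (Bv N.+1))%:Z :> int.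
  elim: N => [|N IH]; first by rewrite !big_ord0 mul1r.
  rewrite !big_ord_recr /= addrAC IH -dim_Zv -dim_Hv !PoszD exprS; ring.
by have := key #|T|; rewrite B1 BN mulr0 !addr0.
Qed.

Lemma sum_good_pairs :
  \sum_(p < #|T|) (-1) ^+ p * #|good_pairs p.+1|%:Z =
  \sum_(I : {set T} | I != set0) (-1) ^+ #|I|.-1 * (\sum_a (gd I (chart_of I) a))%N%:Z :> int.
Proof.
have cg q : #|good_pairs q.+1|%:Z =
    \sum_(I : {set T} | I != set0) (if #|I| == q.+1 then (\sum_a (gd I (chart_of I) a))%N%:Z else 0) :> int.
  rewrite -sum1_card big_mkcond /=.
  transitivity ((\sum_(I : {set T}) \sum_(a : J) ((I, a) \in good_pairs q.+1))%N%:Z : int).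
    by rewrite pair_bigA; congr Posz; apply: eq_bigr => -[I a] _; case: ifP.
  rewrite Posz_sum [RHS]big_mkcond; apply: eq_bigr => I _.
  case: ifP => I0; last by rewrite big1 // => a _; rewrite inE /= I0 andbF.
  case: ifP => Iq; last by rewrite big1 // => a _; rewrite inE /= Iq.
  by congr Posz; apply: eq_bigr => a _; rewrite inE /= Iq I0.
under eq_bigr => p _ do rewrite cg mulr_sumr.
rewrite exchange_big /=; apply: eq_bigr => I I0.
have cI : (#|I|.-1 < #|T|)%N.
  rewrite prednK ?card_gt0 //; exact: max_card.
rewrite (bigD1 (Ordinal cI)) //= prednK ?card_gt0 // eqxx [X in _ + X]big1 ?addr0 // => p pI.
case: eqP => E; last by rewrite mulr0.
by case/eqP: pI; apply: val_inj; rewrite /= E.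
Qed.

End AbstractCech.

(** * Laurent polynomials and regular functions *)

Section Laurent.
Variables (kk : fieldType) (m : nat).
Local Notation K := {fraction {mpoly kk[m.+1]}}.
Local Notation char := {ffun 'I_m.+1 -> int}.
Local Notation sc := (@scal kk m.+1).
Local Notation tc := (@tchar kk m.+1).
Implicit Types (a b : char) (S : seq char).

Lemma scal_is_monoid : GRing.monoid_morphism sc.
Proof. by split=> [|x y]; rewrite /scal ?rmorph1 // !rmorphM. Qed.

Lemma scal_is_additive : GRing.zmod_morphism sc.
Proof. by move=> x y; rewrite /scal !rmorphB. Qed.

HB.instance Definition _ := GRing.isZmodMorphism.Build kk K sc scal_is_additive.
HB.instance Definition _ := GRing.isMonoidMorphism.Build kk K sc scal_is_monoid.

Lemma tX_neq0 (i : 'I_m.+1) : tofrac ('X_i : {mpoly kk[m.+1]}) != 0.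
Proof.
rewrite tofrac_eq0; apply/eqP => /(congr1 (mcoeff U_(i)))/eqP.
by rewrite mcoeffX eqxx mcoeff0 oner_eq0.
Qed.

Lemma tchar0 : tc 0 = 1.
Proof. exact: qchar0. Qed.

Lemma tcharD a b : tc (a + b) = tc a * tc b.
Proof. by apply: qcharD => i; apply: tX_neq0. Qed.

Lemma tchar_neq0 a : tc a != 0.
Proof. exact: (Q_neq0 tchar0 tcharD). Qed.

Lemma tchar_mnm (e : 'X_{1..m.+1}) a : (forall i, a i = (e i)%:Z) ->
  tc a = tofrac ('X_[e] : {mpoly kk[m.+1]}).
Proof.
move=> H; rewrite mpolyXE_id rmorph_prod; apply: eq_bigr => i _.
by rewrite H -exprnP rmorphXn.
Qed.

(** A common shift of the exponents turns the characters into distinct monomials of the polynomial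
    ring. *)
Lemma tchar_free S (f : char -> kk) : uniq S -> \sum_(a <- S) sc (f a) * tc a = 0 ->
  forall a, a \in S -> f a = 0.
Proof.
move=> uS E; pose N := (\sum_(a <- S) \sum_i `|a i|)%N.
have aN a i : a \in S -> (`|a i| <= N)%N.
  move=> aS; rewrite /N (big_rem a) //= (bigD1 i) //= -addnA leq_addr //.
pose b : char := [ffun=> N%:Z]; pose e a : 'X_{1..m.+1} := [multinom absz (a i + N%:Z)%R | i < m.+1].
have eE a i : a \in S -> (a + b) i = (e a i)%:Z.
  move=> aS; rewrite /e mnmE !ffunE gez0_abs //; have := aN a i aS; lia.
have einj a a' : a \in S -> a' \in S -> e a = e a' -> a = a'.
  move=> aS aS' H; apply: (addIr b); apply/ffunP => i; by rewrite eE // H -eE.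
move=> a aS; have : \sum_(a <- S) (f a)%:MP * 'X_[e a] = 0 :> {mpoly kk[m.+1]}.
  apply/eqP; rewrite -tofrac_eq; apply/eqP; rewrite rmorph0 rmorph_sum.
  transitivity ((\sum_(a0 <- S) sc (f a0) * tc a0) * tc b); last by rewrite E mul0r.
  rewrite mulr_suml.
  apply: eq_big_seq => c cS; rewrite rmorphM -mulrA -tcharD; congr (_ * _).
  by rewrite (@tchar_mnm (e c)) // => i; apply: eE.
move=> /(congr1 (fun p : {mpoly kk[m.+1]} => p@_(e a))); rewrite mcoeff0 raddf_sum.
rewrite (bigD1_seq a) //= mul_mpolyC mcoeffZ mcoeffX eqxx mulr1 big1_seq ?addr0 // => c /andP[ca cS].
rewrite mul_mpolyC mcoeffZ mcoeffX; case: eqP => [/(einj _ _ cS aS) E'|_]; last by rewrite mulr0.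
by rewrite E' eqxx in ca.
Qed.

Lemma collect_terms (l : seq (kk * char)) S : uniq S -> {subset [seq p.2 | p <- l] <= S} ->
  \sum_(p <- l) sc p.1 * tc p.2 = \sum_(b <- S) sc (\sum_(p <- l | p.2 == b) p.1) * tc b.
Proof.
move=> uS; elim: l => [|p l IH] H.
  by rewrite big_nil big1 // => b _; rewrite big_nil rmorph0 mul0r.
rewrite big_cons IH; last by move=> b bl; apply: H; rewrite inE bl orbT.
have pS : p.2 \in S by apply: H; rewrite inE eqxx.
rewrite (bigD1_seq p.2) //= [RHS](bigD1_seq p.2) //= big_cons eqxx rmorphD mulrDl -addrA.
congr (_ + (_ + _)); apply: eq_bigr => b bp; by rewrite big_cons eq_sym (negbTE bp).
Qed.

(** By independence of characters, the term has to occur in any expression that witnesses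
    regularity. *)
Lemma regular_term (I : {set {perm 'I_m.+1}}) c a : regular_on I (sc c * tc a) -> c != 0 -> dual_cone I a.
Proof.
move=> [l [/allP dl E]] c0; pose S := undup (a :: [seq p.2 | p <- l]).
have aS : a \in S by rewrite mem_undup inE eqxx.
have := @collect_terms l S (undup_uniq _); rewrite -E => H.
have {}H : sc c * tc a = \sum_(b <- S) sc (\sum_(p <- l | p.2 == b) p.1) * tc b.
  by apply: H => b bl; rewrite mem_undup inE bl orbT.
case: (boolP (has (fun p => p.2 == a) l)) => [/hasP[p pl /eqP <-]|/hasPn N]; first exact: dl.
case/eqP: c0; have := @tchar_free S (fun b => (if b == a then c else 0) - \sum_(p <- l | p.2 == b) p.1) (undup_uniq _).
move=> /(_ _ a aS); rewrite eqxx [\sum_(p <- l | _) _]big1_seq ?subr0 => [|p /andP[/eqP pa pl]]; last first.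
  by have := N p pl; rewrite pa eqxx.
apply; under eq_bigr => b _ do rewrite rmorphB mulrBl.
rewrite sumrB -H (bigD1_seq a) ?undup_uniq //= eqxx big1 ?addr0 ?subrr // => b /negbTE ->.
by rewrite rmorph0 mul0r.
Qed.

Lemma regular_scal (I : {set {perm 'I_m.+1}}) c a : (c != 0 -> dual_cone I a) -> regular_on I (sc c * tc a).
Proof.
have [->|_ /(_ isT) d] := eqVneq c 0.
  by move=> _; exists [::]; split=> //; rewrite big_nil rmorph0 mul0r.
by exists [:: (c, a)]; rewrite /= d big_seq1.
Qed.

Lemma dual_coneD (I : {set {perm 'I_m.+1}}) a b : dual_cone I a -> dual_cone I b -> dual_cone I (a + b).
Proof.
move=> /andP[/eqP a0 /forall_inP aI] /andP[/eqP b0 /forall_inP bI]; apply/andP; split.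
  by under eq_bigr => i _ do rewrite ffunE; rewrite big_split /= a0 b0.
apply/forall_inP => S SI; under eq_bigr => i _ do rewrite ffunE.
by rewrite big_split addr_ge0 //= ?aI ?bI.
Qed.

Lemma dual_coneS (I I' : {set {perm 'I_m.+1}}) a : I \subset I' -> dual_cone I a -> dual_cone I' a.
Proof.
move=> II /andP[a0 /forall_inP aI]; rewrite /dual_cone a0; apply/forall_inP => S SI.
apply: aI; apply/bigcapP => s sI; move/bigcapP: SI; apply; exact: (subsetP II).
Qed.

End Laurent.

(** * Weight decomposition of Cech cochains *)

Section Cochains.
Variables (kk : fieldType) (m : nat) (E : bundle kk m.+1).
Local Notation K := {fraction {mpoly kk[m.+1]}}.
Local Notation char := {ffun 'I_m.+1 -> int}.
Local Notation chart := {perm 'I_m.+1}.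
Variable wt : chart -> frame E -> char.
Hypotheses (hE : is_bundle E) (hL : linearization wt).
Local Notation sc := (@scal kk m.+1).
Local Notation tc := (@tchar kk m.+1).
Local Notation sec := {ffun frame E -> kk^o}.
Local Notation coch := {ffun {set chart} -> sec}.
Local Notation cochK := {ffun {set chart} -> {ffun frame E -> K^o}}.
Implicit Types (mu : char) (I : {set chart}) (x : coch) (S : seq char).

Definition cf s t a b : kk := sval (cid (hL s t a b)).

Lemma cfE s t a b : trans s t a b = sc (cf s t a b) * tc (wt s a - wt t b).
Proof. exact: svalP (cid (hL s t a b)). Qed.

Lemma cf1 s a b : cf s s a b = (a == b)%:R.
Proof.
have [_ h _] := hE; have := h s a b; rewrite cfE.
have [-> |_] := eqVneq a b; last first.
  move/eqP; rewrite mulf_eq0 (negbTE (tchar_neq0 _ _)) orbF fmorph_eq0 => /eqP -> //.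
by rewrite subrr tchar0 mulr1 => /eqP; rewrite fmorph_eq1 => /eqP.
Qed.

Lemma cfM s t u a c : \sum_b cf s t a b * cf t u b c = cf s u a c.
Proof.
have [_ _ h] := hE; have := h s t u a c; rewrite cfE.
under eq_bigr => b _ do rewrite !cfE mulrACA -rmorphM -tcharD addrA subrK.
by rewrite -mulr_suml -rmorph_sum => /(mulIf (tchar_neq0 _ _))/fmorph_inj.
Qed.

(** In weight [mu] the coordinate along a frame vector is a scalar times the function t^(wt s a +
    mu), and [gd] asks this function to be regular. *)
Definition gd mu I s (a : frame E) : bool := dual_cone I (wt s a + mu).

Lemma cf_gd mu I s t a b : cf s t a b != 0 -> s \in I -> t \in I -> gd mu I t b -> gd mu I s a.
Proof.
move=> c0 sI tI; have [h _ _] := hE; have := h s t a b; rewrite cfE => /regular_term/(_ c0) d.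
have stI : [set s; t] \subset I by rewrite subUset !sub1set sI tI.
move=> /(dual_coneD (dual_coneS stI d)); by rewrite addrA subrK.
Qed.

Lemma gdS mu I I' s a : I \subset I' -> s \in I -> gd mu I s a -> gd mu I' s a.
Proof. by move=> II _; apply: dual_coneS. Qed.

Notation coordsE := (coords (1%g : chart) cf).
Notation degE mu := (deg (1%g : chart) cf (gd mu)).

Definition real1 mu x : cochK := [ffun I => [ffun b => sc (x I b) * tc (wt 1%g b + mu)]].

Lemma real1_coords mu x I s a :
  \sum_b trans s 1%g a b * real1 mu x I b = sc (coordsE s (x I) a) * tc (wt s a + mu).
Proof.
rewrite [coords _ _ _ _ _]ffunE rmorph_sum mulr_suml; apply: eq_bigr => b _.
have -> : wt s a + mu = (wt s a - wt 1%g b) + (wt 1%g b + mu) by rewrite addrA subrK.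
by rewrite cfE !ffunE mulrACA -tcharD; congr (_ * _); symmetry; exact: rmorphM.
Qed.

Lemma real1_cochain mu p x : degE mu p.+1 x -> cochain p (real1 mu x).
Proof.
move=> dx I; have := dx I; case: ifP => Ip H; last first.
  by apply/ffunP => b; rewrite ffunE H !ffunE rmorph0 mul0r.
move=> s sI a; rewrite real1_coords; apply: regular_scal => nz.
by move: H; rewrite /secs ifF; [apply|apply/negbTE/set0Pn; exists s].
Qed.

Lemma real1_sum (T : Type) (r : seq T) (P : pred T) mu (F : T -> coch) :
  real1 mu (\sum_(i <- r | P i) F i) = \sum_(i <- r | P i) real1 mu (F i).
Proof.
apply: (big_morph (real1 mu)) => [x y|]; apply/ffunP => I; apply/ffunP => b; rewrite !ffunE.
  by rewrite rmorphD mulrDl.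
by rewrite rmorph0 mul0r.
Qed.

Lemma real1D mu x y : real1 mu (x + y) = real1 mu x + real1 mu y.
Proof. by apply/ffunP => I; apply/ffunP => b; rewrite !ffunE rmorphD mulrDl. Qed.

Lemma real1Z mu c x : real1 mu (c *: x) = sc c *: real1 mu x.
Proof.
apply/ffunP => I; apply/ffunP => b; rewrite !ffunE rmorphM.
by rewrite -[RHS]/(sc c * (sc (x I b) * tc (wt 1%g b + mu))) mulrA.
Qed.

Lemma real1_0 mu : real1 mu 0 = 0.
Proof. by apply/ffunP => I; apply/ffunP => b; rewrite !ffunE rmorph0 mul0r. Qed.

Lemma real1_delta mu x : coboundary (real1 mu x) = real1 mu (delta x).
Proof.
apply/ffunP => J; apply/ffunP => b; rewrite !ffunE !sum_ffunE rmorph_sum mulr_suml.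
apply: eq_bigr => s sJ; rewrite !ffunE -[LHS]/(_ * _) /sgn rmorphM mulrA; congr (_ * _ * _).
by rewrite rmorphXn rmorphN rmorph1.
Qed.

Lemma real1_free S (x : char -> coch) : uniq S -> \sum_(mu <- S) real1 mu (x mu) = 0 ->
  forall mu, mu \in S -> x mu = 0.
Proof.
move=> uS E0 mu muS; apply/ffunP => I; apply/ffunP => b; rewrite !ffunE.
pose w := wt 1%g b.
have := @tchar_free kk m [seq w + nu | nu <- S] (fun a => x (a - w) I b).
rewrite map_inj_uniq; last exact: addrI.
move=> /(_ uS) H; have := H _ (w + mu); rewrite [w + mu - w]addrC addKr; apply; last exact: map_f.
have := congr1 (fun c : cochK => c I b) E0; rewrite /= sum_ffunE sum_ffunE !ffunE => Z.
rewrite big_map -[RHS]Z; apply: eq_bigr => nu _; by rewrite !ffunE [w + nu - w]addrC addKr.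
Qed.

(** Collect the terms of the coordinates by weight; as the transition functions are homogeneous,
    each part is again a cochain. *)
Lemma cochain_split p (c : cochK) : cochain p c -> exists S (x : char -> coch),
  [/\ uniq S, forall mu, degE mu p.+1 (x mu) & c = \sum_(mu <- S) real1 mu (x mu)].
Proof.
move=> hc; pose s I := chart_of (1%g : chart) I.
have sI I : #|I| == p.+1 -> s I \in I.
  by move=> /eqP cI; apply: chart_of_in; rewrite -card_gt0 cI.
have [l Hl] : exists l : {set chart} -> frame E -> seq (kk * char), forall I a, #|I| == p.+1 ->
    all (fun q => dual_cone I q.2) (l I a) /\
    \sum_b trans (s I) 1%g a b * c I b = \sum_(q <- l I a) sc q.1 * tc q.2.
  have H (q : {set chart} * frame E) : exists l : seq (kk * char), #|q.1| == p.+1 ->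
      all (fun r => dual_cone q.1 r.2) l /\
      \sum_b trans (s q.1) 1%g q.2 b * c q.1 b = \sum_(r <- l) sc r.1 * tc r.2.
    have := hc q.1; case: ifP => Iq; last by exists [::].
    by move=> /(_ _ (sI _ Iq) q.2)[l Hl]; exists l.
  by have /fin_all_exists[l Hl] := H; exists (fun I a => l (I, a)) => I a; apply: (Hl (I, a)).
pose y I a mu : kk := \sum_(q <- l I a | q.2 == mu + wt (s I) a) q.1.
pose x mu : coch := [ffun I : {set chart} => if #|I| == p.+1 then [ffun b => \sum_a cf 1%g (s I) b a * y I a mu] else 0].
have xc mu I a : #|I| == p.+1 -> coordsE (s I) (x mu I) a = y I a mu.
  move=> Ip; rewrite ffunE; under eq_bigr => b _ do rewrite ffunE Ip ffunE mulr_sumr.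
  rewrite exchange_big (bigD1 a) //= [X in _ + X]big1 ?addr0 => [|a' ne].
    by under eq_bigr => b _ do rewrite mulrA; rewrite -mulr_suml cfM cf1 eqxx mul1r.
  by under eq_bigr => b _ do rewrite mulrA; rewrite -mulr_suml cfM cf1 eq_sym (negbTE ne) mul0r.
pose S := undup (flatten [seq [seq q.2 - wt (s r.1) r.2 | q <- l r.1 r.2] | r <- enum {: {set chart} * frame E}]).
exists S, x; split; first exact: undup_uniq.
  move=> mu I; case: ifP => Ip; last by rewrite ffunE Ip.
  apply: (secs_one cfM (@cf_gd mu)) (sI I Ip) _ => a; rewrite xc //.
  case: (boolP (has (fun q => q.2 == mu + wt (s I) a) (l I a))) => [/hasP[q ql /eqP E'] _|/hasPn N].
    by have [/allP /(_ q ql)] := Hl I a Ip; rewrite E' /gd addrC.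
  rewrite /y big1_seq ?eqxx // => q /andP[/eqP qE ql]; by have := N q ql; rewrite qE eqxx.
apply/ffunP => I; rewrite sum_ffunE; case: (boolP (#|I| == p.+1)) => Ip; last first.
  have := hc I; rewrite (negbTE Ip) => ->; rewrite big1 // => mu _.
  by apply/ffunP => b; rewrite !ffunE (negbTE Ip) ffunE rmorph0 mul0r.
apply/ffunP => b; rewrite sum_ffunE.
have [_ h1 hM] := hE.
have -> : c I b = \sum_a trans 1%g (s I) b a * \sum_b' trans (s I) 1%g a b' * c I b'.
  under [RHS]eq_bigr => a _ do rewrite mulr_sumr.
  rewrite exchange_big (bigD1 b) //= [X in _ + X]big1 ?addr0 => [|b' ne].
    by under eq_bigr => a _ do rewrite mulrA; rewrite -mulr_suml hM h1 eqxx mul1r.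
  by under eq_bigr => a _ do rewrite mulrA; rewrite -mulr_suml hM h1 eq_sym (negbTE ne) mul0r.
transitivity (\sum_a \sum_(mu <- S) sc (cf 1%g (s I) b a * y I a mu) * tc (wt 1%g b + mu)).
  apply: eq_bigr => a _; have [_ ->] := Hl I a Ip.
  pose S' := [seq mu + wt (s I) a | mu <- S].
  have uS' : uniq S' by rewrite map_inj_uniq ?undup_uniq //; apply: addIr.
  rewrite (collect_terms uS') => [|_ /mapP[q ql ->]]; last first.
    apply/mapP; exists (q.2 - wt (s I) a); last by rewrite subrK.
    rewrite mem_undup; apply/flatten_mapP; exists (I, a); first by rewrite mem_enum.
    by apply/mapP; exists q.
  rewrite big_map mulr_sumr; apply: eq_bigr => mu _.
  rewrite cfE mulrACA -rmorphM -tcharD; congr (_ * tc _).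
  by rewrite addrACA addNr addr0.
rewrite exchange_big; apply: eq_bigr => mu _; rewrite !ffunE Ip ffunE rmorph_sum mulr_suml.
by [].
Qed.

End Cochains.

(** * Moving one element to the front of the orderings *)

Section OneEarlier.
Variables (m : nat) (i : 'I_m.+1).
Local Notation char := {ffun 'I_m.+1 -> int}.
Local Notation chart := {perm 'I_m.+1}.
Implicit Types (s t : chart) (I : {set chart}) (a : char).

Definition ipos s : nat := (s^-1)%g i.
(** [i] is exchanged with its predecessor in the ordering; in first place nothing changes. *)
Definition earlier s : chart := (tperm (inord (ipos s).-1) ((s^-1)%g i) * s)%g.

Lemma ipos_lt s : (ipos s < m.+1)%N. Proof. exact: ltn_ord. Qed.

Lemma earlier_inv s x : ((earlier s)^-1)%g x = tperm (inord (ipos s).-1) ((s^-1)%g i) ((s^-1)%g x).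
Proof.
apply: (@perm_inj _ (earlier s)); rewrite permKV /earlier permM tpermK permKV //.
Qed.

Lemma ipos_earlier s : (0 < ipos s)%N -> (ipos (earlier s) < ipos s)%N.
Proof.
move=> p0; rewrite {1}/ipos earlier_inv tpermR inordK; last exact: leq_ltn_trans (leq_pred _) (ipos_lt s).
by rewrite prednK.
Qed.

Lemma prefix_earlier s d : (0 < ipos s)%N -> d != ipos s -> prefix (earlier s) d = prefix s d.
Proof.
move=> p0 dne; apply/setP => x; rewrite !mem_prefix earlier_inv.
have E : (inord (ipos s).-1 : 'I_m.+1) = (ipos s).-1 :> nat.
  by rewrite inordK //; apply: leq_ltn_trans (leq_pred _) (ipos_lt s).
case: tpermP => [->|->|//]; rewrite E -/(ipos s); move: dne p0; move: (ipos s) => c; lia.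
Qed.

(** The set {i} is then a common ray, and a_i < 0 violates its inequality; for m = 0 it is the whole
    set, where the coordinates sum to 0. *)
Lemma dual_cone_first I s a : a i < 0 -> ipos s = 0%N -> s \in I ->
  (forall t, t \in I -> ipos t = 0%N) -> ~~ dual_cone I a.
Proof.
move=> ai ps sI pI; apply/negP => /andP[/eqP a0 /forall_inP H].
have pr t : t \in I -> prefix t 1 = [set i].
  move=> tI; apply/setP => x; rewrite mem_prefix inE ltnS leqn0 -(pI t tI).
  by rewrite (inj_eq val_inj) (inj_eq perm_inj).
suff : 0 <= a i by rewrite leNgt ai.
case: (posnP m) => [m0|m0].
  have -> : a i = \sum_j a j; last by rewrite a0.
  rewrite (bigD1 i) //= big1 ?addr0 // => j ji; case/eqP: ji; apply: val_inj.
  have z (e : 'I_m.+1) : nat_of_ord e = 0%N by apply/eqP; rewrite -leqn0 -m0 -ltnS.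
  by rewrite /= !z.
have -> : a i = \sum_(j in [set i]) a j by rewrite big_set1.
apply: H; apply/bigcapP => t tI; rewrite rays_prefix; apply/existsP.
by exists (Ordinal m0); rewrite /= pr.
Qed.

(** The exchange destroys a single ray, the set S of the elements before i. If S is common to all
    charts of [I], then S with i added is a common ray or the whole set, and the sum over S is
    larger than the sum over it because a_i < 0. *)
Lemma dual_cone_earlier I s a : a i < 0 -> (0 < ipos s)%N -> s \in I ->
  (forall t, t \in I -> (ipos t <= ipos s)%N) -> dual_cone (earlier s |: I) a -> dual_cone I a.
Proof.
move=> ai p0 sI pI /andP[a0 /forall_inP H]; rewrite /dual_cone a0; apply/forall_inP => S /bigcapP SI.
have := SI s sI; rewrite rays_prefix => /existsP[c /eqP SE].
have [cp|cp] := eqVneq c.+1 (ipos s); last first.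
  apply: H; apply/bigcapP => t; rewrite inE => /orP[/set1P ->|/SI //].
  rewrite rays_prefix; apply/existsP; exists c; by rewrite prefix_earlier // SE.
have iS : i \notin S by rewrite SE mem_prefix -/(ipos s) -cp ltnn.
have pt t : t \in I -> prefix t c.+2 = i |: S.
  move=> tI; have := SI t tI; rewrite rays_prefix => /existsP[d /eqP Sd].
  have cd : c.+1 = d.+1.
    by have := congr1 (fun A : {set _} => #|A|) SE; rewrite {1}Sd !card_prefix ?ltnS // 1?ltnW // ltnS.
  have it : ipos t = c.+1.
    apply/eqP; rewrite eqn_leq cp pI //= -cp cd leqNgt; apply: contra iS.
    by rewrite Sd mem_prefix.
  apply/setP => x; rewrite !inE Sd -cd !mem_prefix ltnS leq_eqVlt; congr (_ || _).
  by rewrite -it (inj_eq val_inj) (inj_eq perm_inj).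
suff : 0 <= a i + \sum_(j in S) a j by move: ai; move: (\sum_(j in S) a j) (a i) => u v; clear; lia.
have -> : a i + \sum_(j in S) a j = \sum_(j in i |: S) a j by rewrite big_setU1.
have cm : (c.+1 <= m)%N := ltn_ord c.
move: cm; rewrite leq_eqVlt => /orP[/eqP cm|cm].
  rewrite (_ : i |: S = setT); first by rewrite (eq_bigl xpredT) ?(eqP a0) // => j; rewrite inE.
  by rewrite -(pt s sI) cm; apply/setP => x; rewrite mem_prefix inE ltn_ord.
apply: H; apply/bigcapP => t; rewrite inE rays_prefix => /orP[/set1P ->|tI]; apply/existsP; exists (Ordinal cm).
  by rewrite prefix_earlier //= ?pt // -cp neq_ltn ltnSn orbT.
by rewrite /= pt.
Qed.

End OneEarlier.

Lemma sum_bounded_pairs (Z : nmodType) (A : finType) (N : nat) (D : A -> nat) (g : A * 'I_N -> Z) :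
  \sum_(q : A * 'I_N | (q.2 < D q.1)%N) g q = \sum_a \sum_(j < N | (j < D a)%N) g (a, j).
Proof. by rewrite pair_big_dep /=; apply: eq_big => [[a j]|[a j] _]. Qed.

(** * Cohomology of a linearized bundle, weight by weight *)

Section EulerCharacteristic.
Variables (kk : fieldType) (m : nat) (E : bundle kk m.+1).
Local Notation K := {fraction {mpoly kk[m.+1]}}.
Local Notation char := {ffun 'I_m.+1 -> int}.
Local Notation chart := {perm 'I_m.+1}.
Variable wt : chart -> frame E -> char.
Hypotheses (hE : is_bundle E) (hL : linearization wt).
Local Notation sc := (@scal kk m.+1).
Local Notation tc := (@tchar kk m.+1).
Local Notation sec := {ffun frame E -> kk^o}.
Local Notation coch := {ffun {set chart} -> sec}.
Local Notation cochK := {ffun {set chart} -> {ffun frame E -> K^o}}.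
Local Notation o := (1%g : chart).
Local Notation cfL := (cf hL).
Local Notation gdw := (gd wt).
Local Notation ZZ mu q := (Zv o cfL (gdw mu) q).
Local Notation BB mu q := (Bv o cfL (gdw mu) q).
Local Notation HH mu q := (Hv o cfL (gdw mu) q).
Local Notation degE mu := (deg o cfL (gdw mu)).
Implicit Types (mu : char) (I : {set chart}) (x : coch) (S : seq char).

Let c1 := cf1 hE hL.
Let cM := cfM hE hL.
Let cg mu := @cf_gd kk m E wt hE hL mu.
Let gS mu := @gdS kk m E wt mu.

Definition wt_bound : nat := (\sum_i \sum_s \sum_a `|wt s a i|)%N.
(** Outside the box the complex is acyclic. The coordinates of a weight are bounded below one by one
    and their sum above, whence the doubling. *)
Definition box_size := wt_bound.*2.
Definition box : finType := {ffun 'I_m.+1 -> 'I_(box_size.*2).+1}.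
Definition of_box (f : box) : char := [ffun i => (f i)%:Z - box_size%:Z].

Lemma of_box_inj : injective of_box.
Proof.
move=> f g H; apply/ffunP => i; apply: val_inj; have := congr1 (fun a : char => a i) H.
by rewrite !ffunE => /addIr[].
Qed.

(** If some coordinate of [wt s a + mu] is negative for all s and a, moving that coordinate to the
    front contracts the complex; if no coordinate sum vanishes, there are no sections at all. In the
    remaining case [mu] lies in the box. *)
Lemma acyclic_outside mu q : mu \notin codom of_box -> (ZZ mu q.+1 <= BB mu q.+1)%VS.
Proof.
move=> nb; apply/subvP => x /(mem_Zv _ c1 cM (@cg mu))[dx zx].
apply/(mem_Bv _ c1 cM (@cg mu)).
case: (pselect (exists i, forall s a, (wt s a + mu) i < 0)) => [[i Hi]|N].
  apply: (cech_acyclic c1 cM (@cg mu) (@gS mu) (pos := ipos i) (mv := earlier i) _ _ _ dx zx).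
  - by move=> I s a; apply: dual_cone_first.
  - exact: ipos_earlier.
  - by move=> I s a; apply: dual_cone_earlier.
case: (pselect (exists s a, \sum_i (wt s a + mu) i = 0)) => [[s0 [a0 z0]]|N']; last first.
  apply: (cech_acyclic c1 cM (@cg mu) (@gS mu) (pos := fun=> 0%N) (mv := id) _ _ _ dx zx) => //.
  move=> I s a _ _ _; apply/negP => /andP[/eqP z _]; apply: N'; by exists s, a.
exfalso; move/negP: nb; apply.
have lo i : - (\sum_s \sum_a `|wt s a i|)%N%:Z <= mu i.
  move/forallNP: N => /(_ i)/existsNP[s /existsNP[a /negP]]; rewrite -leNgt ffunE.
  have : (`|wt s a i| <= \sum_s \sum_a `|wt s a i|)%N.
    by rewrite (bigD1 s) //= (bigD1 a) //= -!addnA leq_addr.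
  move: (\sum_s _)%N (wt s a i) (mu i) => A w u; lia.
have su : \sum_i mu i <= wt_bound%:Z.
  move: z0; under eq_bigr => i _ do rewrite ffunE.
  rewrite big_split /= => /eqP; rewrite addrC addr_eq0 => /eqP ->; rewrite -sumrN /wt_bound Posz_sum.
  apply: ler_sum => i _.
  have : (`|wt s0 a0 i| <= \sum_s \sum_a `|wt s a i|)%N.
    by rewrite (bigD1 s0) //= (bigD1 a0) //= -!addnA leq_addr.
  move: (\sum_s _)%N (wt s0 a0 i) => A w; lia.
have bd i : - box_size%:Z <= mu i <= box_size%:Z.
  have l1 : (\sum_s \sum_a `|wt s a i| <= wt_bound)%N by rewrite /wt_bound (bigD1 i) //= leq_addr.
  have : \sum_(j | j != i) - (\sum_s \sum_a `|wt s a j|)%N%:Z <= \sum_(j | j != i) mu j by apply: ler_sum.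
  rewrite sumrN -Posz_sum.
  have : (\sum_(j | j != i) \sum_s \sum_a `|wt s a j| <= wt_bound)%N by rewrite /wt_bound [leqRHS](bigD1 i) //= leq_addl.
  move: su; rewrite (bigD1 i) //= /box_size; have := lo i; move: l1.
  move: (\sum_(j | j != i) mu j) (\sum_(j | j != i) _)%N (\sum_s _)%N (mu i) wt_bound.
  move=> A C D u W; rewrite -!lez_nat; lia.
have bn i : (`|(mu i + box_size%:Z)%R| < (box_size.*2).+1)%N by have := bd i; move: (mu i) box_size => u W; lia.
apply/codomP; exists [ffun i => Ordinal (bn i)]; apply/ffunP => i; rewrite !ffunE /=.
by have := bd i; move: (mu i) box_size => u W; lia.
Qed.

Definition chi mu : int :=
  \sum_(I : {set chart} | I != set0) (-1) ^+ #|I|.-1 * (\sum_a (gdw mu I (chart_of o I) a))%N%:Z.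

Lemma chiE mu : chi mu = \sum_(p < #|{: chart}|) (-1) ^+ p * (\dim (HH mu p.+1))%:Z.
Proof. by rewrite (euler_Hv _ c1 cM (@cg mu) (@gS mu)) sum_good_pairs. Qed.

Lemma chi_outside mu : mu \notin codom of_box -> chi mu = 0.
Proof.
move=> nb; rewrite chiE big1 // => p _.
have /eqP -> : HH mu p.+1 == 0%VS by rewrite /Hv diffv_eq0 acyclic_outside.
by rewrite dimv0 mulr0.
Qed.

Definition real S (x : char -> coch) : cochK := \sum_(mu <- S) real1 wt mu (x mu).

Lemma real_ext S S' (x : char -> coch) : uniq S -> uniq S' -> {subset S <= S'} ->
  (forall mu, mu \notin S -> x mu = 0) -> real S' x = real S x.
Proof.
move=> uS uS' sub x0; rewrite /real (bigID (mem S)) /= [X in _ + X]big1 ?addr0 => [|mu nS]; last first.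
  by rewrite x0 // real1_0.
rewrite -big_filter; apply: perm_big; apply: uniq_perm; rewrite ?filter_uniq //.
by move=> a; rewrite mem_filter; case: (boolP (a \in S)) => //= /sub ->.
Qed.

Lemma coboundary_real S (x : char -> coch) : coboundary (real S x) = real S (fun mu => delta (x mu)).
Proof.
rewrite /real; under [RHS]eq_bigr => mu _ do rewrite -real1_delta.
apply: (big_morph (@coboundary kk m.+1 E)) => [u v|]; apply/ffunP => J; rewrite !ffunE.
  by rewrite -big_split; apply: eq_bigr => s _; rewrite /= !ffunE scalerDr.
by rewrite big1 // => s _; rewrite ffunE scaler0.
Qed.

Lemma cochain0 p : cochain p (0 : cochK).
Proof.
move=> I; case: ifP => _; rewrite ffunE // => s _ a; exists [::]; split=> //.
by rewrite big_nil big1 // => b _; rewrite ffunE mulr0.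
Qed.

Lemma cochainD p (u v : cochK) : cochain p u -> cochain p v -> cochain p (u + v).
Proof.
move=> hu hv I; have := hu I; have := hv I; case: ifP => _; rewrite ffunE; last by move=> -> ->; rewrite addr0.
move=> sv su s sI a; have [l [dl El]] := su s sI a; have [r [dr Er]] := sv s sI a.
exists (l ++ r); rewrite all_cat dl dr; split=> //.
by rewrite big_cat /= -El -Er -big_split; apply: eq_bigr => b _; rewrite /= ffunE mulrDr.
Qed.

Lemma real_cochain p S (x : char -> coch) : (forall mu, degE mu p.+1 (x mu)) -> cochain p (real S x).
Proof.
move=> dx; rewrite /real; apply: (big_ind (cochain p)) => [|u v|mu _].
- exact: cochain0.
- exact: cochainD.
exact: real1_cochain (dx mu).
Qed.

Lemma deg_zero mu x : degE mu 0 x -> x = 0.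
Proof.
move=> dx; apply/ffunP => I; rewrite [RHS]ffunE; have := dx I.
by case: ifP => //; rewrite cards_eq0 /secs => ->.
Qed.

Lemma coboundaryP p (c : cochK) : is_coboundary p c <->
  exists S (x : char -> coch), [/\ uniq S, forall mu, mu \notin S -> x mu = 0,
    forall mu, x mu \in BB mu p.+1 & c = real S x].
Proof.
split.
  case: p => [|q] /=; first by move=> ->; exists [::], (fun=> 0); split=> // [mu|]; rewrite ?mem0v // /real big_nil.
  move=> [b [hb ->]]; have [S [y [uS dy ->]]] := cochain_split hE hL hb.
  exists S, (fun mu => if mu \in S then delta (y mu) else 0); split=> // [mu /negbTE -> //|mu|].
    case: ifP => _; rewrite ?mem0v //; apply/(mem_Bv _ c1 cM (@cg mu)); by exists (y mu).
  by rewrite coboundary_real; apply: eq_big_seq => mu ->.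
move=> [S [x [uS x0 xB ->]]].
have H mu : exists y, degE mu p y /\ x mu = delta y.
  by have /(mem_Bv _ c1 cM (@cg mu))[y dy E'] := xB mu; exists y.
pose y mu := sval (cid (H mu)); have yP mu : degE mu p (y mu) /\ x mu = delta (y mu) by exact: svalP (cid (H mu)).
case: p xB H @y yP => [|q] xB H y yP /=.
  rewrite /real big1 // => mu _; have [dy ->] := yP mu.
  by rewrite (deg_zero dy) linear0 real1_0.
exists (real S y); split; first by apply: real_cochain => mu; case: (yP mu).
by rewrite coboundary_real; apply: eq_bigr => mu _; case: (yP mu) => _ ->.
Qed.

Lemma real_lin S k (x y : char -> coch) :
  real S (fun mu => k *: x mu + y mu) = sc k *: real S x + real S y.
Proof.
rewrite /real scaler_sumr -big_split; apply: eq_bigr => mu _.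
by rewrite real1D real1Z.
Qed.

Lemma coboundary_lin p k (u v : cochK) :
  is_coboundary p u -> is_coboundary p v -> is_coboundary p (sc k *: u + v).
Proof.
move=> /coboundaryP[S [x [uS x0 xB ->]]] /coboundaryP[S' [y [uS' y0 yB ->]]].
apply/coboundaryP; pose S1 := undup (S ++ S').
have sS : {subset S <= S1} by move=> mu H; rewrite mem_undup mem_cat H.
have sS' : {subset S' <= S1} by move=> mu H; rewrite mem_undup mem_cat H orbT.
exists S1, (fun mu => k *: x mu + y mu); split; first exact: undup_uniq.
- by move=> mu nS; rewrite x0 ?y0 ?scaler0 ?addr0 //; apply: contra nS => H; [apply: sS'|apply: sS].
- by move=> mu; rewrite memvD // memvZ.
by rewrite real_lin (@real_ext S S1) ?undup_uniq // (@real_ext S' S1) ?undup_uniq.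
Qed.

Lemma coboundary_zero p : is_coboundary p (0 : cochK).
Proof.
by apply/coboundaryP; exists [::], (fun=> 0); split=> // [mu|]; rewrite ?mem0v // /real big_nil.
Qed.

Lemma coboundaryD p (u v : cochK) : is_coboundary p u -> is_coboundary p v -> is_coboundary p (u + v).
Proof. by move=> hu hv; have := coboundary_lin 1 hu hv; rewrite rmorph1 scale1r. Qed.

Lemma coboundaryB p (u v : cochK) : is_coboundary p u -> is_coboundary p v -> is_coboundary p (u - v).
Proof.
by move=> hu hv; have := coboundary_lin (-1) hv hu; rewrite rmorphN1 scaleN1r addrC.
Qed.

Lemma coboundary_sum p (I : finType) (k : I -> kk) (u : I -> cochK) :
  (forall i, is_coboundary p (u i)) -> is_coboundary p (\sum_i sc (k i) *: u i).
Proof.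
move=> H; apply: (big_ind (is_coboundary p)) => [|a b|i _]; [exact: coboundary_zero|exact: coboundaryD|].
by rewrite -[_ *: _]addr0; apply: coboundary_lin => //; apply: coboundary_zero.
Qed.

Lemma cocycle_split p (z : cochK) : is_cocycle p z -> exists S (x : char -> coch),
  [/\ uniq S, forall mu, mu \notin S -> x mu = 0, forall mu, x mu \in ZZ mu p.+1 & z = real S x].
Proof.
move=> [hz dz]; have [S [x [uS dx zE]]] := cochain_split hE hL hz.
exists S, (fun mu => if mu \in S then x mu else 0); split=> // [mu /negbTE -> //|mu|].
  case: ifP => muS; last exact: mem0v.
  apply/(mem_Zv _ c1 cM (@cg mu)); split=> //.
  have := dz; rewrite zE coboundary_real => /(real1_free uS); exact.
by rewrite zE; apply: eq_big_seq => mu ->.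
Qed.

Definition is_cohomology_basis p d (b : 'I_d -> cochK) : Prop :=
  (forall i, is_cocycle p (b i)) /\ forall z, is_cocycle p z ->
    exists! a : {ffun 'I_d -> kk}, is_coboundary p (z - \sum_i sc (a i) *: b i).

(** [cohomology_dim] is a definite description, so its value is pinned down by comparing bases: the
    coordinate matrices multiply to the identity. *)
Lemma cohomology_basis_le p d d' (b : 'I_d -> cochK) (b' : 'I_d' -> cochK) :
  is_cohomology_basis p b -> is_cohomology_basis p b' -> (d <= d')%N.
Proof.
move=> [cb hb] [cb' hb'].
have /fin_all_exists[A HA] j : exists a : {ffun 'I_d' -> kk}, is_coboundary p (b j - \sum_i sc (a i) *: b' i).
  by have [a [Ha _]] := hb' (b j) (cb j); exists a.
have /fin_all_exists[B HB'] j : exists a : {ffun 'I_d -> kk}, is_coboundary p (b' j - \sum_i sc (a i) *: b i).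
  by have [a [Ha _]] := hb (b' j) (cb' j); exists a.
pose MA : 'M[kk]_(d, d') := \matrix_(j, i) A j i; pose MB : 'M[kk]_(d', d) := \matrix_(i, k) B i k.
apply: (@mulmx1_min _ _ _ MA MB); apply/matrixP => j k.
have [a0 [_ u0]] := hb (b j) (cb j).
pose a1 : {ffun 'I_d -> kk} := [ffun k => (MA *m MB) j k].
pose a2 : {ffun 'I_d -> kk} := [ffun k => (j == k)%:R].
have h1 : is_coboundary p (b j - \sum_i sc (a1 i) *: b i).
  have -> : b j - \sum_i sc (a1 i) *: b i =
      (b j - \sum_i sc (A j i) *: b' i) + \sum_i sc (A j i) *: (b' i - \sum_k sc (B i k) *: b k).
    rewrite -addrA; congr (_ + _); under [X in _ + X]eq_bigr => i _ do rewrite scalerBr.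
    rewrite sumrB addKr; congr (- _); under [RHS]eq_bigr => i _ do rewrite scaler_sumr.
    rewrite exchange_big; apply: eq_bigr => c _; rewrite ffunE mxE rmorph_sum scaler_suml.
    by apply: eq_bigr => i _; rewrite !mxE rmorphM scalerA.
  by apply: coboundaryD (HA j) _; apply: coboundary_sum.
have h2 : is_coboundary p (b j - \sum_i sc (a2 i) *: b i).
  rewrite (bigD1 j) //= ffunE eqxx rmorph1 scale1r big1 ?addr0 ?subrr; first exact: coboundary_zero.
  by move=> i ij; rewrite ffunE eq_sym (negbTE ij) rmorph0 scale0r.
have := u0 a1 h1; rewrite (u0 a2 h2) => /ffunP/(_ k); rewrite !ffunE => <-.
by rewrite mxE.
Qed.

Lemma vbasis_span (vT : vectType kk) (U : {vspace vT}) v : v \in U ->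
  exists c : nat -> kk, v = \sum_(j < \dim U) c j *: (vbasis U)`_j.
Proof.
move=> /coord_vbasis {1}->; exists (fun j => oapp (fun i => coord (vbasis U) i v) 0 (insub j)).
by apply: eq_bigr => j _; rewrite valK.
Qed.

Lemma vbasis_free (vT : vectType kk) (U : {vspace vT}) (c : nat -> kk) :
  \sum_(j < \dim U) c j *: (vbasis U)`_j = 0 -> forall j, (j < \dim U)%N -> c j = 0.
Proof.
have /freeP H := basis_free (vbasisP U).
by move=> /H Hc j jU; apply: (Hc (Ordinal jU)).
Qed.

Section CohomologyBasis.
Variable p : nat.
Local Notation N := (\dim {:coch}).
Local Notation H f := (HH (of_box f) p.+1).

(** A weight in the box together with an index below the dimension of its cohomology; the common
    bound [N] avoids a dependent index type. *)
Definition basis_index : {set box * 'I_N} := [set q : box * 'I_N | (q.2 < \dim (H q.1))%N].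
Definition basis_vector (q : box * 'I_N) : coch := (vbasis (H q.1))`_q.2.
Definition basis_cocycle (i : 'I_#|basis_index|) : cochK :=
  real1 wt (of_box (enum_val i).1) (basis_vector (enum_val i)).
Definition box_comb (a : box * 'I_N -> kk) (f : box) : coch :=
  \sum_(j < N | (j < \dim (H f))%N) a (f, j) *: basis_vector (f, j).
Definition extend_box (h : box -> coch) mu : coch :=
  if [pick f | of_box f == mu] is Some f then h f else 0.

Lemma extend_boxE h f : extend_box h (of_box f) = h f.
Proof.
rewrite /extend_box; case: pickP => [g /eqP/of_box_inj -> //|/(_ f)].
by rewrite eqxx.
Qed.

Lemma extend_box_out h mu : mu \notin codom of_box -> extend_box h mu = 0.
Proof.
rewrite /extend_box; case: pickP => // f /eqP <-; by rewrite codom_f.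
Qed.

Lemma sum_basis_cocycles (a : box * 'I_N -> kk) :
  \sum_i sc (a (enum_val i)) *: basis_cocycle i = real (codom of_box) (extend_box (box_comb a)).
Proof.
rewrite -(big_enum_val (fun q => sc (a q) *: real1 wt (of_box q.1) (basis_vector q))) /=.
rewrite /real codomE big_map big_enum /=.
rewrite (eq_bigl (fun q : box * 'I_N => (q.2 < \dim (H q.1))%N)); last by move=> q; rewrite inE.
rewrite (sum_bounded_pairs (fun f => \dim (H f))).
apply: eq_bigr => f _; rewrite extend_boxE /box_comb real1_sum.
by apply: eq_bigr => j _; rewrite real1Z.
Qed.

Lemma box_comb_mem a f : box_comb a f \in H f.
Proof.
apply: memv_suml => j jH; apply: memvZ; apply: vbasis_mem; apply: mem_nth; by rewrite size_tuple.
Qed.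

Lemma box_combE (c : nat -> kk) a f : (forall j : 'I_N, a (f, j) = c j) ->
  box_comb a f = \sum_(j < \dim (H f)) c j *: (vbasis (H f))`_j.
Proof.
move=> E'; rewrite (big_ord_widen N (fun j => c j *: (vbasis (H f))`_j)); last by apply/dimvS/subvf.
by apply: eq_bigr => j _; rewrite E'.
Qed.

Lemma basis_cocycle_free a : is_coboundary p (\sum_i sc (a (enum_val i)) *: basis_cocycle i) ->
  forall i : 'I_#|basis_index|, a (enum_val i) = 0.
Proof.
rewrite sum_basis_cocycles => /coboundaryP[S [x [uS x0 xB E']]] i.
have ui : uniq (codom of_box) by rewrite map_inj_uniq ?enum_uniq //; apply: of_box_inj.
pose S1 := undup (codom of_box ++ S); set e := extend_box _ in E'.
have eS : real S1 e = real (codom of_box) e.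
  have sub : {subset codom of_box <= S1} by move=> mu H0; rewrite mem_undup mem_cat H0.
  exact: real_ext ui (undup_uniq _) sub (extend_box_out _).
have xS : real S1 x = real S x.
  by apply: real_ext; rewrite ?undup_uniq // => mu muS; rewrite mem_undup mem_cat muS orbT.
have D0 : real S1 (fun mu => (-1) *: x mu + e mu) = 0.
  by rewrite real_lin eS xS E' rmorphN1 scaleN1r addNr.
set q := enum_val i; have qB : q \in basis_index by apply: enum_valP.
have := real1_free (undup_uniq _) D0 (mu := of_box q.1).
rewrite mem_undup mem_cat codom_f => /(_ isT); rewrite scaleN1r addrC => /eqP; rewrite subr_eq0 => /eqP ex.
have h0 : box_comb a q.1 = 0.
  apply/eqP; rewrite -memv0 -(capv_diff (ZZ (of_box q.1) p.+1) (BB (of_box q.1) p.+1)) memv_cap.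
  by rewrite box_comb_mem -[box_comb a q.1]extend_boxE -/e ex xB.
have [c Hc] : exists c : nat -> kk, forall j : 'I_N, a (q.1, j) = c j.
  by exists (fun j => oapp (fun j' => a (q.1, j')) 0 (insub j)) => j; rewrite valK.
move: h0; rewrite (box_combE Hc) => /vbasis_free/(_ q.2); rewrite -Hc -surjective_pairing; apply.
by move: qB; rewrite inE.
Qed.

Lemma basis_cocycle_span z : is_cocycle p z ->
  exists a, is_coboundary p (z - \sum_i sc (a (enum_val i)) *: basis_cocycle i).
Proof.
move=> /cocycle_split[S [x [uS x0 xZ ->]]].
have /fin_all_exists[h Hh] f : exists h, h \in H f /\ x (of_box f) - h \in BB (of_box f) p.+1.
  have := xZ (of_box f); rewrite -[ZZ _ _](addv_diff_cap _ (BB (of_box f) p.+1)).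
  move=> /memv_addP[u uH [v]]; rewrite memv_cap => /andP[_ vB] ->.
  by exists u; rewrite addrC addKr.
have /fin_all_exists[c Hc] f : exists c : nat -> kk, h f = \sum_(j < \dim (H f)) c j *: (vbasis (H f))`_j.
  by apply: vbasis_span; case: (Hh f).
pose a (q : box * 'I_N) := c q.1 q.2; exists a.
rewrite sum_basis_cocycles; apply/coboundaryP.
pose S1 := undup (codom of_box ++ S); set e := extend_box _.
have eE f : e (of_box f) = h f by rewrite /e extend_boxE (@box_combE (c f)) // Hc.
exists S1, (fun mu => (-1) *: e mu + x mu); split; first exact: undup_uniq.
- move=> mu; rewrite mem_undup mem_cat negb_or => /andP[nb nS].
  by rewrite x0 // /e extend_box_out // scaler0 addr0.
- move=> mu; rewrite scaleN1r addrC; case: (boolP (mu \in codom of_box)) => [/codomP[f ->]|nb].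
    by rewrite eE; case: (Hh f).
  by rewrite /e extend_box_out // subr0; apply: (subvP (acyclic_outside _ nb)).
have ui : uniq (codom of_box) by rewrite map_inj_uniq ?enum_uniq //; apply: of_box_inj.
have sub : {subset codom of_box <= S1} by move=> mu H0; rewrite mem_undup mem_cat H0.
have sub' : {subset S <= S1} by move=> mu H0; rewrite mem_undup mem_cat H0 orbT.
rewrite [RHS]real_lin rmorphN1 scaleN1r addrC.
by rewrite (real_ext ui (undup_uniq _) sub (extend_box_out _)) (real_ext uS (undup_uniq _) sub' x0).
Qed.

Lemma basis_cocycleP : is_cohomology_basis p basis_cocycle.
Proof.
split.
  move=> i; set q := enum_val i; have qB : q \in basis_index by apply: enum_valP.
  have : basis_vector q \in ZZ (of_box q.1) p.+1.
    apply: (subvP (diffvSl _ _)) ; apply: vbasis_mem; apply: mem_nth; rewrite size_tuple.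
    by move: qB; rewrite inE.
  move=> /(mem_Zv _ c1 cM (@cg _))[dv zv]; split; first exact: real1_cochain dv.
  by rewrite real1_delta zv real1_0.
move=> z cz; have [a Ha] := basis_cocycle_span cz.
exists [ffun i => a (enum_val i)]; split.
  by under eq_bigr => i _ do rewrite ffunE.
move=> a' Ha'; apply/ffunP => i.
have [c Hc] : exists c : box * 'I_N -> kk, forall i, c (enum_val i) = a' i.
  exists (fun q => \sum_(i | enum_val i == q) a' i) => j.
  by rewrite (eq_bigl (pred1 j)) ?big_pred1_eq // => k; rewrite (inj_eq enum_val_inj).
rewrite ffunE -Hc; apply/eqP; rewrite -subr_eq0; apply/eqP.
apply: (@basis_cocycle_free (fun q => a q - c q)).
have := coboundaryB Ha' Ha; congr (is_coboundary _ _).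
rewrite opprB addrC addrA subrK -sumrB; apply: eq_bigr => j _.
by rewrite rmorphB scalerBl Hc.
Qed.

Lemma cohomology_dimE : cohomology_dim E p = (\sum_f \dim (H f))%N.
Proof.
have [b Hb] : exists b : 'I_(cohomology_dim E p) -> cochK, is_cohomology_basis p b.
  rewrite /cohomology_dim /the; case: pselect => [h|[]]; first exact: (projT2 (cid h)).
  by exists #|basis_index|, basis_cocycle; apply: basis_cocycleP.
have -> : cohomology_dim E p = #|basis_index|.
  by apply/eqP; rewrite eqn_leq (cohomology_basis_le Hb basis_cocycleP) (cohomology_basis_le basis_cocycleP Hb).
rewrite -sum1_card (eq_bigl (fun q : box * 'I_N => (q.2 < \dim (H q.1))%N)); last by move=> q; rewrite inE.
rewrite (sum_bounded_pairs (fun f => \dim (H f)) (fun=> 1%N)).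
apply: eq_bigr => f _; rewrite -(big_ord_widen N (fun=> 1%N)) ?sum1_card ?card_ord //.
exact/dimvS/subvf.
Qed.

End CohomologyBasis.

Lemma euler_charE : euler_char E = \sum_f chi (of_box f).
Proof.
under [RHS]eq_bigr => f _ do rewrite chiE.
rewrite exchange_big /euler_char cardsT; apply: eq_bigr => p _.
by rewrite cohomology_dimE Posz_sum mulr_sumr.
Qed.

End EulerCharacteristic.

(** * Localization at the fixed points *)

Section Localization.
Variables (kk : fieldType) (m : nat) (E : bundle kk m.+1) (F : fieldType) (t : 'I_m.+1 -> F).
Local Notation char := {ffun 'I_m.+1 -> int}.
Local Notation chart := {perm 'I_m.+1}.
Variable wt : chart -> frame E -> char.
Hypotheses (hE : is_bundle E) (hL : linearization wt) (t0 : forall i, t i != 0) (tinj : injective t).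

(** In the alternating sum, sets of two or more charts represent 0, and a single chart gives the
    character of its fibre times the series of its dual cone. *)
Lemma chi_rat_sum : rat_sum (qchar t) (fun mu => (chi wt mu)%:~R)
  (\sum_s (\sum_a qchar t (wt s a)) * chamber t s).
Proof.
pose x (I : {set chart}) : F := if [pick s | I == [set s]] is Some s then chamber t s else 0.
have xI (I : {set chart}) : I != set0 -> rat_sum (qchar t) (fun mu => (dual_cone I mu)%:R) (x I).
  move=> /set0Pn[s sI]; rewrite /x; case: pickP => [s' /eqP ->|N]; first exact: rat_sum_chamber.
  have /subsetPn[s' s'I] : ~~ (I \subset [set s]) by have := N s; rewrite eqEsubset sub1set sI andbT => ->.
  by rewrite inE eq_sym => ne; apply: (rat_sum_flat t0 tinj sI s'I ne).
have H (I : {set chart}) a : I != set0 -> rat_sum (qchar t)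
    (fun mu => (-1) ^+ #|I|.-1 * (dual_cone I (mu + wt (chart_of (1%g : chart) I) a))%:R)
    ((-1) ^+ #|I|.-1 * (qchar t (wt (chart_of (1%g : chart) I) a) * x I)).
  by move=> I0; apply: (rat_sumZ _ (rat_sum_shift (qcharD t0) _ (xI I I0))).
pose y (I : {set chart}) : F := \sum_a (-1) ^+ #|I|.-1 * (qchar t (wt (chart_of (1%g : chart) I) a) * x I).
have -> : \sum_s (\sum_a qchar t (wt s a)) * chamber t s = \sum_(I : {set chart} | I != set0) y I.
  have x1 s : x [set s] = chamber t s.
    by rewrite /x; case: pickP => [s' /eqP/set1_inj -> //|/(_ s)]; rewrite eqxx.
  have c1 (s : chart) : chart_of (1%g : chart) [set s] = s.
    by apply/set1P; apply: chart_of_in; apply/set0Pn; exists s; rewrite inE.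
  rewrite (bigID (fun I : {set chart} => I == [set chart_of (1%g : chart) I])) /= [X in _ = _ + X]big1 ?addr0.
    rewrite (reindex_onto (fun s : chart => [set s]) (chart_of (1%g : chart))) /= => [|I /andP[_ /eqP <-] //].
    rewrite [RHS](eq_bigl xpredT) => [|s]; last first.
      apply/andP; split; last exact/eqP/c1.
      apply/andP; split; first by apply/set0Pn; exists s; rewrite inE.
      by apply/eqP; exact: (congr1 (fun u : chart => [set u]) (esym (c1 s))).
    by apply: eq_bigr => s _; rewrite /y cards1 c1 x1 mulr_suml; apply: eq_bigr => a _; rewrite mul1r.
  move=> I /andP[_ nI]; rewrite /y big1 // => a _; rewrite /x; case: pickP => [s /eqP Is|_]; last by rewrite !mulr0.
  by move: nI; rewrite {1}Is [in X in X -> _]Is c1 eqxx.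
have -> : (fun mu => (chi wt mu)%:~R : F) = fun mu => \sum_(I : {set chart} | I != set0) \sum_a
    (-1) ^+ #|I|.-1 * (dual_cone I (mu + wt (chart_of (1%g : chart) I) a))%:R.
  apply: funext => mu; rewrite /chi rmorph_sum; apply: eq_bigr => I _.
  rewrite rmorphM rmorphXn rmorphN1 -mulr_sumr; congr (_ * _).
  apply: (etrans (natr_sum F _ _ _)); apply: eq_bigr => a _; by rewrite /gd addrC.
apply: (rat_sum_sum (qcharD t0)) => I I0; apply: (rat_sum_sum (qcharD t0)) => a _; exact: H.
Qed.

Lemma euler_localization :
  \sum_(f : box wt) (chi wt (of_box f))%:~R * qchar t (- of_box f) =
  \sum_s (\sum_a qchar t (wt s a)) * chamber t s.
Proof.
symmetry; apply: (rat_sum_uniq (qcharD t0) chi_rat_sum); exists (codom (@of_box kk m E wt)).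
  by rewrite map_inj_uniq ?enum_uniq //; apply: of_box_inj.
split; last by rewrite codomE big_map big_enum.
move=> mu; apply: contraR => nb; by rewrite (chi_outside hE hL nb).
Qed.

End Localization.

(** * Specialization at q = 1 *)

Section Specialization.
Local Notation L := {fraction {poly int}}.
Local Notation q := (tofrac ('X : {poly int}) : L).
Implicit Types (x y : L) (z u : int).

(* The value of a Laurent polynomial in q at q = 1. *)
Definition at_one x z : Prop := exists N (p : {poly int}), x * q ^+ N = tofrac p /\ p.[1] = z.

Lemma q_neq0 : q != 0. Proof. by rewrite tofrac_eq0 polyX_eq0. Qed.

Lemma at_one_uniq x z u : at_one x z -> at_one x u -> z = u.
Proof.
move=> [N [p [E <-]]] [N' [p' [E' <-]]].
have : tofrac (p * 'X^N') = tofrac (p' * 'X^N) :> L.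
  by rewrite !rmorphM !rmorphXn /= -E -E' mulrAC.
move=> /eqP; rewrite tofrac_eq => /eqP/(congr1 (horner_eval 1)).
by rewrite /horner_eval !hornerM !hornerXn !expr1n !mulr1.
Qed.

Lemma at_one_poly (p : {poly int}) : at_one (tofrac p) p.[1].
Proof. by exists 0%N, p; rewrite mulr1. Qed.

Lemma at_oneM x y z u : at_one x z -> at_one y u -> at_one (x * y) (z * u).
Proof.
move=> [N [p [E <-]]] [N' [p' [E' <-]]]; exists (N + N')%N, (p * p').
by rewrite exprD mulrACA E E' rmorphM hornerM.
Qed.

Lemma at_oneD x y z u : at_one x z -> at_one y u -> at_one (x + y) (z + u).
Proof.
move=> [N [p [E <-]]] [N' [p' [E' <-]]]; exists (N + N')%N, (p * 'X^N' + p' * 'X^N).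
rewrite exprD mulrDl mulrA E [q ^+ N * _]mulrC mulrA E' rmorphD !rmorphM !rmorphXn; split=> //.
by rewrite hornerD !hornerM !hornerXn !expr1n !mulr1.
Qed.

Lemma at_one_int z : at_one z%:~R z.
Proof.
have -> : z%:~R = tofrac z%:P :> L by rewrite -{2}[z]intz !rmorph_int.
by rewrite -{2}(hornerC z 1); apply: at_one_poly.
Qed.

Lemma at_one_sum (I : Type) (r : seq I) (P : pred I) (x : I -> L) (z : I -> int) :
  (forall i, P i -> at_one (x i) (z i)) -> at_one (\sum_(i <- r | P i) x i) (\sum_(i <- r | P i) z i).
Proof.
move=> H; elim: r => [|i r IH]; first by rewrite !big_nil; apply: (at_one_int 0).
by rewrite !big_cons; case: ifP => // Pi; apply: at_oneD => //; apply: H.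
Qed.

(** Distinct powers of q meet the injectivity required by localization, while every character
    becomes 1 at q = 1. *)
Definition qt (n : nat) (i : 'I_n) : L := q ^+ i.

Lemma qt_neq0 n (i : 'I_n) : qt i != 0. Proof. by rewrite expf_neq0 // q_neq0. Qed.

Lemma qt_inj n : injective (@qt n).
Proof.
move=> i j; rewrite /qt -!rmorphXn => /eqP; rewrite tofrac_eq => /eqP/(congr1 (fun p : {poly int} => size p)).
by rewrite !size_polyXn => -[/val_inj].
Qed.

Lemma at_one_exprz (e : int) : at_one (q ^ e) 1.
Proof.
case: e => e; first by exists 0%N, 'X^e; rewrite mulr1 -exprnP rmorphXn hornerXn expr1n.
by exists e.+1, 1; rewrite -[q ^ Negz e]/((q ^+ e.+1)^-1) mulVf ?rmorph1 ?hornerC // expf_neq0 // q_neq0.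
Qed.

Lemma at_one_qchar m (a : {ffun 'I_m.+1 -> int}) : at_one (qchar (@qt _) a) 1.
Proof.
rewrite /qchar; elim/big_ind: _ => [|x y hx hy|i _]; first exact: (at_one_int 1).
  by rewrite -[1]mulr1; apply: at_oneM.
by rewrite /qt exprnP exprz_exp; apply: at_one_exprz.
Qed.

End Specialization.

(** * Characters of classes at the fixed points *)

Section Characters.
Variables (kk : fieldType) (m : nat).
Local Notation L := {fraction {poly int}}.
Local Notation chart := {perm 'I_m.+1}.
Local Notation Qt := (qchar (@qt m.+1)).
Implicit Types (E : bundle kk m.+1) (x : kclass kk m.+1) (g h : chart -> L).

(** [g s] is the character of the fibre at the fixed point of the chart [s], with t_i = q^i. *)
Definition bundle_char E g : Prop := exists2 wt : chart -> frame E -> {ffun 'I_m.+1 -> int},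
  is_bundle E /\ linearization wt & forall s, g s = \sum_a Qt (wt s a).

Fixpoint class_char x g : Prop := if x is (c, E) :: x' then
  exists g1 g2, [/\ bundle_char E g1, class_char x' g2 & forall s, g s = g1 s *~ c + g2 s]
  else forall s, g s = 0.

(** At q = 1 the Euler characteristics of the weight parts, each multiplied by its character, add up
    to the ordinary Euler characteristic. *)
Lemma euler_class x g : class_char x g -> at_one (\sum_s g s * chamber (@qt _) s) (keuler x).
Proof.
elim: x g => [|[c E] x IH] g /=.
  move=> g0; rewrite /keuler big_nil big1 => [|s _]; last by rewrite g0 mul0r.
  exact: (at_one_int 0).
move=> [g1 [g2 [[wt [hE hL] E1] h2 Eg]]]; rewrite /keuler big_cons /=.
have -> : \sum_s g s * chamber (@qt _) s =
    c%:~R * (\sum_s g1 s * chamber (@qt _) s) + \sum_s g2 s * chamber (@qt _) s.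
  rewrite mulr_sumr -big_split; apply: eq_bigr => s _; rewrite Eg mulrDl -mulrzl mulrA //.
apply: at_oneD; last exact: IH; apply: at_oneM; first exact: at_one_int.
rewrite (eq_bigr (fun s => (\sum_a Qt (wt s a)) * chamber (@qt _) s)) => [|s _]; last by rewrite E1.
rewrite -(euler_localization hE hL (@qt_neq0 _) (@qt_inj _)) (euler_charE hE hL).
apply: at_one_sum => f _; rewrite -[X in at_one _ X]mulr1; apply: at_oneM; first exact: at_one_int.
exact: at_one_qchar.
Qed.

Lemma class_char_ext x g h : g =1 h -> class_char x g -> class_char x h.
Proof.
case: x => [|[c E] x] gh /=; first by move=> g0 s; rewrite -gh.
by move=> [g1 [g2 [a b e]]]; exists g1, g2; split=> // s; rewrite -gh.
Qed.

Lemma class_char_cat x y g h : class_char x g -> class_char y h -> class_char (x ++ y) (fun s => g s + h s).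
Proof.
elim: x g => [|[c E] x IH] g /=.
  by move=> g0; apply: class_char_ext => s; rewrite g0 add0r.
move=> [g1 [g2 [a b e]]] hy; exists g1, (fun s => g2 s + h s); split=> //; first exact: IH.
by move=> s; rewrite e addrA.
Qed.

Lemma class_char_flatten (I : Type) (r : seq I) (x : I -> kclass kk m.+1) (g : I -> chart -> L) :
  (forall i, class_char (x i) (g i)) ->
  class_char (flatten [seq x i | i <- r]) (fun s => \sum_(i <- r) g i s).
Proof.
move=> H; elim: r => [|i r IH] /=; first by move=> s; rewrite big_nil.
by apply: class_char_ext (class_char_cat (H i) IH) => s; rewrite big_cons.
Qed.

Lemma class_char_opp x g : class_char x g -> class_char (kopp x) (fun s => - g s).
Proof.
elim: x g => [|[c E] x IH] g /=; first by move=> g0 s; rewrite g0 oppr0.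
move=> [g1 [g2 [a b e]]]; exists g1, (fun s => - g2 s); split=> //; first exact: IH.
by move=> s; rewrite e opprD mulrNz.
Qed.

Lemma regular_onM (I : {set chart}) (u v : {fraction {mpoly kk[m.+1]}}) :
  regular_on I u -> regular_on I v -> regular_on I (u * v).
Proof.
move=> [l [/allP dl ->]] [r [/allP dr ->]].
exists [seq (a.1 * b.1, a.2 + b.2) | a <- l, b <- r]; split.
  by apply/allP => _ /allpairsP[[a b] /= [al br ->]]; apply: dual_coneD; [apply: dl|apply: dr].
rewrite big_allpairs_dep /= mulr_suml; apply: eq_bigr => a _; rewrite mulr_sumr; apply: eq_bigr => b _.
by rewrite tcharD rmorphM mulrACA.
Qed.

Lemma regular_onD (I : {set chart}) (u v : {fraction {mpoly kk[m.+1]}}) :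
  regular_on I u -> regular_on I v -> regular_on I (u + v).
Proof.
move=> [l [dl ->]] [r [dr ->]]; exists (l ++ r).
by rewrite all_cat dl dr big_cat.
Qed.

Lemma regular_on_const (I : {set chart}) (c : kk) : regular_on I (@scal kk m.+1 c).
Proof.
rewrite -[scal _ _]mulr1 -(tchar0 kk m); apply: regular_scal => _.
apply/andP; split; first by rewrite big1 // => i _; rewrite ffunE.
by apply/forall_inP => S _; rewrite big1 // => i _; rewrite ffunE.
Qed.

Lemma dual_bundleP E (wt : chart -> frame E -> _) : is_bundle E -> linearization wt ->
  is_bundle (dual_bundle E) /\ @linearization kk m.+1 (dual_bundle E) (fun s a => - wt s a).
Proof.
move=> [h1 h2 h3] hL; split.
  split=> [s t a b|s a b|s t u a c] /=; first by rewrite setUC; apply: h1.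
    by rewrite h2 eq_sym.
  by rewrite -(h3 u t s c a); apply: eq_bigr => b _; rewrite mulrC.
by move=> s t a b; have [c E1] := hL t s b a; exists c; rewrite /= E1 opprK addrC.
Qed.

Lemma tensor_char E E' g h : bundle_char E g -> bundle_char E' h ->
  bundle_char (tensor_bundle E E') (fun s => g s * h s).
Proof.
move=> [wt [[h1 h2 h3] hL] Eg] [wt' [[k1 k2 k3] kL] Eh].
exists (fun s (a : frame (tensor_bundle E E')) => wt s a.1 + wt' s a.2); last first.
  move=> s; rewrite Eg Eh mulr_suml; under eq_bigr => a _ do rewrite mulr_sumr.
  by rewrite pair_bigA; apply: eq_bigr => a _; rewrite (qcharD (@qt_neq0 _)).
split.
  split=> [s t a b|s a b|s t u a c] /=; first exact: regular_onM.
    by rewrite h2 k2 -natrM mulnb -xpair_eqE -!surjective_pairing.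
  rewrite -(h3 s t u) -(k3 s t u) mulr_suml; under [RHS]eq_bigr => b _ do rewrite mulr_sumr.
  by rewrite pair_bigA; apply: eq_bigr => b _ /=; rewrite mulrACA.
move=> s t a b; have [c E1] := hL s t a.1 b.1; have [d E2] := kL s t a.2 b.2; exists (c * d).
by rewrite /= E1 E2 mulrACA -tcharD [RHS]mulrC rmorphM mulrC opprD addrACA.
Qed.

Lemma class_char_mul x y g h : class_char x g -> class_char y h -> class_char (kmul x y) (fun s => g s * h s).
Proof.
elim: x g => [|[c E] x IH] g /=; first by move=> g0 hy s; rewrite g0 mul0r.
move=> [g1 [g2 [b1 c2 e]]] hy.
have H : class_char [seq (c * b.1, tensor_bundle E b.2) | b <- y] (fun s => (g1 s *~ c) * h s).
  elim: y h {IH} hy => [|[d E'] y IHy] h /=; first by move=> h0 s; rewrite h0 mulr0.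
  move=> [h1 [h2 [b1' c2' e']]]; exists (fun s => g1 s * h1 s), (fun s => g1 s *~ c * h2 s).
  split; [exact: tensor_char|exact: IHy|].
  by move=> s; rewrite e' mulrDr; congr (_ + _); rewrite mulrzAl mulrzAr -mulrzA [d * c]mulrC.
apply: class_char_ext (class_char_cat H (IH _ c2 hy)) => s.
by rewrite e mulrDl.
Qed.

Lemma class_char_bundle E g : bundle_char E g -> class_char [:: (1, E)] g.
Proof. by move=> b; exists g, (fun=> 0); split=> // s; rewrite mulr1z addr0. Qed.

Lemma trivial_char : bundle_char (trivial_bundle kk m.+1) (fun=> 1).
Proof.
exists (fun _ _ => 0); last by move=> s; rewrite big_const card_unit /= qchar0 addr0.
split.
  split=> [s t a b|s a b|s t u a c] /=; first by rewrite -(rmorph1 (@scal kk m.+1)); apply: regular_on_const.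
    by case: a b => -[].
  by rewrite big_const card_unit /= mulr1 addr0.
by move=> s t a b; exists 1; rewrite subrr tchar0 rmorph1 mulr1.
Qed.

Lemma class_char_prod (I : Type) (r : seq I) (x : I -> kclass kk m.+1) (g : I -> chart -> L) :
  (forall i, class_char (x i) (g i)) ->
  class_char (\big[@kmul kk m.+1/kone kk m.+1]_(i <- r) x i) (fun s => \prod_(i <- r) g i s).
Proof.
move=> H; elim: r => [|i r IH].
  rewrite big_nil; apply: class_char_ext (class_char_bundle trivial_char) => s; by rewrite big_nil.
by rewrite big_cons; apply: class_char_ext (class_char_mul (H i) IH) => s; rewrite big_cons.
Qed.

End Characters.

(** * Exterior powers and lambda classes *)

Section CauchyBinet.
Variables (K : comNzRingType) (T : finType) (d : nat).
Implicit Types (A B : {set T}) (f : {ffun 'I_d -> T}).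

Definition minor (X : T -> T -> K) (A B : dsubset T d) : K :=
  \det (\matrix_(i < d, j < d) X (dsubset_nth A i) (dsubset_nth B j)).

Lemma dsubset_nth_inj (A : dsubset T d) : injective (dsubset_nth A).
Proof. by move=> i j /enum_val_inj/cast_ord_inj. Qed.

Lemma dsubset_nth_mem (A : dsubset T d) i : dsubset_nth A i \in val A.
Proof. exact: enum_valP. Qed.

Lemma dsubset_nthP (A : dsubset T d) x : x \in val A -> exists i, x = dsubset_nth A i.
Proof.
move=> xA; exists (cast_ord (eqP (valP A)) (enum_rank_in xA x)).
by rewrite /dsubset_nth cast_ordK enum_rankK_in.
Qed.

(* Expanding each row of the product and discarding the non-injective index functions; an
   injective one is a subset together with a permutation. *)
Lemma minorM (X Y : T -> T -> K) (A C : dsubset T d) :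
  minor (fun a c => \sum_b X a b * Y b c) A C = \sum_B minor X A B * minor Y B C.
Proof.
pose r f : 'M[K]_d := \matrix_(i, j) Y (f i) (dsubset_nth C j).
have exp : minor (fun a c => \sum_b X a b * Y b c) A C =
    \sum_(f : {ffun 'I_d -> T}) (\prod_i X (dsubset_nth A i) (f i)) * \det (r f).
  rewrite /minor /determinant.
  under eq_bigr => s _ do (under eq_bigr => i _ do rewrite mxE; rewrite bigA_distr_bigA /= mulr_sumr).
  rewrite exchange_big; apply: eq_bigr => f _; rewrite mulr_sumr; apply: eq_bigr => s _.
  by rewrite big_split mulrCA; congr (_ * (_ * _)); apply: eq_bigr => i _; rewrite mxE.
pose g (q : dsubset T d * 'S_d) : {ffun 'I_d -> T} := [ffun i => dsubset_nth q.1 (q.2 i)].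
have g_inj : injective g.
  move=> [B s] [B' s'] /ffunP E; have E' i : dsubset_nth B (s i) = dsubset_nth B' (s' i).
    by have := E i; rewrite !ffunE.
  have BB : B = B'.
    apply: val_inj; apply/eqP; rewrite eqEcard (eqP (valP B)) (eqP (valP B')) leqnn andbT.
    apply/subsetP => x /dsubset_nthP[i ->]; rewrite -[i](permKV s) E'; exact: dsubset_nth_mem.
  by rewrite BB in E' *; congr (_, _); apply/permP => i; apply: (@dsubset_nth_inj B').
rewrite exp (bigID (fun f : {ffun 'I_d -> T} => injectiveb f)) /= [X in _ + X]big1 ?addr0 => [|f /injectivePn[i [j ij fij]]]; last first.
  by rewrite (determinant_alternate ij) ?mulr0 // => c; rewrite !mxE fij.
under [RHS]eq_bigr => B _ do rewrite /minor [X in X * _]/determinant mulr_suml.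
rewrite pair_bigA /=.
have gim f : injectiveb f = (f \in codom g).
  apply/injectiveP/codomP => [fi|[[B s] -> i j]]; last first.
    by rewrite !ffunE => /dsubset_nth_inj/perm_inj.
  have cB : #|f @: 'I_d| == d by rewrite card_imset // card_ord.
  pose B : dsubset T d := exist _ (f @: 'I_d) cB.
  have /fin_all_exists[s Hs] i : exists j, f i = dsubset_nth B j by apply: dsubset_nthP; apply: imset_f.
  have si : injective s by move=> i j E; apply: fi; rewrite !Hs E.
  by exists (B, perm si); apply/ffunP => i; rewrite ffunE permE Hs.
have U : uniq (codom g) by rewrite map_inj_uniq ?enum_uniq.
rewrite (eq_bigl (mem (codom g)) _ gim) -(big_uniq _ U) codomE big_map big_enum /=.
apply: eq_bigr => -[B s] _ /=.
have -> : r (g (B, s)) = row_perm s (\matrix_(i, j) Y (dsubset_nth B i) (dsubset_nth C j)).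
  by apply/matrixP => i j; rewrite !mxE ffunE.
rewrite row_permE det_mulmx det_perm mulrA [X in X * _]mulrC; congr (_ * _ * _).
by apply: eq_bigr => i _; rewrite mxE ffunE.
Qed.


End CauchyBinet.

Section ExteriorPowers.
Variables (kk : fieldType) (m : nat) (E : bundle kk m.+1) (d : nat).
Local Notation K := {fraction {mpoly kk[m.+1]}}.
Local Notation L := {fraction {poly int}}.
Local Notation chart := {perm 'I_m.+1}.
Local Notation char := {ffun 'I_m.+1 -> int}.
Local Notation Qt := (qchar (@qt m.+1)).

Lemma regular_on_sum (I : {set chart}) (J : Type) (r : seq J) (P : pred J) (f : J -> K) :
  (forall i, P i -> regular_on I (f i)) -> regular_on I (\sum_(i <- r | P i) f i).
Proof.
move=> H; elim/big_rec: _ => [|i x Pi IH]; last exact: regular_onD (H i Pi) IH.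
by rewrite -(rmorph0 (@scal kk m.+1)); apply: regular_on_const.
Qed.

Lemma regular_on_prod (I : {set chart}) (J : Type) (r : seq J) (f : J -> K) :
  (forall i, regular_on I (f i)) -> regular_on I (\prod_(i <- r) f i).
Proof.
move=> H; elim/big_rec: _ => [|i x _ IH]; last exact: regular_onM (H i) IH.
by rewrite -(rmorph1 (@scal kk m.+1)); apply: regular_on_const.
Qed.

Lemma minor_delta (T : finType) (A B : dsubset T d) :
  minor (fun a b => (a == b)%:R : K) A B = (A == B)%:R.
Proof.
have [->|AB] := eqVneq A B.
  have -> : minor (fun a b => (a == b)%:R : K) B B = \det (1%:M : 'M[K]_d).
    congr (\det _); apply/matrixP => i j; rewrite !mxE; congr (_%:R).
    by rewrite (inj_eq (@dsubset_nth_inj _ _ _)).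
  by rewrite det1.
have /subsetPn[x xA xB] : ~~ (val A \subset val B).
  apply: contra AB => sub; apply/eqP/val_inj/eqP.
  by rewrite eqEcard sub (eqP (valP A)) (eqP (valP B)) leqnn.
have [i xi] := dsubset_nthP xA; rewrite /minor (expand_det_row _ i) big1 // => j _.
rewrite mxE -xi (_ : (x == _) = false) ?mul0r //.
by apply/eqP => E'; move: xB; rewrite E' dsubset_nth_mem.
Qed.

Lemma sum_dsubset (T : finType) (V : nmodType) (A : dsubset T d) (f : T -> V) :
  \sum_(i < d) f (dsubset_nth A i) = \sum_(a in val A) f a.
Proof.
rewrite [RHS]big_enum_val /= (reindex (cast_ord (esym (eqP (valP A))))) //=.
by exists (cast_ord (eqP (valP A))) => i _; rewrite ?cast_ordK ?cast_ordKV.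
Qed.

(** The cocycle condition for minors is the Cauchy-Binet formula; weights add because all terms of a
    determinant have the same character. *)
Lemma ext_bundleP (wt : chart -> frame E -> char) : is_bundle E -> linearization wt ->
  is_bundle (ext_bundle d E) /\
  @linearization _ _ (ext_bundle d E) (fun s A => \sum_(a in val A) wt s a).
Proof.
move=> [h1 h2 h3] hL; split.
  split=> [s t A B|s A B|s t u A C] /=.
  - apply: regular_on_sum => p _; apply: regular_onM.
      rewrite (_ : (-1) ^+ p = @scal kk m.+1 ((-1) ^+ p)); first exact: regular_on_const.
      by rewrite rmorphXn rmorphN1.
    by apply: regular_on_prod => i; rewrite mxE; apply: h1.
  - transitivity (minor (fun a b => (a == b)%:R : K) A B); last exact: minor_delta.
    congr (\det _).
    by apply/matrixP => i j; rewrite !mxE h2.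
    transitivity (minor (fun a c => \sum_b @trans _ _ E s t a b * @trans _ _ E t u b c) A C); first by rewrite minorM.
    by congr (\det _); apply/matrixP => i j; rewrite !mxE h3.
move=> s t A B /=.
have /all_sig[c E1] a : {c : frame E -> kk | forall b, trans s t a b = scal m.+1 (c b) * tchar kk (wt s a - wt t b)}.
  by apply: cid; have /fin_all_exists[c Ec] := hL s t a; exists c.
exists (\det (\matrix_(i < d, j < d) c (dsubset_nth A i) (dsubset_nth B j))).
rewrite /determinant rmorph_sum mulr_suml; apply: eq_bigr => p _.
rewrite rmorphM rmorphXn rmorphN1 -mulrA; congr (_ * _); rewrite rmorph_prod.
under eq_bigr => i _ do rewrite mxE E1.
rewrite big_split; congr (_ * _); first by apply: eq_bigr => i _; rewrite mxE.
rewrite -!sum_dsubset [X in _ - X](reindex_inj (@perm_inj _ p)) -sumrB.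
by elim/big_rec2: _ => [|i x y _ ->]; rewrite ?tchar0 ?tcharD.
Qed.

(* The generating polynomial of the exterior powers of a fibre. *)
Definition epoly (T : finType) (Q : T -> L) : {poly L} := \prod_a (1 + Q a *: 'X).

Lemma coef_epoly (T : finType) (Q : T -> L) : (epoly Q)`_d = \sum_(A : dsubset T d) \prod_(a in val A) Q a.
Proof.
rewrite /epoly; under eq_bigr => a _ do rewrite addrC.
rewrite bigA_distr /= coef_sum.
under eq_bigr => A _.
  rewrite (bigID (mem A)) /= (eq_bigr (fun a => Q a *: 'X)) => [|a ->] //.
  rewrite [X in _ * X]big1 ?mulr1 => [|a /negbTE-> //].
  rewrite scaler_prod prodr_const coefZ coefXn eq_sym; over.
rewrite (bigID (fun A : {set T} => #|A| == d)) /= [X in _ + X]big1 ?addr0 => [|A /negbTE->]; last by rewrite mulr0.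
rewrite (eq_bigr (fun A : {set T} => \prod_(a in A) Q a)) => [|A ->]; last by rewrite mulr1.
rewrite (reindex_omap (fun A : dsubset T d => val A) insub) /= => [|A cA]; last by rewrite insubT.
by apply: eq_bigl => A; rewrite (valP A) valK eqxx.
Qed.

Lemma ext_bundle_char (wt : chart -> frame E -> char) : is_bundle E -> linearization wt ->
  class_char (kexp d E) (fun s => (epoly (fun a => Qt (wt s a)))`_d).
Proof.
move=> hE hL; apply: class_char_bundle.
exists (fun s (A : frame (ext_bundle d E)) => \sum_(a in val A) wt s a); first exact: ext_bundleP.
move=> s; rewrite coef_epoly; apply: eq_bigr => A _; apply/esym/(big_morph Qt).
  exact: (qcharD (@qt_neq0 _)).
exact: qchar0.
Qed.

End ExteriorPowers.

Section LambdaClasses.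
Variables (kk : fieldType) (m : nat).
Local Notation L := {fraction {poly int}}.
Local Notation chart := {perm 'I_m.+1}.
Local Notation char := {ffun 'I_m.+1 -> int}.
Local Notation Qt := (qchar (@qt m.+1)).

(** The recursion of [lambda_inv_rec] on characters, where it computes the coefficients of the
    inverse power series. *)
Fixpoint inverse_rec (p : {poly L}) (d : nat) : seq L :=
  if d is e.+1 then
    let l := inverse_rec p e in (- \sum_(i <- iota 0 d) p`_i.+1 * nth 0 l i) :: l
  else [:: 1].

Lemma nth_inverse_rec p d i : (i <= d)%N -> nth 0 (inverse_rec p d) i = head 0 (inverse_rec p (d - i)).
Proof. by elim: d i => [|d IH] [|i] //= id; rewrite IH. Qed.

Lemma inverse_coef (p : {poly L}) d : p`_0 = 1 ->
  \sum_(i < d.+1) p`_i * head 0 (inverse_rec p (d - i)) = (d == 0%N)%:R.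
Proof.
move=> p0; rewrite big_ord_recl p0 mul1r subn0; case: d => [|d]; first by rewrite big_ord0 addr0.
rewrite [head _ _]/(- \sum_(i <- index_iota 0 d.+1) _) big_mkord addrC; apply/eqP; rewrite subr_eq0; apply/eqP.
by apply: eq_bigr => i _; rewrite nth_inverse_rec // -ltnS.
Qed.

Lemma inverse_cancel (p r : {poly L}) d : p`_0 = 1 ->
  \sum_(i < d.+1) (p * r)`_i * head 0 (inverse_rec p (d - i)) = r`_d.
Proof.
move=> p0; pose c := \poly_(i < d.+1) head 0 (inverse_rec p i).
have cE i : (i <= d)%N -> c`_i = head 0 (inverse_rec p i) by move=> id; rewrite coef_poly ltnS id.
transitivity ((p * r * c)`_d).
  by rewrite coefM; apply: eq_bigr => i _; rewrite cE // leq_subr.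
rewrite mulrAC [_ * r]mulrC coefMr (bigD1 ord0) //= subn0 big1 ?addr0 => [|i i0].
  rewrite coefM big_ord1 subnn cE // p0 mulr1 mulr1 //.
rewrite coefM (eq_bigr (fun j : 'I_i.+1 => p`_j * head 0 (inverse_rec p (i - j)))) => [|j _].
  by rewrite inverse_coef // -[i == _ :> nat]/(i == ord0) (negbTE i0) mulr0.
by rewrite cE // (leq_trans (leq_subr _ _)) // -ltnS.
Qed.

Lemma lambda_inv_char E (p : chart -> {poly L}) :
  (forall d, class_char (@kexp kk m.+1 d E) (fun s => (p s)`_d)) ->
  forall d, class_char (lambda_inv E d) (fun s => head 0 (inverse_rec (p s) d)).
Proof.
move=> H d; have R i : class_char (nth [::] (lambda_inv_rec E d) i) (fun s => nth 0 (inverse_rec (p s) d) i).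
  elim: d i => [|d IH] [|i] //=.
  - exact: class_char_bundle (@trivial_char kk m).
  - by case: i.
  apply/class_char_opp/class_char_flatten => j.
  exact: class_char_mul (H _) (IH _).
by have := R 0%N; rewrite /lambda_inv -nth0 => /class_char_ext; apply => s; rewrite nth0.
Qed.

(** Turns equal multiplicities into an identity of products, with the negative part moved to the
    other side. *)
Lemma prod_weights (T T' : finType) (f : T -> char) (g : T' -> char) (P : pred 'I_m.+1) (A : char -> {poly L}) :
  (forall a, #|[set x | f x == a]|%:Z - #|[set y | g y == a]|%:Z = #|[set i | P i && (coord_char i == a)]|%:Z) ->
  \prod_x A (f x) = \prod_y A (g y) * \prod_(i | P i) A (coord_char i).
Proof.
move=> H; pose sf := [seq f x | x <- enum T]; pose sg := [seq g y | y <- enum T'].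
pose sh := [seq coord_char i | i <- enum P].
have cnt (U : finType) (Q : pred U) (h : U -> char) a :
    count_mem a [seq h x | x <- enum Q] = #|[set x | Q x && (h x == a)]|.
  by rewrite count_map cardsE cardE /enum_mem -enumT size_filter count_filter; apply: eq_count => x /=; rewrite andbC.
have pe : perm_eq sf (sg ++ sh).
  apply/allP => a _ /=; rewrite count_cat /sf /sg !cnt; apply/eqP/eqP; rewrite -eqz_nat PoszD -(H a).
  by rewrite addrC subrK.
have : \prod_(a <- sf) A a = \prod_(a <- sg ++ sh) A a by apply: perm_big.
by rewrite big_cat !big_map !big_enum.
Qed.

Lemma epoly0 (T : finType) (Q : T -> L) : (epoly Q)`_0 = 1.
Proof.
rewrite -horner_coef0 horner_prod big1 // => a _.
by rewrite hornerD hornerZ hornerX mulr0 hornerC addr0.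
Qed.

(** The generating polynomial of P is that of N times the product over the elements outside the
    basis, so division by the series of N is exact. *)
Lemma lambda_taut_char (M : matroid 'I_m.+1) q d : @is_taut_quotient kk m.+1 M q ->
  class_char (lambda (kdual q) d)
    (fun s => (\prod_(i | i \notin flag_basis s M) (1 + @qt _ i *: 'X : {poly L}))`_d).
Proof.
case: q => P N [/= hP hN [wP [wN [lP lN H]]]].
have [{}hP {}lP] := dual_bundleP hP lP; have [{}hN {}lN] := dual_bundleP hN lN.
have eN := lambda_inv_char (fun d => ext_bundle_char d hN lN).
have F := class_char_flatten (iota 0 d.+1) (fun i => class_char_mul (ext_bundle_char i hP lP) (eN (d - i)%N)).
apply: class_char_ext F => s; rewrite -[iota 0 d.+1]/(index_iota 0 d.+1) big_mkord.
rewrite -(@inverse_cancel (epoly (fun a => Qt (- wN s a))) _ d (epoly0 _)).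
apply: eq_bigr => i _; congr (_`_i * _).
have W := prod_weights (fun a => 1 + Qt a *: 'X : {poly L}) (H s).
have -> : epoly (fun a : frame (dual_bundle P) => Qt (- wP s a)) = \prod_x (1 + Qt (- wP s x) *: 'X).
  by [].
rewrite W (eq_bigr (fun j => 1 + @qt m.+1 j *: 'X)) => [|j _]; first by [].
by rewrite qchar_coord.
Qed.

End LambdaClasses.

(** * Bases attached to permutations *)

Section FlagBasis.
Variables (m : nat).
Local Notation chart := {perm 'I_m.+1}.
Implicit Types (s : chart) (M : matroid 'I_m.+1).

Lemma flag_vectorE s i : flag_vector s i = (m - (s^-1)%g i)%N.
Proof.
rewrite ffunE; have -> : rays s = [set prefix s c.+1 | c : 'I_m].
  by apply/setP => S; rewrite rays_prefix; apply/existsP/imsetP => [[c /eqP ->]|[c _ ->]]; exists c.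
rewrite big_imset /= => [|c d _ _ /(congr1 (fun A : {set _} => #|A|))]; last first.
  by rewrite !card_prefix ?ltnS 1?ltnW // => -[E]; apply: val_inj.
under eq_bigr => c _ do rewrite mem_prefix ltnS.
rewrite -natr_sum natz; congr (_%:Z).
rewrite -(big_mkord xpredT (fun c => ((s^-1)%g i <= c)%N : nat)) /=.
have le : ((s^-1)%g i <= m)%N by rewrite -ltnS.
rewrite (@big_cat_nat _ _ _ ((s^-1)%g i)) //= big1_seq ?add0n => [|c /andP[_]]; last first.
  by rewrite mem_index_iota => /andP[_ H]; rewrite leqNgt H.
transitivity (\sum_((s^-1)%g i <= c < m) 1)%N; last by rewrite sum_nat_const_nat muln1.
by apply: eq_big_nat => c /andP[->].
Qed.

Lemma flag_vector_lt s i j : (flag_vector s i < flag_vector s j) = ((s^-1)%g j < (s^-1)%g i)%N.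
Proof.
rewrite !flag_vectorE ltz_nat; have := ltn_ord ((s^-1)%g i); have := ltn_ord ((s^-1)%g j).
by move: (nat_of_ord _) (nat_of_ord _) => a b; lia.
Qed.

Lemma flag_basisE s M : flag_basis s M = [set i | ~~ spn M (prefix s ((s^-1)%g i)) i].
Proof.
have inj : injective (flag_vector s).
  move=> i j E; have := flag_vector_lt s i j; have := flag_vector_lt s j i.
  rewrite E ltxx => /esym/negbT; rewrite -leqNgt => a /esym/negbT; rewrite -leqNgt => b.
  by apply/(@perm_inj _ (s^-1)%g)/val_inj/eqP; rewrite eqn_leq a b.
have aboveE i : [set e | flag_vector s i < flag_vector s e] = prefix s ((s^-1)%g i).
  by apply/setP => e; rewrite inE mem_prefix flag_vector_lt.
rewrite /flag_basis; case: pickP => [B iB|no] /=.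
  by rewrite (initial_uniq inj iB); apply/setP => i; rewrite !inE -aboveE.
have [B bB] : exists B, B \in bases M by have /andP[/set0Pn[B]] := basesP M; exists B.
have := no [arg max_(C > B in bases M) \sum_(i in C) flag_vector s i]%O.
case: Order.TotalTheory.arg_maxP => // C bC max; rewrite inE bC /= => /negP[].
by apply/forall_inP.
Qed.

Lemma nonbasis_prod (F : fieldType) M (V : F) (t : 'I_m.+1 -> F) A l :
  nonbasis M V t A l = \prod_(i < size l)
    (if spn M (A :|: [set x in take i l]) (nth ord0 l i) then 1 - V * t (nth ord0 l i) else 1).
Proof.
elim: l A => [|y l IH] A /=; first by rewrite big_ord0.
rewrite big_ord_recl /= IH.
congr (_ * _).
  by congr (if spn M _ _ then _ else _); apply/setP => x; rewrite !inE orbF.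
apply: eq_bigr => i _; congr (if spn M _ _ then _ else _).
by apply/setP => x; rewrite !inE orbCA orbA.
Qed.

(** This links the two localizations: the elements rejected along the ordering are those outside the
    basis of the flag. *)
Lemma nonbasis_flag (F : fieldType) M (V : F) (t : 'I_m.+1 -> F) s :
  nonbasis M V t set0 (ordering s) = \prod_(i | i \notin flag_basis s M) (1 - V * t i).
Proof.
have so : size (ordering s) = m.+1 by rewrite size_map size_enum_ord.
have nE (i : 'I_m.+1) : nth ord0 (ordering s) i = s i.
  by rewrite (nth_map ord0) ?size_enum_ord ?nth_ord_enum.
rewrite nonbasis_prod so [RHS]big_mkcond [RHS](reindex_inj (@perm_inj _ s)) /=.
apply: eq_bigr => i _; rewrite nE flag_basisE inE negbK permK set0U.
congr (if spn M _ _ then _ else _); apply/setP => x; rewrite inE mem_prefix.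
have -> : x = s ((s^-1)%g x) by rewrite permKV.
by rewrite permK -map_take mem_map ?in_take_leq ?mem_enum ?index_enum_ord ?size_enum_ord // 1?ltnW //; apply: perm_inj.
Qed.

End FlagBasis.

(** * The tautological quotient *)

Section TautologicalQuotient.
Variables (kk : fieldType) (m : nat).
Local Notation chart := {perm 'I_m.+1}.
Local Notation char := {ffun 'I_m.+1 -> int}.
Implicit Types (s t : chart) (S A : {set 'I_m.+1}).

(* The element of the ordering [s] at which the prefixes start to satisfy [Q]. *)
Definition entry s (Q : pred {set 'I_m.+1}) : 'I_m.+1 :=
  s [arg min_(p < ord_max | Q (prefix s p.+1)) p].

(** The condition under which the prefixes of every ordering start to satisfy [Q] at a well defined
    element. *)
Definition upward (Q : pred {set 'I_m.+1}) : Prop :=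
  [/\ Q setT, ~~ Q set0 & forall A B : {set 'I_m.+1}, A \subset B -> Q A -> Q B].

Lemma prefix_full s : prefix s m.+1 = setT.
Proof. by apply/setP => x; rewrite mem_prefix inE ltn_ord. Qed.

Lemma prefix_empty s : prefix s 0 = set0.
Proof. by apply/setP => x; rewrite mem_prefix inE. Qed.

Lemma mem_entry s Q c : upward Q -> (c <= m.+1)%N -> (entry s Q \in prefix s c) = Q (prefix s c).
Proof.
move=> [QT Q0 Qm] cm; rewrite mem_prefix permK.
case: arg_minnP => [|p Qp pmin]; first by rewrite prefix_full.
apply/idP/idP => [pc|]; last first.
  case: c cm => [|c] cm Qc; first by rewrite prefix_empty (negbTE Q0) in Qc.
  exact: (pmin (Ordinal cm)).
apply: Qm Qp; apply/subsetP => x; rewrite !mem_prefix => xp; exact: leq_trans xp pc.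
Qed.

Lemma entry_eq s Q p : upward Q ->
  ((entry s Q == s p)%:Z = (Q (prefix s p.+1))%:Z - (Q (prefix s p))%:Z :> int).
Proof.
move=> Qu; rewrite -!mem_entry // 1?ltnW // !mem_prefix -(inj_eq (@perm_inj _ (s^-1)%g)) permK.
by rewrite -val_eqE /= ltnS; case: ltngtP.
Qed.

Section SplitBundle.
Variables (T : finType) (Q : T -> pred {set 'I_m.+1}).
Hypothesis Qu : forall a, upward (Q a).

Definition split_weight s a : char := - coord_char (entry s (Q a)).

(** A direct sum of line bundles. The transition functions are regular because, for a common prefix
    S of two charts, either entry lies in S exactly when S satisfies the family. *)
Definition split_bundle : bundle kk m.+1 :=
  @Bundle kk m.+1 T (fun s t a b => scal m.+1 (a == b)%:R * tchar kk (split_weight s a - split_weight t b)).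

Lemma sum_coord_char S i : \sum_(j in S) coord_char i j = (i \in S)%:R :> int.
Proof.
case: (boolP (i \in S)) => iS; last first.
  by rewrite big1 // => j jS; rewrite ffunE; case: eqP iS jS => // -> /negP.
by rewrite (bigD1 i) //= ffunE eqxx big1 ?addr0 // => j /andP[_ /negbTE ji]; rewrite ffunE eq_sym ji.
Qed.

Lemma split_bundleP : is_bundle split_bundle.
Proof.
split=> [s t a b|s a b|s t u a c] /=.
- apply: regular_scal; have [<- _|_] := eqVneq a b; last by rewrite eqxx.
  have key S i j : (i \in S) = (j \in S) -> \sum_(x in S) (coord_char j - coord_char i) x = 0 :> int.
    move=> ij; rewrite -[RHS](subrr ((j \in S)%:R : int)) -{2}ij -!sum_coord_char -sumrB.
    by apply: eq_bigr => x _; rewrite !ffunE.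
  rewrite /split_weight opprK addrC; apply/andP; split.
    by rewrite -[X in _ == X](key [set: 'I_m.+1] (entry s (Q a)) (entry t (Q a))) ?inE //; apply/eqP/eq_bigl => x; rewrite inE.
  apply/forall_inP => S /bigcapP HS; rewrite key //.
  have mem r : r \in [set s; t] -> (entry r (Q a) \in S) = Q a S.
    by move=> /HS; rewrite rays_prefix => /existsP[c /eqP ->]; rewrite mem_entry // ltnS ltnW.
  by rewrite !mem // !inE eqxx ?orbT.
- by case: eqP => [<-|_]; rewrite ?rmorph0 ?mul0r // subrr tchar0 rmorph1 mulr1.
rewrite (bigD1 a) //= big1 ?addr0 => [|b ba]; last by rewrite eq_sym (negbTE ba) rmorph0 !mul0r.
by rewrite eqxx rmorph1 mul1r mulrCA -tcharD addrA subrK.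
Qed.

Lemma split_linearization : linearization (E := split_bundle) split_weight.
Proof. by move=> s t a b; exists (a == b)%:R. Qed.

End SplitBundle.

Variable M : matroid 'I_m.+1.

Definition nullity S : nat := (#|S| - rk M S)%N.

Lemma nullity_lt S : (nullity S <= m.+1)%N.
Proof. by rewrite (leq_trans (leq_subr _ _)) // (leq_trans (max_card _)) ?card_ord. Qed.

Section Count.
Variables U W : pred {set 'I_m.+1}.

Definition copies : finType :=
  {x : {set 'I_m.+1} * 'I_m.+1 | U x.1 && (x.2 < nullity x.1)%N}.

Lemma card_copies : #|[set a : copies | W (val a).1]| = (\sum_(S | U S) nullity S * W S)%N.
Proof.
rewrite -sum1_card (eq_bigl (fun a : copies => W (val a).1)) => [|a]; last by rewrite inE.
rewrite big_mkcond /=.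
transitivity (\sum_(x : {set 'I_m.+1} * 'I_m.+1 | U x.1 && (x.2 < nullity x.1)) W x.1)%N.
  rewrite (reindex_omap (fun a : copies => val a) insub) /= => [|x Hx]; last by rewrite insubT.
  by apply: eq_big => a; rewrite ?(valP a) ?valK ?eqxx // => _; case: (W _).
rewrite -(pair_big_dep U (fun S (c : 'I_m.+1) => (c < nullity S)%N) (fun S _ => W S : nat)).
apply: eq_bigr => S _; rewrite sum_nat_const; congr (_ * _)%N.
rewrite -sum1_card (big_ord_narrow (nullity_lt S)) /=.
by rewrite sum1_card card_ord.
Qed.

End Count.

Local Notation P_frame := (copies (fun S => S != set0)).
Local Notation N_frame := (copies (fun S => (S != set0) && (S != setT))).
(** As [S in A] - [S properly in A] = [S = A], counting sets with multiplicity their nullity leaves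
    exactly the nullity of A. The full set has no proper superset and is absent from N. *)
Definition P_entry (a : P_frame) : pred {set 'I_m.+1} := fun A => (val a).1 \subset A.
Definition N_entry (a : N_frame) : pred {set 'I_m.+1} := fun A => (val a).1 \proper A.

Lemma upward_sub S : S != set0 -> upward (fun A => S \subset A).
Proof.
by move=> S0; split=> [||A B AB SA]; [exact: subsetT|rewrite subset0|exact: subset_trans SA AB].
Qed.

Lemma upward_proper S : S != setT -> upward (fun A => S \proper A).
Proof.
move=> ST; split=> [||A B AB SA]; last exact: proper_sub_trans SA AB; last by rewrite properE sub0set andbF.
by rewrite properEneq ST subsetT.
Qed.

(* The splitting bundles P and N of the class differ by the nullities of the prefixes: a set S
   which is not a prefix contributes the same characters to both. *)
Lemma taut_quotient_exists :
  is_taut_quotient M (split_bundle P_entry, split_bundle N_entry).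
Proof.
have uP a : upward (P_entry a) by apply: upward_sub; have /andP[] := valP a.
have uN a : upward (N_entry a) by apply: upward_proper; have /andP[/andP[]] := valP a.
split; [exact: split_bundleP|exact: split_bundleP|].
exists (split_weight P_entry), (split_weight N_entry); split; try exact: split_linearization.
move=> s mu; rewrite /split_weight.
case: (pickP (fun i : 'I_m.+1 => coord_char i == mu)) => [i /eqP <-|no]; last first.
  have -> : [set a | - - coord_char (entry s (P_entry a)) == mu] = set0 by apply/setP => a; rewrite !inE opprK no.
  have -> : [set a | - - coord_char (entry s (N_entry a)) == mu] = set0 by apply/setP => a; rewrite !inE opprK no.
  have -> : [set i | (i \notin flag_basis s M) && (coord_char i == mu)] = set0.
    by apply/setP => i; rewrite !inE no andbF.
  by rewrite !cards0.
have cinj (l j : 'I_m.+1) : (coord_char j == coord_char l :> char) = (j == l).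
  apply/eqP/eqP => [/ffunP/(_ l)|-> //]; rewrite !ffunE eqxx; by case: eqP.
have [p ->] : exists p, i = s p by exists ((s^-1)%g i); rewrite permKV.
pose nu S := (nullity S)%:Z.
pose hP A := \sum_(S : {set 'I_m.+1} | S != set0) nu S * (S \subset A)%:Z.
pose hN A := \sum_(S : {set 'I_m.+1} | S != set0) nu S * (S \proper A)%:Z.
have hPN A : hP A - hN A = nu A.
  have nu0 : nu set0 = 0 by rewrite /nu /nullity cards0.
  rewrite -sumrB (eq_bigr (fun S => if S == A then nu S else 0)) => [|S _]; last first.
    by rewrite -mulrBr properEneq; case: eqP => [->|_]; rewrite ?subxx ?mulr1 ?subrr ?mulr0 ?subr0 ?mulr1.
  rewrite -big_mkcondr; have [->|A0] := eqVneq A set0.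
    by rewrite nu0 big1 // => S /andP[_ /eqP ->].
  by rewrite (big_pred1 A) // => S /=; have [->|_] := eqVneq S A; rewrite ?A0 ?andbF.
pose A := prefix s p; pose A' := prefix s p.+1.
have cP : #|[set a | - - coord_char (entry s (P_entry a)) == coord_char (s p) :> char]|%:Z = hP A' - hP A.
  rewrite -sumrB; have -> : [set a | - - coord_char (entry s (P_entry a)) == coord_char (s p) :> char] =
      [set a : P_frame | (fun S => entry s (fun B => S \subset B) == s p) (val a).1].
    by apply/setP => a; rewrite !inE opprK cinj.
  rewrite (card_copies _ (fun S => entry s (fun B => S \subset B) == s p)) -natz natr_sum.
  apply: eq_bigr => S S0; rewrite natrM natz natz entry_eq ?mulrBr //; exact: upward_sub.
have cN : #|[set a | - - coord_char (entry s (N_entry a)) == coord_char (s p) :> char]|%:Z = hN A' - hN A.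
  rewrite -sumrB; have -> : [set a | - - coord_char (entry s (N_entry a)) == coord_char (s p) :> char] =
      [set a : N_frame | (fun S => entry s (fun B => S \proper B) == s p) (val a).1].
    by apply/setP => a; rewrite !inE opprK cinj.
  rewrite (card_copies _ (fun S => entry s (fun B => S \proper B) == s p)) -natz natr_sum big_mkcondr /=.
  apply: eq_bigr => S S0; have [->|ST] := eqVneq S setT; first by rewrite !properE !subsetT !andbF !mulr0 subrr.
  rewrite natrM natz natz entry_eq ?mulrBr //; exact: upward_proper.
rewrite cP cN; have -> : hP A' - hP A - (hN A' - hN A) = nu A' - nu A.
  by rewrite -!hPN; move: (hP A') (hP A) (hN A') (hN A) => a b c d; lia.
have -> : [set i | (i \notin flag_basis s M) && (coord_char i == coord_char (s p) :> char)] =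
    if s p \notin flag_basis s M then [set s p] else set0.
  apply/setP => l; rewrite inE cinj; have [->|/negbTE ne] := eqVneq l (s p); rewrite ?andbT ?andbF.
    by case: ifP; rewrite !inE ?eqxx.
  by case: ifP; rewrite !inE ?ne.
have A'E : A' = s p |: A by apply/setP => x; rewrite !inE !mem_prefix -(inj_eq (@perm_inj _ (s^-1)%g)) permK ltnS leq_eqVlt.
have npA : s p \notin A by rewrite mem_prefix permK ltnn.
(* The nullity grows at [s p] exactly when [s p] is spanned by the earlier elements, i.e. lies
   outside the basis. *)
rewrite flag_basisE inE permK negbK -/A /nu /nullity A'E rkU1 cardsU1 npA.
have := rk_le_card M A; case: (spn M A (s p)); rewrite ?cards1 ?cards0; lia.
Qed.

Lemma taut_quotientP : is_taut_quotient M (taut_quotient kk M).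
Proof.
rewrite /taut_quotient /the; case: pselect => [h|[]]; first by case: (cid h).
by exists (split_bundle P_entry, split_bundle N_entry); apply: taut_quotient_exists.
Qed.

End TautologicalQuotient.

(** * The K-polynomial *)

Section CoefficientIdentity.
Variable k : nat.
Local Notation L := {fraction {poly int}}.

(** Substituting the negated variables accounts for the sign in lambda_{-V}. *)
Lemma mcoeff_prod_horner (K : comNzRingType) (p : 'I_k -> {poly K}) (d : 'X_{1..k}) :
  (\prod_j (map_poly (@mpolyC k K) (p j)).[- 'X_j])@_d = \prod_j ((-1) ^+ d j * (p j)`_(d j)).
Proof.
pose N := (\max_j maxn (size (p j)) (d j).+1)%N.
have hN j : (maxn (size (p j)) (d j).+1 <= N)%N by apply: leq_bigmax.
have dN j : (d j < N)%N by apply: leq_trans (hN j); rewrite leq_max leqnn orbT.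
have sign e : ((-1) ^+ e)%:MP = (-1) ^+ e :> {mpoly K[k]} by rewrite rmorphXn rmorphN1.
rewrite (eq_bigr (fun j => \sum_(e < N) (((-1) ^+ e * (p j)`_e)%:MP : {mpoly K[k]}) * 'X_j ^+ e)) => [|j _]; last first.
  rewrite (@horner_coef_wide _ N) => [|]; last first.
    by rewrite (leq_trans (size_poly _ _)) // (leq_trans _ (hN j)) // leq_maxl.
  apply: eq_bigr => e _; rewrite coef_map [(- 'X_j) ^+ e]exprNn mulrA -sign mpolyCM; congr (_ * _); exact: mulrC.
rewrite bigA_distr_bigA raddf_sum /=.
pose mf (f : {ffun 'I_k -> 'I_N}) := [multinom (f j : nat) | j < k].
rewrite (eq_bigr (fun f : {ffun 'I_k -> 'I_N} => (\prod_j ((-1) ^+ f j * (p j)`_(f j))) * (mf f == d)%:R)) => [|f _]; last first.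
  have -> : \prod_j (((-1) ^+ f j * (p j)`_(f j))%:MP * 'X_j ^+ f j) =
      (\prod_j ((-1) ^+ f j * (p j)`_(f j)))%:MP * 'X_[mf f] :> {mpoly K[k]}.
    rewrite big_split rmorph_prod mpolyXE_id; congr (_ * _); by apply: eq_bigr => j _; rewrite mnmE.
  by rewrite mcoeffCM mcoeffX.
pose fd : {ffun 'I_k -> 'I_N} := [ffun j => Ordinal (dN j)].
rewrite (bigD1 fd) //= [X in _ + X]big1 ?addr0 => [|f fd'].
  rewrite (_ : mf fd = d) ?eqxx ?mulr1; last by apply/mnmP => j; rewrite mnmE ffunE.
  by apply: eq_bigr => j _; rewrite ffunE.
rewrite (_ : (mf f == d) = false) ?mulr0 //; apply: contraNF fd' => /eqP/mnmP E.
by apply/eqP/ffunP => j; apply: ord_inj; rewrite ffunE /= -E mnmE.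
Qed.


Definition at_one_mpoly (P : {mpoly L[k]}) (Q : {mpoly int[k]}) : Prop := forall d, at_one P@_d Q@_d.

Lemma at_one_mpolyD P P' Q Q' : at_one_mpoly P Q -> at_one_mpoly P' Q' -> at_one_mpoly (P + P') (Q + Q').
Proof. by move=> h h' d; rewrite !mcoeffD; apply: at_oneD. Qed.

Lemma at_one_mpolyM P P' Q Q' : at_one_mpoly P Q -> at_one_mpoly P' Q' -> at_one_mpoly (P * P') (Q * Q').
Proof. by move=> h h' d; rewrite !mcoeffM; apply: at_one_sum => e _; apply: at_oneM. Qed.

Lemma at_one_mpoly1 : at_one_mpoly 1 1.
Proof. by move=> d; rewrite !mcoeff1; case: (_ == _); [exact: (at_one_int 1)|exact: (at_one_int 0)]. Qed.

Lemma at_one_mpoly_sum (I : Type) (r : seq I) (C : pred I) P Q : (forall i, C i -> at_one_mpoly (P i) (Q i)) ->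
  at_one_mpoly (\sum_(i <- r | C i) P i) (\sum_(i <- r | C i) Q i).
Proof. by move=> H d; rewrite !raddf_sum; apply: at_one_sum => i Ci; apply: H. Qed.

Lemma at_one_mpoly_prod (I : Type) (r : seq I) (C : pred I) P Q : (forall i, C i -> at_one_mpoly (P i) (Q i)) ->
  at_one_mpoly (\prod_(i <- r | C i) P i) (\prod_(i <- r | C i) Q i).
Proof.
move=> H; elim/big_rec2: _ => [|i x y Ci]; first exact: at_one_mpoly1.
by move=> h; apply: at_one_mpolyM => //; apply: H.
Qed.

Lemma at_one_mpolyX n (i : 'I_n.+1) j : at_one_mpoly (qt i *: 'X_j) 'X_j.
Proof.
move=> d; rewrite mcoeffZ !mcoeffX -[X in at_one _ X]mul1r; apply: at_oneM.
  by rewrite /qt exprnP; apply: at_one_exprz.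
by case: (_ == _); [exact: (at_one_int 1)|exact: (at_one_int 0)].
Qed.

Lemma at_one_mpoly1B P Q : at_one_mpoly P Q -> at_one_mpoly (1 - P) (1 - Q).
Proof.
move=> h; apply: at_one_mpolyD at_one_mpoly1 _ => d; rewrite !mcoeffN -mulN1r -[X in at_one _ X]mulN1r.
by apply: at_oneM (h d); rewrite -[X in at_one X _](rmorphN1 (intmul 1 : int -> L)); apply: at_one_int.
Qed.

Variables (m : nat) (R : realType) (w : {ffun 'I_k * 'I_m.+1 -> R}) (M : 'I_k -> matroid 'I_m.+1).
Hypotheses (kp : (0 < k)%N) (gw : generic_pair w).

Section Weighted.
Variables (K : fieldType) (t : 'I_m.+1 -> K).

Definition kpoly_weighted : {mpoly K[k]} := \sum_(G in ext_faces w M)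
  (\prod_(p in G) (t p.2 *: 'X_p.1)) * (\prod_(p in ~: G) (1 - t p.2 *: 'X_p.1)).

Definition nonbasis_poly j s : {poly K} :=
  \prod_(i | i \notin flag_basis s (M j)) (1 + t i *: 'X).

Hypotheses (t0 : forall i, t i != 0) (tinj : injective t).

(** The localization identity is stated over a field, so it is applied in the fraction field of the
    polynomials in the V_j and pulled back by injectivity. *)
Lemma kpoly_weightedE : kpoly_weighted = \sum_(s : {perm 'I_m.+1})
  chamber t s *: \prod_j (map_poly (@mpolyC k K) (nonbasis_poly j s)).[- 'X_j].
Proof.
pose F := {fraction {mpoly K[k]}}; pose ph (x : K) : F := tofrac x%:MP.
have phM : {morph ph : x y / x * y} by move=> x y; rewrite /ph !rmorphM.
have ph1 : ph 1 = 1 by rewrite /ph !rmorph1.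
have phB : {morph ph : x y / x - y} by move=> x y; rewrite /ph !rmorphB.
have phinj : injective ph.
  by move=> x y /eqP; rewrite /ph tofrac_eq mpolyC_eq => /eqP.
have ph0 x : x != 0 -> ph x != 0 by apply: contra_neq => E; apply: phinj; rewrite E /ph !rmorph0.
have phV x : ph x^-1 = (ph x)^-1.
  have [->|x0] := eqVneq x 0; first by rewrite invr0 /ph !rmorph0 invr0.
  by apply: (mulfI (ph0 x x0)); rewrite -phM !divff ?ph0 // ph1.
pose u i : F := ph (t i).
have u0 i : u i != 0 by apply: ph0.
have uinj : injective u by move=> i j /phinj/tinj.
have chE s : chamber u s = ph (chamber t s).
  rewrite /chamber (big_morph ph phM ph1); apply: eq_bigr => a _.
  by rewrite phV phB ph1 phM phV.
have VtE j i : tofrac 'X_j * u i = tofrac (t i *: 'X_j : {mpoly K[k]}).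
  by rewrite /u /ph -rmorphM mulrC mul_mpolyC.
have := ext_localization M (fun j => tofrac 'X_j) kp gw u0 uinj.
have -> : \sum_(G in ext_faces w M) face_term (fun j => tofrac 'X_j) u G = tofrac kpoly_weighted.
  rewrite rmorph_sum; apply: eq_bigr => G _; rewrite /face_term rmorphM !rmorph_prod.
  congr (_ * _); apply: eq_bigr => p _; rewrite VtE // rmorphB rmorph1 //.
move=> E; apply/eqP; rewrite -tofrac_eq E rmorph_sum; apply/eqP; apply: eq_bigr => s _.
have -> : \prod_j nonbasis (M j) (tofrac 'X_j) u set0 (ordering s) =
    tofrac (\prod_j (map_poly (@mpolyC k K) (nonbasis_poly j s)).[- 'X_j]).
  rewrite rmorph_prod; apply: eq_bigr => j _.
  rewrite nonbasis_flag rmorph_prod horner_prod rmorph_prod; apply: eq_bigr => i _.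
  have mE : map_poly (@mpolyC k K) (1 + t i *: 'X) = 1 + (t i)%:MP *: 'X.
    by rewrite rmorphD rmorph1 /= map_polyZ map_polyX.
  rewrite /= mE.
  by rewrite hornerD hornerZ hornerX hornerC mulrN rmorphB rmorph1 VtE mul_mpolyC.
by rewrite chE -mul_mpolyC [RHS]rmorphM mulrC.
Qed.

End Weighted.

Lemma kpoly_weighted_at_one : at_one_mpoly (kpoly_weighted (@qt _)) (kpoly (ext_complex w M)).
Proof.
apply: at_one_mpoly_sum => G _; apply: at_one_mpolyM; apply: at_one_mpoly_prod => p _.
  exact: at_one_mpolyX.
by apply: at_one_mpoly1B; apply: at_one_mpolyX.
Qed.

(** Both coefficients are values at q = 1 of the same sum over permutations; its single terms may
    have poles there, so the comparison goes through uniqueness of the value of the whole sum. *)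
Theorem kpoly_taut (kk : fieldType) (d : 'X_{1..k}) : (kpoly (ext_complex w M))@_d = taut_kpoly_coeff kk M d.
Proof.
apply: (at_one_uniq (kpoly_weighted_at_one d)); rewrite (kpoly_weightedE (@qt_neq0 _) (@qt_inj _)) raddf_sum /=.
have C := euler_class (class_char_prod (index_enum 'I_k) (fun j => lambda_taut_char (d j) (taut_quotientP kk (M j)))).
have := at_oneM (at_one_int (\prod_j (-1) ^+ d j)) C.
rewrite mulr_sumr; congr (at_one _ _); apply: eq_bigr => s _.
rewrite mcoeffZ mcoeff_prod_horner big_split /= rmorph_prod mulrA [RHS]mulrC.
apply: (congr1 (fun x => x * chamber _ s)); congr (_ * _).
by apply: eq_bigr => j _; rewrite rmorphXn rmorphN1.
Qed.

End CoefficientIdentity.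

(** * Valuativity *)

Section Slices.
Variable R : realType.

Lemma upoly_half m (T : finType) (a : T -> R) (p : T -> nat) (b : R) : (forall i, (p i < m)%N) ->
  upoly m (fun x => b <= \sum_i a i * x (p i)).
Proof.
move=> pm; apply: upoly_iff (upoly_sat m [:: (fun j => \sum_(i | p i == j) a i, b)]) => x.
rewrite /sat /= andbT /holds /= /lform; suff -> : \sum_(j < m) (\sum_(i | p i == j) a i) * x j = \sum_i a i * x (p i) by [].
under eq_bigr => j _ do rewrite mulr_suml.
rewrite (partition_big (fun i => Ordinal (pm i)) xpredT) //=.
by apply: eq_bigr => j _; apply: eq_big => [i|i /eqP ->].
Qed.

Lemma upoly_restrict m N (X : (nat -> R) -> Prop) : upoly (m + N) X ->
  upoly m (fun x => exists2 y, (forall i, (i < m)%N -> y i = x i) & X y).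
Proof.
elim: N X => [|N IH] X.
  rewrite addn0 => -[l H]; exists l => x; rewrite -H; split=> [[y yx /H Xy]|Xx]; last by exists x.
  by apply/H; move: Xy; congr (is_true (has _ _)); apply: funext => C; apply: eq_sat.
rewrite addnS => /upoly_proj/IH; apply: upoly_iff => x; split=> [[y yx [t Xy]]|[y yx Xy]].
  exists (upd y (m + N) t) => // i im; rewrite /upd ltn_eqF ?yx //; exact: leq_trans im (leq_addr _ _).
by exists y => //; exists (y (m + N)%N); rewrite upd_id.
Qed.

Variables (m : nat) (M : matroid 'I_m.+1) (v : 'I_m.+1 -> R) (b : R).

(** A convex compact set, of Euler characteristic 1 or 0 according to whether the half-space reaches
    the polytope. *)
Definition slice (x : nat -> R) : Prop :=
  in_base_polytope M [ffun i : 'I_m.+1 => x i] /\ b <= \sum_(i < m.+1) v i * x i.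

Lemma convex_slice : convex slice.
Proof.
move=> x y l [[c [c0 c1 cx]] bx] [[d [d0 d1 dy]] by_] /andP[l0 l1]; have l1' : 0 <= 1 - l by rewrite subr_ge0.
split.
  exists (fun B => l * c B + (1 - l) * d B); split=> [B||i].
  - by rewrite addr_ge0 // mulr_ge0.
  - by rewrite big_split /= -!mulr_sumr c1 d1 !mulr1; ring.
  rewrite ffunE; have := cx i; have := dy i; rewrite !ffunE => -> ->.
  by rewrite !mulr_sumr -big_split; apply: eq_bigr => B _ /=; ring.
under eq_bigr => i _ do rewrite mulrDr !(mulrCA (v i)).
rewrite big_split -!mulr_sumr -[b]mul1r -[X in X * b](subrK l 1) addrC mulrDl.
by apply: lerD; rewrite ler_wpM2l.
Qed.

Lemma upoly_slice : upoly m.+1 slice.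
Proof.
(* The coefficients of the convex combination occupy the coordinates from [m.+1] on and are then
   projected away; equations are written as pairs of inequalities. *)
pose N := #|{set 'I_m.+1}|; pose p (B : {set 'I_m.+1}) := (m.+1 + enum_rank B)%N.
have pN B : (p B < m.+1 + N)%N by rewrite ltn_add2l.
have xN (i : 'I_m.+1) : (i < m.+1 + N)%N by apply: leq_trans (ltn_ord i) (leq_addr _ _).
pose Y (y : nat -> R) := (forall B, 0 <= y (p B)) /\
  ((1 <= \sum_B (B \in bases M)%:R * y (p B) /\ -1 <= \sum_B - (B \in bases M)%:R * y (p B)) /\
  ((forall i : 'I_m.+1, 0 <= 1 * y i + \sum_B (- ((B \in bases M) && (i \in B))%:R) * y (p B) /\
     0 <= -1 * y i + \sum_B ((B \in bases M) && (i \in B))%:R * y (p B)) /\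
  b <= \sum_(i < m.+1) v i * y i)).
have single (a : R) (j : nat) (T : finType) (f : T -> R) (q : T -> nat) : (j < m.+1 + N)%N ->
    (forall i, (q i < m.+1 + N)%N) -> upoly (m.+1 + N) (fun y => 0 <= a * y j + \sum_i f i * y (q i)).
  move=> jN qN; apply: upoly_iff (upoly_half (fun o => if o is Some i then f i else a)
    0 (p := fun o => if o is Some i then q i else j) _) => [y|[i|]] //.
  suff -> : \sum_i (if i is Some i' then f i' else a) * y (if i is Some i' then q i' else j) =
    a * y j + \sum_i f i * y (q i) by [].
  rewrite (bigD1 None) //=; congr (_ + _).
  by rewrite (reindex_omap Some id) /= => [|[]//]; apply: eq_bigl => i; rewrite eqxx.
have uY : upoly (m.+1 + N) Y.
  apply: upoly_and.
    apply: upoly_all => B; apply: upoly_iff (single 1 (p B) void (fun=> 0) (fun=> 0%N) _ _) => // y.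
    by rewrite mul1r big1 ?addr0 // => -[].
  apply: upoly_and; first by apply: upoly_and; apply: upoly_half.
  apply: upoly_and; last by apply: upoly_half.
  by apply: upoly_all => i; apply: upoly_and; apply: single.
apply: upoly_iff (upoly_restrict uY) => x; split=> [[y yx [y0 [[y1 y1'] [yi yb]]]]|[[c [c0 c1 cx]] bx]].
  have E i : y (i : 'I_m.+1) = x i by apply: yx.
  split; last by move: yb; under eq_bigr => i _ do rewrite E.
  exists (fun B => y (p B)); split=> // [|i].
    apply/eqP; rewrite eq_le; apply/andP; split.
      move: y1'; under eq_bigr => B _ do rewrite mulNr; rewrite sumrN lerN2 => y1'.
      by rewrite big_mkcond; apply: le_trans y1'; apply: ler_sum => B _; case: (_ \in _); rewrite ?mul1r ?mul0r.
    apply: le_trans y1 _; rewrite [X in _ <= X]big_mkcond; apply: ler_sum => B _.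
    by case: (_ \in _); rewrite ?mul1r ?mul0r.
  have S : \sum_(B in bases M) y (p B) * (i \in B)%:R = \sum_B ((B \in bases M) && (i \in B))%:R * y (p B).
    by rewrite big_mkcond; apply: eq_bigr => B _; case: (_ \in _); rewrite ?mul0r //= mulrC.
  rewrite ffunE -E S; have [a1 a2] := yi i; apply/eqP; rewrite eq_le; apply/andP; split.
    by move: a2; rewrite mulN1r addrC subr_ge0.
  move: a1; under eq_bigr => B _ do rewrite mulNr.
  by rewrite sumrN mul1r subr_ge0.
pose y j := if (j < m.+1)%N then x j else c (nth set0 (enum {set 'I_m.+1}) (j - m.+1)).
have yp B : y (p B) = c B by rewrite /y /p ltnNge leq_addr /= addKn nth_enum_rank.
have yi (i : 'I_m.+1) : y i = x i by rewrite /y ltn_ord.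
have sc : \sum_B (B \in bases M)%:R * y (p B) = 1.
  by rewrite -[RHS]c1 [RHS]big_mkcond; apply: eq_bigr => B _; rewrite yp; case: (_ \in _); rewrite ?mul1r ?mul0r.
have si i : \sum_B ((B \in bases M) && (i \in B))%:R * y (p B) = x i.
  have := cx i; rewrite ffunE => ->; rewrite [RHS]big_mkcond; apply: eq_bigr => B _; rewrite yp.
  by case: (_ \in _); rewrite ?mul0r //= mulrC.
exists y; first by move=> i im; rewrite /y im.
split; first by move=> B; rewrite yp.
split; first by under [X in _ /\ _ <= X]eq_bigr => B _ do rewrite mulNr; rewrite sumrN sc.
split; last by under eq_bigr => i _ do rewrite yi.
move=> i; under eq_bigr => B _ do rewrite mulNr.
by rewrite sumrN si yi mul1r subrr mulN1r addNr.
Qed.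

(** A linear functional is largest on the polytope at the vertex of a basis of maximal weight. *)
Lemma slice_basis B0 : B0 \in bases M -> (forall B, B \in bases M -> \sum_(i in B) v i <= \sum_(i in B0) v i) ->
  (exists x, slice x) <-> b <= \sum_(i in B0) v i.
Proof.
move=> b0 mx; split=> [[x [[c [c0 c1 cx]] bx]]|bB].
  apply: le_trans bx _.
  have -> : \sum_(i < m.+1) v i * x i = \sum_(B in bases M) c B * \sum_(i in B) v i.
    under eq_bigr => i _ do (have := cx i; rewrite ffunE => ->; rewrite mulr_sumr).
    rewrite exchange_big; apply: eq_bigr => B _; rewrite [X in _ * X]big_mkcond mulr_sumr.
    by apply: eq_bigr => i _; rewrite mulrCA; case: (_ \in _); rewrite ?mulr1 ?mulr0.
  rewrite -[leRHS]mul1r -c1 mulr_suml; apply: ler_sum => B bB.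
  by rewrite ler_wpM2l // mx.
exists (fun j => if insub j is Some i then (i \in B0)%:R else 0); split.
  exists (fun B => (B == B0)%:R); split=> [B||i]; first exact: ler0n.
    by rewrite (bigD1 B0) //= eqxx big1 ?addr0 // => B /andP[_ /negbTE ->].
  rewrite ffunE valK (bigD1 B0) //= eqxx mul1r big1 ?addr0 // => B /andP[_ /negbTE ->].
  by rewrite mul0r.
apply: le_trans bB _; rewrite le_eqVlt; apply/orP; left; apply/eqP.
by rewrite big_mkcond; apply: eq_bigr => i _; rewrite valK; case: (_ \in _); rewrite ?mulr1 ?mulr0.
Qed.

End Slices.

Lemma binary_digits n (d e : nat -> bool) :
  (\sum_(j < n) d j * 2 ^ j = \sum_(j < n) e j * 2 ^ j)%N -> forall j, (j < n)%N -> d j = e j.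
Proof.
elim: n d e => [|n IH] d e //; rewrite !big_ord_recl !muln1 /=.
have S (f : nat -> bool) : (\sum_(j < n) f (bump 0 j) * 2 ^ bump 0 j = (\sum_(j < n) f j.+1 * 2 ^ j).*2)%N.
  rewrite -muln2 big_distrl; apply: eq_bigr => j _; by rewrite /bump add1n expnS mulnCA [LHS]mulnC.
rewrite !S => E; have d0 : d 0%N = e 0%N.
  by have := congr1 odd E; rewrite !oddD !odd_double !addbF; case: (d 0%N) (e 0%N) => -[].
move: E; rewrite d0 => /addnI/double_inj E [|j] //; exact: (IH (fun j => d j.+1) (fun j => e j.+1)).
Qed.

(** * Relations between base polytopes *)

Section Valuativity.
Variables (R : realType) (m r : nat) (c : 'I_r -> int) (Ms : 'I_r -> matroid 'I_m.+1).
Hypothesis rel : forall x : {ffun 'I_m.+1 -> R}, \sum_(a < r) c a * polytope_indicator (Ms a) x = 0.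

Lemma slice_relation (v : 'I_m.+1 -> R) b : \sum_a c a *+ `[< exists x, slice (Ms a) v b x >] = 0.
Proof.
apply: (@euler_good R _ _ m.+1 c (fun a => slice (Ms a) v b)) => [a|x].
  by apply: upoly_good; [apply: upoly_slice|apply/convex_fibre/convex_slice].
have [bx|bx] := boolP (b <= \sum_(i < m.+1) v i * x i); last first.
  by rewrite big1 // => a _; rewrite asboolF // => -[_ /(negP bx)].
rewrite -[RHS](rel [ffun i : 'I_m.+1 => x i]); apply: eq_bigr => a _.
by rewrite -mulr_natr natz; congr (_ * (nat_of_bool _)%:Z); apply: asbool_equiv_eq; split=> [[]|].
Qed.

Implicit Type s : {perm 'I_m.+1}.

(* Slicing by a functional with binary weights isolates one basis of the initial matroid. *)
Definition binary_weight s i : nat := 2 ^ (m - (s^-1)%g i).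

Lemma binary_weight_lt s i j : (binary_weight s i < binary_weight s j)%N = ((s^-1)%g j < (s^-1)%g i)%N.
Proof.
rewrite ltn_exp2l //; have := ltn_ord ((s^-1)%g i); have := ltn_ord ((s^-1)%g j).
by move: (nat_of_ord _) (nat_of_ord _) => a b; lia.
Qed.

Lemma sum_binary_weight s (B : {set 'I_m.+1}) :
  (\sum_(i in B) binary_weight s i = \sum_(j < m.+1) (s (rev_ord j) \in B) * 2 ^ j)%N.
Proof.
rewrite big_mkcond (reindex_inj (@perm_inj _ s)) (reindex_inj rev_ord_inj).
apply: eq_bigr => j _; rewrite /binary_weight permK /= subSS subKn ?mulnb; last by rewrite -ltnS.
by case: ifP; rewrite ?mul1n.
Qed.

Lemma binary_weight_inj s (A B : {set 'I_m.+1}) :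
  (\sum_(i in A) binary_weight s i = \sum_(i in B) binary_weight s i)%N -> A = B.
Proof.
rewrite !sum_binary_weight => E; apply/setP => i.
pose d (C : {set 'I_m.+1}) j := s (rev_ord (inord j)) \in C.
have dE C : (\sum_(j < m.+1) d C j * 2 ^ j = \sum_(j < m.+1) (s (rev_ord j) \in C) * 2 ^ j)%N.
  by apply: eq_bigr => j _; rewrite /d inord_val.
have := @binary_digits m.+1 (d A) (d B); rewrite !dE => /(_ E (rev_ord ((s^-1)%g i)) (ltn_ord _)).
by rewrite /d inord_val rev_ordK permKV.
Qed.

Lemma flag_basis_max s (M : matroid 'I_m.+1) : flag_basis s M \in bases M /\
  forall B, B \in bases M -> (\sum_(i in B) binary_weight s i <= \sum_(i in flag_basis s M) binary_weight s i)%N.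
Proof.
pose w : {ffun 'I_m.+1 -> int} := [ffun i => (binary_weight s i)%:Z].
have wE (B : {set 'I_m.+1}) : \sum_(i in B) w i = (\sum_(i in B) binary_weight s i)%N%:Z.
  by rewrite -natz natr_sum; apply: eq_bigr => i _; rewrite ffunE natz.
have winj : injective w.
  move=> i j; rewrite !ffunE => -[E]; have := @binary_weight_inj s [set i] [set j].
  by rewrite !big_set1 => /(_ E)/set1_inj.
have [B0 b0] : exists B, B \in bases M by have /andP[/set0Pn[B]] := basesP M; exists B.
pose C := [arg max_(B > B0 in bases M) \sum_(i in B) w i]%O.
have iC : C \in initial w M.
  rewrite /C; case: Order.TotalTheory.arg_maxP => // B bB max; rewrite inE bB.
  by apply/forall_inP.
have CE : C = flag_basis s M.
  rewrite flag_basisE (initial_uniq winj iC); apply/setP => i; rewrite !inE; congr (~~ spn M _ _).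
  by apply/setP => e; rewrite inE mem_prefix !ffunE ltz_nat binary_weight_lt.
move: iC; rewrite CE inE => /andP[-> /forall_inP mx]; split=> // B /mx.
by rewrite !wE lez_nat.
Qed.

(** Slicing gives, for every threshold z, the relation restricted to the matroids whose maximal
    weight is at least z. Two consecutive thresholds leave those of maximal weight equal to that of
    [B], and binary weights determine the set. *)
Lemma flag_basis_relation s B : \sum_a c a *+ (flag_basis s (Ms a) == B) = 0.
Proof.
pose h (A : {set 'I_m.+1}) := (\sum_(i in A) binary_weight s i)%N.
have H z : \sum_a c a *+ (z <= h (flag_basis s (Ms a)))%N = 0.
  rewrite -[RHS](slice_relation (fun i => (binary_weight s i)%:R) z%:R).
  apply: eq_bigr => a _; congr (_ *+ nat_of_bool _).
  have [bB mx] := flag_basis_max s (Ms a).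
  have sE (A : {set 'I_m.+1}) : \sum_(i in A) (binary_weight s i)%:R = (h A)%:R :> R by rewrite natr_sum.
  have mxR A : A \in bases (Ms a) -> \sum_(i in A) (binary_weight s i)%:R <=
      \sum_(i in flag_basis s (Ms a)) (binary_weight s i)%:R :> R.
    by move=> bA; rewrite !sE ler_nat mx.
  apply/idP/asboolP => [zh|/(slice_basis z%:R bB mxR)]; last by rewrite sE ler_nat.
  by apply/(slice_basis z%:R bB mxR); rewrite sE ler_nat.
have E0 : \sum_a (c a *+ (h B <= h (flag_basis s (Ms a)))%N - c a *+ (h B < h (flag_basis s (Ms a)))%N) = 0.
  by rewrite sumrB !H subrr.
rewrite -[RHS]E0; apply: eq_bigr => a _; rewrite -(inj_eq (@binary_weight_inj s)) -/(h _) -/(h _) eqn_leq andbC.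
by case: (leqP (h B)) => le; case: (leqP (h (flag_basis s (Ms a))) (h B)) => le'; rewrite ?subr0 ?subrr //; lia.
Qed.


Variables (k : nat) (w : {ffun 'I_k * 'I_m.+1 -> R}) (M : 'I_k -> matroid 'I_m.+1) (j : 'I_k).
Hypotheses (kp : (0 < k)%N) (gw : generic_pair w).

(** After localization the weighted polynomial depends on [Ms a] only through the bases
    [flag_basis s (Ms a)], so the relation holds for each s and each basis separately; q is set to 1
    afterwards. *)
Lemma kpoly_valuative : \sum_(a < r) kpoly (ext_complex w (update M j (Ms a))) *~ c a = 0.
Proof.
pose W a := kpoly_weighted w (update M j (Ms a)) (@qt m.+1).
suff W0 : \sum_a W a *~ c a = 0.
  apply/mpolyP => d; rewrite mcoeff0.
  have A : at_one (\sum_a (W a)@_d * (c a)%:~R) (\sum_a (kpoly (ext_complex w (update M j (Ms a))))@_d * c a).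
    apply: at_one_sum => a _; apply: at_oneM (at_one_int _); exact: kpoly_weighted_at_one.
  have E : \sum_a (W a)@_d * (c a)%:~R = 0.
    have := congr1 (mcoeff d) W0; rewrite mcoeff0 raddf_sum => Z; rewrite -[RHS]Z.
    by apply: eq_bigr => a _; rewrite raddfMz /= mulrzr.
  rewrite E in A; rewrite -[RHS](at_one_uniq A (at_one_int 0)) raddf_sum.
  by apply: eq_bigr => a _; rewrite raddfMz /= -mulrzz.
pose T s (B : {set 'I_m.+1}) : {mpoly {fraction {poly int}}[k]} := chamber (@qt m.+1) s *:
  \prod_i (map_poly (@mpolyC k _) (\prod_(l | l \notin (if i == j then B else flag_basis s (M i))) (1 + qt l *: 'X))).[- 'X_i].
have WE a : W a = \sum_s T s (flag_basis s (Ms a)).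
  rewrite /W (kpoly_weightedE _ kp gw (@qt_neq0 _) (@qt_inj _)); apply: eq_bigr => s _.
  congr (_ *: _); apply: eq_bigr => i _; congr (map_poly _ _).[_].
  by rewrite /nonbasis_poly /update; case: ifP.
under eq_bigr => a _ do rewrite WE mulrz_suml.
rewrite exchange_big big1 // => s _.
transitivity (\sum_B \sum_a T s B *~ (c a *+ (flag_basis s (Ms a) == B))).
  rewrite exchange_big; apply: eq_bigr => a _; rewrite (bigD1 (flag_basis s (Ms a))) //= eqxx mulr1n.
  by rewrite big1 ?addr0 // => B /negbTE nB; rewrite eq_sym nB mulr0n mulr0z.
by rewrite big1 // => B _; rewrite -mulrz_sumr flag_basis_relation mulr0z.
Qed.

End Valuativity.

Theorem theoremD (kk : fieldType) (R : realType) (n k : nat)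
    (hn : (0 < n)%N) (hk : (2 <= k)%N)
    (M : 'I_k -> matroid 'I_n) (hM : no_common_loop M)
    (w : {ffun 'I_k * 'I_n -> R}) (hw : sufficiently_generic w) :
  [/\ forall d : 'X_{1..k},
        (kpoly (ext_complex w M))@_d = taut_kpoly_coeff kk M d,
      forall w' : {ffun 'I_k * 'I_n -> R}, sufficiently_generic w' ->
        kpoly (ext_complex w' M) = kpoly (ext_complex w M),
      forall (j : 'I_k) (r : nat) (c : 'I_r -> int) (Ms : 'I_r -> matroid 'I_n),
        (forall a, no_common_loop (update M j (Ms a))) ->
        (forall x : {ffun 'I_n -> R},
            \sum_(a < r) c a * polytope_indicator (Ms a) x = 0) ->
        \sum_(a < r) kpoly (ext_complex w (update M j (Ms a))) *~ c a = 0,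
      cohen_macaulay (stanley_reisner kk (ext_complex w M))
    & cdim (ext_complex w M) = n%:Z + rho M [set: 'I_n] - 1].
Proof.
case: n hn M hM w hw => [//|m] _ {}M {}hM {}w {}hw.
have kp : (0 < k)%N by apply: leq_trans hk.
have coef w' : sufficiently_generic w' ->
    forall d : 'X_{1..k}, (kpoly (ext_complex w' M))@_d = taut_kpoly_coeff kk M d.
  by move=> [_ gw]; apply: kpoly_taut.
have [gt gp] := hw; have [r [rE mx ex]] := dind_rank hM.
have rank : has_rank (dind M) r.
  split; last exact: mx.
  have [|S [_ dS cS]] := ex set0; last by exists S.
  exact: ext_faces_dind hk gp _ (ext_faces0 w M).
have face_le F : F \in faces (ext_complex w M) -> (#|F| <= r)%N.
  by move=> /(ext_faces_dind hk gp); apply: mx.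
have W := ext_wreg hk gp _ _ _ rank.
split=> [||j r' c Ms _ rel||].
- exact: coef.
- by move=> w' hw'; apply/mpolyP => d; rewrite (coef _ _ hw') (coef _ _ hw).
- exact: kpoly_valuative.
- apply: cohen_macaulay_wreg face_le _ => g mg sg g0; exact: W.
(* The dimension is read off at the origin, where [g] is ['X]. *)
- rewrite -rE; apply: (cdim_wreg (kk := kk) face_le); apply: W; rewrite ?monicX ?size_polyX ?coefX //.
Qed.
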